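(* Let $\alpha\in(1,2)$ and let $X=(X_t)_{t\ge0}$ be a stable process with index $\alpha$ such that $\mathbb{E}(e^{-qX_t})=\exp(tq^\alpha)$ for all $t>0$, $q\ge0$. Then $X_1$ and $\overline X_1$ have joint probability density function $$\frac{\mathbb{P}\{X_1\in dx,\ \overline X_1\in dc\}}{dx\,dc}=\mathbf{1}\{c>\max(x,0)\}\,\frac{\partial h_c(x,1)}{\partial c}$$ with, for $c>\max(x,0)$, $$\frac{\partial h_c(x,1)}{\partial c}=\frac1\pi\sum_{k=1}^\infty\sum_{n=1}^\infty\frac{\Gamma(k/\alpha+n)}{\Gamma(\alpha n)\,k!}(-1)^{k+n}\sin(\pi k/\alpha)\,\big[kc+(\alpha n-1)(c-x)\big]\,(c-x)^{k-1}c^{\alpha n-2}.$$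
   Context: $X$ is a Lévy process with $X_0=0$; under the stated normalization it is spectrally positive and strictly stable. $\overline X_t=\sup_{0\le s\le t}X_s$. For $c>0$, $t>0$, $x\in(-\infty,c)$, $h_c(x,t)=\mathbb{P}\{X_t\in dx,\ \overline X_t\le c\}/dx$, i.e. $h_c(\cdot,t)$ is the density on $(-\infty,c)$ of $A\mapsto\mathbb{P}\{X_t\in A,\ \overline X_t\le c\}$ (the version continuous in $x$). *)

(* Defs.v *)
From HB Require Import structures.
From mathcomp Require Export all_boot all_order all_algebra.
From mathcomp Require Export all_classical all_reals all_analysis.
Export Order.TTheory GRing.Theory Num.Theory.
Export numFieldNormedType.Exports.

Set Implicit Arguments.
Unset Strict Implicit.
Unset Printing Implicit Defensive.

Global Open Scope classical_set_scope.
Global Open Scope ring_scope.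

Section Gamma.
Context (R : realType).

(* Euler's integral; only meaningful for a > 0. *)
Definition Gamma (a : R) : R :=
  \int[@lebesgue_measure R]_(x in `]0, +oo[) (x `^ (a - 1) * expR (- x)).

End Gamma.

Section Processes.
Context d (T : measurableType d) (R : realType) (P : probability T R).

(* Taking some B i to be setT yields the product rule for every subfamily. *)
Definition mutually_independent (n : nat) (Y : 'I_n -> T -> R) : Prop :=
  forall B : 'I_n -> set R, (forall i, measurable (B i)) ->
    P (\bigcap_(i in [set: 'I_n]) Y i @^-1` B i)
      = (\prod_(i < n) P (Y i @^-1` B i))%E.

Definition cadlag (f : R -> R) : Prop :=
  (forall t, 0 <= t -> f s @[s --> t^'+] --> f t) /\
  (forall t, 0 < t -> cvg (f s @[s --> t^'-])).

(* The time set is [0, +oo[: values of a process at negative times are never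
   constrained nor used.  All paths (not merely almost all) start at 0 and are
   cadlag, which makes the running supremum a random variable even when P is
   not complete. *)
Record levy_process (X : R -> {RV P >-> R}) : Prop := LevyProcess {
  levy_start : forall w, X 0 w = 0 ;
  levy_cadlag : forall w, cadlag (fun t => X t w) ;
  levy_independent_increments : forall (n : nat) (t : nat -> R),
    0 <= t 0%N -> (forall i, (i < n)%N -> t i <= t i.+1) ->
    mutually_independent (fun (i : 'I_n) w => X (t i.+1) w - X (t i) w) ;
  levy_stationary_increments : forall s t : R, 0 <= s -> 0 <= t ->
    forall B : set R, measurable B ->
      P [set w | B (X (s + t) w - X s w)] = P [set w | B (X t w)]
}.

(* For each a > 0 the processes (X_(a t)) and (a^(1/alpha) X_t + b t), for some
   b depending on a, have the same finite-dimensional distributions.  The drift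
   b allows stable processes that are not strictly stable. *)
Definition stable_process (alpha : R) (X : R -> {RV P >-> R}) : Prop :=
  levy_process X /\
  forall a : R, 0 < a -> exists b : R,
    forall (n : nat) (t : 'I_n -> R), (forall i, 0 <= t i) ->
    forall B : 'I_n -> set R, (forall i, measurable (B i)) ->
      P [set w | forall i, B i (X (a * t i) w)]
      = P [set w | forall i, B i (a `^ alpha^-1 * X (t i) w + b * t i)].

(* A real-valued supremum; cadlag paths are bounded on [0, t]. *)
Definition running_sup (X : R -> {RV P >-> R}) (t : R) (w : T) : R :=
  sup [set X s w | s in `[0, t]].

(* f is, on ]-oo, c[, the continuous version of the density of the measure
   A |-> P(X_t \in A, sup_(s <= t) X_s <= c).  This determines f uniquely on
   ]-oo, c[ and says nothing about its values elsewhere. *)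
Definition is_killed_density (X : R -> {RV P >-> R}) (c t : R) (f : R -> R)
    : Prop :=
  [/\ {in `]-oo, c[, forall x, 0 <= f x},
      {in `]-oo, c[, continuous f} &
      forall A : set R, measurable A -> A `<=` `]-oo, c[ ->
        P [set w | A (X t w) /\ running_sup X t w <= c]
        = (\int[@lebesgue_measure R]_(x in A) (f x)%:E)%E].

Definition is_joint_density (Y Z : T -> R) (f : R * R -> R) : Prop :=
  [/\ measurable_fun [set: T] Y, measurable_fun [set: T] Z,
      measurable_fun [set: R * R] f, (forall z, 0 <= f z) &
      forall B : set (R * R), measurable B ->
        P [set w | B (Y w, Z w)]
        = (\int[@lebesgue_measure R \x @lebesgue_measure R]_(z in B)
             (f z)%:E)%E].

End Processes.

(* sum_(k >= 1) sum_(n >= 1) a k n = l as an iterated sum: every inner series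
   converges, and the series of their sums converges to l. *)
Definition double_series_sum (R : realType) (a : nat -> nat -> R) (l : R)
    : Prop :=
  exists s : nat -> R,
    (forall k, (1 <= k)%N ->
       (\sum_(1 <= n < N) a k n) @[N --> \oo] --> s k) /\
    (\sum_(1 <= k < N) s k) @[N --> \oo] --> l.

(* Main.v *)
(* Let W be the running supremum of X, D = W - X the drawdown and a = 1/alpha.
   Sampling X on a finer and finer grid turns the one-step recursion of a random
   walk and its running maximum into the identity, for b > 0 and g > 0,
     E e^(-b W_t - g D_t) = 1 + b^alpha int_0^t E e^(-b W_s - g D_s) ds
                              + (b + g)/g (E e^(-g D_t) - 1),
   whose Laplace transform in t at q = b^alpha involves D alone and so determines
   the law of D_t.  By uniqueness of Laplace transforms the identity becomes a
   recursion in t for the functions E (w - W_t)_+^r (y - D_t)_+^j / (r! j!).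
   Iterating it, and comparing iterated antiderivatives with iterated differences
   to see that the remainder vanishes, expresses them as double power series.
   Differentiating in w and y gives the density of (W_t, D_t), and the shear
   (w, y) |-> (w - y, w) gives the law of (X_t, W_t). *)

From HB Require Import structures.
Require Import Defs.
From mathcomp Require Import measurable_realfun ring lra.
Set Implicit Arguments.
Unset Strict Implicit.
Unset Printing Implicit Defensive.

(** * Iterated antiderivatives and dominated series *)

Section IteratedAntiderivative.
Context (R : realType).
Implicit Types (f g : nat -> R -> R) (t l mu M : R).

Lemma is_derive_shift (f : R -> R) (c x df : R) :
  is_derive (x + c) 1 f df -> is_derive x 1 (fun u => f (u + c)) df.
Proof.
move=> h.
have h1 : is_derive x (1:R) (fun u : R => u + c) (1:R).
  by apply: is_derive_eq; rewrite addr0.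
have := @is_derive1_comp _ f (fun u : R => u + c) x df 1 h h1.
by rewrite mulr1.
Qed.

Lemma increment_ge_derive (f df : R -> R) (a b mu : R) : a <= b ->
  (forall x, a <= x <= b -> is_derive x 1 f (df x)) ->
  (forall x, a <= x <= b -> mu <= df x) -> mu * (b - a) <= f b - f a.
Proof.
move=> ab fd dmu.
have [c cab ->] := @MVT_segment _ f df a b ab
  (fun x xab => fd x (subset_itv_oo_cc xab))
  (derivable_within_continuous
    (fun x (xab : x \in `[a, b]) => @ex_derive _ _ _ _ _ _ _ (fd x xab))).
by rewrite ler_wpM2r ?subr_ge0// dmu.
Qed.

(* Iterating the difference operator trades one derivative for a factor l, while
   it at most doubles the sup norm. *)
Lemma iterated_antiderivative_lower_bound m g t l mu M : 0 < l -> 0 <= mu ->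
  (forall u v, t <= u -> u <= v -> v <= t + m.+1%:R * l ->
     mu * (v - u) <= g 0%N v - g 0%N u) ->
  (forall i, (i < m)%N -> forall u, t <= u <= t + m.+1%:R * l ->
     is_derive u 1 (g i.+1) (g i u)) ->
  (forall u, t <= u <= t + m.+1%:R * l -> `|g m u| <= M) ->
  mu * l ^+ m.+1 <= 2 ^+ m.+1 * M.
Proof.
move=> l0; elim: m g mu M => [|m IH] g mu M mu0 g0 gd gM.
  rewrite mul1r in g0 gM; rewrite !expr1.
  have := g0 t (t + l) (lexx _) _ (lexx _); rewrite addrAC subrr add0r.
  move=> /(_ _)/le_trans; apply; first by rewrite lerDl ltW.
  have h1 : `|g 0%N (t + l)| <= M by apply: gM; rewrite lexx lerDl ltW.
  have h2 : `|g 0%N t| <= M by apply: gM; rewrite lexx lerDl ltW.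
  by move: h1 h2; rewrite !ler_norml => /andP[_ h1] /andP[h2 _]; lra.
have El : m.+2%:R * l = m.+1%:R * l + l by rewrite -natr1 mulrDl mul1r.
pose h i u := g i.+1 (u + l) - g i.+1 u.
have hd i : (i < m.+1)%N -> forall u, t <= u <= t + m.+1%:R * l ->
    is_derive u 1 (h i) (g i (u + l) - g i u).
  move=> im u /andP[tu ut].
  have d1 : is_derive u 1 (fun v => g i.+1 (v + l)) (g i (u + l)).
    apply: is_derive_shift; apply: gd => //; rewrite El; apply/andP; split; lra.
  have d2 : is_derive u 1 (g i.+1) (g i u).
    by apply: gd => //; rewrite El; apply/andP; split; lra.
  exact: is_deriveB.
rewrite (exprSr 2) -mulrA [l ^+ _]exprS mulrA.
apply: (IH h (mu * l) (2 * M)).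
- by rewrite mulr_ge0// ltW.
- move=> u v tu uv vt.
  apply: (@increment_ge_derive (h 0%N) (fun x => g 0%N (x + l) - g 0%N x)) => //.
    by move=> x /andP[ux xv]; apply: hd => //; apply/andP; split; lra.
  move=> x /andP[ux xv].
  have := g0 x (x + l); rewrite addrAC subrr add0r; apply; [lra|lra|].
  by rewrite El; lra.
- by move=> i im u tu; rewrite /h; apply: (hd i.+1).
- move=> u /andP[tu ut]; rewrite /h (le_trans (ler_normB _ _))//.
  have h1 : `|g m.+1 (u + l)| <= M by apply: gM; rewrite El; apply/andP; split; lra.
  have h2 : `|g m.+1 u| <= M by apply: gM; rewrite El; apply/andP; split; lra.
  lra.
Qed.

End IteratedAntiderivative.

Section Tannery.
Context (R : realType).

Lemma series_norm_le (u M : R^nat) : (forall k, `|u k| <= M k) ->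
  cvgn (series M) -> cvgn (series u).
Proof.
move=> uM cM; apply: normed_cvg.
apply: series_le_cvg cM => //= k.
  exact: le_trans (normr_ge0 _) (uM k).
Qed.

Lemma series_tail_le (u M : R^nat) (N : nat) : (forall k, `|u k| <= M k) ->
  cvgn (series M) ->
  `|limn (series u) - series u N| <= limn (series M) - series M N.
Proof.
move=> uM cM; have cu := series_norm_le uM cM.
have c1 : `|series u n - series u N| @[n --> \oo]
    --> `|limn (series u) - series u N|.
  by apply: cvg_norm; apply: cvgB => //; exact: cvg_cst.
have c2 : series M n - series M N @[n --> \oo] --> limn (series M) - series M N.
  by apply: cvgB => //; exact: cvg_cst.
apply: ler_cvg_to c1 c2 _; near=> n.
have Nn : (N <= n)%N by near: n; exists N.
rewrite !sub_series_geq//.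
by rewrite (le_trans (ler_norm_sum _ _ _))// ler_sum.
Unshelve. all: by end_near. Qed.

Lemma tannery (T : topologicalType) (F : set_system T) (FF : ProperFilter F)
    (f : nat -> T -> R) (g M : R^nat) :
  cvgn (series M) -> (\forall x \near F, forall k, `|f k x| <= M k) ->
  (forall k, f k x @[x --> F] --> g k) ->
  limn (series (f ^~ x)) @[x --> F] --> limn (series g).
Proof.
move=> cM fM fg.
have gM k : `|g k| <= M k.
  have c1 : `|f k x| @[x --> F] --> `|g k| by apply: cvg_norm.
  have c2 : M k @[x --> F] --> M k by exact: cvg_cst.
  apply: (ler_cvg_to c1 c2).
  by apply: filterS fM => x /(_ k).
apply/cvgrPdist_lt => e e0.
have e3 : 0 < e / 3 by rewrite divr_gt0.
have /cvgrPdist_lt/(_ _ e3)[N _ hN] := cM.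
have tail : limn (series M) - series M N < e / 3.
  by apply: le_lt_trans (hN N (leqnn _)); exact: ler_norm.
have cs : (series (f ^~ x) N) @[x --> F] --> series g N.
  rewrite /series/=; elim: N {hN tail} => [|N IH].
    rewrite big_geq//.
    under eq_fun do rewrite big_geq//.
    exact: cvg_cst.
  rewrite big_nat_recr//=.
  under eq_fun do rewrite big_nat_recr//=.
  by apply: cvgD.
move/cvgrPdist_lt : cs => /(_ _ e3) cs.
near=> x.
have fMx : forall k, `|f k x| <= M k by near: x.
have h1 : `|series g N - series (f ^~ x) N| < e / 3 by near: x.
have h2 := series_tail_le N gM cM.
have h3 := @series_tail_le (f ^~ x) M N fMx cM.
have -> : limn (series g) - limn (series (f^~ x)) =
  (limn (series g) - series g N) + (series g N - series (f ^~ x) N)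
  - (limn (series (f ^~ x)) - series (f ^~ x) N) by ring.
rewrite (le_lt_trans (ler_normB _ _))//.
have := ler_normD (limn (series g) - series g N) (series g N - series (f ^~ x) N).
lra.
Unshelve. all: by end_near. Qed.

Lemma is_derive_cvg (f : R -> R) (x l : R) :
  (h^-1 * (f (x + h) - f x)) @[h --> 0^'] --> l -> is_derive x 1 f l.
Proof.
move=> c.
have E : (fun h : R => h^-1 *: (f (h *: (1:R) + x) - f x)) =
         (fun h => h^-1 * (f (x + h) - f x)).
  by apply/funext => h; rewrite /GRing.scale/= mulr1 (addrC h).
apply: DeriveDef.
  by rewrite /derivable E; apply/cvg_ex; exists l.
by rewrite /derive E; exact/cvg_lim.
Qed.

Lemma is_derive_series (f df : nat -> R -> R) (M : R^nat) (x e : R) : 0 < e ->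
  cvgn (series M) ->
  (forall k z, `|z - x| < e -> is_derive z 1 (f k) (df k z)) ->
  (forall k z, `|z - x| < e -> `|df k z| <= M k) ->
  (forall z, `|z - x| < e -> cvgn (series (f ^~ z))) ->
  is_derive x 1 (fun z => limn (series (f ^~ z))) (limn (series (df ^~ x))).
Proof.
move=> e0 cM fd dM cf.
have xx : `|x - x| < e by rewrite subrr normr0.
apply: is_derive_cvg.
have q : limn (series (fun k => h^-1 * (f k (x + h) - f k x))) @[h --> 0^']
    --> limn (series (df ^~ x)).
  apply: (@tannery R ((0 : R)^') _ (fun k h => h^-1 * (f k (x + h) - f k x)) (df ^~ x) M) => //.
    near=> h => k.
    have he : `|h| < e.
      by near: h; apply: dnbhs0_lt.
    have h0 : h != 0 by near: h; exact: nbhs_dnbhs_neq.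
    have bnd (a b : R) : a < b -> `|a - x| < e -> `|b - x| < e ->
        `|f k b - f k a| <= M k * (b - a).
      move=> ab ax bx.
      have inn y : a <= y <= b -> `|y - x| < e.
        by move: ax bx; rewrite !ltr_norml => /andP[? ?] /andP[? ?] /andP[? ?]; apply/andP; split; lra.
      have [c cab ->] := @MVT_segment _ (f k) (df k) a b (ltW ab)
        (fun y yab => fd k y (inn y (subset_itv_oo_cc yab)))
        (derivable_within_continuous
          (fun y (yab : y \in `[a, b]) => @ex_derive _ _ _ _ _ _ _ (fd k y (inn y yab)))).
      rewrite normrM (ger0_norm (_ : 0 <= b - a)) ?subr_ge0 ?(ltW ab)//.
      by rewrite ler_wpM2r ?subr_ge0 ?(ltW ab)// dM// inn.
    have xh : `|x + h - x| < e by rewrite addrAC subrr add0r.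
    rewrite normrM normfV ler_pdivrMl ?normr_gt0// mulrC.
    have [hneg|hpos] := ltP h 0.
      have xhx : x + h < x by lra.
      have := bnd (x + h) x xhx xh xx; rewrite distrC => /le_trans; apply.
      by rewrite ltr0_norm// opprD addrA subrr add0r.
    have xhx : x < x + h by move: hpos; rewrite le_eqVlt eq_sym (negbTE h0)/=; lra.
    have := bnd x (x + h) xhx xx xh => /le_trans; apply.
    by rewrite ger0_norm// addrAC subrr add0r.
  move=> k; have := fd k x xx => -[dk <-].
  have := dk; rewrite /derivable/derive => /cvg_ex[/= l hl].
  rewrite (cvg_lim _ hl)//.
  move: hl; under eq_fun do rewrite /GRing.scale/= mulr1 (addrC _ x).
  by [].
apply: cvg_trans q; apply: near_eq_cvg; near=> h.
have he : `|h| < e by near: h; apply: dnbhs0_lt.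
have xh : `|x + h - x| < e by rewrite addrAC subrr add0r.
apply/cvg_lim => //.
have c : h^-1 * (series (f ^~ (x + h)) n - series (f ^~ x) n) @[n --> \oo] -->
    h^-1 * (limn (series (f ^~ (x + h))) - limn (series (f ^~ x))).
  apply: cvgM; first exact: cvg_cst.
  by apply: cvgB; apply: cf.
apply: cvg_trans c; apply: near_eq_cvg; near=> n.
by rewrite /series/= -sumrB mulr_sumr.
Unshelve. all: by end_near. Qed.

End Tannery.

(** * Improper integrals *)

Section OpenFTC.
Context (R : realType).
Notation mu := (@lebesgue_measure R).
Implicit Types (f F : R -> R) (a b x : R).

Lemma FTC2_segment f F a b : a < b ->
  (forall x, a <= x <= b -> is_derive x 1 F (f x)) ->
  (forall x, a <= x <= b -> {for x, continuous f}) ->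
  (\int[mu]_(x in `[a, b]) (f x)%:E = (F b - F a)%:E)%E.
Proof.
move=> ab dF cf.
have cF x : a <= x <= b -> {for x, continuous F}.
  move=> xab; apply: differentiable_continuous; apply/derivable1_diffP.
  by have [] := dF _ xab.
rewrite (@continuous_FTC2 _ f F)//.
- by apply: continuous_in_subspaceT => x; rewrite inE/= in_itv/=; exact: cf.
- split.
  + by move=> x /subset_itv_oo_cc; rewrite in_itv/= => /dF[].
  + by apply: cvg_at_right_filter; apply: cF; rewrite lexx ltW.
  + by apply: cvg_at_left_filter; apply: cF; rewrite lexx ltW.
- by move=> x /subset_itv_oo_cc; rewrite in_itv/= derive1E => /dF[].
Qed.

Lemma ge0_FTC_bigcup f F (u v : R^nat) la lb :
  (forall n, u n < v n) -> nonincreasing_seq u -> nondecreasing_seq v ->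
  (forall n x, u n <= x <= v n -> 0 <= f x) ->
  (forall n x, u n <= x <= v n -> is_derive x 1 F (f x)) ->
  (forall n x, u n <= x <= v n -> {for x, continuous f}) ->
  F (u n) @[n --> \oo] --> la -> F (v n) @[n --> \oo] --> lb ->
  (\int[mu]_(x in \bigcup_n `[u n, v n]%classic) (f x)%:E = (lb - la)%:E)%E.
Proof.
move=> uv nu nv f0 dF cf Fla Flb.
have mf n : measurable_fun (`[u n, v n]%classic : set R) (fun x => (f x)%:E).
  apply/measurable_EFinP; apply: subspace_continuous_measurable_fun => //.
  by apply: continuous_in_subspaceT => x; rewrite inE/= in_itv/=; exact: cf.
have h : ((\int[mu]_(x in `[u n, v n]) (f x)%:E) @[n --> \oo] -->
    \int[mu]_(x in \bigcup_n `[u n, v n]%classic) (f x)%:E)%E.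
  apply: ge0_nondecreasing_set_cvg_integral => //.
  - apply/nondecreasing_seqP => n; apply/subsetPset => x /=.
    rewrite !in_itv/= => /andP[ux xv]; rewrite (le_trans _ ux) ?(le_trans xv)//.
      exact: nv.
    exact: nu.
rewrite -(cvg_lim _ h)//; apply/cvg_lim => //.
under eq_fun do rewrite (FTC2_segment (uv _) (@dF _) (@cf _)).
by apply: cvg_EFin; [near=> n|apply: cvgB].
Unshelve. all: by end_near. Qed.

Lemma itv_oo_bigcup a b : a < b ->
  `]a, b[%classic = \bigcup_n `[a + (b - a) / n.+3%:R, b - (b - a) / n.+3%:R]%classic.
Proof.
move=> ab; have ab0 : 0 < b - a by rewrite subr_gt0.
apply/seteqP; split=> [x /=|x [n _] /=]; rewrite !in_itv/=.
- move=> /andP[ax xb].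
  pose e := Num.min (x - a) (b - x).
  have e0 : 0 < e by rewrite lt_min !subr_gt0 ax.
  have [n hn] : exists n : nat, (b - a) / e < n%:R.
    by exists (Num.truncn ((b - a) / e)).+1; exact: truncnS_gt.
  exists n => //=; rewrite in_itv/=.
  have hh : (b - a) / n.+3%:R <= e.
    rewrite ler_pdivrMr// mulrC -ler_pdivrMr// ltW// (lt_le_trans hn)//.
    by rewrite ler_nat -addn3 leq_addr.
  have h1 : e <= x - a by rewrite ge_min lexx.
  have h2 : e <= b - x by rewrite ge_min lexx orbT.
  by move: hh; set d := _ / _ => hh; apply/andP; split; lra.
- move=> /andP[h1 h2].
  have : 0 < (b - a) / n.+3%:R by rewrite divr_gt0.
  by move: h1 h2; set d := _ / _ => h1 h2 h; apply/andP; split; lra.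
Qed.

Lemma cvg_divn (c : R) (k : nat) : c / (n + k).+1%:R @[n --> \oo] --> (0 : R).
Proof.
rewrite -[X in _ --> X](mulr0 c); apply: cvgM; first exact: cvg_cst.
have h : [sequence (@harmonic R) (n + k)%N]_n @ \oo --> (0 : R).
  by rewrite cvg_shiftn; exact: cvg_harmonic.
exact: h.
Qed.

Lemma ge0_FTC_oo f F a b la lb : a < b ->
  (forall x, a < x < b -> 0 <= f x) ->
  (forall x, a < x < b -> is_derive x 1 F (f x)) ->
  (forall x, a < x < b -> {for x, continuous f}) ->
  F x @[x --> a^'+] --> la -> F x @[x --> b^'-] --> lb ->
  (\int[mu]_(x in `]a, b[) (f x)%:E = (lb - la)%:E)%E.
Proof.
move=> ab f0 dF cf Fla Flb; have ab0 : 0 < b - a by rewrite subr_gt0.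
have inn (n : nat) x : a + (b - a) / n.+3%:R <= x <= b - (b - a) / n.+3%:R ->
    a < x < b.
  have : 0 < (b - a) / n.+3%:R by rewrite divr_gt0.
  by set d := _ / _ => h /andP[? ?]; apply/andP; split; lra.
have c0 : (b - a) / n.+3%:R @[n --> \oo] --> (0 : R).
  by have := cvg_divn (b - a) 2; under eq_fun do rewrite addn2.
rewrite itv_oo_bigcup//; apply: (@ge0_FTC_bigcup f F _ _ la lb).
- move=> n; have : (b - a) / n.+3%:R <= (b - a) / 3.
    by rewrite ler_pM2l// lef_pV2 ?posrE// ler_nat.
  by set d := _ / n.+3%:R => h; lra.
- apply/nonincreasing_seqP => n; rewrite lerD2l ler_pM2l// lef_pV2 ?posrE//.
  by rewrite ler_nat.
- apply/nondecreasing_seqP => n; rewrite lerD2l lerN2 ler_pM2l// lef_pV2 ?posrE//.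
  by rewrite ler_nat.
- by move=> n x /inn; exact: f0.
- by move=> n x /inn; exact: dF.
- by move=> n x /inn; exact: cf.
- move/cvg_at_rightP : Fla; apply; split.
    by move=> n; rewrite ltrDl divr_gt0.
  by rewrite -[X in _ --> X]addr0; apply: cvgD => //; exact: cvg_cst.
- move/cvg_at_leftP : Flb; apply; split.
    by move=> n; rewrite ltrBlDr ltrDl divr_gt0.
  by rewrite -[X in _ --> X]subr0; apply: cvgB => //; exact: cvg_cst.
Qed.

Lemma itv_oy_bigcup a :
  `]a, +oo[%classic = \bigcup_n `[a + n.+1%:R^-1, a + n.+2%:R]%classic.
Proof.
apply/seteqP; split=> [x /=|x [n _] /=]; rewrite !in_itv/= ?andbT; last first.
  by move=> /andP[+ _]; apply: lt_le_trans; rewrite ltrDl.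
move=> ax; have ax0 : 0 < x - a by rewrite subr_gt0.
exists (Num.truncn (x - a) + Num.truncn (x - a)^-1)%N => //=; rewrite in_itv/=.
apply/andP; split.
  rewrite -lerBrDl -[leRHS]invrK lef_pV2 ?posrE ?invr_gt0//.
  by rewrite (le_trans (ltW (truncnS_gt _)))// ler_nat ltnS leq_addl.
by rewrite -lerBlDl (le_trans (ltW (truncnS_gt _)))// ler_nat ltnS leqW// leq_addr.
Qed.

Lemma ge0_FTC_oy f F a la lb :
  (forall x, a < x -> 0 <= f x) ->
  (forall x, a < x -> is_derive x 1 F (f x)) ->
  (forall x, a < x -> {for x, continuous f}) ->
  F x @[x --> a^'+] --> la -> F x @[x --> +oo] --> lb ->
  (\int[mu]_(x in `]a, +oo[) (f x)%:E = (lb - la)%:E)%E.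
Proof.
move=> f0 dF cf Fla Flb.
have inn (n : nat) x : a + n.+1%:R^-1 <= x <= a + n.+2%:R -> a < x.
  by move=> /andP[+ _]; apply: lt_le_trans; rewrite ltrDl.
rewrite itv_oy_bigcup//; apply: (@ge0_FTC_bigcup f F _ _ la lb).
- move=> n; rewrite ltrD2l (@le_lt_trans _ _ 1)//.
    by rewrite invf_le1// ler1n.
  by rewrite ltr1n.
- by apply/nonincreasing_seqP => n; rewrite lerD2l lef_pV2 ?posrE// ler_nat.
- by apply/nondecreasing_seqP => n; rewrite lerD2l ler_nat.
- by move=> n x /inn; exact: f0.
- by move=> n x /inn; exact: dF.
- by move=> n x /inn; exact: cf.
- move/cvg_at_rightP : Fla; apply; split.
    by move=> n; rewrite ltrDl.
  rewrite -[X in _ --> X]addr0; apply: cvgD; first exact: cvg_cst.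
  exact: cvg_harmonic.
- move/cvg_pinftyP : Flb; apply.
  apply/cvgryPge => A; near=> n.
  have : A - a <= n%:R by near: n; exact: nbhs_infty_ger.
  by rewrite -lerBlDl => /le_trans; apply; rewrite ler_nat -addn2 leq_addr.
Unshelve. all: by end_near. Qed.

End OpenFTC.

Section PowerFacts.
Context (R : realType).
Implicit Types (x s p : R).

Lemma is_derive_powR x p : 0 < x ->
  is_derive x 1 (fun x => x `^ p) (p * x `^ (p - 1)).
Proof.
move=> x0; apply: DeriveDef; first by apply: derivable_powR; rewrite in_itv/= x0.
by rewrite -derive1E powR_derive1// in_itv/= x0.
Qed.

Lemma continuous_powR x p : 0 < x -> {for x, continuous (fun x => x `^ p)}.
Proof.
move=> x0; apply: differentiable_continuous; apply/derivable1_diffP.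
by apply: derivable_powR; rewrite in_itv/= x0.
Qed.

Lemma powRS x p : 0 < x -> x `^ (p + 1) = x * x `^ p.
Proof.
by move=> x0; rewrite powRD ?powRr1 1?mulrC ?ltW// (gt_eqF x0) implybT.
Qed.

Lemma powRDp x p q : 0 < x -> x `^ (p + q) = x `^ p * x `^ q.
Proof. by move=> x0; rewrite powRD// (gt_eqF x0) implybT. Qed.

Lemma powRBp x p q : 0 < x -> x `^ (p - q) = x `^ p / x `^ q.
Proof. by move=> x0; rewrite powRB// (gt_eqF x0) implybT. Qed.

Lemma powR_cvgy0 (s : R) : 0 < s -> x `^ (- s) @[x --> +oo] --> (0 : R).
Proof.
move=> s0; apply/cvgrPdist_lt => e e0; near=> x.
have x0 : 0 < x by near: x; exact: nbhs_pinfty_gt.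
rewrite sub0r normrN ger0_norm ?powR_ge0// powRN.
have hx : e `^ (- s^-1) < x by near: x; exact: nbhs_pinfty_gt.
rewrite invf_plt ?posrE ?powR_gt0//.
have -> : e^-1 = (e `^ (- s^-1)) `^ s.
  by rewrite -powRrM mulNr mulVf ?gt_eqF// powR_inv1 ?ltW.
by apply: gt0_ltr_powR; rewrite ?nnegrE ?powR_ge0// ltW.
Unshelve. all: by end_near. Qed.

End PowerFacts.

Section OpenFTCDifference.
Context (R : realType).
Notation mu := (@lebesgue_measure R).
Implicit Types (f g F : R -> R) (a x : R).

Lemma ge0_FTC_oy_diff f g F a la lb :
  (forall x, a < x -> 0 <= f x) -> (forall x, a < x -> 0 <= g x) ->
  (forall x, a < x -> is_derive x 1 F (f x - g x)) ->
  (forall x, a < x -> {for x, continuous f}) ->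
  (forall x, a < x -> {for x, continuous g}) ->
  F x @[x --> a^'+] --> la -> F x @[x --> +oo] --> lb ->
  (\int[mu]_(x in `]a, +oo[) (f x)%:E + la%:E =
   \int[mu]_(x in `]a, +oo[) (g x)%:E + lb%:E)%E.
Proof.
move=> f0 g0 dF cf cg Fla Flb.
pose u n := a + n.+1%:R^-1; pose v n := a + n.+2%:R.
have inn (n : nat) x : u n <= x <= v n -> a < x.
  by move=> /andP[+ _]; apply: lt_le_trans; rewrite ltrDl.
have uv n : u n < v n.
  rewrite ltrD2l (@le_lt_trans _ _ 1)// ?ltr1n//.
  by rewrite invf_le1// ler1n.
have mh (h : R -> R) n : (forall x, a < x -> {for x, continuous h}) ->
   measurable_fun (`[u n, v n]%classic : set R) h.
  move=> ch; apply: subspace_continuous_measurable_fun => //.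
  apply: continuous_in_subspaceT => x; rewrite inE/= in_itv/= => /inn; exact: ch.
have ih (h : R -> R) n : (forall x, a < x -> {for x, continuous h}) ->
   mu.-integrable `[u n, v n] (EFin \o h).
  move=> ch; apply: continuous_compact_integrable; first exact: segment_compact.
  apply: continuous_in_subspaceT => x; rewrite inE/= in_itv/= => /inn; exact: ch.
have lim (h : R -> R) : (forall x, a < x -> 0 <= h x) ->
    (forall x, a < x -> {for x, continuous h}) ->
    ((\int[mu]_(x in `[u n, v n]) (h x)%:E) @[n --> \oo] -->
    \int[mu]_(x in `]a, +oo[) (h x)%:E)%E.
  move=> h0 ch; rewrite itv_oy_bigcup; apply: ge0_nondecreasing_set_cvg_integral => //.
  - apply/nondecreasing_seqP => n; apply/subsetPset => x /=.
    rewrite !in_itv/= => /andP[ux xv]; apply/andP; split.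
      by rewrite (le_trans _ ux)// lerD2l lef_pV2 ?posrE// ler_nat.
    by rewrite (le_trans xv)// lerD2l ler_nat.
  - by move=> n; apply/measurable_EFinP; apply: mh.
  - by move=> n x /=; rewrite in_itv/= lee_fin => /inn/h0.
have Fu : F (u n) @[n --> \oo] --> la.
  move/cvg_at_rightP : Fla; apply; split.
    by move=> n; rewrite ltrDl.
  rewrite -[X in _ --> X]addr0; apply: cvgD; first exact: cvg_cst.
  exact: cvg_harmonic.
have Fv : F (v n) @[n --> \oo] --> lb.
  move/cvg_pinftyP : Flb; apply.
  apply/cvgryPge => A; near=> n.
  have : A - a <= n%:R by near: n; exact: nbhs_infty_ger.
  by rewrite -lerBlDl => /le_trans; apply; rewrite ler_nat -addn2 leq_addr.
have h1 : ((\int[mu]_(x in `[u n, v n]) (f x)%:E + (F (u n))%:E) @[n --> \oo] -->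
    \int[mu]_(x in `]a, +oo[) (f x)%:E + la%:E)%E.
  apply: cvgeD; [by rewrite fin_num_adde_defl|exact: lim|].
  by apply: cvg_EFin => //; near=> n.
have h2 : ((\int[mu]_(x in `[u n, v n]) (g x)%:E + (F (v n))%:E) @[n --> \oo] -->
    \int[mu]_(x in `]a, +oo[) (g x)%:E + lb%:E)%E.
  apply: cvgeD; [by rewrite fin_num_adde_defl|exact: lim|].
  by apply: cvg_EFin => //; near=> n.
suff E : (fun n => \int[mu]_(x in `[u n, v n]) (f x)%:E + (F (u n))%:E)%E =
    (fun n => \int[mu]_(x in `[u n, v n]) (g x)%:E + (F (v n))%:E)%E.
  by rewrite E in h1; exact: cvg_unique h1 h2.
apply/funext => n.
have := @FTC2_segment _ (fun x => f x - g x) F _ _ (uv n)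
  (fun x xx => dF x (inn n x xx))
  (fun x xx => continuousB (cf x (inn n x xx)) (cg x (inn n x xx))).
under eq_integral do rewrite EFinB.
rewrite integralB//; [|exact: ih|exact: ih].
have /fineK <- : (\int[mu]_(x in `[u n, v n]) (f x)%:E \is a fin_num)%E.
  by apply: integrable_fin_num => //; exact: ih.
have /fineK <- : (\int[mu]_(x in `[u n, v n]) (g x)%:E \is a fin_num)%E.
  by apply: integrable_fin_num => //; exact: ih.
by rewrite -EFinB -!EFinD => -[] h; congr EFin; lra.
Unshelve. all: by end_near. Qed.

End OpenFTCDifference.

Section TonelliDomain.
Context d1 d2 (T1 : measurableType d1) (T2 : measurableType d2) (R : realType).
Context (m1 : {sigma_finite_measure set T1 -> \bar R}).
Context (m2 : {sigma_finite_measure set T2 -> \bar R}).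

Lemma tonelli_domain (A : set T1) (B : set T2) (f : T1 * T2 -> \bar R) :
  measurable A -> measurable B -> measurable_fun [set: T1 * T2] f ->
  (forall x y, A x -> B y -> (0 <= f (x, y))%E) ->
  (\int[m1]_(x in A) \int[m2]_(y in B) f (x, y) =
   \int[m2]_(y in B) \int[m1]_(x in A) f (x, y))%E.
Proof.
move=> mA mB mf f0.
pose g := f \_ (A `*` B).
have mg : measurable_fun [set: T1 * T2] g.
  apply/(measurable_restrictT f); first exact: measurableX.
  exact: measurable_funS mf.
have g0 z : (0 <= g z)%E.
  rewrite /g patchE; case: ifPn => //; rewrite inE => -[z1 z2].
  by case: z z1 z2 => x y /=; exact: f0.
have := @fubini_tonelli _ _ _ _ _ m1 m2 g mg g0.
have -> : (\int[m1]_x \int[m2]_y g (x, y) = \int[m1]_(x in A) \int[m2]_(y in B) f (x, y))%E.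
  rewrite [RHS]integral_mkcond; apply: eq_integral => x _.
  rewrite patchE; case: ifPn => xA.
    rewrite [RHS]integral_mkcond; apply: eq_integral => y _.
    by rewrite /g !patchE in_setX/= xA.
  by apply: integral0_eq => y _; rewrite /g patchE in_setX/= (negbTE xA).
move=> ->.
rewrite [RHS]integral_mkcond; apply: eq_integral => y _.
rewrite patchE; case: ifPn => yB.
  rewrite [RHS]integral_mkcond; apply: eq_integral => x _.
  by rewrite /g !patchE in_setX/= yB andbT.
by apply: integral0_eq => x _; rewrite /g patchE in_setX/= (negbTE yB) andbF.
Qed.

End TonelliDomain.

(** * The Gamma function *)

Section GammaFunction.
Context (R : realType).
Notation mu := (@lebesgue_measure R).
Implicit Types (x s q p c M : R).

Lemma expR_ge_exprn x n : 0 <= x -> x ^+ n / n`!%:R <= expR x.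
Proof.
move=> x0; case: n => [|n].
  by rewrite expr0 fact0 divr1 (le_trans _ (expR_ge1Dx x))// lerDl.
by rewrite (le_trans _ (expR_ge1Dxn n x0))// lerDr.
Qed.

Lemma powR_le_expR p c : 0 < c ->
  exists2 C, 0 <= C & forall x, 1 <= x -> x `^ p <= C * expR (c * x).
Proof.
move=> c0; have [n pn] : exists n : nat, p <= n%:R.
  by exists (Num.truncn p).+1; exact/ltW/truncnS_gt.
exists (n`!%:R * c ^- n); first by rewrite mulr_ge0// invr_ge0 exprn_ge0// ltW.
move=> x x1; have x0 : 0 <= x by rewrite (le_trans _ x1).
apply: (@le_trans _ _ (x ^+ n)); first by rewrite -powR_mulrn// ler_powR.
have := @expR_ge_exprn (c * x) n; rewrite mulr_ge0 ?(ltW c0)// => /(_ isT).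
rewrite exprMn ler_pdivrMr ?ltr0n ?fact_gt0// mulrC => h.
by rewrite -mulrA mulrCA mulrC ler_pdivlMr ?exprn_gt0// mulrC [leRHS]mulrC mulrC.
Qed.

Definition gamma_integrand s q x : R := x `^ (s - 1) * expR (- (q * x)).

Lemma gamma_integrand_ge0 s q x : 0 <= gamma_integrand s q x.
Proof. by rewrite mulr_ge0 ?powR_ge0 ?expR_ge0. Qed.

Lemma measurable_gamma_integrand s q (D : set R) :
  measurable_fun D (gamma_integrand s q).
Proof.
apply: measurable_funTS; apply: measurable_funM; first exact: measurable_powR.
by apply: measurableT_comp => //; apply: measurableT_comp => //.
Qed.

Lemma is_derive_expRM (k x : R) :
  is_derive x 1 (fun x => expR (- (k * x))) (- k * expR (- (k * x))).
Proof.
have h1 : is_derive x 1 (fun x : R => - (k * x)) (- k).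
  by apply: is_derive_eq; rewrite /GRing.scale/= mulr1.
have := @is_derive1_comp _ (@expR R) (fun x : R => - (k * x)) x _ _ (is_derive_expR _) h1.
by rewrite mulrC.
Qed.

Lemma continuous_expRM (k x : R) : {for x, continuous (fun x => expR (- (k * x)))}.
Proof.
apply: differentiable_continuous; apply/derivable1_diffP.
by have [] := is_derive_expRM k x.
Qed.

Lemma continuous_gamma_integrand s q x : 0 < x ->
  {for x, continuous (gamma_integrand s q)}.
Proof.
by move=> x0; apply: continuousM; [exact: continuous_powR|exact: continuous_expRM].
Qed.

Lemma is_derive_gamma_integrand s q x : 0 < x ->
  is_derive x 1 (fun x => x `^ s * expR (- (q * x)))
    (s * gamma_integrand s q x - q * gamma_integrand (s + 1) q x).
Proof.
move=> x0; have h1 := is_derive_powR s x0; have h2 := is_derive_expRM q x.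
apply: is_derive_eq; rewrite /GRing.scale/= /gamma_integrand addrK.
ring.
Qed.

Lemma powR_expRM_cvgy s q : 0 < q ->
  x `^ s * expR (- (q * x)) @[x --> +oo] --> (0 : R).
Proof.
move=> q0; have [C C0 hC] := @powR_le_expR (s + 1) q q0.
apply: (@squeeze_cvgr _ _ _ _ (fun=> 0) (fun x => C * x `^ (- 1))); last 2 first.
- exact: cvg_cst.
- rewrite -[X in _ --> X](mulr0 C); apply: cvgM; first exact: cvg_cst.
  exact: powR_cvgy0.
near=> x; have x1 : 1 <= x by near: x; exact: nbhs_pinfty_ge.
have x0 : 0 < x by rewrite (lt_le_trans _ x1).
rewrite mulr_ge0 ?powR_ge0 ?expR_ge0//= expRN.
rewrite ler_pdivrMr ?expR_gt0// -(ler_pM2l x0) -powRS//.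
rewrite (le_trans (hC x x1))// powR_inv1 ?(ltW x0)//.
by rewrite le_eqVlt; apply/orP; left; apply/eqP; field; rewrite gt_eqF.
Unshelve. all: by end_near. Qed.

Lemma integral_expRM q a : 0 < q ->
  (\int[mu]_(x in `]a, +oo[) (expR (- (q * x)))%:E = (q^-1 * expR (- (q * a)))%:E)%E.
Proof.
move=> q0.
transitivity ((0 - - (q^-1 * expR (- (q * a))))%:E); last by rewrite sub0r opprK.
apply: (@ge0_FTC_oy _ (fun x => expR (- (q * x))) (fun x => - (q^-1 * expR (- (q * x))))).
- by move=> x _; exact: expR_ge0.
- move=> x _; have h := is_derive_expRM q x; apply: is_derive_eq.
  by rewrite /GRing.scale/= mulNr mulrN opprK mulrA mulVf ?gt_eqF// mul1r.
- by move=> x _; exact: continuous_expRM.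
- apply: cvgN; apply: cvgM; first exact: cvg_cst.
  by apply: cvg_at_right_filter; exact: continuous_expRM.
- rewrite -oppr0; apply: cvgN; rewrite -[X in _ --> X](mulr0 q^-1).
  apply: cvgM; first exact: cvg_cst.
  have := @powR_expRM_cvgy 0 q q0.
  by under eq_fun do rewrite powRr0 mul1r.
Qed.

Lemma integral_powR01 s : 0 < s ->
  (\int[mu]_(x in `]0%R, 1%R[) (x `^ (s - 1))%:E = (s^-1)%:E)%E.
Proof.
move=> s0.
rewrite -[in RHS](subr0 s^-1).
apply: (@ge0_FTC_oo _ (fun x => x `^ (s - 1)) (fun x => s^-1 * x `^ s)) => //.
- by move=> x _; exact: powR_ge0.
- move=> x /andP[x0 _]; have h := is_derive_powR s x0; apply: is_derive_eq.
  by rewrite /GRing.scale/= mulrA mulVf ?gt_eqF// mul1r.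
- by move=> x /andP[x0 _]; exact: continuous_powR.
- rewrite -[X in _ --> X](mulr0 s^-1).
  by apply: cvgM; [exact: cvg_cst|exact: powR_cvg0].
- rewrite -[X in _ --> X]mulr1; apply: cvgM; first exact: cvg_cst.
  apply: cvg_at_left_filter; have := @continuous_powR R 1 s ltr01.
  by rewrite /prop_for /continuous_at powR1.
Qed.

Lemma gamma_integrand_fin s q : 0 < s -> 0 < q ->
  (\int[mu]_(x in `]0%R, +oo[) (gamma_integrand s q x)%:E < +oo)%E.
Proof.
move=> s0 q0; have q2 : 0 < q / 2 by rewrite divr_gt0.
have [C C0 hC] := @powR_le_expR (s - 1) (q / 2) q2.
have mf (D : set R) : measurable_fun D (fun x => (gamma_integrand s q x)%:E).
  by apply/measurable_EFinP; exact: measurable_gamma_integrand.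
have -> : `]0%R, +oo[%classic = `]0%R, 1%R[%classic `|` `[1%R, +oo[%classic :> set R.
  by rewrite -itv_bndbnd_setU ?bnd_simp.
rewrite ge0_integral_setU//=; last 3 first.
- exact: mf.
- by move=> x _; rewrite lee_fin gamma_integrand_ge0.
- by apply/disj_setPS => x [] /=; rewrite !in_itv/= andbT => /andP[_]; lra.
apply: lte_add_pinfty.
  apply: (@le_lt_trans _ _ (\int[mu]_(x in `]0%R, 1%R[) (x `^ (s - 1))%:E)%E); last first.
    by rewrite integral_powR01// ltry.
  apply: ge0_le_integral => //=.
  - by move=> x _; rewrite lee_fin gamma_integrand_ge0.
  - exact: mf.
  - by apply/measurable_EFinP; apply: measurable_funTS; exact: measurable_powR.
  - move=> x; rewrite in_itv/= => /andP[x0 _]; rewrite lee_fin.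
    rewrite ler_piMr ?powR_ge0// expR_le1 oppr_le0 mulr_ge0// ltW//.
have pw x : 1 <= x -> gamma_integrand s q x <= C * expR (- (q / 2 * x)).
  move=> x1; rewrite /gamma_integrand.
  apply: le_trans (ler_wpM2r (expR_ge0 _) (hC x x1)) _; rewrite /= -(mulrA C) -expRD.
  by rewrite ler_wpM2l// ler_expR; lra.
have mE : measurable_fun [set: R] (fun x => expR (- (q / 2 * x))).
  by apply: measurableT_comp => //; apply: measurableT_comp => //; exact: measurable_funM.
apply: (@le_lt_trans _ _ (\int[mu]_(x in `[1%R, +oo[) (C * expR (- (q / 2 * x)))%:E)%E).
  apply: ge0_le_integral => //=.
  - by move=> x _; rewrite lee_fin gamma_integrand_ge0.
  - exact: mf.
  - by apply/measurable_EFinP; apply: measurable_funTS; exact: measurable_funM.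
  - by move=> x; rewrite in_itv/= andbT => x1; rewrite lee_fin; exact: pw.
under eq_integral do rewrite EFinM.
rewrite ge0_integralZl_EFin//=; last by apply/measurable_EFinP; exact: measurable_funTS.
apply: lte_mul_pinfty => //.
rewrite -integral_itv_obnd_cbnd; last by apply/measurable_EFinP; exact: measurable_funTS.
by rewrite integral_expRM// ltry.
Qed.

Lemma gammaE s : 0 < s ->
  (\int[mu]_(x in `]0%R, +oo[) (gamma_integrand s 1 x)%:E = (Gamma s)%:E)%E.
Proof.
move=> s0.
have E : (\int[mu]_(x in `]0%R, +oo[) (x `^ (s - 1) * expR (- x))%:E =
    \int[mu]_(x in `]0%R, +oo[) (gamma_integrand s 1 x)%:E)%E.
  by apply: eq_integral => x _; rewrite /gamma_integrand mul1r.
rewrite /Gamma /Rintegral E fineK// ge0_fin_numE; first exact: gamma_integrand_fin.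
by apply: integral_ge0 => x _; rewrite lee_fin gamma_integrand_ge0.
Qed.

Lemma integral_scale (G : R -> R) q : 0 < q ->
  (forall x, 0 < x -> 0 <= G x) -> (forall x, 0 < x -> {for x, continuous G}) ->
  (\int[mu]_(x in `]0%R, +oo[) (G x)%:E =
   \int[mu]_(x in `]0%R, +oo[) (G (q * x) * q)%:E)%E.
Proof.
move=> q0 G0 cG.
have lim (h : R -> R) (c : R) : 0 < c -> (forall x, 0 < x -> 0 <= h x) ->
    (forall x, 0 < x -> {for x, continuous h}) ->
    ((\int[mu]_(x in `[(c / n.+1%:R)%R, +oo[) (h x)%:E) @[n --> \oo] -->
    \int[mu]_(x in `]0%R, +oo[) (h x)%:E)%E.
  move=> c0 h0 ch.
  have -> : `]0%R, +oo[%classic = \bigcup_n `[c / n.+1%:R, +oo[%classic :> set R.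
    apply/seteqP; split=> [x /=|x [n _] /=]; rewrite !in_itv/= !andbT; last first.
      by apply: lt_le_trans; rewrite divr_gt0.
    move=> x0; exists (Num.truncn (c / x)) => //=; rewrite in_itv/= andbT.
    by rewrite ler_pdivrMr// mulrC -ler_pdivrMr// ltW// truncnS_gt.
  have inn n x : c / n.+1%:R <= x -> 0 < x.
    by apply: lt_le_trans; rewrite divr_gt0.
  apply: ge0_nondecreasing_set_cvg_integral => //.
  - apply/nondecreasing_seqP => n; apply/subsetPset => x /=.
    rewrite !in_itv/= !andbT; apply: le_trans.
    by rewrite ler_pM2l// lef_pV2 ?posrE// ler_nat.
  - move=> n; apply/measurable_EFinP; apply: subspace_continuous_measurable_fun => //.
    by apply: continuous_in_subspaceT => x; rewrite inE/= in_itv/= andbT => /inn; exact: ch.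
  - by move=> n x /=; rewrite in_itv/= andbT lee_fin => /inn/h0.
have dq x : is_derive x (1 : R) (fun x : R => q * x) q.
  by apply: is_derive_eq; rewrite /GRing.scale/= mulr1.
have dqE : derive1 (fun x : R => q * x) = cst q.
  by apply/funext => x; rewrite derive1E; have [_ ->] := dq x.
have cq : continuous (fun x : R => q * x).
  by move=> x; apply: cvgM; [exact: cvg_cst|exact: cvg_id].
have h1 := lim G q q0 G0 cG.
have h2 : ((\int[mu]_(x in `[(1 / n.+1%:R)%R, +oo[) (G (q * x) * q)%:E) @[n --> \oo] -->
    \int[mu]_(x in `]0%R, +oo[) (G (q * x) * q)%:E)%E.
  apply: (lim (fun x => G (q * x) * q)) => //.
    by move=> x x0; rewrite mulr_ge0 ?(ltW q0)// G0// mulr_gt0.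
  move=> x x0; apply: continuousM; last exact: cst_continuous.
  apply: (@continuous_comp _ _ _ (fun x => q * x) G); first exact: cq.
  by apply: cG; rewrite mulr_gt0.
suff E : (fun n => \int[mu]_(x in `[(q / n.+1%:R)%R, +oo[) (G x)%:E)%E =
    (fun n => \int[mu]_(x in `[(1 / n.+1%:R)%R, +oo[) (G (q * x) * q)%:E)%E.
  by rewrite E in h1; exact: cvg_unique h1 h2.
apply/funext => n.
have := @increasing_ge0_integration_by_substitutiony R (fun x => q * x) G (1 / n.+1%:R).
rewrite dqE /= mulrA mulr1 => -> //.
- by move=> x y _ _ xy; rewrite ltr_pM2l.
- by move=> x _; exact: cst_continuous.
- exact: is_cvg_cst.
- exact: is_cvg_cst.
- split; first by move=> x _; have [] := dq x.
  by apply: cvg_at_right_filter; exact: cq.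
- apply/cvgryPge => A; near=> x.
  by rewrite mulrC -ler_pdivrMr//; near: x; apply: nbhs_pinfty_ge; rewrite num_real.
- apply: continuous_in_subspaceT => x; rewrite inE/= in_itv/= andbT => xx.
  by apply: cG; rewrite (lt_le_trans _ xx)// divr_gt0.
- move=> x; rewrite in_itv/= andbT => xx.
  by apply: G0; rewrite (lt_trans _ xx)// divr_gt0.
Unshelve. all: by end_near. Qed.

Lemma integral_gamma_integrand s q : 0 < s -> 0 < q ->
  (\int[mu]_(x in `]0%R, +oo[) (gamma_integrand s q x)%:E =
   (Gamma s * q `^ (- s))%:E)%E.
Proof.
move=> s0 q0; rewrite EFinM -gammaE//.
rewrite (@integral_scale (gamma_integrand s 1) q)//; last 2 first.
- by move=> x _; exact: gamma_integrand_ge0.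
- by move=> x; exact: continuous_gamma_integrand.
rewrite muleC -ge0_integralZl_EFin ?powR_ge0//; last 2 first.
- by move=> x _; rewrite lee_fin mulr_ge0 ?(ltW q0)// gamma_integrand_ge0.
- apply/measurable_EFinP; apply: measurable_funM => //.
  apply: measurableT_comp; first exact: measurable_gamma_integrand.
  exact: measurable_funM.
apply: eq_integral => x; rewrite inE/= in_itv/= andbT => x0.
rewrite -EFinM; congr EFin; rewrite /gamma_integrand mul1r.
rewrite (powRM _ (ltW q0) (ltW x0)) powRN (powRBp _ _ q0) powRr1 ?(ltW q0)//.
by field; rewrite !gt_eqF// powR_gt0.
Qed.

Lemma GammaS s : 0 < s -> Gamma (s + 1) = s * Gamma s.
Proof.
move=> s0.
have h : (\int[mu]_(x in `]0%R, +oo[) (s * gamma_integrand s 1 x)%:E + 0%:E =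
   \int[mu]_(x in `]0%R, +oo[) (gamma_integrand (s + 1) 1 x)%:E + 0%:E)%E.
  apply: (@ge0_FTC_oy_diff R _ _ (fun x => x `^ s * expR (- (1 * x)))).
  - by move=> x _; rewrite mulr_ge0 ?(ltW s0)// gamma_integrand_ge0.
  - by move=> x _; exact: gamma_integrand_ge0.
  - by move=> x x0; have := is_derive_gamma_integrand s 1 x0; rewrite mul1r.
  - move=> x x0; apply: continuousM; first exact: cst_continuous.
    exact: continuous_gamma_integrand.
  - by move=> x x0; exact: continuous_gamma_integrand.
  - rewrite -[X in _ --> X](mul0r (expR (- (1 * 0)))); apply: cvgM.
      exact: powR_cvg0.
    by apply: cvg_at_right_filter; exact: continuous_expRM.
  - by apply: powR_expRM_cvgy.
move: h; rewrite !adde0 gammaE ?addr_gt0//.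
under eq_integral do rewrite EFinM.
rewrite ge0_integralZl_EFin ?(ltW s0)//; last 2 first.
- by move=> x _; rewrite lee_fin gamma_integrand_ge0.
- by apply/measurable_EFinP; exact: measurable_gamma_integrand.
by rewrite gammaE// -EFinM => -[].
Qed.

Lemma gamma_integrand1 : gamma_integrand 1 1 = fun x => expR (- (1 * x)).
Proof.
by apply/funext => x; rewrite /gamma_integrand subrr powRr0 mul1r.
Qed.

Lemma Gamma_ge_expN1 s : 1 <= s -> expR (- 1) <= Gamma s.
Proof.
move=> s1; have s0 : 0 < s by rewrite (lt_le_trans _ s1).
rewrite -lee_fin -gammaE//.
apply: (@le_trans _ _ (\int[mu]_(x in `]1%R, +oo[) (gamma_integrand s 1 x)%:E)%E); last first.
  apply: ge0_subset_integral => //=.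
  - by apply/measurable_EFinP; exact: measurable_gamma_integrand.
  - by move=> x _; rewrite lee_fin gamma_integrand_ge0.
  - by move=> x /=; rewrite !in_itv/= !andbT; exact: lt_trans.
apply: (@le_trans _ _ (\int[mu]_(x in `]1%R, +oo[) (gamma_integrand 1 1 x)%:E)%E).
  by rewrite gamma_integrand1 integral_expRM// invr1 !mul1r.
apply: ge0_le_integral => //=.
- by move=> x _; rewrite lee_fin gamma_integrand_ge0.
- by apply/measurable_EFinP; exact: measurable_gamma_integrand.
- by apply/measurable_EFinP; exact: measurable_gamma_integrand.
move=> x; rewrite in_itv/= andbT => x1; rewrite lee_fin ler_wpM2r ?expR_ge0// subrr powRr0.
rewrite -[leLHS](powRr0 (x : R)).
by apply: ler_powR; rewrite ?(ltW x1)// subr_ge0.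
Qed.

Lemma Gamma_gt0 s : 0 < s -> 0 < Gamma s.
Proof.
move=> s0; rewrite -(pmulr_rgt0 _ s0) -GammaS//.
by apply: lt_le_trans (Gamma_ge_expN1 _); rewrite ?expR_gt0// lerDr ltW.
Qed.

Lemma Gamma1 : Gamma (1 : R) = 1.
Proof.
apply: EFin_inj; rewrite -gammaE// gamma_integrand1.
by rewrite integral_expRM// mulr0 oppr0 expR0 mulr1 invr1.
Qed.

Lemma Gamma_nat n : Gamma (n.+1%:R : R) = n`!%:R.
Proof.
elim: n => [|n IH]; first by rewrite Gamma1 fact0.
by rewrite -natr1 GammaS// IH factS natrM.
Qed.

End GammaFunction.

(** * Euler's reflection formula *)

Section Cotangent.
Context (R : realType).
Implicit Types (s x : R).

Lemma sin_le_id x : 0 <= x -> sin x <= x.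
Proof.
move=> x0; have := @increment_ge_derive R (fun x => x - sin x) (fun x => 1 - cos x) 0 x 0 x0.
rewrite mul0r sin0 subr0 subr0 subr_ge0; apply.
by move=> y _; rewrite subr_ge0 cos_le1.
Qed.

Lemma mul_cos_le_sin x : 0 <= x <= pi / 2 -> x * cos x <= sin x.
Proof.
move=> /andP[x0 xpi]; have := @increment_ge_derive R (fun x => sin x - x * cos x)
  (fun x => x * sin x) 0 x 0 x0.
rewrite mul0r sin0 mul0r subr0 subr0 subr_ge0; apply.
  move=> y _; apply: is_derive_eq; rewrite /GRing.scale/=; ring.
move=> y /andP[y0 yx]; rewrite mulr_ge0// sin_ge0_pi// y0/=.
by rewrite (le_trans yx)// (le_trans xpi)// ler_pdivrMr// ler_peMr ?pi_ge0// ler1n.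
Qed.

Lemma cot_bound x : 0 < x <= pi / 2 -> `|cos x / sin x - x^-1| <= x.
Proof.
move=> /andP[x0 xpi]; have x1 : 0 <= x <= pi / 2 by rewrite ltW.
have s0 : 0 < sin x.
  apply: sin_gt0_pi; rewrite x0 (le_lt_trans xpi)//.
  by rewrite ltr_pdivrMr// ltr_pMr ?pi_gt0// ltr1n.
have c0 : 0 <= cos x.
  by apply: cos_ge0_pihalf; rewrite xpi andbT (le_trans _ (ltW x0))// oppr_le0 divr_ge0// pi_ge0.
have h1 := mul_cos_le_sin x1; have h2 := sin_le_id (ltW x0).
have h3 := cos2Dsin2 x.
have c1 := cos_le1 x.
rewrite ler_norml; apply/andP; split; last first.
  rewrite lerBlDr (@le_trans _ _ x^-1)//; last by rewrite lerDr ltW.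
  by rewrite ler_pdivrMr// mulrC ler_pdivlMr// mulrC.
rewrite lerBrDr -[leRHS]/(cos x / sin x) ler_pdivlMr// mulrDl mulNr.
have : x^-1 * sin x <= 1 by rewrite mulrC ler_pdivrMr// mul1r.
have : 1 - cos x <= x * sin x.
  have h4 : sin x ^+ 2 <= x * sin x by rewrite expr2 ler_pM2r.
  have h5 : 1 - cos x <= sin x ^+ 2 by rewrite -h3; nra.
  lra.
lra.
Qed.

Definition cot_term s (k : nat) : R := (s + k.+1%:R)^-1 - (k.+1%:R - s)^-1.

Definition cot_series s : R := s^-1 + limn (series (cot_term s)).

Lemma cot_term_bound s k : 0 < s <= 2^-1 ->
  `|cot_term s k| <= s * 2 * ((k%:R + 2^-1)^-1 - (k.+1%:R + 2^-1)^-1).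
Proof.
move=> /andP[s0 s1]; rewrite /cot_term -natr1.
have k0 : (0 : R) <= k%:R by [].
have a1 : 0 < s + (k%:R + 1) by lra.
have a2 : 0 < k%:R + 1 - s by lra.
have a3 : 0 < k%:R + 2^-1 :> R by lra.
have a4 : 0 < k%:R + 1 + 2^-1 :> R by lra.
have -> : (s + (k%:R + 1))^-1 - (k%:R + 1 - s)^-1 =
    - (2 * s / ((s + (k%:R + 1)) * (k%:R + 1 - s))).
  by field; rewrite !gt_eqF.
rewrite normrN ger0_norm; last by rewrite divr_ge0 ?mulr_ge0 ?ltW.
have -> : (k%:R + 2^-1)^-1 - (k%:R + 1 + 2^-1)^-1 =
    ((k%:R + 2^-1) * (k%:R + 1 + 2^-1))^-1 :> R.
  field; apply/andP; split; rewrite gt_eqF//; lra.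
rewrite (mulrC 2) ler_pM2l; last by rewrite mulr_gt0.
rewrite lef_pV2 ?posrE ?mulr_gt0//; nra.
Qed.

Lemma half_telescope : series (fun k : nat => (k%:R + 2^-1)^-1 - (k.+1%:R + 2^-1)^-1 : R)
  @ \oo --> (2 : R).
Proof.
have -> : series (fun k : nat => (k%:R + 2^-1)^-1 - (k.+1%:R + 2^-1)^-1 : R) =
    fun n => 2 - (n%:R + 2^-1)^-1.
  apply/funext => n; rewrite /series/=; elim: n => [|n IH].
    by rewrite big_geq// add0r invrK subrr.
  by rewrite big_nat_recr//= IH; ring.
rewrite -[X in _ --> X]subr0; apply: cvgB; first exact: cvg_cst.
apply/cvgrPdist_lt => e e0; near=> n.
rewrite sub0r normrN ger0_norm ?invr_ge0 ?addr_ge0// invf_plt ?posrE ?addr_gt0 ?invr_gt0//.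
  rewrite (@lt_le_trans _ _ n%:R)// ?lerDl//.
  by near: n; exact: nbhs_infty_gtr.
by near: n; exact: nbhs_infty_gtr.
Unshelve. all: by end_near. Qed.

Lemma cvg_cot_term s : 0 < s <= 2^-1 -> cvgn (series (cot_term s)).
Proof.
move=> s01; apply: (@series_norm_le _ _ _ (fun k => cot_term_bound k s01)).
apply/cvg_ex; exists (s * 2 * 2).
have c : s * 2 * series (fun k : nat => (k%:R + 2^-1)^-1 - (k.+1%:R + 2^-1)^-1) n
    @[n --> \oo] --> s * 2 * 2.
  by apply: cvgM; [exact: cvg_cst|exact: half_telescope].
apply: cvg_trans c; apply: near_eq_cvg; near=> n.
by rewrite /series/= mulr_sumr.
Unshelve. all: by end_near. Qed.

Lemma cot_series_bound s : 0 < s <= 2^-1 -> `|cot_series s - s^-1| <= s * 4.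
Proof.
move=> s01; rewrite /cot_series addrAC subrr add0r.
have h := @series_tail_le _ _ _ 0 (fun k => cot_term_bound k s01).
have c : series (fun k : nat => s * 2 * ((k%:R + 2^-1)^-1 - (k.+1%:R + 2^-1)^-1)) @ \oo --> s * 2 * 2.
  have c : s * 2 * series (fun k : nat => (k%:R + 2^-1)^-1 - (k.+1%:R + 2^-1)^-1) n
      @[n --> \oo] --> s * 2 * 2.
    by apply: cvgM; [exact: cvg_cst|exact: half_telescope].
  apply: cvg_trans c; apply: near_eq_cvg; near=> n.
  by rewrite /series/= mulr_sumr.
have := h (cvgP _ c); rewrite (cvg_lim _ c)// /series/= !big_geq// !subr0.
by rewrite -mulrA -natrM.
Unshelve. all: by end_near. Qed.

Definition cot_sum s (n : nat) : R :=
  \sum_(0 <= k < n) ((s + k%:R)^-1 - (k.+1%:R - s)^-1).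

Lemma cvg_cot_sum s : 0 < s <= 2^-1 -> cot_sum s @ \oo --> cot_series s.
Proof.
move=> s01; have s0 : 0 < s by case/andP: s01.
have -> : cot_sum s = fun n => s^-1 + series (cot_term s) n - (s + n%:R)^-1.
  apply/funext => n; rewrite /cot_sum /series/=; elim: n => [|n IH].
    by rewrite !big_geq// addr0 addr0 subrr.
  rewrite !big_nat_recr//= IH /cot_term; ring.
rewrite -[X in _ --> X]subr0; apply: cvgB; last first.
  apply/cvgrPdist_lt => e e0; near=> n.
  rewrite sub0r normrN ger0_norm ?invr_ge0 ?addr_ge0 ?(ltW s0)//.
  rewrite invf_plt ?posrE//; last by rewrite ltr_pwDl.
  rewrite (@lt_le_trans _ _ n%:R)// ?lerDr ?(ltW s0)//.
  by near: n; exact: nbhs_infty_gtr.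
apply: cvgD; first exact: cvg_cst.
exact: cvg_cot_term.
Unshelve. all: by end_near. Qed.

Lemma cvg_double (u : R^nat) l : u @ \oo --> (l : R) -> u (2 * n)%N @[n --> \oo] --> (l : R).
Proof.
move=> ul; apply: cvg_comp ul.
apply/cvgnyPge => A; near=> n.
have An : (A <= n)%N by near: n; exact: nbhs_infty_ge.
by rewrite (leq_trans An)// leq_pmull.
Unshelve. all: by end_near. Qed.

Lemma cot_series_duplication s : 0 < s <= 2^-1 ->
  2 * cot_series s = cot_series (s / 2) - cot_series ((1 - s) / 2).
Proof.
move=> s01; have [s0 s1] := andP s01.
have h1 : 0 < s / 2 <= 2^-1 by apply/andP; split; lra.
have h2 : 0 < (1 - s) / 2 <= 2^-1 by apply/andP; split; lra.
have c1 : 2 * cot_sum s (2 * n)%N @[n --> \oo] --> 2 * cot_series s.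
  by apply: cvgM; [exact: cvg_cst|exact/cvg_double/cvg_cot_sum].
have c2 : cot_sum (s / 2) n - cot_sum ((1 - s) / 2) n @[n --> \oo] -->
    cot_series (s / 2) - cot_series ((1 - s) / 2).
  by apply: cvgB; exact: cvg_cot_sum.
suff E : (fun n => cot_sum (s / 2) n - cot_sum ((1 - s) / 2) n) =
    (fun n => 2 * cot_sum s (2 * n)%N) by rewrite E in c2; exact: cvg_unique c1 c2.
apply/funext => n; rewrite /cot_sum/=.
elim: n => [|n IH]; first by rewrite !big_geq// subr0 mulr0.
rewrite big_nat_recr//= [in LHS]big_nat_recr//= mulnS addSn add1n.
rewrite [in RHS]big_nat_recr//= [in RHS]big_nat_recr//=.
have k0 : (0 : R) <= n%:R by [].
rewrite opprD addrACA IH -[in RHS]addrA mulrDr; congr (_ + _).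
rewrite -!(natr1 (2 * n).+1) -(natr1 (2 * n)) -(natr1 n) natrM.
field.
do ![apply/andP; split]; rewrite gt_eqF//; lra.
Qed.

Lemma cot_duplication s : 0 < s <= 2^-1 ->
  2 * (cos (pi * s) / sin (pi * s)) =
  cos (pi * (s / 2)) / sin (pi * (s / 2)) -
  cos (pi * ((1 - s) / 2)) / sin (pi * ((1 - s) / 2)).
Proof.
move=> /andP[s0 s1].
pose x := pi * (s / 2) : R.
have pp := @pi_gt0 R.
have x0 : 0 < x by rewrite mulr_gt0// divr_gt0.
have x1 : x < pi / 2 by rewrite /x; nra.
have sx : 0 < sin x by apply: sin_gt0_pi; rewrite x0; lra.
have cx : 0 < cos x by apply: cos_gt0_pihalf; rewrite x1 andbT; lra.
have -> : pi * s = x *+ 2 by rewrite /x mulr2n; lra.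
have -> : pi * ((1 - s) / 2) = pi / 2 - x by rewrite /x; lra.
rewrite -/x sinB cosB sin_pihalf cos_pihalf mul0r add0r mul0r subr0 !mul1r.
rewrite sin_mulr2n cos_mulr2n.
have h := cos2Dsin2 x.
have -> : cos x ^+ 2 *+ 2 - 1 = cos x ^+ 2 - sin x ^+ 2 by rewrite -h mulr2n; ring.
rewrite mulr2n; field.
by rewrite !gt_eqF// addr_gt0// mulr_gt0.
Qed.

(* Herglotz's trick: the distance g between both sides is O(u) and satisfies
   2 g(u) <= g(u/2) + g((1 - u)/2); iterating along u/2 gives sup g = 0. *)
Lemma cot_series_eq s : 0 < s <= 2^-1 ->
  cot_series s = pi * (cos (pi * s) / sin (pi * s)).
Proof.
pose g (u : R) : R := `|cot_series u - pi * (cos (pi * u) / sin (pi * u))|.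
pose c : R := 4 + pi ^+ 2.
have c0 : 0 <= c by rewrite addr_ge0// sqr_ge0.
have gb (u : R) : 0 < u <= 2^-1 -> g u <= c * u.
  move=> u01; have [u0 u1] := andP u01.
  have pu : 0 < pi * u <= pi / 2.
    by rewrite mulr_gt0 ?pi_gt0//= ler_pM2l ?pi_gt0.
  have h1 := cot_series_bound u01; have h2 := cot_bound pu.
  rewrite /g.
  have -> : cot_series u - pi * (cos (pi * u) / sin (pi * u)) =
    (cot_series u - u^-1) - pi * (cos (pi * u) / sin (pi * u) - (pi * u)^-1).
    have p0 := @pi_gt0 R.
    have su : 0 < sin (pi * u).
      apply: sin_gt0_pi; rewrite mulr_gt0//= gtr_pMr//; lra.
    move: su p0; move: (sin _) (cos _) => ss cc; move: pi => p su p0; field.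
    by rewrite (gt_eqF su) (gt_eqF u0) gt_eqF.
  rewrite (le_trans (ler_normB _ _))// normrM (ger0_norm (pi_ge0 R)).
  have h3 := ler_wpM2l (pi_ge0 R) h2.
  rewrite (le_trans (lerD h1 h3))// /c; lra.
have gd (u : R) : 0 < u <= 2^-1 -> 2 * g u <= g (u / 2) + g ((1 - u) / 2).
  move=> u01; rewrite /g; have h1 := cot_series_duplication u01.
  have h2 := cot_duplication u01.
  rewrite -(normrN (cot_series ((1 - u) / 2) - _)) (le_trans _ (ler_normD _ _))//.
  rewrite -[X in X * _ <= _](ger0_norm (ler0n R 2)) -normrM.
  rewrite le_eqVlt; apply/orP; left; apply/eqP; congr `|_|.
  by rewrite mulrBr h1 mulrCA h2; ring.
pose E := [set g u | u in [set u | 0 < u <= 2^-1]].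
have supE : has_sup E.
  split; first by exists (g 2^-1), 2^-1 => //=; lra.
  exists c => _ [u /= u01 <-]; rewrite (le_trans (gb _ u01))// ler_piMr//.
  by case/andP: u01 => _ /le_trans; apply; lra.
have gS (u : R) : 0 < u <= 2^-1 -> g u <= sup E.
  by move=> u01; apply: sup_upper_bound => //; exists u.
have iter n (u : R) : 0 < u <= 2^-1 -> 2 ^+ n * (g u - sup E) <= c * u / 2 ^+ n - sup E.
  elim: n u => [|n IH] u u01; have [u0 u1] := andP u01.
    by rewrite expr0 mul1r divr1 lerB// gb.
  have h1 : 0 < u / 2 <= 2^-1 by apply/andP; split; lra.
  have h2 : 0 < (1 - u) / 2 <= 2^-1 by apply/andP; split; lra.
  have := gd u u01; have := gS _ h2 => e1 e2.
  rewrite exprSr -mulrA; apply: (@le_trans _ _ (2 ^+ n * (g (u / 2) - sup E))).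
    by rewrite ler_wpM2l ?exprn_ge0//; lra.
  rewrite (le_trans (IH _ h1))// lerD2r.
  by rewrite invfM -!mulrA [2^-1 * _]mulrC.
have S0 : sup E <= 0.
  rewrite leNgt; apply/negP => S0.
  have [n hn] : exists n : nat, c / sup E < n%:R.
    by exists (Num.truncn (c / sup E)).+1; exact: truncnS_gt.
  have h2n : (n%:R : R) < 2 ^+ n by rewrite -natrX ltr_nat ltn_expl.
  have cn : c / 2 ^+ n < sup E.
    rewrite ltr_pdivrMr ?exprn_gt0// mulrC -ltr_pdivrMr//.
    exact: lt_trans h2n.
  have p2 : (0 : R) < 2 ^+ n by rewrite exprn_gt0.
  have e0 : 0 < (sup E - c / 2 ^+ n) / 2 ^+ n by rewrite divr_gt0// subr_gt0.
  have [_ [u /= u01 <-] hu] := sup_adherent e0 supE.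
  have h1 := iter n u u01; have [u0 u1] := andP u01.
  have h3 : c * u / 2 ^+ n <= c / 2 ^+ n.
    rewrite ler_pM2r ?invr_gt0// ler_piMr//; lra.
  move: hu; rewrite ltrBlDr -ltrBlDl -(ltr_pM2l p2) [X in _ < X]mulrC divfK ?gt_eqF//.
  have -> : sup E - g u = - (g u - sup E) by ring.
  by rewrite mulrN; lra.
move=> s01; apply/eqP; rewrite -subr_eq0 -normr_le0.
exact: le_trans (gS _ s01) S0.
Qed.

End Cotangent.

Section Reflection.
Context (R : realType).
Notation mu := (@lebesgue_measure R).
Implicit Types (s v : R).

Lemma measurable_powR_comp d (T : measurableType d) (D : set T) (f : T -> R) p :
  measurable_fun D f -> measurable_fun D (fun x => f x `^ p).
Proof. by move=> mf; apply: (measurableT_comp (@measurable_powR R p)). Qed.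

Lemma ge0_integralZl_real d (T : measurableType d) (m : {measure set T -> \bar R})
    (D : set T) (k : R) (f : T -> R) : measurable D -> measurable_fun D f ->
  (forall x : T, D x -> 0 <= f x) -> 0 <= k ->
  (\int[m]_(x in D) (k * f x)%:E = k%:E * \int[m]_(x in D) (f x)%:E)%E.
Proof.
move=> mD mf f0 k0; under eq_integral do rewrite EFinM.
rewrite ge0_integralZl_EFin//; last exact/measurable_EFinP.
Qed.

Lemma measurable_inv1D : measurable_fun [set: R] (fun v : R => (1 + v)^-1).
Proof.
have -> : (fun v : R => (1 + v)^-1) =
    (fun v => if 0 <= 1 + v then (1 + v) `^ (-1) else - (- (1 + v)) `^ (-1)).
  apply/funext => v; case: ifPn => [v0|]; first by rewrite powR_inv1.
  rewrite -ltNge => v0; rewrite powR_inv1 ?oppr_ge0 ?(ltW v0)//.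
  by rewrite invrN opprK.
apply: measurable_fun_ifT => /=.
- by apply: measurable_fun_ler => //; exact: measurable_funD.
- by apply: measurable_powR_comp; exact: measurable_funD.
- apply: measurableT_comp => //; apply: measurable_powR_comp.
  by apply: measurableT_comp => //; exact: measurable_funD.
Qed.

Lemma integral_alternating d (T : measurableType d) (m : {measure set T -> \bar R})
    (D : set T) (f : T -> R) (e : nat -> T -> R) (c : R^nat) (K : nat) :
  measurable D -> measurable_fun D f ->
  (forall k, measurable_fun D (e k)) -> (forall k (x : T), D x -> 0 <= e k x) ->
  (forall k, (\int[m]_(x in D) (e k x)%:E = (c k)%:E)%E) ->
  (forall N (x : T), D x -> `|f x - \sum_(0 <= k < N) (-1) ^+ k * e k x| <= e N x) ->
  `|\int[m]_(x in D) f x - \sum_(0 <= k < K) (-1) ^+ k * c k| <= c K.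
Proof.
move=> mD mf me e0 ec fe.
have ie k : m.-integrable D (EFin \o e k).
  apply/integrableP; split; first exact/measurable_EFinP.
  have -> : (\int[m]_(x in D) `|(EFin \o e k) x| = \int[m]_(x in D) (e k x)%:E)%E.
    by apply: eq_integral => x; rewrite inE => Dx; rewrite /= ger0_norm// e0.
  by rewrite ec ltry.
have if_ : m.-integrable D (EFin \o f).
  apply: (le_integrable mD _ _ (ie 0%N)); first exact/measurable_EFinP.
  move=> x Dx; rewrite /= lee_fin [leRHS]ger0_norm ?e0//.
  by have := fe 0%N x Dx; rewrite big_geq// subr0.
have Rec k : \int[m]_(x in D) e k x = c k by rewrite /Rintegral ec.
have is_ N : m.-integrable D (EFin \o (fun x => \sum_(0 <= k < N) (-1) ^+ k * e k x)) /\
    \int[m]_(x in D) (\sum_(0 <= k < N) (-1) ^+ k * e k x) = \sum_(0 <= k < N) (-1) ^+ k * c k.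
  elim: N => [|N [IH1 IH2]].
    rewrite (_ : (fun x => \sum_(0 <= k < 0) (-1) ^+ k * e k x) = cst 0).
      by split; [exact: integrable0|rewrite big_geq// Rintegral_cst// mul0r].
    by apply/funext => x; rewrite big_geq.
  have E : (fun x => \sum_(0 <= k < N.+1) (-1) ^+ k * e k x) =
     (fun x => \sum_(0 <= k < N) (-1) ^+ k * e k x + (-1) ^+ N * e N x).
    by apply/funext => x; rewrite big_nat_recr.
  have i2 : m.-integrable D (EFin \o (fun x => (-1) ^+ N * e N x)).
    by have := integrableZl mD ((-1) ^+ N) (ie N).
  rewrite E; split.
    by have := integrableD mD IH1 i2.
  by rewrite RintegralD// IH2 RintegralZl// Rec big_nat_recr.
have [i1 <-] := is_ K.
rewrite -RintegralB// -(Rec K) (le_trans (le_normr_Rintegral _ _))//.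
  by have := integrableB mD if_ i1.
apply: le_Rintegral => //.
  by apply: integrable_norm; have := integrableB mD if_ i1.
by move=> x Dx; exact: fe.
Qed.

Lemma geometric_alternating v N : 0 < v -> v <= 1 ->
  `|(1 + v)^-1 - \sum_(0 <= k < N) (-1) ^+ k * v ^+ k| <= v ^+ N.
Proof.
move=> v0 v1; have v2 : 0 < 1 + v by rewrite addr_gt0.
have -> : (1 + v)^-1 - \sum_(0 <= k < N) (-1) ^+ k * v ^+ k = (- v) ^+ N / (1 + v).
  elim: N => [|N IH]; first by rewrite big_geq// subr0 mul1r.
  rewrite big_nat_recr//= opprD addrA IH -exprMn mulN1r exprS; field.
  by rewrite gt_eqF.
rewrite normrM normrX normrN (gtr0_norm v0) normfV (gtr0_norm v2).
by rewrite ler_piMr ?exprn_ge0 ?(ltW v0)// invf_le1// lerDl ltW.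
Qed.

Lemma integral_beta_kernel s : 0 < s < 1 ->
  (\int[mu]_(v in `]0%R, +oo[) (v `^ (- s) / (1 + v))%:E = (Gamma s * Gamma (1 - s))%:E)%E.
Proof.
move=> /andP[s0 s1]; have s2 : 0 < 1 - s by rewrite subr_gt0.
pose f (z : R * R) : \bar R := (expR (- z.1) * gamma_integrand (1 - s) z.1 z.2)%:E.
have mf : measurable_fun [set: R * R] f.
  apply/measurable_EFinP; apply: measurable_funM.
    by apply: measurableT_comp => //; apply: measurableT_comp.
  apply: measurable_funM.
    by apply: measurable_powR_comp.
  by apply: measurableT_comp => //; apply: measurableT_comp => //; exact: measurable_funM.
have f0 (x v : R) : (0 <= f (x, v))%E.
  by rewrite /f lee_fin; exact: mulr_ge0 (expR_ge0 _) (gamma_integrand_ge0 _ _ _).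
have in1 (v : R) : 0 < v ->
    (\int[mu]_(x in `]0%R, +oo[) f (x, v) = (v `^ (- s) / (1 + v))%:E)%E.
  move=> v0; have v1 : 0 < 1 + v by rewrite addr_gt0.
  have E (x : R) : f (x, v) = (v `^ (- s) * expR (- ((1 + v) * x)))%:E.
    rewrite /f/= /gamma_integrand; congr EFin; rewrite mulrCA -expRD.
    by congr (_ `^ _ * expR _); ring.
  under eq_integral do rewrite E.
  rewrite (ge0_integralZl_real mu (k := v `^ (- s)) (f := fun x => expR (- ((1 + v) * x))))//.
  - by rewrite integral_expRM// mulr0 oppr0 expR0 mulr1.
  - apply: measurable_funTS.
    by apply: measurableT_comp => //; apply: measurableT_comp.
  - by rewrite powR_ge0.
have in2 (x : R) : 0 < x ->
    (\int[mu]_(v in `]0%R, +oo[) f (x, v) = (Gamma (1 - s) * gamma_integrand s 1 x)%:E)%E.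
  move=> x0; rewrite (ge0_integralZl_real mu (k := expR (- x))
    (f := gamma_integrand (1 - s) x)) ?expR_ge0//.
  - rewrite integral_gamma_integrand// -!EFinM; congr EFin.
    by rewrite /gamma_integrand opprB mul1r; ring.
  - exact: measurable_gamma_integrand.
  - by move=> y _; exact: gamma_integrand_ge0.
transitivity (\int[mu]_(v in `]0%R, +oo[) \int[mu]_(x in `]0%R, +oo[) f (x, v))%E.
  by apply: eq_integral => v; rewrite inE/= in_itv/= andbT => v0; rewrite in1.
have h := @tonelli_domain _ _ _ _ R (@lebesgue_measure R) (@lebesgue_measure R)
  `]0, +oo[%classic `]0, +oo[%classic f (measurable_itv _) (measurable_itv _) mf
  (fun x v _ _ => f0 x v).
rewrite -h; clear h.
transitivity (\int[mu]_(x in `]0%R, +oo[) (Gamma (1 - s) * gamma_integrand s 1 x)%:E)%E.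
  by apply: eq_integral => x; rewrite inE/= in_itv/= andbT => x0; rewrite in2.
rewrite (ge0_integralZl_real mu (k := Gamma (1 - s)) (f := gamma_integrand s 1))//.
- by rewrite (gammaE s0) -EFinM; congr EFin; exact: mulrC.
- exact: measurable_gamma_integrand.
- by move=> y _; exact: gamma_integrand_ge0.
- exact/ltW/Gamma_gt0.
Qed.

Lemma beta_kernel_near0 s K : 0 < s < 1 ->
  `|\int[mu]_(v in `]0%R, 1%R[) (v `^ (- s) / (1 + v)) -
    \sum_(0 <= k < K) (-1) ^+ k * (k.+1%:R - s)^-1| <= (K.+1%:R - s)^-1.
Proof.
move=> /andP[s0 s1].
have ks k : 0 < k.+1%:R - s :> R by rewrite subr_gt0 (lt_le_trans s1)// ler1n.
apply: (@integral_alternating _ _ mu _ _ (fun k v => v `^ (k.+1%:R - s - 1))).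
- exact: measurable_itv.
- apply: measurable_funTS; apply: measurable_funM; first exact: measurable_powR.
  exact: measurable_inv1D.
- by move=> k; apply: measurable_funTS; exact: measurable_powR.
- by move=> k v _; exact: powR_ge0.
- by move=> k; exact: integral_powR01.
- move=> N v; rewrite /= in_itv/= => /andP[v0 v1].
  have E k : v `^ (k.+1%:R - s - 1) = v `^ (- s) * v ^+ k.
    by rewrite -powR_mulrn ?(ltW v0)// -powRDp// -natr1; congr (_ `^ _); ring.
  under eq_bigr do rewrite E mulrCA.
  rewrite -mulr_sumr -mulrBr normrM (ger0_norm (powR_ge0 _ _)) E.
  by rewrite ler_wpM2l ?powR_ge0// geometric_alternating// ltW.
Qed.

Lemma integral_powR1y p : 0 < p ->
  (\int[mu]_(v in `]1%R, +oo[) (v `^ (- p - 1))%:E = (p^-1)%:E)%E.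
Proof.
move=> p0; transitivity ((0 - - p^-1)%:E); last by rewrite sub0r opprK.
apply: (@ge0_FTC_oy R (fun v => v `^ (- p - 1)) (fun v => - (p^-1 * v `^ (- p))) 1 (- p^-1) 0).
- by move=> x _; exact: powR_ge0.
- move=> x x1; have x0 : 0 < x by rewrite (lt_trans _ x1).
  have h := is_derive_powR (- p) x0; apply: is_derive_eq.
  by rewrite /GRing.scale/= mulrA mulrN mulVf ?gt_eqF// mulN1r opprK.
- by move=> x x1; apply: continuous_powR; rewrite (lt_trans _ x1).
- apply: cvgN; rewrite -[X in _ --> X]mulr1; apply: cvgM; first exact: cvg_cst.
  apply: cvg_at_right_filter; have := @continuous_powR R 1 (- p) ltr01.
  by rewrite /prop_for /continuous_at powR1.
- rewrite -oppr0; apply: cvgN; rewrite -[X in _ --> X](mulr0 p^-1).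
  by apply: cvgM; [exact: cvg_cst|exact: powR_cvgy0].
Qed.

Lemma beta_kernel_neary s K : 0 < s < 1 ->
  `|\int[mu]_(v in `]1%R, +oo[) (v `^ (- s) / (1 + v)) -
    \sum_(0 <= k < K) (-1) ^+ k * (s + k%:R)^-1| <= (s + K%:R)^-1.
Proof.
move=> /andP[s0 s1].
have ks k : 0 < s + k%:R :> R by rewrite ltr_pwDl.
apply: (@integral_alternating _ _ mu _ _ (fun k v => v `^ (- (s + k%:R) - 1))).
- exact: measurable_itv.
- apply: measurable_funTS; apply: measurable_funM; first exact: measurable_powR.
  exact: measurable_inv1D.
- by move=> k; apply: measurable_funTS; exact: measurable_powR.
- by move=> k v _; exact: powR_ge0.
- by move=> k; exact: integral_powR1y.
- move=> N v; rewrite /= in_itv/= andbT => v1; have v0 : 0 < v by rewrite (lt_trans _ v1).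
  have E k : v `^ (- (s + k%:R) - 1) = v `^ (- s - 1) * v^-1 ^+ k.
    rewrite -powR_mulrn ?invr_ge0 ?(ltW v0)// -(powR_inv1 (ltW v0)) -powRrM -powRDp//.
    by congr (_ `^ _); ring.
  under eq_bigr do rewrite E mulrCA.
  have -> : v `^ (- s) / (1 + v) = v `^ (- s - 1) * (1 + v^-1)^-1.
    rewrite powRBp// powRr1 ?(ltW v0)//; field.
    by rewrite (gt_eqF v0)/= gt_eqF// addr_gt0.
  rewrite -mulr_sumr -mulrBr normrM (ger0_norm (powR_ge0 _ _)) E.
  by rewrite ler_wpM2l ?powR_ge0// geometric_alternating ?invr_gt0// invf_le1// ltW.
Qed.

Lemma beta_partial_sum s n : 0 < s < 1 ->
  \sum_(0 <= k < 2 * n) (-1) ^+ k * (k.+1%:R - s)^-1 +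
  \sum_(0 <= k < 2 * n) (-1) ^+ k * (s + k%:R)^-1 =
  2^-1 * (cot_sum (s / 2) n + cot_sum ((1 - s) / 2) n).
Proof.
move=> /andP[s0 s1]; rewrite /cot_sum; elim: n => [|n IH]; first by rewrite !big_geq// !addr0 mulr0.
rewrite mulnS addSn add1n !big_nat_recr//=.
have k0 : (0 : R) <= n%:R by [].
have s2 : 0 < 1 - s by rewrite subr_gt0.
have Eq (a b a' b' c d : R) : a + b + b' + (c + d + a') = (a + c) + (b + b' + d + a').
  by ring.
rewrite Eq.
have e1 : (-1) ^+ (2 * n) = 1 :> R by rewrite exprM sqrrN !expr1n.
rewrite IH exprS e1 mulr1.
rewrite -!(natr1 (2 * n).+1) -(natr1 (2 * n)) -(natr1 n) natrM.
rewrite !mulrDr -[in RHS]addrA.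
set U := \sum_(_ <= _ < _) _; set V := \sum_(_ <= _ < _) _.
move: U V => U V.
field.
do ![apply/andP; split]; rewrite gt_eqF//; lra.
Qed.

Lemma half_cot_sum s : 0 < s < 1 ->
  2^-1 * (pi * (cos (pi * (s / 2)) / sin (pi * (s / 2))) +
    pi * (cos (pi * ((1 - s) / 2)) / sin (pi * ((1 - s) / 2)))) = pi / sin (pi * s).
Proof.
move=> /andP[s0 s1].
pose x := pi * (s / 2) : R.
have pp := @pi_gt0 R.
have x0 : 0 < x by rewrite mulr_gt0// divr_gt0.
have x1 : x < pi / 2 by rewrite /x; nra.
have sx : 0 < sin x by apply: sin_gt0_pi; rewrite x0; lra.
have cx : 0 < cos x by apply: cos_gt0_pihalf; rewrite x1 andbT; lra.
have -> : pi * s = x *+ 2 by rewrite /x mulr2n; lra.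
have -> : pi * ((1 - s) / 2) = pi / 2 - x by rewrite /x; lra.
rewrite -/x sinB cosB sin_pihalf cos_pihalf mul0r add0r mul0r subr0 !mul1r.
rewrite sin_mulr2n -(mulr_natl (cos x * sin x)) invfM -mulrDr mulrCA; congr (_ * _).
congr (_ * _).
have h := cos2Dsin2 x.
have -> : (cos x * sin x)^-1 = (cos x ^+ 2 + sin x ^+ 2) / (cos x * sin x).
  by rewrite h mul1r.
by field; rewrite !gt_eqF.
Qed.

Lemma Gamma_reflection s : 0 < s < 1 -> Gamma s * Gamma (1 - s) = pi / sin (pi * s).
Proof.
move=> s01; have [s0 s1] := andP s01.
have hs1 : 0 < s / 2 <= 2^-1 by apply/andP; split; lra.
have hs2 : 0 < (1 - s) / 2 <= 2^-1 by apply/andP; split; lra.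
pose f v := v `^ (- s) / (1 + v).
have mf : measurable_fun [set: R] f.
  apply: measurable_funM; first exact: measurable_powR.
  exact: measurable_inv1D.
have f0 v : 0 < v -> 0 <= f v.
  by move=> v0; rewrite divr_ge0 ?powR_ge0// addr_ge0// ltW.
have I : mu.-integrable `]0%R, +oo[ (EFin \o f).
  apply/integrableP; split; first by apply/measurable_EFinP; exact: measurable_funTS.
  have -> : (\int[mu]_(x in `]0%R, +oo[) `|(EFin \o f) x| = \int[mu]_(x in `]0%R, +oo[) (f x)%:E)%E.
    by apply: eq_integral => v; rewrite inE/= in_itv/= andbT => v0; rewrite ger0_norm// f0.
  by rewrite integral_beta_kernel// ltry.
have E : Gamma s * Gamma (1 - s) =
    \int[mu]_(v in `]0%R, 1%R[) f v + \int[mu]_(v in `]1%R, +oo[) f v.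
  have -> : Gamma s * Gamma (1 - s) = \int[mu]_(v in `]0%R, +oo[) f v.
    by rewrite /Rintegral integral_beta_kernel.
  have S : `]0%R, +oo[%classic = `]0%R, 1%R[%classic `|` `[1%R, +oo[%classic :> set R.
    by rewrite -itv_bndbnd_setU ?bnd_simp.
  have -> : \int[mu]_(v in `]1%R, +oo[) f v = \int[mu]_(v in `[1%R, +oo[) f v.
    apply: Rintegral_itv_obnd_cbnd; apply: integrableS I => //.
    by move=> x /=; rewrite !in_itv/= !andbT; lra.
  rewrite S Rintegral_setU//.
  - by rewrite -S.
  - by apply/disj_setPS => x [] /=; rewrite !in_itv/= andbT => /andP[_]; lra.
pose A n : R := \sum_(0 <= k < n) (-1) ^+ k * (k.+1%:R - s)^-1 +
  \sum_(0 <= k < n) (-1) ^+ k * (s + k%:R)^-1.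
have A2 n : A (2 * n)%N = 2^-1 * (cot_sum (s / 2) n + cot_sum ((1 - s) / 2) n).
  exact: beta_partial_sum.
have Ac : A (2 * n)%N @[n --> \oo] --> Gamma s * Gamma (1 - s).
  apply/cvgrPdist_le => e e0; near=> n.
  have h1 := beta_kernel_near0 (2 * n) s01; have h2 := beta_kernel_neary (2 * n) s01.
  rewrite E /A opprD addrACA (le_trans (ler_normD _ _))// (le_trans (lerD h1 h2))//.
  clear h1 h2 E A2 A I mf.
  have n0 : (0 : R) < n%:R by near: n; exact: nbhs_infty_gtr.
  have b1 : ((2 * n).+1%:R - s)^-1 <= n%:R^-1.
    rewrite lef_pV2 ?posrE//; rewrite -natr1 natrM; lra.
  have b2 : (s + (2 * n)%:R)^-1 <= n%:R^-1.
    rewrite lef_pV2 ?posrE//; rewrite natrM; lra.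
  rewrite (le_trans (lerD b1 b2))//.
  have -> : n%:R^-1 + n%:R^-1 = 2 / n%:R :> R by rewrite mulr_natl mulr2n.
  rewrite ler_pdivrMr// mulrC -ler_pdivrMr//.
  by near: n; exact: nbhs_infty_ger.
have Bc : A (2 * n)%N @[n --> \oo] -->
    2^-1 * (cot_series (s / 2) + cot_series ((1 - s) / 2)).
  under eq_fun do rewrite A2.
  apply: cvgM; first exact: cvg_cst.
  by apply: cvgD; exact: cvg_cot_sum.
rewrite (cvg_unique _ Ac Bc)// !cot_series_eq//.
exact: half_cot_sum.
Unshelve. all: by end_near. Qed.

End Reflection.

(** * Uniqueness of bivariate Laplace transforms *)

Section SigmaFiniteProduct.
Context d1 d2 (T1 : measurableType d1) (T2 : measurableType d2) (R : realType).
Context (m1 : {sigma_finite_measure set T1 -> \bar R}).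
Context (m2 : {sigma_finite_measure set T2 -> \bar R}).

(* The canonical sigma-finite structure of \x is the one of finite measures:
   an alias is needed to register the one of sigma-finite measures. *)
Definition prod_measure : set (T1 * T2) -> \bar R := (m1 \x m2)%E.

HB.instance Definition _ := Measure.copy prod_measure (m1 \x m2)%E.

Lemma sigma_finite_prod : sigma_finite setT prod_measure.
Proof.
have /sigma_finiteP[F [FT ndF Foo]] := sigma_finiteT m1.
have /sigma_finiteP[G [GT ndG Goo]] := sigma_finiteT m2.
exists (fun n => F n `*` G n).
  apply/seteqP; split => [[x y] _|//].
  have [n _ Fx] : (\bigcup_n F n) x by rewrite -FT.
  have [k _ Gy] : (\bigcup_n G n) y by rewrite -GT.
  exists (maxn n k) => //; split => /=.
    by move: Fx; apply/subsetPset/ndF; rewrite leq_maxl.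
  by move: Gy; apply/subsetPset/ndG; rewrite leq_maxr.
move=> n; have [mF Fn] := Foo n; have [mG Gn] := Goo n.
split; first exact: measurableX.
by rewrite /prod_measure product_measure1E// lte_mul_pinfty// ge0_fin_numE.
Qed.

HB.instance Definition _ :=
  Measure_isSigmaFinite.Build _ _ _ prod_measure sigma_finite_prod.

End SigmaFiniteProduct.

Section LebesgueInvariance.
Context (R : realType).
Notation mu := (@lebesgue_measure R).

Section Isometry.
Context (phi : measurableTypeR R -> measurableTypeR R).
Hypothesis mphi : measurable_fun setT phi.
Hypothesis phi_itv : forall a b : R, a <= b ->
  mu (phi @^-1` `]a, b]) = (b - a)%:E.

Let mphi_mixin := isMeasurableFun.Build _ _ _ _ _ mphi.
Let mphi_pack : {mfun measurableTypeR R >-> measurableTypeR R} := HB.pack phi mphi_mixin.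

Lemma ge0_integral_isometry (f : R -> \bar R) : measurable_fun [set: R] f ->
  (forall x, (0 <= f x)%E) -> (\int[mu]_x f (phi x) = \int[mu]_x f x)%E.
Proof.
move=> mf f0.
pose m : {measure set (measurableTypeR R) -> \bar R} := pushforward mu mphi_pack.
have E A : measurable A -> mu A = m mphi A.
  apply: lebesgue_measure_unique => X [[a b] /= _ <-].
  have [ab|ba] := leP a b.
    by rewrite lebesgue_measure_itv/= lte_fin /m /pushforward phi_itv//; case: ltP => //; move=> ?; congr EFin; lra.
  by rewrite set_itv_ge ?bnd_simp -?leNgt ?ltW// !measure0.
have := @ge0_integral_pushforward _ _ _ _ R phi mphi mu [set: R] f measurableT mf (fun x _ => f0 x).
rewrite preimage_setT => <-.
by apply: eq_measure_integral => A mA _; exact/esym/E.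
Qed.

End Isometry.

Lemma ge0_integral_shift (c : R) (f : R -> \bar R) : measurable_fun [set: R] f ->
  (forall x, (0 <= f x)%E) -> (\int[mu]_x f (x + c)%R = \int[mu]_x f x)%E.
Proof.
move=> mf f0; apply: (@ge0_integral_isometry (fun x => x + c)) => //.
  exact: measurable_funD.
move=> a b ab; have -> : (fun x => x + c) @^-1` `]a, b] = `]a - c, b - c]%classic.
  by apply/seteqP; split => x /=; rewrite !in_itv/= ltrBlDr lerBrDr.
rewrite lebesgue_measure_itv/= lte_fin ltrD2r; case: ltP => h.
  by rewrite -EFinB; congr EFin; ring.
by congr EFin; lra.
Qed.

Lemma ge0_integral_reflect (c : R) (f : R -> \bar R) : measurable_fun [set: R] f ->
  (forall x, (0 <= f x)%E) -> (\int[mu]_x f (c - x)%R = \int[mu]_x f x)%E.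
Proof.
move=> mf f0; apply: (@ge0_integral_isometry (fun x => c - x)) => //.
  exact: measurable_funB.
move=> a b ab; have -> : (fun x => c - x) @^-1` `]a, b] = `[c - b, c - a[%classic.
  by apply/seteqP; split => x /=; rewrite !in_itv/= => /andP[? ?]; apply/andP; split; lra.
rewrite lebesgue_measure_itv/= lte_fin; case: ltP => h.
  by rewrite -EFinB; congr EFin; ring.
by congr EFin; lra.
Qed.

End LebesgueInvariance.

Section Peak.
Context d (T : measurableType d) (R : realType) (m : {measure set T -> \bar R}).
Context (D B : set T) (x y g : T -> R) (x0 y0 r k : R).
Hypotheses (mD : measurable D) (mB : measurable B) (BD : B `<=` D).
Hypotheses (x01 : forall z, D z -> 0 <= x z <= 1) (y01 : forall z, D z -> 0 <= y z <= 1).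
Hypotheses (hx0 : 0 <= x0 <= 1) (hy0 : 0 <= y0 <= 1) (r01 : 0 < r < 1) (k0 : 0 < k).
Hypothesis moments : forall i j, m.-integrable D (EFin \o (fun z => x z ^+ i * y z ^+ j * g z)) /\
  \int[m]_(z in D) (x z ^+ i * y z ^+ j * g z) = 0.
Hypothesis g_ge0 : forall z, D z -> `|x z - x0| < r -> `|y z - y0| < r -> 0 <= g z.
Hypothesis gB : forall z, B z -> [/\ `|x z - x0| <= r / 2, `|y z - y0| <= r / 2 & k <= g z].
Hypothesis Boo : (m B < +oo)%E.

Let K z := 1 - ((x z - x0) ^+ 2 + (y z - y0) ^+ 2) / 2.

Let annihilated (h : T -> R) := forall i j,
  m.-integrable D (EFin \o (fun z => x z ^+ i * y z ^+ j * h z)) /\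
  \int[m]_(z in D) (x z ^+ i * y z ^+ j * h z) = 0.

Let annihilatedD h1 h2 : annihilated h1 -> annihilated h2 ->
  annihilated (fun z => h1 z + h2 z).
Proof.
move=> a1 a2 i j; have [i1 e1] := a1 i j; have [i2 e2] := a2 i j.
have E : (fun z => x z ^+ i * y z ^+ j * (h1 z + h2 z)) =
  (fun z => x z ^+ i * y z ^+ j * h1 z + x z ^+ i * y z ^+ j * h2 z).
  by apply/funext => z; rewrite mulrDr.
rewrite E; split; first by have := integrableD mD i1 i2.
by rewrite RintegralD// e1 e2 addr0.
Qed.

Let annihilatedZ c h : annihilated h -> annihilated (fun z => c * h z).
Proof.
move=> a1 i j; have [i1 e1] := a1 i j.
have E : (fun z => x z ^+ i * y z ^+ j * (c * h z)) =
  (fun z => c * (x z ^+ i * y z ^+ j * h z)).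
  by apply/funext => z; rewrite mulrCA.
rewrite E; split; first by have := integrableZl mD c i1.
by rewrite RintegralZl// e1 mulr0.
Qed.

Let annihilatedX h : annihilated h -> annihilated (fun z => x z * h z).
Proof.
move=> a1 i j; have [i1 e1] := a1 i.+1 j.
have E : (fun z => x z ^+ i * y z ^+ j * (x z * h z)) =
  (fun z => x z ^+ i.+1 * y z ^+ j * h z).
  by apply/funext => z; rewrite exprSr; ring.
by rewrite E.
Qed.

Let annihilatedY h : annihilated h -> annihilated (fun z => y z * h z).
Proof.
move=> a1 i j; have [i1 e1] := a1 i j.+1.
have E : (fun z => x z ^+ i * y z ^+ j * (y z * h z)) =
  (fun z => x z ^+ i * y z ^+ j.+1 * h z).
  by apply/funext => z; rewrite exprSr; ring.
by rewrite E.
Qed.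

Let annihilatedK h : annihilated h -> annihilated (fun z => K z * h z).
Proof.
move=> a.
have E : (fun z => K z * h z) = (fun z =>
   (1 - (x0 ^+ 2 + y0 ^+ 2) / 2) * h z + x0 * (x z * h z) + y0 * (y z * h z)
   + (- 2^-1) * (x z * (x z * h z)) + (- 2^-1) * (y z * (y z * h z))).
  by apply/funext => z; rewrite /K; field.
rewrite E; do ?apply: annihilatedD; do ?apply: annihilatedZ => //.
- exact: annihilatedX.
- exact: annihilatedY.
- exact/annihilatedX/annihilatedX.
- exact/annihilatedY/annihilatedY.
Qed.

Let K01 z : D z -> 0 <= K z <= 1.
Proof.
move=> Dz; move: (x01 Dz) (y01 Dz) hx0 hy0 => /andP[? ?] /andP[? ?] /andP[? ?] /andP[? ?].
have h3 := sqr_ge0 (x z - x0); have h4 := sqr_ge0 (y z - y0).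
rewrite /K; apply/andP; split; last lra.
have h1 : (x z - x0) ^+ 2 <= 1 by nra.
have h2 : (y z - y0) ^+ 2 <= 1 by nra.
lra.
Qed.

(* K^n peaks at (x0, y0): it decays geometrically faster away from that point
   than on B, while integrating to zero against g. *)
Lemma peak_null : m B = 0.
Proof.
have [r0 r1] := andP r01.
pose k1 := 1 - r ^+ 2 / 2; pose k2 := 1 - r ^+ 2 / 4.
have k1_gt0 : 0 < k1 by rewrite /k1; nra.
have k12 : k1 < k2 by rewrite /k1 /k2; nra.
have k2_gt0 : 0 < k2 by lra.
have annK n : annihilated (fun z => K z ^+ n * g z).
  elim: n => [|n IH].
    have -> : (fun z => K z ^+ 0 * g z) = g by apply/funext => z; rewrite mul1r.
    exact: moments.
  have -> : (fun z => K z ^+ n.+1 * g z) = (fun z => K z * (K z ^+ n * g z)).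
    by apply/funext => z; rewrite exprS mulrA.
  exact: annihilatedK.
have intKg n : m.-integrable D (EFin \o (fun z => K z ^+ n * g z)) /\
    \int[m]_(z in D) (K z ^+ n * g z) = 0.
  have := annK n 0%N 0%N.
  have -> : (fun z => x z ^+ 0 * y z ^+ 0 * (K z ^+ n * g z)) = (fun z => K z ^+ n * g z).
    by apply/funext => z; rewrite !mul1r.
  by [].
have ig : m.-integrable D (EFin \o g).
  by have [+ _] := intKg 0%N; under [X in m.-integrable _ X]eq_fun do rewrite /= mul1r.
pose C := \int[m]_(z in D) `|g z|.
pose b := fine (m B).
have ineq n z : D z -> k2 ^+ n * k * \1_B z - k1 ^+ n * `|g z| <= K z ^+ n * g z.
  move=> Dz; have /andP[Kz0 Kz1] := K01 Dz.
  have pos1 : 0 <= k1 ^+ n * `|g z| by rewrite mulr_ge0// exprn_ge0// ltW.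
  rewrite indicE; have [/set_mem Bz|nBz] := boolP (z \in B).
    have [bx by_ bg] := gB Bz.
    rewrite mulr1 (@le_trans _ _ (k2 ^+ n * k))//; first by rewrite gerBl.
    have kK : k2 <= K z.
      move: bx by_; rewrite !ler_norml /k2 /K => /andP[? ?] /andP[? ?].
      have h1 : (x z - x0) ^+ 2 <= (r / 2) ^+ 2 by nra.
      have h2 : (y z - y0) ^+ 2 <= (r / 2) ^+ 2 by nra.
      by move: h1 h2; rewrite expr_div_n; lra.
    rewrite ler_pM ?exprn_ge0 ?(ltW k2_gt0) ?(ltW k0)//.
    by rewrite lerXn2r ?nnegrE// ltW.
  rewrite mulr0 sub0r.
  have [hx|hx] := ltP `|x z - x0| r; first have [hy|hy] := ltP `|y z - y0| r.
  - rewrite (@le_trans _ _ 0)//; first by rewrite oppr_le0.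
    by rewrite mulr_ge0// ?exprn_ge0// g_ge0.
  - have Kk : K z <= k1.
      have h2 : r ^+ 2 <= (y z - y0) ^+ 2.
        by rewrite -(real_normK (num_real (y z - y0))) lerXn2r ?nnegrE// ltW.
      have h1 : 0 <= (x z - x0) ^+ 2 by rewrite sqr_ge0.
      by rewrite /K /k1; lra.
    rewrite lerNl -mulrN (le_trans (ler_norm _))// normrM normrN normrX.
    by rewrite ler_wpM2r// (ger0_norm Kz0) lerXn2r ?nnegrE// ltW.
  - have Kk : K z <= k1.
      have h2 : r ^+ 2 <= (x z - x0) ^+ 2.
        by rewrite -(real_normK (num_real (x z - x0))) lerXn2r ?nnegrE// ltW.
      have h1 : 0 <= (y z - y0) ^+ 2 by rewrite sqr_ge0.
      by rewrite /K /k1; lra.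
    rewrite lerNl -mulrN (le_trans (ler_norm _))// normrM normrN normrX.
    by rewrite ler_wpM2r// (ger0_norm Kz0) lerXn2r ?nnegrE// ltW.
have iB : m.-integrable D (EFin \o (\1_B : T -> R)).
  apply/integrableP; split; first exact/measurable_EFinP/measurable_indic.
  under eq_integral do rewrite /= ger0_norm//.
  by rewrite integral_indic// setIidl.
have iabs : m.-integrable D (EFin \o (fun z => `|g z|)) by exact: integrable_norm.
have IB : \int[m]_(z in D) (\1_B z) = b.
  by rewrite /Rintegral integral_indic// setIidl.
have main n : k2 ^+ n * k * b <= k1 ^+ n * C.
  have [i1 e1] := intKg n.
  have h := @le_Rintegral _ _ _ m D (fun z => k2 ^+ n * k * \1_B z - k1 ^+ n * `|g z|)
    (fun z => K z ^+ n * g z) mD.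
  have j1 : m.-integrable D (EFin \o (fun z => k2 ^+ n * k * \1_B z)).
    by have := integrableZl mD (k2 ^+ n * k) iB.
  have j2 : m.-integrable D (EFin \o (fun z => k1 ^+ n * `|g z|)).
    by have := integrableZl mD (k1 ^+ n) iabs.
  have := h (integrableB mD j1 j2) i1 (ineq n).
  by rewrite e1 RintegralB// !RintegralZl// IB -/C subr_le0.
have b0 : 0 <= b by exact: fine_ge0.
have : b <= 0.
  rewrite leNgt; apply/negP => bpos.
  pose q := k2 / k1.
  have q1 : 1 < q by rewrite /q ltr_pdivlMr// mul1r.
  have main' n : q ^+ n <= C / (k * b).
    rewrite ler_pdivlMr ?mulr_gt0// /q expr_div_n mulrAC ler_pdivrMr ?exprn_gt0//.
    by have := main n; rewrite mulrA (mulrC C).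
  pose e := q - 1.
  have e0 : 0 < e by rewrite /e subr_gt0.
  have bern n : n%:R * e <= q ^+ n.
    elim: n => [|n IH]; first by rewrite mul0r.
    rewrite exprS -natr1 mulrDl mul1r.
    have qn : 1 <= q ^+ n by rewrite exprn_ege1// ltW.
    have -> : q = 1 + e by rewrite /e; ring.
    rewrite mulrDl mul1r; apply: lerD.
      by move: IH; rewrite /e; congr (_ <= _); congr (_ ^+ _); ring.
    rewrite ler_peMr ?(ltW e0)//.
    by move: qn; rewrite /e; congr (_ <= _); congr (_ ^+ _); ring.
  have [n hn] : exists n : nat, C / (k * b) / e < n%:R.
    by exists (Num.truncn (C / (k * b) / e)).+1; exact: truncnS_gt.
  have := le_trans (bern n) (main' n).
  by rewrite leNgt -ltr_pdivrMr// hn.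
move=> bneg; have b00 : b = 0 by apply/eqP; rewrite eq_le bneg.
by rewrite -(@fineK _ (m B)) ?ge0_fin_numE//; rewrite -/b b00.
Qed.

End Peak.

Section LaplaceTransform.
Context (R : realType).
Notation mu := (@lebesgue_measure R).
Notation mu2 := (mu \x mu)%E.
Implicit Types (phi psi : R * R -> R) (L : R -> R -> R).

Definition quadrant : set (R * R) := `]0, +oo[%classic `*` `]0, +oo[%classic.

Lemma measurable_quadrant :
  measurable (quadrant : set (measurableTypeR R * measurableTypeR R)).
Proof. exact: measurableX. Qed.

Definition is_laplace phi L :=
  (forall b g, 1 <= b -> 1 <= g ->
    mu2.-integrable quadrant
      (EFin \o (fun z : R * R => expR (- (b * z.1 + g * z.2)) * phi z)) /\
    \int[mu2]_(z in quadrant) (expR (- (b * z.1 + g * z.2)) * phi z) = L b g) /\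
  (forall w y : R, 0 < w -> 0 < y -> forall e : R, 0 < e -> exists2 rho : R, 0 < rho &
    forall w' y' : R, w <= w' <= w + rho -> y <= y' <= y + rho ->
    `|phi (w', y') - phi (w, y)| <= e).

Lemma is_laplaceD phi psi L L' : is_laplace phi L -> is_laplace psi L' ->
  is_laplace (fun z => phi z + psi z) (fun b g => L b g + L' b g).
Proof.
move=> [I1 C1] [I2 C2]; split.
  move=> b g b1 g1; have [i1 e1] := I1 b g b1 g1; have [i2 e2] := I2 b g b1 g1.
  have E : (fun z : R * R => expR (- (b * z.1 + g * z.2)) * (phi z + psi z)) =
    (fun z => expR (- (b * z.1 + g * z.2)) * phi z + expR (- (b * z.1 + g * z.2)) * psi z).
    by apply/funext => z; rewrite mulrDr.
  rewrite E; split; first by have := integrableD measurable_quadrant i1 i2.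
  by rewrite (RintegralD measurable_quadrant i1 i2) e1 e2.
move=> w y w0 y0 e e0.
have e20 : 0 < e / 2 by rewrite divr_gt0.
have [r1 r10 H1] := C1 w y w0 y0 _ e20; have [r2 r20 H2] := C2 w y w0 y0 _ e20.
exists (Num.min r1 r2); first by rewrite lt_min r10.
move=> w' y' /andP[ww' w'r] /andP[yy' y'r].
have [m1 m2] : Num.min r1 r2 <= r1 /\ Num.min r1 r2 <= r2 by rewrite !ge_min !lexx orbT.
have -> : phi (w', y') + psi (w', y') - (phi (w, y) + psi (w, y)) =
  (phi (w', y') - phi (w, y)) + (psi (w', y') - psi (w, y)) by ring.
rewrite (le_trans (ler_normD _ _))// (splitr e) lerD//.
  by apply: H1; rewrite ?ww' ?yy'/=; lra.
by apply: H2; rewrite ?ww' ?yy'/=; lra.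
Qed.

Lemma is_laplaceZ c phi L : is_laplace phi L ->
  is_laplace (fun z => c * phi z) (fun b g => c * L b g).
Proof.
move=> [I1 C1]; split.
  move=> b g b1 g1; have [i1 e1] := I1 b g b1 g1.
  have E : (fun z : R * R => expR (- (b * z.1 + g * z.2)) * (c * phi z)) =
    (fun z => c * (expR (- (b * z.1 + g * z.2)) * phi z)).
    by apply/funext => z; rewrite mulrCA.
  rewrite E; split; first by have := integrableZl measurable_quadrant c i1.
  by rewrite (RintegralZl c measurable_quadrant i1) e1.
move=> w y w0 y0 e e0.
have c0 : 0 < `|c| + 1 by rewrite ltr_wpDl.
have [r1 r10 H1] := C1 w y w0 y0 (e / (`|c| + 1)) (divr_gt0 e0 c0).
exists r1 => // w' y' ww' yy'; rewrite -mulrBr normrM.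
rewrite (le_trans (ler_wpM2l _ (H1 _ _ ww' yy')))// mulrCA ger_pMr//.
by rewrite ler_pdivrMr// mul1r lerDl.
Qed.

Let norm_half_le (u v r : R) :
  (`|u - (v - r)| <= r / 2) = (u <= v - r / 2) && (v - 3 / 2 * r <= u).
Proof. by rewrite ler_norml andbC; congr andb; apply/idP/idP; lra. Qed.

Lemma is_laplace_le0 phi L (w y : R) : is_laplace phi L ->
  (forall b g, 1 <= b -> 1 <= g -> L b g = 0) -> 0 < w -> 0 < y -> phi (w, y) <= 0.
Proof.
move=> [I C] L0 w0 y0; rewrite leNgt; apply/negP => phi0.
pose k := phi (w, y) / 2.
have k0 : 0 < k by rewrite divr_gt0.
have [rho rho0 H] := C w y w0 y0 _ k0.
have phik w' y' : w <= w' <= w + rho -> y <= y' <= y + rho -> k <= phi (w', y').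
  by move=> h1 h2; have := H _ _ h1 h2; rewrite ler_norml /k => /andP[? ?]; lra.
clearbody k; clear H phi0.
pose ex (u : R) := expR (- u).
have ex0 u : 0 < ex u by exact: expR_gt0.
have exlt u v : (ex u < ex v) = (v < u) by rewrite ltr_expR ltrN2.
have exle u v : (ex u <= ex v) = (v <= u) by rewrite ler_expR lerN2.
have wr : ex (w + rho) < ex w by rewrite exlt ltrDl.
have yr : ex (y + rho) < ex y by rewrite exlt ltrDl.
have ew1 : ex w < 1 by rewrite -expR0 ltr_expR oppr_lt0.
have ey1 : ex y < 1 by rewrite -expR0 ltr_expR oppr_lt0.
pose r : R := Num.min (ex w - ex (w + rho)) (ex y - ex (y + rho)) / 2.
have rw : 2 * r <= ex w - ex (w + rho) by rewrite /r mulrCA divff// mulr1 ge_min lexx.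
have ry : 2 * r <= ex y - ex (y + rho) by rewrite /r mulrCA divff// mulr1 ge_min lexx orbT.
have r0 : 0 < r by rewrite divr_gt0// lt_min !subr_gt0 wr.
have wr0 := ex0 (w + rho); have yr0 := ex0 (y + rho).
clearbody r.
pose lg (u : R) := - ln u.
have exlg u : 0 < u -> ex (lg u) = u by move=> u0; rewrite /ex /lg opprK lnK.
have exE u : ex u = expR (- u) by [].
clearbody lg; clearbody ex.
pose B : set (R * R) := `[lg (ex w - r / 2), lg (ex w - 3 / 2 * r)]%classic `*`
  `[lg (ex y - r / 2), lg (ex y - 3 / 2 * r)]%classic.
have pos1 (u v : R) : 0 < u -> 2 * r <= v - u -> 0 < v - r / 2 by clear -r0; lra.
have pos3 (u v : R) : 0 < u -> 2 * r <= v - u -> 0 < v - 3 / 2 * r by clear -r0; lra.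
have r2 : r / 2 < r by clear -r0; lra.
have r32 (v : R) : v - 3 / 2 * r < v - r / 2 by clear -r0; lra.
have BE z : B z <-> `|ex z.1 - (ex w - r)| <= r / 2 /\ `|ex z.2 - (ex y - r)| <= r / 2.
  rewrite !norm_half_le /B /= !in_itv/= -![lg _ <= _]exle -![_ <= lg _]exle !exlg.
  - by [].
  - exact: pos3 yr0 ry.
  - exact: pos1 yr0 ry.
  - exact: pos3 wr0 rw.
  - exact: pos1 wr0 rw.
have near (u v : R) : `|ex u - (ex v - r)| < r -> 2 * r <= ex v - ex (v + rho) ->
    v < u < v + rho.
  rewrite ltr_norml -exlt -[_ < v + rho]exlt => /andP[]; move: (ex u) (ex v) (ex _).
  by clear => p q s h1 h2 h3; apply/andP; split; lra.
have lglt u v : 0 < u -> u < v -> lg v < lg u.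
  by move=> u0 uv; rewrite -exlt !exlg// (lt_trans u0).
have l1 : lg (ex w - r / 2) < lg (ex w - 3 / 2 * r) by apply: lglt => //; exact: pos3 wr0 rw.
have l2 : lg (ex y - r / 2) < lg (ex y - 3 / 2 * r) by apply: lglt => //; exact: pos3 yr0 ry.
have mB : mu2 B = ((lg (ex w - 3 / 2 * r) - lg (ex w - r / 2)) *
    (lg (ex y - 3 / 2 * r) - lg (ex y - r / 2)))%:E.
  have mI u v : u < v -> mu `[u, v]%classic = (v - u)%:E.
    by move=> uv; rewrite lebesgue_measure_itv/= lte_fin uv.
  by rewrite EFinM -(mI _ _ l1) -(mI _ _ l2); exact: product_measure1E.
have Boo : (mu2 B < +oo)%E by rewrite mB ltry.
have nul : mu2 B = 0%E.
  apply: (@peak_null _ _ _ mu2 quadrant B (fun z => ex z.1) (fun z => ex z.2)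
    (fun z => expR (- (1 * z.1 + 1 * z.2)) * phi z) (ex w - r) (ex y - r) r
    (ex (w + rho) * ex (y + rho) * k)).
  - exact: measurable_quadrant.
  - by apply: measurableX.
  - move=> z /BE[h1 h2].
    have /andP[wz _] := near _ _ (le_lt_trans h1 r2) rw.
    have /andP[yz _] := near _ _ (le_lt_trans h2 r2) ry.
    by split; rewrite /= in_itv/= andbT; [exact: lt_trans wz|exact: lt_trans yz].
  - move=> z [/=]; rewrite in_itv/= andbT => z1 _.
    by rewrite ltW ?ex0//= exE -expR0 ler_expR oppr_le0 ltW.
  - move=> z [/=]; rewrite !in_itv/= !andbT => _ z1.
    by rewrite ltW ?ex0//= exE -expR0 ler_expR oppr_le0 ltW.
  - by move: wr0 rw ew1; clear -r0; move: (ex w) (ex _) => p q *; apply/andP; split; lra.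
  - by move: yr0 ry ey1; clear -r0; move: (ex y) (ex _) => p q *; apply/andP; split; lra.
  - by move: wr0 rw ew1; clear -r0; move: (ex w) (ex _) => p q *; apply/andP; split; lra.
  - by rewrite !mulr_gt0.
  - move=> i j.
    have := I (i%:R + 1) (j%:R + 1).
    rewrite !lerDr !ler0n L0 ?lerDr ?ler0n// => /(_ isT isT).
    have -> // : (fun z : R * R => ex z.1 ^+ i * ex z.2 ^+ j * (expR (- (1 * z.1 + 1 * z.2)) * phi z)) =
       (fun z => expR (- ((i%:R + 1) * z.1 + (j%:R + 1) * z.2)) * phi z).
    apply/funext => z; rewrite !exE -!expRM_natl mulrA -!expRD; congr (expR _ * _); ring.
  - move=> z _ h1 h2; rewrite mulr_ge0 ?expR_ge0// (surjective_pairing z).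
    have /andP[? ?] := near _ _ h1 rw; have /andP[? ?] := near _ _ h2 ry.
    by rewrite (le_trans (ltW k0))// phik//; apply/andP; split; apply: ltW.
  - move=> z /BE[h1 h2]; split => //.
    have /andP[? ?] := near _ _ (le_lt_trans h1 r2) rw.
    have /andP[? ?] := near _ _ (le_lt_trans h2 r2) ry.
    rewrite !mul1r opprD expRD -!exE ler_pM ?mulr_ge0 ?(ltW (ex0 _)) ?(ltW k0)//.
      by rewrite ler_pM ?(ltW (ex0 _))// exle ltW.
    by rewrite (surjective_pairing z) phik//; apply/andP; split; apply: ltW.
  - exact: Boo.
have : (lg (ex w - 3 / 2 * r) - lg (ex w - r / 2)) * (lg (ex y - 3 / 2 * r) - lg (ex y - r / 2)) = 0.
  by apply: EFin_inj; exact: etrans (esym mB) nul.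
by move=> /eqP; rewrite mulf_eq0 !subr_eq0 !gt_eqF.
Qed.

Lemma is_laplace_inj phi psi L L' (w y : R) : is_laplace phi L -> is_laplace psi L' ->
  (forall b g, 1 <= b -> 1 <= g -> L b g = L' b g) -> 0 < w -> 0 < y ->
  phi (w, y) = psi (w, y).
Proof.
move=> H1 H2 LL w0 y0; apply/eqP; rewrite eq_le; apply/andP; split; rewrite -subr_le0.
  apply: (@is_laplace_le0 (fun z => phi z - psi z) (fun b g => L b g - L' b g)) => //.
    have := is_laplaceD H1 (is_laplaceZ (-1) H2).
    by congr is_laplace; [apply/funext => z|apply/funext => b; apply/funext => g]; rewrite mulN1r.
  by move=> b g b1 g1; rewrite LL// subrr.
apply: (@is_laplace_le0 (fun z => psi z - phi z) (fun b g => L' b g - L b g)) => //.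
  have := is_laplaceD H2 (is_laplaceZ (-1) H1).
  by congr is_laplace; [apply/funext => z|apply/funext => b; apply/funext => g]; rewrite mulN1r.
by move=> b g b1 g1; rewrite LL// subrr.
Qed.

End LaplaceTransform.

Section RealIntegral.
Context d (T : measurableType d) (R : realType) (m : {measure set T -> \bar R}).
Context (D : set T) (mD : measurable D).
Implicit Types f g : T -> R.

Lemma cvg_Rintegral (f_ : nat -> T -> R) f g :
  (forall n, measurable_fun D (f_ n)) ->
  (forall x, D x -> f_ ^~ x @ \oo --> f x) ->
  m.-integrable D (EFin \o g) -> (forall n x, D x -> `|f_ n x| <= g x) ->
  m.-integrable D (EFin \o f) /\
  \int[m]_(x in D) f_ n x @[n --> \oo] --> \int[m]_(x in D) f x.
Proof.
move=> mf_ ff ig fg.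
have mf : measurable_fun D f by apply: measurable_fun_cvg ff.
have intf n : m.-integrable D (EFin \o f_ n).
  apply: (le_integrable mD _ _ ig) => [|x Dx /=]; first exact/measurable_EFinP.
  by rewrite lee_fin (le_trans (fg _ _ Dx))// ler_norm.
have [|||||i1 _ h] := @dominated_convergence _ _ _ m D mD (fun n => EFin \o f_ n) (EFin \o f) (EFin \o g) => //.
- by move=> n; exact/measurable_EFinP.
- exact/measurable_EFinP.
- by apply: aeW => x Dx /=; apply: cvg_EFin; [exact: nearW|exact: ff].
- by apply: aeW => x n Dx /=; rewrite lee_fin fg.
split => //.
by apply: fine_cvg; rewrite fineK ?(integrable_fin_num mD i1).
Qed.

Lemma EFin_Rintegral f : m.-integrable D (EFin \o f) ->
  (\int[m]_(x in D) f x)%:E = (\int[m]_(x in D) (f x)%:E)%E.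
Proof. by move=> i; rewrite /Rintegral fineK// (integrable_fin_num mD i). Qed.

Lemma ge0_integrable f : measurable_fun D f -> (forall x, D x -> 0 <= f x) ->
  (\int[m]_(x in D) (f x)%:E < +oo)%E -> m.-integrable D (EFin \o f).
Proof.
move=> mf f0 foo; apply/integrableP; split; first exact/measurable_EFinP.
by under eq_integral => x /set_mem Dx do rewrite /= ger0_norm ?f0//.
Qed.

End RealIntegral.

Section ProductIntegral.
Context d1 d2 (T1 : measurableType d1) (T2 : measurableType d2) (R : realType).
Context (m1 : {sigma_finite_measure set T1 -> \bar R}).
Context (m2 : {sigma_finite_measure set T2 -> \bar R}).

Lemma ge0_integral_setX (A : set T1) (B : set T2) (f : T1 * T2 -> \bar R) :
  measurable A -> measurable B -> measurable_fun [set: T1 * T2] f ->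
  (forall x y, A x -> B y -> (0 <= f (x, y))%E) ->
  (\int[m1 \x m2]_(z in A `*` B) f z =
   \int[m1]_(x in A) \int[m2]_(y in B) f (x, y))%E.
Proof.
move=> mA mB mf f0.
rewrite integral_mkcond.
pose g := f \_ (A `*` B).
have mg : measurable_fun [set: T1 * T2] g.
  apply/(measurable_restrictT f); first exact: measurableX.
  exact: measurable_funS mf.
have g0 z : (0 <= g z)%E.
  rewrite /g patchE; case: ifPn => //; rewrite inE => -[z1 z2].
  by case: z z1 z2 => x y /=; exact: f0.
rewrite -/g (@fubini_tonelli1 _ _ _ _ _ m1 m2 g mg g0) [RHS]integral_mkcond.
apply: eq_integral => x _; rewrite patchE /fubini_F; case: ifPn => xA.
  rewrite [RHS]integral_mkcond; apply: eq_integral => y _.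
  by rewrite /g !patchE in_setX/= xA.
by apply: integral0_eq => y _; rewrite /g patchE in_setX/= (negbTE xA).
Qed.

End ProductIntegral.

#[global] Opaque Gamma.

Section FractionalPower.
Context (R : realType).
Notation mu := (@lebesgue_measure R).
Implicit Types r u b w : R.

Definition fpow r u := (if 0 < u then u `^ r else 0) / Gamma (r + 1).

Lemma Gamma1_gt0 r : 0 <= r -> 0 < Gamma (r + 1).
Proof. by move=> r0; apply: Gamma_gt0; rewrite ltr_wpDl. Qed.

Lemma fpow_ge0 r u : 0 <= r -> 0 <= fpow r u.
Proof.
move=> r0; rewrite divr_ge0 ?(ltW (Gamma1_gt0 r0))//.
by case: ifP => // _; exact: powR_ge0.
Qed.

Lemma fpow_le0 r u : u <= 0 -> fpow r u = 0.
Proof. by move=> u0; rewrite /fpow ltNge u0 mul0r. Qed.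

Lemma fpowE r u : 0 < u -> fpow r u = u `^ r / Gamma (r + 1).
Proof. by move=> u0; rewrite /fpow u0. Qed.

Lemma fpow_nat n u : 0 < u -> fpow n%:R u = u ^+ n / n`!%:R.
Proof. by move=> u0; rewrite fpowE// powR_mulrn ?ltW// natr1 Gamma_nat. Qed.

Lemma le_fpow r : 0 <= r -> {homo fpow r : u v / u <= v}.
Proof.
move=> r0 u v uv; have [u0|u0] := leP u 0; first by rewrite fpow_le0// fpow_ge0.
have v0 : 0 < v by exact: lt_le_trans uv.
rewrite !fpowE// ler_wpM2r ?invr_ge0 ?(ltW (Gamma1_gt0 r0))//.
by apply: ge0_ler_powR; rewrite ?nnegrE ?(ltW u0) ?(ltW v0).
Qed.

Lemma measurable_fpow d (T : measurableType d) (D : set T) (f : T -> R) r :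
  measurable_fun D f -> measurable_fun D (fun x => fpow r (f x)).
Proof.
move=> mf; have m : measurable_fun [set: R] (fpow r).
  apply: measurable_funM => //; apply: measurable_fun_ifT.
  - exact: measurable_fun_ltr.
  - exact: measurable_powR.
  - exact: measurable_cst.
exact: measurableT_comp m mf.
Qed.

Lemma continuous_fpow r : 0 < r -> continuous (fpow r).
Proof.
move=> r0 u; apply: cvgM; last exact: cvg_cst.
case: (boolP (u < 0)) => [u0|].
  have h : \near u, (if 0 < u then u `^ r else 0) = 0.
    near=> v; have v0 : v < 0 by near: v; exact: lt_nbhsl.
    by rewrite ltNge (ltW v0).
  by rewrite ltNge (ltW u0)/=; apply: cvg_near_cst; exact: h.
rewrite -leNgt le_eqVlt => /predU1P[<-|u0]; last first.
  have h : \near u, (if 0 < u then u `^ r else 0) = u `^ r.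
    by near=> v; have -> // : 0 < v; near: v; exact: lt_nbhsr.
  rewrite u0; apply: cvg_trans; last exact: (continuous_powR u0).
  by apply: near_eq_cvg; apply: filterS h => x ->.
rewrite ltxx; apply/cvgrPdist_lt => e e0.
have /cvgrPdist_lt /(_ e e0) := @powR_cvg0 R r r0.
rewrite near_withinE => /nbhs_ballP[dl /= dl0 H].
near=> v; case: ifPn => v0; last by rewrite subrr normr0.
apply: H => //.
by near: v; apply/nbhs_ballP; exists dl.
Unshelve. all: by end_near. Qed.

Lemma fpow_le_expR r w u : 0 <= r -> 0 <= u ->
  fpow r (w - u) <= fpow r w * expR w * expR (- u).
Proof.
move=> r0 u0; have g0 v := fpow_ge0 v r0.
have [wu|uw] := leP w u; last first.
  rewrite -mulrA -expRD (le_trans (le_fpow r0 (_ : w - u <= w)))//.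
    by rewrite gerBl.
  by rewrite ler_peMr// -expR0 ler_expR subr_ge0 ltW.
by rewrite [leLHS]fpow_le0 ?subr_le0// mulr_ge0 ?expR_ge0// mulr_ge0 ?expR_ge0.
Qed.

Lemma integral_fpow r b w : 0 < r -> 0 < b -> 0 <= w ->
  (\int[mu]_(x in `]0%R, +oo[) (expR (- (b * x)) * fpow r (x - w))%:E =
   (expR (- (b * w)) * b `^ (- (r + 1)))%:E)%E.
Proof.
move=> r0 b0 w0.
have G0 := Gamma1_gt0 (ltW r0).
pose f u := expR (- (b * (u + w))) * fpow r u.
have mf : measurable_fun [set: R] f.
  apply: measurable_funM; last exact: measurable_fpow.
  by apply: measurableT_comp => //; apply: measurableT_comp => //;
     apply: measurable_funM => //; exact: measurable_funD.
have f0 u : 0 <= f u by rewrite mulr_ge0 ?expR_ge0// fpow_ge0// ltW.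
have fneg u : u <= 0 -> f u = 0 by move=> u0; rewrite /f fpow_le0 ?mulr0.
have E1 (x : R) : expR (- (b * x)) * fpow r (x - w) = f (x + - w) by rewrite /f subrK.
transitivity (\int[mu]_x (f (x + - w)%R)%:E)%E.
  rewrite integral_mkcond; apply: eq_integral => x _.
  rewrite patchE; case: ifPn => xD; first by rewrite E1.
  rewrite fneg// subr_le0 (le_trans _ w0)//.
  by move: xD; rewrite notin_setE/= in_itv/= andbT => /negP; rewrite -leNgt.
rewrite (@ge0_integral_shift _ (- w) (EFin \o f)); [|exact/measurable_EFinP|by move=> x /=; rewrite lee_fin].
transitivity (\int[mu]_(x in `]0%R, +oo[) (expR (- (b * w)) / Gamma (r + 1) * gamma_integrand (r + 1) b x)%:E)%E.
  rewrite [RHS]integral_mkcond; apply: eq_integral => x _.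
  rewrite patchE /=; case: ifPn => xD.
    move: xD; rewrite inE/= in_itv/= andbT => x0.
    congr EFin; rewrite /f (fpowE _ x0) /gamma_integrand addrK mulrDr opprD expRD.
    move: (expR _) (expR _) (_ `^ _) (Gamma _)^-1 => A B C D; ring.
  by rewrite fneg//; move: xD; rewrite notin_setE/= in_itv/= andbT => /negP; rewrite -leNgt.
have r10 : 0 < r + 1 by rewrite addr_gt0.
rewrite ge0_integralZl_real//.
- rewrite (integral_gamma_integrand r10 b0) -EFinM; congr EFin.
  by rewrite mulrA divfK// gt_eqF.
- exact: measurable_gamma_integrand.
- by move=> x _; exact: gamma_integrand_ge0.
- by rewrite divr_ge0 ?expR_ge0// ltW.
Qed.

Lemma ge0_integral_quadrantM (u v : R -> R) (A B : R) :
  measurable_fun [set: R] u -> measurable_fun [set: R] v ->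
  (forall x, 0 <= u x) -> (forall x, 0 <= v x) ->
  (\int[mu]_(x in `]0%R, +oo[) (u x)%:E = A%:E)%E ->
  (\int[mu]_(x in `]0%R, +oo[) (v x)%:E = B%:E)%E ->
  (\int[mu \x mu]_(z in @quadrant R) (u z.1 * v z.2)%:E = (A * B)%:E)%E.
Proof.
move=> m_u m_v u0 v0 IU IV.
have B0 : 0 <= B by rewrite -lee_fin -IV; apply: integral_ge0 => x _; rewrite lee_fin.
transitivity (\int[mu]_(w in `]0%R, +oo[) \int[mu]_(y in `]0%R, +oo[) (u w * v y)%:E)%E.
  apply: (@ge0_integral_setX _ _ _ _ R mu mu `]0, +oo[%classic `]0, +oo[%classic
    (fun z => (u z.1 * v z.2)%:E)) => //.
  - apply/measurable_EFinP.
    by apply: measurable_funM; [exact: measurableT_comp m_u _|exact: measurableT_comp m_v _].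
  - by move=> w y _ _; rewrite lee_fin mulr_ge0.
transitivity (\int[mu]_(w in `]0%R, +oo[) (B * u w)%:E)%E.
  apply: eq_integral => w _.
  rewrite (ge0_integralZl_real mu _ _ (fun x _ => v0 x) (u0 w)) ?IV ?EFinM 1?muleC//.
  exact: measurable_funTS.
rewrite (ge0_integralZl_real mu _ _ (fun x _ => u0 x) B0) ?IU -?EFinM 1?mulrC//.
exact: measurable_funTS.
Qed.

End FractionalPower.

#[global] Opaque fpow.

Section Phi.
Context (R : realType) d (T : measurableType d).
Context (eta : {sigma_finite_measure set T -> \bar R}) (E : set T) (W D : T -> R).
Hypotheses (mE : measurable E).
Hypotheses (mW : measurable_fun [set: T] W) (mD : measurable_fun [set: T] D).
Hypotheses (W0 : forall x, E x -> 0 <= W x) (D0 : forall x, E x -> 0 <= D x).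
Hypothesis etaWD : eta.-integrable E (EFin \o (fun x => expR (- (W x + D x)))).
Notation mu := (@lebesgue_measure R).
Notation mu2 := (mu \x mu)%E.

Definition Phi (r j : R) (z : R * R) : R :=
  \int[eta]_(x in E) (fpow r (z.1 - W x) * fpow j (z.2 - D x)).

Variables (r j : R).

Let F (z : R * R) x := fpow r (z.1 - W x) * fpow j (z.2 - D x).

Let measurable_F z : measurable_fun E (F z).
Proof.
by apply: measurable_funTS; apply: measurable_funM; apply: measurable_fpow; exact: measurable_funB.
Qed.

Section Monotone.
Hypotheses (r0 : 0 <= r) (j0 : 0 <= j).

Let F_ge0 z x : 0 <= F z x.
Proof. by rewrite mulr_ge0 ?fpow_ge0. Qed.

Lemma integrable_Phi z : eta.-integrable E (EFin \o F z).
Proof.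
pose C := fpow r z.1 * expR z.1 * (fpow j z.2 * expR z.2).
have C0 : 0 <= C.
  apply: mulr_ge0; apply: mulr_ge0; rewrite ?expR_ge0//.
    exact: fpow_ge0 r0.
  exact: fpow_ge0 j0.
have := integrableZl mE C etaWD.
apply: le_integrable => //; first exact/measurable_EFinP/measurable_F.
move=> x Ex /=; rewrite lee_fin ger0_norm// ger0_norm; last first.
  by rewrite mulr_ge0 ?expR_ge0.
rewrite /C opprD expRD mulrACA ler_pM ?fpow_ge0//.
  exact: fpow_le_expR (W0 Ex).
exact: fpow_le_expR (D0 Ex).
Qed.

Lemma Phi_ge0 z : 0 <= Phi r j z.
Proof. by apply: Rintegral_ge0 => x _; exact: F_ge0. Qed.

Lemma le_Phi z z' : z.1 <= z'.1 -> z.2 <= z'.2 -> Phi r j z <= Phi r j z'.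
Proof.
move=> h1 h2; apply: le_Rintegral => //; [exact: integrable_Phi|exact: integrable_Phi|].
move=> x _; rewrite ler_pM ?fpow_ge0//.
  by apply: le_fpow => //; rewrite lerD2r.
by apply: le_fpow => //; rewrite lerD2r.
Qed.

End Monotone.

Hypotheses (r0 : 0 < r) (j0 : 0 < j).

Let F_ge0 z x : 0 <= F z x.
Proof. by rewrite mulr_ge0 ?fpow_ge0 ?(ltW r0) ?(ltW j0). Qed.

Lemma measurable_Phi :
  measurable_fun [set: measurableTypeR R * measurableTypeR R] (Phi r j).
Proof.
pose f (p : (R * R) * T) := (F p.1 p.2 * \1_E p.2)%:E.
have mf : measurable_fun [set: (measurableTypeR R * measurableTypeR R) * T] f.
  apply/measurable_EFinP; apply: measurable_funM.
    apply: measurable_funM; apply: measurable_fpow; apply: measurable_funB.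
    + exact: (measurableT_comp measurable_fst measurable_fst).
    + exact: (measurableT_comp mW measurable_snd).
    + exact: (measurableT_comp measurable_snd measurable_fst).
    + exact: (measurableT_comp mD measurable_snd).
  by apply: measurableT_comp measurable_snd; exact: measurable_indic.
have f0 p : (0 <= f p)%E by rewrite lee_fin mulr_ge0.
have := @measurable_fun_fubini_tonelli_F _ _ _ _ _ eta f mf f0.
have mfine : measurable_fun [set: \bar R] (@fine R) by [].
move/(measurableT_comp mfine).
apply: eq_measurable_fun => z _; rewrite /Phi /Rintegral /=; congr fine.
rewrite [RHS]integral_mkcond; apply: eq_integral => x _.
by rewrite /f patchE /= indicE; case: ifPn => xE; rewrite ?mulr1 ?mulr0.
Qed.

Lemma Phi_right_continuous (w y e : R) : 0 < e -> exists2 rho : R, 0 < rho &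
  forall w' y' : R, w <= w' <= w + rho -> y <= y' <= y + rho ->
  `|Phi r j (w', y') - Phi r j (w, y)| <= e.
Proof.
move=> e0.
have [||||_ h] := @cvg_Rintegral _ T R eta E mE (fun n => F (w + n.+1%:R^-1, y + n.+1%:R^-1)) (F (w, y))
  (F (w + 1, y + 1)).
- by move=> n; exact: measurable_F.
- move=> x Ex; rewrite /F /=; apply: cvgM; apply: continuous_cvg => //; try exact: continuous_fpow.
    rewrite -[X in _ --> X]addr0; under eq_fun do rewrite addrAC.
    by apply: cvgD; [exact: cvg_cst|exact: cvg_harmonic].
  rewrite -[X in _ --> X]addr0; under eq_fun do rewrite addrAC.
  by apply: cvgD; [exact: cvg_cst|exact: cvg_harmonic].
- exact: (integrable_Phi (ltW r0) (ltW j0)).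
- move=> n x Ex; rewrite ger0_norm//.
  have n1 : n.+1%:R^-1 <= (1 : R) by rewrite invf_le1// ler1n.
  rewrite ler_pM ?fpow_ge0 ?(ltW r0) ?(ltW j0)//.
    by apply: le_fpow; [exact: ltW|rewrite lerD2r lerD2l].
  by apply: le_fpow; [exact: ltW|rewrite lerD2r lerD2l].
move/cvgrPdistC_lt : h => /(_ e e0) [N _ HN].
exists N.+1%:R^-1 => // w' y' /andP[w1 w2] /andP[y1 y2].
have : `|Phi r j (w + N.+1%:R^-1, y + N.+1%:R^-1) - Phi r j (w, y)| < e := HN N (leqnn _).
have : Phi r j (w, y) <= Phi r j (w', y') by apply: (le_Phi (ltW r0) (ltW j0)).
have : Phi r j (w', y') <= Phi r j (w + N.+1%:R^-1, y + N.+1%:R^-1) by apply: (le_Phi (ltW r0) (ltW j0)).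
move: (Phi r j (w, y)) (Phi r j (w', y')) (Phi r j (_, _)) => A B C BC AB.
by rewrite ltr_norml ler_norml => /andP[_ ?]; apply/andP; split; lra.
Qed.

Lemma integral_Phi b g : 0 < b -> 0 < g ->
  (\int[mu2]_(z in @quadrant R) \int[eta]_(x in E)
     (expR (- (b * z.1 + g * z.2)) * F z x)%:E =
   \int[eta]_(x in E)
     (b `^ (- (r + 1)) * g `^ (- (j + 1)) * expR (- (b * W x + g * D x)))%:E)%E.
Proof.
move=> b0 g0.
have mexp d' (T' : measurableType d') (c : R) (f : T' -> R) : measurable_fun setT f ->
    measurable_fun setT (fun z => expR (- (c * f z))).
  by move=> mf; apply: measurableT_comp => //; apply: measurableT_comp => //; exact: measurable_funM.
transitivity (\int[eta]_(x in E) \int[prod_measure mu mu]_(z in @quadrant R)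
    (expR (- (b * z.1 + g * z.2)) * F z x)%:E)%E.
  apply: (@tonelli_domain _ _ _ _ R (prod_measure mu mu) eta (@quadrant R) E
    (fun p => (expR (- (b * p.1.1 + g * p.1.2)) * F p.1 p.2)%:E)) => //.
  - exact: measurable_quadrant.
  - apply/measurable_EFinP; apply: measurable_funM.
    apply: measurableT_comp => //; apply: measurableT_comp => //.
    apply: measurable_funD; apply: measurable_funM => //.
      exact: (measurableT_comp measurable_fst measurable_fst).
    exact: (measurableT_comp measurable_snd measurable_fst).
  apply: measurable_funM; apply: measurable_fpow; apply: measurable_funB.
  + exact: (measurableT_comp measurable_fst measurable_fst).
  + exact: (measurableT_comp mW measurable_snd).
  + exact: (measurableT_comp measurable_snd measurable_fst).
  + exact: (measurableT_comp mD measurable_snd).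
  - by move=> z x _ _; rewrite lee_fin mulr_ge0// expR_ge0.
apply: eq_integral => x /set_mem Ex.
pose u (w : R) := expR (- (b * w)) * fpow r (w - W x).
pose v (y : R) := expR (- (g * y)) * fpow j (y - D x).
have uv (z : R * R) : expR (- (b * z.1 + g * z.2)) * F z x = u z.1 * v z.2.
  by rewrite /F /u /v opprD expRD mulrACA.
under eq_integral do rewrite uv.
rewrite (@ge0_integral_quadrantM R u v _ _ _ _ _ _ (integral_fpow r0 b0 (W0 Ex)) (integral_fpow j0 g0 (D0 Ex))).
- congr EFin; rewrite (opprD (b * W x)) expRD.
  move: (expR _) (expR _) (_ `^ _) (_ `^ _) => A B C' D'; ring.
- by apply: measurable_funM; [exact: mexp|apply: measurable_fpow; exact: measurable_funB].
- by apply: measurable_funM; [exact: mexp|apply: measurable_fpow; exact: measurable_funB].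
- by move=> y; rewrite mulr_ge0 ?expR_ge0 ?fpow_ge0 ?(ltW r0).
- by move=> y; rewrite mulr_ge0 ?expR_ge0 ?fpow_ge0 ?(ltW j0).
Qed.

Lemma is_laplace_Phi : is_laplace (Phi r j) (fun b g =>
  b `^ (- (r + 1)) * g `^ (- (j + 1)) *
  \int[eta]_(x in E) expR (- (b * W x + g * D x))).
Proof.
split=> [b g b1 g1|w y _ _ e e0]; last exact: Phi_right_continuous.
have b0 : 0 < b by rewrite (lt_le_trans _ b1).
have g0 : 0 < g by rewrite (lt_le_trans _ g1).
pose h x := expR (- (b * W x + g * D x)).
have mh : measurable_fun E h.
  apply: measurable_funTS; apply: measurableT_comp => //; apply: measurableT_comp => //.
  by apply: measurable_funD; exact: measurable_funM.
have ih : eta.-integrable E (EFin \o h).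
  apply: (le_integrable mE _ _ etaWD) => [|x Ex /=]; first exact/measurable_EFinP.
  rewrite lee_fin !ger0_norm ?expR_ge0// ler_expR lerN2 lerD//.
    by rewrite ler_peMl ?W0.
  by rewrite ler_peMl ?D0.
pose c := b `^ (- (r + 1)) * g `^ (- (j + 1)).
have c0 : 0 <= c by rewrite mulr_ge0 ?powR_ge0.
have key := integral_Phi b0 g0.
have E1 z : (\int[eta]_(x in E) (expR (- (b * z.1 + g * z.2)) * F z x)%:E =
    (expR (- (b * z.1 + g * z.2)) * Phi r j z)%:E)%E.
  rewrite ge0_integralZl_real ?expR_ge0//.
  by rewrite EFinM (EFin_Rintegral mE (integrable_Phi (ltW r0) (ltW j0) z)).
have E2 : (\int[eta]_(x in E) (c * h x)%:E = (c * \int[eta]_(x in E) h x)%:E)%E.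
  rewrite ge0_integralZl_real//; last by move=> x _; exact: expR_ge0.
  by rewrite [RHS]EFinM; congr (_ * _)%E; exact/esym/EFin_Rintegral.
have {key} key : (\int[mu2]_(z in @quadrant R) (expR (- (b * z.1 + g * z.2)) * Phi r j z)%:E =
    (c * \int[eta]_(x in E) h x)%:E)%E.
  by rewrite -E2 -key; apply: eq_integral => z _; rewrite E1.
split; last by rewrite /Rintegral key.
apply: ge0_integrable.
- apply: measurable_funM.
    apply: measurable_funTS; apply: measurableT_comp => //; apply: measurableT_comp => //.
    by apply: measurable_funD; apply: measurable_funM.
  exact: measurable_funTS measurable_Phi.
- by move=> z _; rewrite mulr_ge0 ?expR_ge0 ?(Phi_ge0 (ltW r0) (ltW j0)).
- by rewrite key ltry.
Qed.

End Phi.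

(** * Grid approximation of cadlag paths *)

Section CadlagPath.
Context (R : realType) (f : R -> R).
Hypothesis cf : cadlag f.
Implicit Types s t u e : R.

Lemma cadlag_right t e : 0 <= t -> 0 < e ->
  exists2 r : R, 0 < r & forall u, t <= u -> u < t + r -> `|f u - f t| < e.
Proof.
move=> t0 e0; have [/(_ t t0)/cvgrPdistC_lt/(_ e e0) + _] := cf.
rewrite near_withinE => /nbhs_ballP[r /= r0 H]; exists r => // u tu ur.
move: tu; rewrite le_eqVlt => /predU1P[<-|tu]; first by rewrite subrr normr0.
apply: H => //; rewrite /ball/= distrC ger0_norm ?subr_ge0 ?(ltW tu)//; lra.
Qed.

Lemma cadlag_left t : 0 < t ->
  exists2 r : R, 0 < r & exists K, forall u, t - r < u -> u < t -> `|f u| <= K.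
Proof.
move=> t0; have [_ /(_ t t0) cvl] := cf.
move: cvl => /cvg_ex[l /cvgrPdistC_lt/(_ 1 ltr01)].
rewrite near_withinE => /nbhs_ballP[r /= r0 H]; exists r => //; exists (`|l| + 1) => u ru ut.
have : `|f u - l| < 1.
  apply: H => //; rewrite /ball/= ger0_norm; first by move: ru; lra.
  by rewrite subr_ge0 ltW.
move=> h; rewrite -[f u](subrK l) (le_trans (ler_normD _ _))// addrC lerD2l; exact: ltW.
Qed.

Lemma cadlag_bounded t : exists M, forall s, 0 <= s <= t -> `|f s| <= M.
Proof.
have /compact_near_coveringP/(_ R +oo%R (fun M s => 0 <= s -> `|f s| <= M)) h := @segment_compact R 0 t.
have [x|M [_ HM]] := h _.
  rewrite /= in_itv/= => /andP[x0 xt].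
  have [r r0 Hr] := cadlag_right x0 ltr01.
  have [r' r'0 [K HK]] : exists2 r' : R, 0 < r' & exists K, forall u, 0 <= u -> x - r' < u -> u < x -> `|f u| <= K.
    move: x0; rewrite le_eqVlt => /predU1P[x0|x0].
      by exists 1 => //; exists 0 => u u0 _; rewrite -x0 ltNge u0.
    by have [r' r'0 [K HK]] := cadlag_left x0; exists r' => //; exists K => u _; exact: HK.
  exists (ball x (Num.min r r'), [set M | Num.max K (`|f x| + 1) <= M]).
    split => /=; first by apply: nbhsx_ballx; rewrite lt_min r0.
    by exists (Num.max K (`|f x| + 1)); split; [exact: num_real|move=> M; exact: ltW].
  move=> [u M] [/= + hM] u0; rewrite /ball/= lt_min ltr_norml => /andP[/andP[h1 _] +].
  rewrite ltr_norml => /andP[_ h2].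
  move: hM; rewrite ge_max => /andP[KM fM].
  have [ux|xu] := ltP u x.
    by rewrite (le_trans _ KM)//; apply: HK => //; lra.
  rewrite (le_trans _ fM)// -[f u](subrK (f x)) (le_trans (ler_normD _ _))// addrC lerD2l ltW//.
  by apply: Hr => //; lra.
exists (M + 1) => s /andP[s0 st]; apply: (HM (M + 1)) => //; first by rewrite ltrDl.
by rewrite /= in_itv/= s0.
Qed.

Definition rsup t := sup [set f s | s in `[0, t]].

Let bounded t : has_ubound [set f s | s in `[0, t]].
Proof.
have [M HM] := cadlag_bounded t; exists M => _ [s /= + <-]; rewrite in_itv/= => st.
by rewrite (le_trans (ler_norm _))// HM.
Qed.

Lemma le_rsup s t : 0 <= s <= t -> f s <= rsup t.
Proof. by move=> st; apply: ub_le_sup => //; exists s => //=; rewrite in_itv. Qed.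

Lemma rsup_le t c : 0 <= t -> (forall s, 0 <= s <= t -> f s <= c) -> rsup t <= c.
Proof.
move=> t0 H; apply: ge_sup; first by exists (f 0), 0 => //=; rewrite in_itv/= lexx.
by move=> _ [s /= + <-]; rewrite in_itv/= => st; exact: H.
Qed.

Lemma rsup_adherent t e : 0 <= t -> 0 < e -> exists2 s, 0 <= s <= t & rsup t - e < f s.
Proof.
move=> t0 e0; have [|_ [s /= + <-] h] := @sup_adherent _ [set f s | s in `[0, t]] e e0.
  by split => //; exists (f 0), 0 => //=; rewrite in_itv/= lexx.
by rewrite in_itv/= => st; exists s.
Qed.

Lemma rsup_nondecreasing s t : 0 <= s -> s <= t -> rsup s <= rsup t.
Proof.
move=> s0 st; apply: rsup_le => // u /andP[u0 us]; apply: le_rsup.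
by rewrite u0 (le_trans us).
Qed.

Lemma rsup_right t e : 0 <= t -> 0 < e ->
  exists2 r : R, 0 < r & forall u, t <= u -> u < t + r -> `|rsup u - rsup t| <= e.
Proof.
move=> t0 e0; have [r r0 Hr] := cadlag_right t0 e0; exists r => // u tu ur.
rewrite ger0_norm ?subr_ge0 ?rsup_nondecreasing// lerBlDr.
apply: rsup_le => [|s /andP[s0 su]]; first exact: le_trans tu.
have [st|ts] := leP s t.
  by rewrite (le_trans (le_rsup (_ : 0 <= s <= t))) ?s0// lerDr ltW.
have := Hr s (ltW ts) (le_lt_trans su ur); rewrite ltr_norml => /andP[_ h].
have := @le_rsup t t; rewrite t0 lexx => /(_ isT); lra.
Qed.

Hypothesis f0 : f 0 = 0.

Lemma rsup_ge0 t : 0 <= t -> 0 <= rsup t.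
Proof. by move=> t0; rewrite -f0 le_rsup// lexx. Qed.

Definition grid_max (g : R -> R) dl k := \big[Num.max/0]_(j < k) g (j.+1%:R * dl).

Lemma grid_max_cvg (dl : nat -> R) (k : nat -> nat) s : 0 <= s ->
  (forall n, 0 < dl n) -> dl n @[n --> \oo] --> 0 ->
  (forall n, s <= (k n)%:R * dl n) -> (k n)%:R * dl n @[n --> \oo] --> s ->
  grid_max f (dl n) (k n) @[n --> \oo] --> rsup s.
Proof.
move=> s0 dl0 dlc sk skc; apply/cvgrPdistC_lt => e e0.
have e20 : 0 < e / 2 by rewrite divr_gt0.
have [r r0 Hr] := rsup_right s0 e20.
have [u /andP[u0 us] hu] := rsup_adherent s0 e20.
have [r' r'0 Hr'] := cadlag_right u0 e20.
have key : \forall n \near \oo, exists2 j, (j <= k n)%N & u <= j%:R * dl n < u + r'.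
  move: us; rewrite le_eqVlt => /predU1P[us|us].
    move/cvgrPdistC_lt : skc => /(_ r' r'0); apply: filterS => n h.
    exists (k n) => //; rewrite us sk/=.
    by move: h; rewrite ltr_norml => /andP[_]; lra.
  have p0 : 0 < Num.min r' (s - u) by rewrite lt_min r'0 subr_gt0.
  move/cvgrPdistC_lt : dlc => /(_ _ p0); apply: filterS => n; rewrite subr0 (gtr0_norm (dl0 n)) lt_min => /andP[h1 h2].
  pose j := (Num.truncn (u / dl n)).+1.
  have ud0 : 0 <= u / dl n by rewrite divr_ge0// ltW.
  have /andP[j1 j2] : u < j%:R * dl n <= u + dl n.
    rewrite -ltr_pdivrMr// truncnS_gt/= /j -natr1 mulrDl mul1r lerD2r -ler_pdivlMr//.
    by case/andP: (truncn_itv ud0).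
  exists j; last by rewrite (ltW j1)/=; lra.
  have : j%:R * dl n <= (k n)%:R * dl n by have := sk n; lra.
  by rewrite ler_pM2r// ler_nat.
move/cvgrPdistC_lt : skc => /(_ r r0) skc.
near=> n.
have [j jk /andP[j1 j2]] : exists2 j, (j <= k n)%N & u <= j%:R * dl n < u + r' by near: n.
have : `|(k n)%:R * dl n - s| < r by near: n.
rewrite ger0_norm ?subr_ge0// => sr.
have up : grid_max f (dl n) (k n) <= rsup ((k n)%:R * dl n).
  apply: bigmax_le; first by apply: rsup_ge0; rewrite (le_trans s0).
  move=> i _; apply: le_rsup; rewrite mulr_ge0 ?(ltW (dl0 n))//=.
  by rewrite ler_pM2r// ler_nat.
have lo : f (j%:R * dl n) <= grid_max f (dl n) (k n).
  case: j jk {j1 j2} => [|j] jk; first by rewrite mul0r f0; apply: bigmax_ge_id.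
  exact: (le_bigmax_cond _ _ (isT : xpredT (Ordinal jk))).
have /(_ (sk n)) := Hr ((k n)%:R * dl n).
move=> /(_ ltac:(lra)); rewrite ler_norml => /andP[_ h1].
have := Hr' _ j1 j2; rewrite ltr_norml => /andP[h2 _].
rewrite ltr_norml; apply/andP; split; lra.
Unshelve. all: by end_near. Qed.

Lemma cadlag_right_cvg (r_ : nat -> R) s : 0 <= s -> (forall n, s <= r_ n) ->
  r_ n @[n --> \oo] --> s -> f (r_ n) @[n --> \oo] --> f s.
Proof.
move=> s0 sr rs; apply/cvgrPdistC_lt => e e0.
have [r r0 Hr] := cadlag_right s0 e0.
move/cvgrPdistC_lt : rs => /(_ r r0); apply: filterS => n.
by rewrite ger0_norm ?subr_ge0// => h; apply: Hr => //; lra.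
Qed.

Lemma rsup_right_cvg (r_ : nat -> R) s : 0 <= s -> (forall n, s <= r_ n) ->
  r_ n @[n --> \oo] --> s -> rsup (r_ n) @[n --> \oo] --> rsup s.
Proof.
move=> s0 sr rs; apply/cvgrPdistC_lt => e e0.
have e20 : 0 < e / 2 by rewrite divr_gt0.
have [r r0 Hr] := rsup_right s0 e20.
move/cvgrPdistC_lt : rs => /(_ r r0); apply: filterS => n.
rewrite ger0_norm ?subr_ge0// => h; have := Hr (r_ n) (sr n) ltac:(lra) => h1.
by rewrite (le_lt_trans h1)// gtr_pMr// invf_lt1// ltr1n.
Qed.

End CadlagPath.

Section RightGrid.
Context (R : realType).

Definition right_grid (dl s : R) : R := (Num.truncn (s / dl)).+1%:R * dl.

Lemma right_grid_ge dl s : 0 < dl -> s <= right_grid dl s.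
Proof. by move=> dl0; rewrite -ler_pdivrMr// ltW// truncnS_gt. Qed.

Lemma right_grid_le dl s : 0 < dl -> 0 <= s -> right_grid dl s <= s + dl.
Proof.
move=> dl0 s0; rewrite /right_grid -natr1 mulrDl mul1r lerD2r -ler_pdivlMr//.
have sd : 0 <= s / dl by rewrite divr_ge0// ltW.
by case/andP: (truncn_itv sd).
Qed.

Lemma right_grid_cvg (dl : nat -> R) s : (forall n, 0 < dl n) ->
  dl n @[n --> \oo] --> 0 -> 0 <= s -> right_grid (dl n) s @[n --> \oo] --> s.
Proof.
move=> dl0 dlc s0.
apply: (squeeze_cvgr _ (cvg_cst s)); last first.
  by rewrite -[X in _ --> X]addr0; apply: cvgD dlc; exact: cvg_cst.
by apply: nearW => n; rewrite right_grid_ge// right_grid_le.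
Qed.

End RightGrid.

Section JointMeasurability.
Context (R : realType) d (T : measurableType d) (g : R -> T -> R).
Hypothesis mg : forall t, 0 <= t -> measurable_fun [set: T] (g t).
Hypothesis rg : forall (r_ : nat -> R) s w, 0 <= s -> (forall n, s <= r_ n) ->
  r_ n @[n --> \oo] --> s -> g (r_ n) w @[n --> \oo] --> g s w.

Lemma measurable_right_continuous :
  measurable_fun [set: measurableTypeR R * T] (fun z => g (Num.max z.1 0) z.2).
Proof.
pose dl n : R := n.+1%:R^-1.
have dl0 n : 0 < dl n by rewrite invr_gt0.
apply: (@measurable_fun_cvg _ _ _ _ (fun n (z : measurableTypeR R * T) => g (right_grid (dl n) (Num.max z.1 0)) z.2)); last first.
  move=> z _; have z0 : 0 <= Num.max z.1 0 by rewrite le_max lexx orbT.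
  apply: rg => // [n|]; first exact: right_grid_ge.
  by apply: right_grid_cvg => //; exact: cvg_harmonic.
move=> n _ B mB; rewrite setTI.
pose A k : set R := [set s | Num.truncn (Num.max s 0 / dl n) = k].
have -> : (fun z : measurableTypeR R * T => g (right_grid (dl n) (Num.max z.1 0)) z.2) @^-1` B =
  \bigcup_k (A k `*` (g (k.+1%:R * dl n) @^-1` B)).
  apply/seteqP; split => [[s w] /= Bz|[s w] [k _ [/= + ?]]].
    by exists (Num.truncn (Num.max s 0 / dl n)).
  by rewrite /A/= /right_grid => ->.
apply: bigcup_measurable => k _; apply: measurableX.
  have -> : A k = (fun s : R => Num.max s 0 / dl n) @^-1` `[k%:R, k.+1%:R[%classic.
    apply/seteqP; split => s; rewrite /A/= in_itv/=.
      have sd : 0 <= Num.max s 0 / dl n by rewrite divr_ge0 ?le_max ?lexx ?orbT// ltW.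
      by move=> <-; exact: truncn_itv.
    exact: truncn_def.
  have mm : measurable_fun [set: R] (fun s : R => Num.max s 0 / dl n).
    by apply: measurable_funM => //; exact: measurable_maxr.
  by rewrite -[X in measurable X]setTI; apply: mm => //; exact: measurable_itv.
rewrite -[X in measurable X]setTI; apply: mg => //.
by rewrite mulr_ge0// ltW.
Qed.

End JointMeasurability.

Section PushforwardMeasure.
Context d1 d2 (T1 : measurableType d1) (T2 : measurableType d2) (R : realType).

Lemma pushforward_measure (m : {measure set T1 -> \bar R}) (f : T1 -> T2) :
  measurable_fun [set: T1] f ->
  exists m' : {measure set T2 -> \bar R}, forall A, m' A = m (f @^-1` A).
Proof. by move=> mf; pose m' : {measure set T2 -> \bar R} := pushforward m f; exists (m' mf). Qed.

Lemma eq_measure_setX (m1 m2 : {measure set (T1 * T2) -> \bar R}) :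
  (m1 [set: T1 * T2] < +oo)%E ->
  (forall A B, measurable A -> measurable B -> m1 (A `*` B) = m2 (A `*` B)) ->
  forall C, measurable C -> m1 C = m2 C.
Proof.
move=> m1oo m12 C mC.
pose G : set (set (T1 * T2)) :=
  [set C | exists A, measurable A /\ exists B, measurable B /\ C = A `*` B].
apply: (measure_unique G (fun=> setT)) => //.
- rewrite measurable_prod_measurableType //; congr (<<s _ >>).
  rewrite predeqE; split => [[A mA [B mB <-]]|[A [mA [B [mB ->]]]]].
    by exists A; split => //; exists B.
  by exists A => //; exists B.
- move=> _ _ [X1 [mX1 [X2 [mX2 ->]]]] [Y1 [mY1 [Y2 [mY2 ->]]]].
  rewrite -setXI; exists (X1 `&` Y1); split; first exact: measurableI.
  by exists (X2 `&` Y2); split => //; exact: measurableI.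
- move=> n; exists setT; split => //; exists setT; split => //.
  by rewrite setXTT.
- by rewrite bigcup_const.
- by move=> A [A1 [mA1 [A2 [mA2 ->]]]]; exact: m12.
Qed.

End PushforwardMeasure.

(** * Random walks and their running maximum *)

Section IndependentPair.
Context d (T : measurableType d) (R : realType) (P : probability T R).
Context d1 d2 (T1 : measurableType d1) (T2 : measurableType d2).
Context (xi : T -> T1) (Z : T -> T2).
Hypotheses (mxi : measurable_fun [set: T] xi) (mZ : measurable_fun [set: T] Z).
Hypothesis indep : forall A B, measurable A -> measurable B ->
  P (xi @^-1` A `&` Z @^-1` B) = (P (xi @^-1` A) * P (Z @^-1` B))%E.

Lemma ge0_expectationM (f : T1 -> R) (g : T2 -> R) :
  measurable_fun [set: T1] f -> measurable_fun [set: T2] g ->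
  (forall x, 0 <= f x) -> (forall x, 0 <= g x) ->
  (\int[P]_w (f (xi w) * g (Z w))%:E =
   \int[P]_w (f (xi w))%:E * \int[P]_w (g (Z w))%:E)%E.
Proof.
move=> mf mg f0 g0.
pose xi_ : {mfun T >-> T1} := HB.pack xi (isMeasurableFun.Build _ _ _ _ _ mxi).
pose Z_ : {mfun T >-> T2} := HB.pack Z (isMeasurableFun.Build _ _ _ _ _ mZ).
pose l := distribution P xi_; pose n := distribution P Z_.
have mpair : measurable_fun [set: T] (fun w => (xi w, Z w)) by exact/measurable_fun_pair.
have [m' m'E] := pushforward_measure P mpair.
have E C : measurable C -> (l \x n)%E C = m' C.
  apply: product_measure_unique => A B mA mB.
  by rewrite m'E /l /n /distribution /pushforward/= -indep.
pose h (z : T1 * T2) := f z.1 * g z.2.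
have mh : measurable_fun [set: T1 * T2] h.
  by apply: measurable_funM; [exact: measurableT_comp mf _|exact: measurableT_comp mg _].
have h0 z : 0 <= h z by rewrite mulr_ge0.
transitivity (\int[(l \x n)%E]_z (h z)%:E)%E.
  transitivity (\int[pushforward P (fun w => (xi w, Z w))]_z (h z)%:E)%E.
    rewrite ge0_integral_pushforward ?preimage_setT//; first exact/measurable_EFinP.
    by move=> z _ /=; rewrite lee_fin.
  by apply: eq_measure_integral => A mA _; exact/esym/(etrans (E _ mA) (m'E A)).
have /measurable_EFinP mh' := mh.
rewrite (fubini_tonelli1 _ mh'); last by move=> z; rewrite /= lee_fin.
have mf' : measurable_fun [set: T1] (EFin \o f) by exact/measurable_EFinP.
have mg' : measurable_fun [set: T2] (EFin \o g) by exact/measurable_EFinP.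
have L : (\int[P]_w (f (xi w))%:E = \int[l]_x (f x)%:E)%E.
  have := @ge0_integral_pushforward _ _ _ _ _ _ mxi P setT _ measurableT mf' (fun x _ => f0 x).
  by rewrite preimage_setT => <-.
have N : (\int[P]_w (g (Z w))%:E = \int[n]_x (g x)%:E)%E.
  have := @ge0_integral_pushforward _ _ _ _ _ _ mZ P setT _ measurableT mg' (fun x _ => g0 x).
  by rewrite preimage_setT => <-.
rewrite L N /fubini_F.
transitivity (\int[l]_x ((\int[n]_x (g x)%:E) * (f x)%:E))%E.
  apply: eq_integral => x _; rewrite /h /=.
  by rewrite (ge0_integralZl_real n measurableT mg (fun x _ => g0 x) (f0 x)) muleC.
rewrite ge0_integralZl//; first by rewrite muleC.
- by move=> x _; rewrite lee_fin.
- by apply: integral_ge0 => x _; rewrite lee_fin.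
Qed.

End IndependentPair.

Section Walk.
Context d (T : measurableType d) (R : realType) (P : probability T R).
Implicit Types (x : R) (z : R * R).

(* Prepending an increment x to a walk with running maximum z.1 and drawdown z.2
   (both counting the starting point 0). *)
Definition step x z : R * R :=
  (Num.max (x + z.1) 0, z.2 + Num.max (- (x + z.1)) 0).

Lemma measurable_step d' (T' : measurableType d') (f : T' -> R) (g : T' -> R * R) :
  measurable_fun [set: T'] f -> measurable_fun [set: T'] g ->
  measurable_fun [set: T'] (fun w => step (f w) (g w)).
Proof.
move=> mf mg.
have m1 : measurable_fun [set: T'] (fun w => (g w).1) by exact: measurableT_comp measurable_fst mg.
have m2 : measurable_fun [set: T'] (fun w => (g w).2) by exact: measurableT_comp measurable_snd mg.
have ms : measurable_fun [set: T'] (fun w => f w + (g w).1) by exact: measurable_funD.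
apply/measurable_fun_pair; first exact: measurable_maxr.
apply: measurable_funD => //; apply: measurable_maxr => //.
exact: measurableT_comp.
Qed.

Context (xi : nat -> T -> R).

Fixpoint walk k m w : R * R :=
  if k is k'.+1 then step (xi m w) (walk k' m.+1 w) else (0, 0).

Hypothesis mxi : forall i, measurable_fun [set: T] (xi i).

Lemma measurable_walk k m : measurable_fun [set: T] (walk k m).
Proof. by elim: k m => [|k IH] m /=; [exact: measurable_cst|exact: measurable_step]. Qed.

Let G n (B : nat -> set R) := [set w | forall i, (i < n)%N -> B i (xi i w)].

Hypothesis indep : forall n B, (forall i, measurable (B i)) ->
  P (G n B) = (\prod_(i < n) P (xi i @^-1` B i))%E.
Hypothesis stat : forall i B, measurable B -> P (xi i @^-1` B) = P (xi 0%N @^-1` B).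

Let measurable_G n B : (forall i, measurable (B i)) -> measurable (G n B).
Proof.
move=> mB; elim: n => [|n IH].
  by have -> : G 0 B = setT by apply/seteqP; split.
have -> : G n.+1 B = G n B `&` (xi n @^-1` B n).
  apply/seteqP; split => w /= => [h|[h1 h2] i].
    by split; [move=> i im; apply: h; rewrite ltnS ltnW|exact: h].
  by rewrite ltnS leq_eqVlt => /predU1P[->//|]; exact: h1.
apply: measurableI => //; rewrite -[X in measurable X]setTI; exact: mxi.
Qed.

Let GS n B : G n.+1 B = G n B `&` (xi n @^-1` B n).
Proof.
apply/seteqP; split => w /= => [h|[h1 h2] i].
  by split; [move=> i im; apply: h; rewrite ltnS ltnW|exact: h].
by rewrite ltnS leq_eqVlt => /predU1P[->//|]; exact: h1.
Qed.

Lemma walk_indep k m B A : (forall i, measurable (B i)) -> measurable A ->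
  P (G m B `&` walk k m @^-1` A) = (P (G m B) * P (walk k 0 @^-1` A))%E.
Proof.
elim: k m B A => [|k IH] m B A mB mA.
  rewrite /walk /=; have [A0|A0] := pselect (A (0, 0)).
    by rewrite !preimage_cst (mem_set A0) setIT probability_setT mule1.
  rewrite !preimage_cst; case: ifPn => [/set_mem//|_].
  by rewrite setI0 measure0 mule0.
have IH1 (C : set R) (D : set (R * R)) : measurable C -> measurable D ->
    P (xi 0%N @^-1` C `&` walk k 1 @^-1` D) = (P (xi 0%N @^-1` C) * P (walk k 0 @^-1` D))%E.
  move=> mC mD; have := IH 1%N (fun=> C) D (fun=> mC) mD.
  have -> // : G 1 (fun=> C) = xi 0%N @^-1` C.
  by apply/seteqP; split => w /= => [h|h i]; [exact: h|rewrite ltnS leqn0 => /eqP->].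
have mpair i : measurable_fun [set: T] (fun w => (xi i w, walk k i.+1 w)).
  by apply/measurable_fun_pair => //; exact: measurable_walk.
have mG := measurable_G m mB.
have [L LE0] := pushforward_measure (mrestr P mG) (mpair m).
have LE C : L C = P ((fun w => (xi m w, walk k m.+1 w)) @^-1` C `&` G m B) by exact: LE0.
have [Q QE] := pushforward_measure P (mpair 0%N).
have PG0 : 0 <= fine (P (G m B)) by exact: fine_ge0.
pose Q' : {measure set (R * (R * R))%type -> \bar R} := mscale (NngNum PG0) Q.
have PGfin : P (G m B) \is a fin_num by exact: fin_num_measure.
have Q'E C : Q' C = (P (G m B) * P ((fun w => (xi 0%N w, walk k 1 w)) @^-1` C))%E.
  by transitivity ((fine (P (G m B)))%:E * Q C)%E => //; rewrite fineK// QE.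
have key C : measurable C -> L C = Q' C.
  apply: eq_measure_setX.
    rewrite LE (_ : _ `&` _ = G m B); last by apply/seteqP; split => [w []|w].
    by rewrite (le_lt_trans (probability_le1 _ mG))// ltry.
  move=> C1 C2 mC1 mC2; rewrite LE Q'E.
  pose B' i := if i == m then C1 else B i.
  have mB' i : measurable (B' i) by rewrite /B'; case: ifP.
  have G' : G m B' = G m B.
    apply/seteqP; split => w h i im; have := h i im; rewrite /B' ltn_eqF//.
  have -> : (fun w => (xi m w, walk k m.+1 w)) @^-1` (C1 `*` C2) `&` G m B =
      G m.+1 B' `&` walk k m.+1 @^-1` C2.
    rewrite GS G' /B' eqxx; apply/seteqP; split => w /=; tauto.
  rewrite IH//.
  have -> : (fun w => (xi 0%N w, walk k 1 w)) @^-1` (C1 `*` C2) =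
      xi 0%N @^-1` C1 `&` walk k 1 @^-1` C2 by [].
  rewrite IH1// muleA; congr (_ * _)%E.
  rewrite !indep// big_ord_recr/= /B' eqxx stat//; congr (_ * _)%E.
  by apply: eq_bigr => i _; rewrite ltn_eqF.
pose D : set (R * (R * R)) := (fun p => step p.1 p.2) @^-1` A.
have mD : measurable D.
  rewrite -[X in measurable X]setTI.
  exact: (measurable_step measurable_fst measurable_snd).
have := key D mD; rewrite LE Q'E.
by rewrite setIC => ->.
Qed.

Lemma walk_stationary k m A : measurable A ->
  P (walk k m @^-1` A) = P (walk k 0 @^-1` A).
Proof.
move=> mA; have := @walk_indep k m (fun=> setT) A (fun=> measurableT) mA.
have -> : G m (fun=> setT) = setT by apply/seteqP; split.
by rewrite setTI probability_setT mul1e.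
Qed.

Lemma walk_step_indep k (A : set R) (B : set (R * R)) : measurable A -> measurable B ->
  P (xi 0%N @^-1` A `&` walk k 1 @^-1` B) = (P (xi 0%N @^-1` A) * P (walk k 1 @^-1` B))%E.
Proof.
move=> mA mB; rewrite walk_stationary//.
have := @walk_indep k 1%N (fun=> A) B (fun=> mA) mB.
have -> // : G 1 (fun=> A) = xi 0%N @^-1` A.
by apply/seteqP; split => w /= => [h|h i]; [exact: h|rewrite ltnS leqn0 => /eqP->].
Qed.

Lemma walk_ge0 k m w : 0 <= (walk k m w).1 /\ 0 <= (walk k m w).2.
Proof.
elim: k m => [|k IH] m //=; have [_ h] := IH m.+1.
by rewrite !le_max !lexx !orbT/= addr_ge0// le_max lexx orbT.
Qed.

End Walk.

Lemma walk_path (R : realType) d (T : measurableType d) (S : nat -> T -> R) k m w :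
  let z := walk (fun i w => S i.+1 w - S i w) k m w in
  z.1 = \big[Num.max/0]_(j < k) (S (m + j).+1 w - S m w) /\
  z.1 - z.2 = S (m + k)%N w - S m w.
Proof.
elim: k m => [|k IH] m /=; first by rewrite big_ord0 addn0 !subrr.
have [E1 E2] := IH m.+1; rewrite addSnnS in E2.
move: E1 E2; set z := walk _ _ _ _ => E1 E2.
set x := S m.+1 w - S m w; split; last first.
  have -> : S (m + k.+1)%N w - S m w = x + (z.1 - z.2) by rewrite E2 /x; ring.
  case: (boolP (0 <= x + z.1)) => h.
    by rewrite (max_idPl h) (max_idPr (_ : - (x + z.1) <= 0)) ?oppr_le0//; ring.
  move: h; rewrite -ltNge => /ltW h.
  by rewrite (max_idPr h) (max_idPl (_ : 0 <= - (x + z.1))) ?oppr_ge0//; ring.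
rewrite big_ord_recl addn0 -/x; apply/eqP; rewrite eq_le ge_max; apply/andP; split.
  apply/andP; split; last by rewrite le_max bigmax_ge_id orbT.
  have [h|h] := leP z.1 0.
    rewrite le_max -lerBrDl subrr h orTb; done.
  have h' : 0 < z.1 by [].
  rewrite -lerBrDl E1; apply: bigmax_le.
    by rewrite lerBrDl addr0 le_max lexx.
  move=> i _; rewrite lerBrDl le_max; apply/orP; right.
  apply: le_trans; last exact: (le_bigmax_cond _ _ (isT : xpredT i)).
  by rewrite /x /= /bump/= add1n addnS addSn; lra.
rewrite ge_max; apply/andP; split.
  by rewrite le_max lerDl (_ : 0 <= z.1) ?orTb// E1 bigmax_ge_id.
apply: bigmax_le; first by rewrite le_max lexx orbT.
move=> i _; rewrite le_max; apply/orP; left.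
have : S (m.+1 + i).+1 w - S m.+1 w <= z.1 by rewrite E1; exact: (le_bigmax_cond _ _ (isT : xpredT i)).
by rewrite /x /= /bump/= add1n addnS addSn; lra.
Qed.

Section OneStepAlgebra.
Context (R : realType).
Implicit Types b g u x : R.

Lemma expRB1_le u : expR u - 1 - u <= u * (expR u - 1).
Proof.
have h1 := expR_ge1Dx (- u); have h2 := expR_gt0 u.
have h3 : expR u * expR (- u) = 1 by rewrite -expRD subrr expR0.
have : expR u * (1 - u) <= 1 by rewrite -[leRHS]h3 ler_pM2l.
lra.
Qed.

(* The error made in the one-step identity when the new maximum x + z.1 = u is
   cut off at 0. *)
Definition kappa b g u : R :=
  if u < 0 then expR (g * u) - expR (- (b * u)) - (b + g) / g * (expR (g * u) - 1) else 0.

Lemma normr_kappa_le b g x u : 0 <= b -> 0 < g -> x <= u ->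
  `|kappa b g u| <= (b * g + b ^+ 2) * (if x < 0 then x ^+ 2 * expR (- (b * x)) else 0).
Proof.
move=> b0 g0 xu; rewrite /kappa; case: ifPn => u0; last first.
  rewrite normr0 mulr_ge0// ?addr_ge0 ?sqr_ge0 ?mulr_ge0 ?(ltW g0)//.
  by case: ifP => _ //; rewrite mulr_ge0 ?sqr_ge0 ?expR_ge0.
have x0 : x < 0 by exact: le_lt_trans xu u0.
rewrite x0.
have -> : expR (g * u) - expR (- (b * u)) - (b + g) / g * (expR (g * u) - 1) =
    - ((b / g) * (expR (g * u) - 1 - g * u) + (expR (- (b * u)) - 1 - - (b * u))).
  by field; rewrite gt_eqF.
set A := expR (g * u) - 1 - g * u; set B := expR (- (b * u)) - 1 - - (b * u).
have A0 : 0 <= A by rewrite /A; have := expR_ge1Dx (g * u); lra.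
have B0 : 0 <= B by rewrite /B; have := expR_ge1Dx (- (b * u)); lra.
have bg0 : 0 <= b / g by rewrite divr_ge0// ltW.
have AB0 : 0 <= b / g * A + B by apply: addr_ge0 => //; exact: mulr_ge0.
rewrite normrN ger0_norm//.
have gu : g * u <= 0 by rewrite pmulr_rle0// ltW.
have bu : 0 <= - (b * u) by rewrite oppr_ge0 mulr_ge0_le0// ltW.
have uu : u ^+ 2 <= x ^+ 2.
  by rewrite -[u ^+ 2]sqrrN -[x ^+ 2]sqrrN lerXn2r ?nnegrE ?oppr_ge0 ?lerN2 ?(ltW u0) ?(ltW x0).
have ebx : 1 <= expR (- (b * x)).
  by rewrite -expR0 ler_expR oppr_ge0 mulr_ge0_le0// ltW.
have A1 : A <= g ^+ 2 * u ^+ 2.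
  apply: (le_trans (expRB1_le _)).
  have e1 := expR_ge1Dx (g * u).
  have -> : g ^+ 2 * u ^+ 2 = (g * u) * (g * u) by ring.
  by rewrite ler_wnM2l//; lra.
have B1 : B <= b ^+ 2 * u ^+ 2 * expR (- (b * u)).
  apply: (le_trans (expRB1_le _)).
  have -> : b ^+ 2 * u ^+ 2 * expR (- (b * u)) = (- (b * u)) * (- (b * u) * expR (- (b * u))) by ring.
  rewrite ler_wpM2l//.
  have h1 := expR_ge1Dx (b * u); have h2 := expR_gt0 (- (b * u)).
  have h3 : expR (- (b * u)) * expR (b * u) = 1 by rewrite -expRD addNr expR0.
  have : expR (- (b * u)) * (1 + b * u) <= 1 by rewrite -[leRHS]h3 ler_pM2l.
  lra.
have ebu : expR (- (b * u)) <= expR (- (b * x)) by rewrite ler_expR lerN2 ler_wpM2l.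
rewrite mulrDl; apply: lerD.
  apply: (le_trans (ler_wpM2l bg0 A1)).
  have -> : b / g * (g ^+ 2 * u ^+ 2) = b * g * u ^+ 2 by field; rewrite gt_eqF.
  rewrite ler_wpM2l// ?mulr_ge0 ?(ltW g0)//.
  by rewrite (le_trans uu)// ler_peMr ?sqr_ge0.
apply: (le_trans B1); rewrite -mulrA ler_wpM2l ?sqr_ge0//.
by rewrite ler_pM ?sqr_ge0 ?expR_ge0.
Qed.

Lemma sqr_expR_le b q x : 0 <= b -> b <= q -> 0 < q ->
  (if x < 0 then x ^+ 2 * expR (- (b * x)) else 0) <= 4 * q ^- 2 * (expR (- (q * x)) - 1) ^+ 2.
Proof.
move=> b0 bq q0; case: ifPn => x0; last first.
  by rewrite mulr_ge0 ?sqr_ge0// mulr_ge0// invr_ge0 exprn_ge0// ltW.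
pose v := - (q * x).
have v0 : 0 <= v by rewrite /v oppr_ge0 pmulr_rle0// ltW.
have ev : expR v - 1 = (expR (v / 2) - 1) * (expR (v / 2) + 1).
  have -> : expR v = expR (v / 2) * expR (v / 2) by rewrite -expRD; congr expR; lra.
  ring.
have e1 := expR_ge1Dx (v / 2).
have e2 := expR_gt0 (v / 2).
have h : (v / 2 * expR (v / 2)) ^+ 2 <= (expR v - 1) ^+ 2.
  have h1 : v / 2 * expR (v / 2) <= expR v - 1.
    by rewrite ev ler_pM//; lra.
  have h0 : 0 <= v / 2 * expR (v / 2) by rewrite mulr_ge0 ?divr_ge0 ?expR_ge0.
  by rewrite lerXn2r ?nnegrE// (le_trans h0).
rewrite -/v.
have h2 : 4 * q ^- 2 * (v / 2 * expR (v / 2)) ^+ 2 = x ^+ 2 * expR v.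
  have -> : expR v = expR (v / 2) ^+ 2 by rewrite expr2 -expRD; congr expR; lra.
  by rewrite /v; field; rewrite gt_eqF.
have c0 : 0 <= 4 * q ^- 2 by rewrite mulr_ge0// invr_ge0 exprn_ge0// ltW.
apply: (le_trans _ (ler_wpM2l c0 h)); rewrite h2 ler_wpM2l ?sqr_ge0// ler_expR /v lerN2.
by rewrite ler_wnM2r// ltW.
Qed.

Definition lap b g (z : R * R) : R := expR (- (b * z.1 + g * z.2)).

Lemma lap_step b g x (z : R * R) : 0 < g -> lap b g (step x z) =
  expR (- (b * x)) * lap b g z + (b + g) / g * (lap 0 g (step x z) - lap 0 g z)
  + lap 0 g z * kappa b g (x + z.1).
Proof.
move=> g0; rewrite /lap /step /kappa /= !mul0r !add0r.
case: (boolP (x + z.1 < 0)) => u0.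
  rewrite (max_idPr (ltW u0)) (max_idPl (_ : 0 <= - (x + z.1))) ?oppr_ge0 ?(ltW u0)//.
  have -> : - (b * 0 + g * (z.2 - (x + z.1))) = - (g * z.2) + g * (x + z.1) by ring.
  have -> : - (g * (z.2 - (x + z.1))) = - (g * z.2) + g * (x + z.1) by ring.
  have -> : expR (- (b * x)) * expR (- (b * z.1 + g * z.2)) = expR (- (g * z.2)) * expR (- (b * (x + z.1))).
    by rewrite -!expRD; congr expR; ring.
  rewrite expRD; ring.
rewrite -leNgt in u0.
rewrite (max_idPl u0) (max_idPr (_ : - (x + z.1) <= 0)) ?oppr_le0//.
rewrite addr0 subrr !mulr0 !addr0 -expRD; congr expR; ring.
Qed.

End OneStepAlgebra.

Section StepSums.
Context (R : realType).
Notation mu := (@lebesgue_measure R).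

Lemma measurable_truncn_comp (u : nat -> R) (dl : R) (D : set R) : 0 < dl ->
  (D `<=` [set s | 0 <= s]) -> measurable_fun D (fun s => u (Num.truncn (s / dl))).
Proof.
move=> dl0 D0 mD B mB.
have -> : D `&` (fun s => u (Num.truncn (s / dl))) @^-1` B =
    \bigcup_(k in [set k | B (u k)]) (D `&` `[k%:R * dl, k.+1%:R * dl[%classic).
  apply/seteqP; split => [s [Ds /= Bs]|s [k /= Bk [Ds]]].
    exists (Num.truncn (s / dl)) => //; split => //=; rewrite in_itv/= -ler_pdivlMr// -ltr_pdivrMr//.
    by apply: truncn_itv; rewrite divr_ge0// ?(D0 _ Ds)// ltW.
  rewrite /= in_itv/= -ler_pdivlMr// -ltr_pdivrMr// => h; split => //=.
  by rewrite (truncn_def h).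
by apply: bigcup_measurable => k _; apply: measurableI.
Qed.

Lemma integral_step_sum (u : nat -> R) (dl : R) n : 0 < dl -> (forall k, 0 <= u k) ->
  (\int[mu]_(s in `[0%R, (n%:R * dl)%R[) (u (Num.truncn (s / dl)))%:E =
   (\sum_(k < n) u k * dl)%:E)%E.
Proof.
move=> dl0 u0.
elim: n => [|n IH]; first by rewrite mul0r set_itvco0 integral_set0 big_ord0.
have n0 : 0 <= n%:R * dl by rewrite mulr_ge0// ltW.
have nn : n%:R * dl <= n.+1%:R * dl by rewrite ler_pM2r// ler_nat.
have -> : `[0, n.+1%:R * dl[%classic = `[0, n%:R * dl[ `|` `[n%:R * dl, n.+1%:R * dl[%classic :> set R.
  by rewrite -itv_bndbnd_setU// bnd_simp.
rewrite ge0_integral_setU//=.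
- rewrite IH big_ord_recr /= EFinD; congr (_ + _)%E.
  transitivity (\int[mu]_(s in `[(n%:R * dl)%R, (n.+1%:R * dl)%R[) (cst (u n)%:E s))%E.
    apply: eq_integral => s; rewrite inE/= in_itv/= -ler_pdivlMr// -ltr_pdivrMr// => h.
    by rewrite (truncn_def h).
  rewrite integral_cst//= lebesgue_measure_itv/= lte_fin ltr_pM2r// ltr_nat ltnSn.
  by rewrite -EFinB -EFinM; congr EFin; rewrite -natr1; ring.
- apply/measurable_EFinP; apply: (@measurable_truncn_comp u) => // s /=.
  by rewrite !in_itv/= => -[/andP[]//|/andP[+ _]]; exact: le_trans.
- by move=> s _; rewrite lee_fin.
- by apply/disj_setPS => s [/=]; rewrite !in_itv/= => /andP[_ h1] /andP[h2 _]; lra.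
Qed.

Lemma expRB1_cvg (k : R) (dl : nat -> R) : 0 <= k -> (forall n, 0 < dl n) ->
  dl n @[n --> \oo] --> 0 -> (expR (dl n * k) - 1) / dl n @[n --> \oo] --> k.
Proof.
move=> k0 dl0 dlc.
have hk : k * expR (dl n * k) @[n --> \oo] --> k.
  rewrite -[X in _ --> X]mulr1 -expR0; apply: cvgM; first exact: cvg_cst.
  apply: continuous_cvg; first exact: continuous_expR.
  by rewrite -[X in _ --> X](mul0r k); apply: cvgM => //; exact: cvg_cst.
apply: (squeeze_cvgr _ (cvg_cst k) hk); apply: nearW => n.
have h2 := expR_ge1Dx (dl n * k); have h1 := expRB1_le (dl n * k).
rewrite ler_pdivlMr// ler_pdivrMr//; apply/andP; split; first by rewrite mulrC; lra.
rewrite -subr_ge0 (_ : _ - _ = dl n * k * (expR (dl n * k) - 1) - (expR (dl n * k) - 1 - dl n * k)); last ring.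
by rewrite subr_ge0.
Qed.

End StepSums.

Lemma lap_cvg (R : realType) (b g : R) (z : nat -> R * R) (x y : R) :
  (z n).1 @[n --> \oo] --> x -> (z n).2 @[n --> \oo] --> y ->
  lap b g (z n) @[n --> \oo] --> expR (- (b * x + g * y)).
Proof.
move=> h1 h2.
have h : - (b * (z n).1 + g * (z n).2) @[n --> \oo] --> - (b * x + g * y).
  apply: cvgN; apply: cvgD; apply: cvgM; [exact: cvg_cst|exact: h1|exact: cvg_cst|exact: h2].
by apply: (cvg_comp _ _ h); exact: continuous_expR.
Qed.

(** * Joint Laplace transform of supremum and drawdown *)

Section LevyProcess.
Context (R : realType) d (T : measurableType d) (P : probability T R).
Context (X : R -> {RV P >-> R}) (alpha : R).
Hypotheses (lX : levy_process X) (a12 : 1 < alpha < 2).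
Hypothesis laplaceX : forall t q : R, 0 < t -> 0 <= q ->
  'E_P[fun w => expR (- q * X t w)]%E = (expR (t * q `^ alpha))%:E.
Notation mu := (@lebesgue_measure R).

Definition drawdown t w := running_sup X t w - X t w.

Let path w s := X s w.
Let cpath w : cadlag (path w). Proof. exact: levy_cadlag. Qed.
Let path0 w : path w 0 = 0. Proof. exact: levy_start. Qed.

Let xi dl i w := X (i.+1%:R * dl) w - X (i%:R * dl) w.

Let measurable_xi dl i : measurable_fun [set: T] (xi dl i).
Proof. exact: measurable_funB. Qed.

Let xi_indep dl n B : 0 < dl -> (forall i, measurable (B i)) ->
  P [set w | forall i, (i < n)%N -> B i (xi dl i w)] =
  (\prod_(i < n) P (xi dl i @^-1` B i))%E.
Proof.
move=> dl0 mB.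
have h := @levy_independent_increments _ _ _ _ _ lX n (fun i => i%:R * dl).
rewrite mul0r in h.
have nd (i : nat) : (i < n)%N -> i%:R * dl <= i.+1%:R * dl by rewrite ler_pM2r// ler_nat.
have h2 := h (lexx _) nd (fun i : 'I_n => B i) (fun i => mB i).
rewrite -h2.
congr (P _); apply/seteqP; split => w /= h' i; first by move=> _; exact: h'.
by move=> im; exact: (h' (Ordinal im)).
Qed.

Let xi_stat dl i B : 0 < dl -> measurable B ->
  P (xi dl i @^-1` B) = P (xi dl 0%N @^-1` B).
Proof.
move=> dl0 mB.
have h k := @levy_stationary_increments _ _ _ _ _ lX (k%:R * dl) dl (mulr_ge0 (ler0n _ _) (ltW dl0)) (ltW dl0) B mB.
have E k : P (xi dl k @^-1` B) = P [set w | B (X dl w)].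
  by rewrite -(h k); congr (P _); apply/seteqP; split => w; rewrite /xi /= -natr1 mulrDl mul1r.
by rewrite !E.
Qed.

Let xi0E dl w : xi dl 0 w = X dl w.
Proof. by rewrite /xi mul0r mul1r -/(path w 0) path0 subr0. Qed.

Let walkX dl := walk (xi dl).

Let walkXE dl k w :
  (walkX dl k 0 w).1 = grid_max (path w) dl k /\
  (walkX dl k 0 w).1 - (walkX dl k 0 w).2 = X (k%:R * dl) w.
Proof.
have [E1 E2] := walk_path (fun i w => X (i%:R * dl) w) k 0 w.
rewrite -/(xi dl) -/(walkX dl) in E1 E2.
have X0 : X (0%:R * dl) w = 0 by rewrite mul0r; exact: path0.
rewrite X0 subr0 in E2; split => //.
rewrite E1; apply: eq_bigr => i _; first by rewrite X0 subr0.
Qed.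

Let measurable_walkX dl k m : measurable_fun [set: T] (walkX dl k m).
Proof. by apply: measurable_walk => i; exact: measurable_xi. Qed.

Let measurable_lap d' (T' : measurableType d') (f : T' -> R * R) b g :
  measurable_fun [set: T'] f -> measurable_fun [set: T'] (fun w => lap b g (f w)).
Proof.
move=> mf.
have m1 : measurable_fun [set: T'] (fun w => (f w).1) by exact: measurableT_comp measurable_fst mf.
have m2 : measurable_fun [set: T'] (fun w => (f w).2) by exact: measurableT_comp measurable_snd mf.
have m : measurable_fun [set: T'] (fun w => - (b * (f w).1 + g * (f w).2)).
  by apply: measurableT_comp => //; apply: measurable_funD; exact: measurable_funM.
exact: (measurableT_comp (@measurable_expR R) m).
Qed.

Let lap01 b g dl k m w : 0 <= b -> 0 <= g -> 0 <= lap b g (walkX dl k m w) <= 1.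
Proof.
move=> b0 g0; rewrite expR_ge0/= -expR0 ler_expR oppr_le0.
have [h1 h2] := walk_ge0 (xi dl) k m w.
by rewrite addr_ge0 ?mulr_ge0.
Qed.

Let integrable_bounded (f : T -> R) (M : R) : measurable_fun [set: T] f ->
  (forall w, `|f w| <= M) -> P.-integrable [set: T] (EFin \o f).
Proof.
move=> mf fM; apply: measurable_bounded_integrable => //.
  by rewrite (le_lt_trans (probability_le1 _ _))// ltry.
exists M; split; first exact: num_real.
by move=> y My w _ /=; rewrite (le_trans (fM w))// ltW.
Qed.

Let integrable_lap b g dl k m : 0 <= b -> 0 <= g ->
  P.-integrable [set: T] (EFin \o (fun w => lap b g (walkX dl k m w))).
Proof.
move=> b0 g0; apply: (@integrable_bounded _ 1); first exact: measurable_lap.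
by move=> w; have /andP[? ?] := lap01 dl k m w b0 g0; rewrite ger0_norm.
Qed.

Definition walk_lap dl b g k := \int[P]_w lap b g (walkX dl k 0 w).

Let walk_lap_shift dl b g k m : 0 < dl -> 0 <= b -> 0 <= g ->
  \int[P]_w lap b g (walkX dl k m w) = walk_lap dl b g k.
Proof.
move=> dl0 b0 g0; rewrite /walk_lap /Rintegral; congr fine.
have mF : measurable_fun [set: R * R] (EFin \o lap b g).
  by apply/measurable_EFinP; exact: (@measurable_lap _ _ id).
have F0 z : (0 <= (EFin \o lap b g) z)%E by rewrite lee_fin expR_ge0.
have E i : (\int[P]_w (lap b g (walkX dl k i w))%:E = \int[pushforward P (walkX dl k i)]_y (lap b g y)%:E)%E.
  exact/esym/(@ge0_integral_pushforward _ _ _ _ R _ (measurable_walkX dl k i) P setT _ measurableT mF (fun x _ => F0 x)).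
rewrite !E; apply: eq_measure_integral => A mA _; rewrite /pushforward.
by apply: walk_stationary => //; move=> *; [exact: xi_indep|exact: xi_stat].
Qed.

Let expX dl q : 0 < dl -> 0 <= q ->
  P.-integrable [set: T] (EFin \o (fun w => expR (- (q * xi dl 0 w)))) /\
  \int[P]_w expR (- (q * xi dl 0 w)) = expR (dl * q `^ alpha).
Proof.
move=> dl0 q0; have := laplaceX dl0 q0; rewrite unlock => h.
have E : (\int[P]_w (expR (- (q * xi dl 0 w)))%:E = (expR (dl * q `^ alpha))%:E)%E.
  by rewrite -h; apply: eq_integral => w _; rewrite xi0E mulNr.
split; last by rewrite /Rintegral E.
apply: ge0_integrable; last by rewrite E ltry.
  by apply: measurableT_comp => //; apply: measurableT_comp => //; exact: measurable_funM.
by move=> w _; exact: expR_ge0.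
Qed.

Let one_step dl q b g k : 0 < dl -> 0 <= b -> 0 < g -> b <= q -> 0 < q ->
  `|walk_lap dl b g k.+1 - expR (dl * b `^ alpha) * walk_lap dl b g k -
    (b + g) / g * (walk_lap dl 0 g k.+1 - walk_lap dl 0 g k)| <=
  (b * g + b ^+ 2) * (4 * q ^- 2) *
  (expR (dl * (2 * q) `^ alpha) - 2 * expR (dl * q `^ alpha) + 1).
Proof.
move=> dl0 b0 g0 bq q0.
pose Z w := walkX dl k 1 w.
have mZ : measurable_fun [set: T] Z by exact: measurable_walkX.
have S w : walkX dl k.+1 0 w = step (xi dl 0 w) (Z w) by [].
pose f1 w := expR (- (b * xi dl 0 w)) * lap b g (Z w).
pose f2 w := lap 0 g (walkX dl k.+1 0 w); pose f3 w := lap 0 g (Z w).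
pose f4 w := lap b g (walkX dl k.+1 0 w).
pose K w := f4 w - f1 w - (b + g) / g * (f2 w - f3 w).
have KE w : K w = lap 0 g (Z w) * kappa b g (xi dl 0 w + (Z w).1).
  by rewrite /K /f4 S lap_step// /f2 S /f1 /f3; ring.
have i2 : P.-integrable setT (EFin \o f2) by apply: integrable_lap => //; exact: ltW.
have i3 : P.-integrable setT (EFin \o f3) by apply: integrable_lap => //; exact: ltW.
have i4 : P.-integrable setT (EFin \o f4) by apply: integrable_lap => //; exact: ltW.
have mexp q' : measurable_fun [set: R] (fun x => expR (- (q' * x))).
  by apply: measurableT_comp => //; apply: measurableT_comp => //; exact: measurable_funM.
have [ie ee] := expX dl0 b0.
have mf1 : measurable_fun setT f1.
  by apply: measurable_funM; [exact: (measurableT_comp (mexp b))|exact: measurable_lap].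
have e1 : (\int[P]_w (f1 w)%:E = (expR (dl * b `^ alpha) * walk_lap dl b g k)%:E)%E.
  rewrite (@ge0_expectationM _ _ _ P _ _ _ _ (xi dl 0) Z _ mZ _ (fun x => expR (- (b * x))) (lap b g)) //.
  - rewrite EFinM -ee -(@walk_lap_shift dl b g k 1%N) ?(ltW g0)//; congr (_ * _)%E.
      exact/esym/EFin_Rintegral.
    by apply/esym/EFin_Rintegral => //; apply: integrable_lap => //; exact: ltW.
  - move=> A B mA mB; apply: walk_step_indep => //.
    + by move=> *; exact: xi_indep.
    + by move=> *; exact: xi_stat.
  - exact: (@measurable_lap _ _ id).
  - by move=> x; exact: expR_ge0.
have i1 : P.-integrable setT (EFin \o f1).
  apply: ge0_integrable => //; last by rewrite e1 ltry.
  by move=> w _; rewrite mulr_ge0 ?expR_ge0.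
have i23 : P.-integrable setT (EFin \o (fun w => f2 w - f3 w)) by have := integrableB measurableT i2 i3.
have i23' : P.-integrable setT (EFin \o (fun w => (b + g) / g * (f2 w - f3 w))).
  by have := integrableZl measurableT ((b + g) / g) i23.
have i41 : P.-integrable setT (EFin \o (fun w => f4 w - f1 w)) by have := integrableB measurableT i4 i1.
have iK : P.-integrable setT (EFin \o K) by have := integrableB measurableT i41 i23'.
have EK : \int[P]_w K w = walk_lap dl b g k.+1 - expR (dl * b `^ alpha) * walk_lap dl b g k -
    (b + g) / g * (walk_lap dl 0 g k.+1 - walk_lap dl 0 g k).
  rewrite (RintegralB measurableT i41 i23') (RintegralB measurableT i4 i1).
  rewrite (RintegralZl _ measurableT i23) (RintegralB measurableT i2 i3).
  rewrite -(@walk_lap_shift dl 0 g k 1%N) ?(ltW g0)//.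
  by rewrite {2}/Rintegral e1.
rewrite -EK.
have q20 : 0 <= 2 * q by rewrite mulr_ge0// ltW.
have [iq eq_] := expX dl0 (ltW q0); have [iqq eqq] := expX dl0 q20.
pose C := (b * g + b ^+ 2) * (4 * q ^- 2).
pose sq w := expR (- (2 * q * xi dl 0 w)) - 2 * expR (- (q * xi dl 0 w)) + 1.
have sqE w : sq w = (expR (- (q * xi dl 0 w)) - 1) ^+ 2.
  rewrite /sq; have -> : expR (- (2 * q * xi dl 0 w)) = expR (- (q * xi dl 0 w)) ^+ 2.
    by rewrite expr2 -expRD; congr expR; ring.
  ring.
have Kle w : `|K w| <= C * sq w.
  rewrite KE normrM.
  have l1 : `|lap 0 g (Z w)| <= 1.
    by have /andP[? ?] := lap01 dl k 1 w (lexx 0) (ltW g0); rewrite ger0_norm.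
  have [z1 _] := walk_ge0 (xi dl) k 1 w.
  have k1 := @normr_kappa_le _ b g (xi dl 0 w) (xi dl 0 w + (Z w).1) b0 g0 (_ : _ <= _).
  rewrite (le_trans (ler_wpM2r (normr_ge0 _) l1))// mul1r (le_trans (k1 _)) ?lerDl//.
  rewrite sqE /C -mulrA ler_wpM2l ?addr_ge0 ?sqr_ge0 ?mulr_ge0 ?(ltW g0)//.
  exact: sqr_expR_le.
have i1_ : P.-integrable setT (EFin \o (fun=> 1 : R)).
  by apply: (@integrable_bounded _ 1) => // w; rewrite normr1.
have i2q : P.-integrable setT (EFin \o (fun w => 2 * expR (- (q * xi dl 0 w)))).
  by have := integrableZl measurableT 2 iq.
have iqq2 : P.-integrable setT (EFin \o (fun w => expR (- (2 * q * xi dl 0 w)) - 2 * expR (- (q * xi dl 0 w)))).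
  by have := integrableB measurableT iqq i2q.
have isq : P.-integrable setT (EFin \o sq) by have := integrableD measurableT iqq2 i1_.
have esq : \int[P]_w sq w = expR (dl * (2 * q) `^ alpha) - 2 * expR (dl * q `^ alpha) + 1.
  rewrite (RintegralD measurableT iqq2 i1_) (RintegralB measurableT iqq i2q) (RintegralZl _ measurableT iq).
  by rewrite eqq eq_ Rintegral_cst//= probability_setT mulr1.
rewrite -esq -(RintegralZl _ measurableT isq).
apply: (le_trans (le_normr_Rintegral measurableT iK)).
apply: le_Rintegral => //; first exact: integrable_norm.
by have := integrableZl measurableT C isq.
Qed.

Lemma running_sup_ge0 t w : 0 <= t -> 0 <= running_sup X t w.
Proof. by move=> t0; apply: (rsup_ge0 (cpath w)). Qed.

Lemma drawdown_ge0 t w : 0 <= t -> 0 <= drawdown t w.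
Proof.
move=> t0; rewrite /drawdown subr_ge0.
by apply: (le_rsup (cpath w) (_ : 0 <= t <= t)); rewrite t0 lexx.
Qed.

Definition levy_lap b g t := \int[P]_w expR (- (b * running_sup X t w + g * drawdown t w)).

Let grid_cvg (dl : nat -> R) (k : nat -> nat) s w : 0 <= s ->
  (forall n, 0 < dl n) -> dl n @[n --> \oo] --> 0 ->
  (forall n, s <= (k n)%:R * dl n) -> (k n)%:R * dl n @[n --> \oo] --> s ->
  (walkX (dl n) (k n) 0 w).1 @[n --> \oo] --> running_sup X s w /\
  (walkX (dl n) (k n) 0 w).2 @[n --> \oo] --> drawdown s w.
Proof.
move=> s0 dl0 dlc sk skc.
have h1 : (walkX (dl n) (k n) 0 w).1 @[n --> \oo] --> running_sup X s w.
  under eq_fun do rewrite (walkXE _ _ _).1.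
  exact: (grid_max_cvg (cpath w) (path0 w)).
split => //.
have -> : (fun n => (walkX (dl n) (k n) 0 w).2) =
    (fun n => (walkX (dl n) (k n) 0 w).1 - X ((k n)%:R * dl n) w).
  by apply/funext => n; rewrite -(walkXE _ _ _).2; ring.
by apply: cvgB => //; exact: (cadlag_right_cvg (cpath w)).
Qed.

Let dyadic n : R := n.+1%:R^-1.

Lemma measurable_running_sup t : 0 <= t -> measurable_fun [set: T] (running_sup X t).
Proof.
move=> t0.
pose k n := (Num.truncn (t / dyadic n)).+1.
apply: (@measurable_fun_cvg _ _ _ _ (fun n w => (walkX (dyadic n) (k n) 0 w).1)).
  by move=> n; apply: measurableT_comp measurable_fst _; exact: measurable_walkX.
have d0 n : 0 < dyadic n by rewrite invr_gt0.
move=> w _; apply: (@grid_cvg dyadic k t w _ _ _ _ _).1 => //.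
- exact: cvg_harmonic.
- by move=> n; exact: right_grid_ge.
- by apply: right_grid_cvg => //; exact: cvg_harmonic.
Qed.

Lemma measurable_drawdown t : 0 <= t -> measurable_fun [set: T] (drawdown t).
Proof. by move=> t0; apply: measurable_funB => //; exact: measurable_running_sup. Qed.

Lemma measurable_running_sup2 : measurable_fun [set: measurableTypeR R * T]
  (fun z => running_sup X (Num.max z.1 0) z.2).
Proof.
apply: (@measurable_right_continuous _ _ _ (running_sup X)).
  exact: measurable_running_sup.
by move=> r s w s0 rs rc; apply: (rsup_right_cvg (cpath w)).
Qed.

Lemma measurable_drawdown2 : measurable_fun [set: measurableTypeR R * T]
  (fun z => drawdown (Num.max z.1 0) z.2).
Proof.
apply: (@measurable_right_continuous _ _ _ drawdown).
  exact: measurable_drawdown.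
move=> r s w s0 rs rc; apply: cvgB; first exact: (rsup_right_cvg (cpath w)).
exact: (cadlag_right_cvg (cpath w)).
Qed.

Let walk_lap_cvg (dl : nat -> R) (k : nat -> nat) s b g : 0 <= b -> 0 <= g -> 0 <= s ->
  (forall n, 0 < dl n) -> dl n @[n --> \oo] --> 0 ->
  (forall n, s <= (k n)%:R * dl n) -> (k n)%:R * dl n @[n --> \oo] --> s ->
  walk_lap (dl n) b g (k n) @[n --> \oo] --> levy_lap b g s.
Proof.
move=> b0 g0 s0 dl0 dlc sk skc.
have [||||_ //] := @cvg_Rintegral _ T R P setT measurableT (fun n w => lap b g (walkX (dl n) (k n) 0 w))
  (fun w => expR (- (b * running_sup X s w + g * drawdown s w))) (fun=> 1).
- by move=> n; apply: measurable_lap; exact: measurable_walkX.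
- move=> w _; have [h1 h2] := grid_cvg w s0 dl0 dlc sk skc.
  exact: lap_cvg h1 h2.
- by apply: (@integrable_bounded _ 1) => // w; rewrite normr1.
- by move=> n w _; have /andP[? ?] := lap01 (dl n) (k n) 0 w b0 g0; rewrite ger0_norm.
Qed.

Let walk_lap01 dl b g k : 0 <= b -> 0 <= g -> 0 <= walk_lap dl b g k <= 1.
Proof.
move=> b0 g0; apply/andP; split.
  by apply: Rintegral_ge0 => w _; exact: expR_ge0.
have -> : 1 = \int[P]_w (cst 1 w) :> R by rewrite Rintegral_cst//= probability_setT mulr1.
apply: le_Rintegral => //; first exact: integrable_lap.
  by apply: (@integrable_bounded _ 1) => // w; rewrite normr1.
by move=> w _; have /andP[] := lap01 dl k 0 w b0 g0.
Qed.

Let walk_lap0 dl b g : walk_lap dl b g 0 = 1.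
Proof.
rewrite /walk_lap /walkX /= /lap /= !mulr0 addr0 oppr0 expR0.
by rewrite Rintegral_cst//= probability_setT mulr1.
Qed.

Let walk_sum dl q b g n : 0 < dl -> 0 <= b -> 0 < g -> b <= q -> 0 < q ->
  `|walk_lap dl b g n - 1 - (expR (dl * b `^ alpha) - 1) * (\sum_(k < n) walk_lap dl b g k)
    - (b + g) / g * (walk_lap dl 0 g n - 1)| <=
  n%:R * ((b * g + b ^+ 2) * (4 * q ^- 2) *
  (expR (dl * (2 * q) `^ alpha) - 2 * expR (dl * q `^ alpha) + 1)).
Proof.
move=> dl0 b0 g0 bq q0.
have H k := one_step k dl0 b0 g0 bq q0.
move: (_ * _ * _ : R) H => K H.
elim: n => [|n IH]; first by rewrite !walk_lap0 big_ord0 !subrr !mulr0 !subrr normr0 mul0r.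
rewrite big_ord_recr/= -natr1 [leRHS]mulrDl mul1r [leRHS]addrC.
apply: le_trans (lerD (H n) IH); apply: le_trans (ler_normD _ _).
rewrite le_eqVlt; apply/orP; left; apply/eqP; congr (`|_|).
move: (\sum_(k < n) _) (walk_lap dl b g n.+1) (walk_lap dl b g n) (walk_lap dl 0 g n.+1) (walk_lap dl 0 g n) => S v v' m m'.
move: (expR _) ((b + g) / g) => e c; ring.
Qed.

Lemma levy_lap_eq b g t : 0 <= b -> 0 < g -> 0 < t ->
  levy_lap b g t = 1 + b `^ alpha * \int[mu]_(s in `[0, t[) levy_lap b g s
    + (b + g) / g * (levy_lap 0 g t - 1).
Proof.
move=> b0 g0 t0.
have alpha0 : 0 < alpha by move/andP: a12 => [/(lt_trans ltr01)].
pose dl n : R := t / 2 ^+ n.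
have p20 n : 0 < 2 ^+ n :> R by rewrite exprn_gt0.
have dl0 n : 0 < dl n by rewrite divr_gt0.
have dlc : dl n @[n --> \oo] --> (0 : R).
  rewrite -[X in _ --> X](mulr0 t); apply: cvgM; first exact: cvg_cst.
  under eq_fun do rewrite -exprVn; apply: cvg_expr; rewrite ger0_norm ?invr_ge0// invf_lt1// ltr1n.
  by [].
pose N n := (2 ^ n)%N.
have Ndl n : (N n)%:R * dl n = t by rewrite /N /dl natrX mulrC divfK// gt_eqF.
pose u n k := walk_lap (dl n) b g k.
have uc : u n (N n) @[n --> \oo] --> levy_lap b g t.
  apply: walk_lap_cvg => //; [exact: ltW|exact: ltW|by move=> n; rewrite Ndl|].
  by under eq_fun do rewrite Ndl; exact: cvg_cst.
have mc : walk_lap (dl n) 0 g (N n) @[n --> \oo] --> levy_lap 0 g t.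
  apply: walk_lap_cvg => //; [exact: ltW|exact: ltW|by move=> n; rewrite Ndl|].
  by under eq_fun do rewrite Ndl; exact: cvg_cst.
have u01 n k : 0 <= u n k <= 1 by apply: walk_lap01 => //; exact: ltW.
have Ic : \sum_(k < N n) u n k.+1 * dl n @[n --> \oo] --> \int[mu]_(s in `[0, t[) levy_lap b g s.
  have -> : (fun n => \sum_(k < N n) u n k.+1 * dl n) =
      (fun n => \int[mu]_(s in `[0, t[) u n (Num.truncn (s / dl n)).+1).
    apply/funext => n; have := @integral_step_sum R (fun k => u n k.+1) (dl n) (N n) (dl0 n).
    rewrite Ndl /Rintegral => ->//= k.
    by have /andP[] := u01 n k.+1.
  have [||||_ //] := @cvg_Rintegral _ _ R mu `[0, t[%classic (measurable_itv _)
     (fun n s => u n (Num.truncn (s / dl n)).+1) (levy_lap b g) (fun=> 1).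
  - move=> n; apply: (@measurable_truncn_comp _ (fun k => u n k.+1)) => // s /=.
    by rewrite in_itv/= => /andP[].
  - move=> s /=; rewrite in_itv/= => /andP[s0 st].
    apply: walk_lap_cvg => //; first exact: ltW.
      by move=> n; exact: right_grid_ge.
    exact: right_grid_cvg.
  - apply: ge0_integrable => //.
    rewrite integral_cst//= lebesgue_measure_itv/= lte_fin t0 mul1e.
    by rewrite -EFinB ltry.
  - by move=> n s _; have /andP[? ?] := u01 n (Num.truncn (s / dl n)).+1; rewrite ger0_norm.
have Jc : \sum_(k < N n) u n k * dl n @[n --> \oo] --> \int[mu]_(s in `[0, t[) levy_lap b g s.
  have -> : (fun n => \sum_(k < N n) u n k * dl n) =
      (fun n => \sum_(k < N n) u n k.+1 * dl n + (1 - u n (N n)) * dl n).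
    have summation_by_parts (v : nat -> R) q m :
        \sum_(k < m) v k * q = \sum_(k < m) v k.+1 * q + (v 0%N - v m) * q.
      elim: m => [|m IH]; first by rewrite !big_ord0 subrr mul0r addr0.
      by rewrite !big_ord_recr/= IH; ring.
    by apply/funext => n; rewrite (summation_by_parts (u n)) {2}/u walk_lap0.
  rewrite -[X in _ --> X]addr0; apply: cvgD => //.
  rewrite -[X in _ --> X](mulr0 (1 - levy_lap b g t)); apply: cvgM; last exact: dlc.
  by apply: cvgB; [exact: cvg_cst|exact: uc].
have ba0 : 0 <= b `^ alpha by exact: powR_ge0.
have ec := expRB1_cvg ba0 dl0 dlc.
pose E n := u n (N n) - 1 - (expR (dl n * b `^ alpha) - 1) * (\sum_(k < N n) u n k)
    - (b + g) / g * (walk_lap (dl n) 0 g (N n) - 1).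
have E1 : E n @[n --> \oo] --> levy_lap b g t - 1 - b `^ alpha * \int[mu]_(s in `[0, t[) levy_lap b g s
    - (b + g) / g * (levy_lap 0 g t - 1).
  have -> : E = (fun n => u n (N n) - 1 - (expR (dl n * b `^ alpha) - 1) / dl n * (\sum_(k < N n) u n k * dl n)
    - (b + g) / g * (walk_lap (dl n) 0 g (N n) - 1)).
    apply/funext => n; rewrite /E -mulr_suml; congr (_ - _ - _).
    by rewrite mulrACA mulVf ?mulr1// gt_eqF.
  apply: cvgB; last by apply: cvgM; [exact: cvg_cst|apply: cvgB; [exact: mc|exact: cvg_cst]].
  apply: cvgB; first by apply: cvgB; [exact: uc|exact: cvg_cst].
  by apply: cvgM; [exact: ec|exact: Jc].
pose p := alpha^-1.
have p_gt : 0 < 2 * p - 1.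
  by rewrite subr_gt0 /p ltr_pdivlMr// mul1r; case/andP: a12.
pose K1 := (b * g + b ^+ 2) * 4 * (expR (2 `^ alpha) - 2 * expR 1 + 1).
have dlp r : 0 < r -> dl n `^ r @[n --> \oo] --> (0 : R).
  move=> r0.
  have h : fpow r (dl n) @[n --> \oo] --> fpow r 0 by apply: continuous_cvg => //; exact: continuous_fpow.
  have G0 := Gamma1_gt0 (ltW r0).
  have -> : (fun n => dl n `^ r) = (fun n => fpow r (dl n) * Gamma (r + 1)).
    by apply/funext => n; rewrite (fpowE _ (dl0 n)) divfK// gt_eqF.
  rewrite -[X in _ --> X](mul0r (Gamma (r + 1))); apply: cvgM; last exact: cvg_cst.
  by rewrite -(fpow_le0 r (lexx 0)).
have E2 : E n @[n --> \oo] --> (0 : R).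
  apply: norm_cvg0.
  apply: (@squeeze_cvgr _ _ _ _ (fun=> 0) (fun n => t * K1 * dl n `^ (2 * p - 1))); last 2 first.
  - exact: cvg_cst.
  - rewrite -[X in _ --> X](mulr0 (t * K1)); apply: cvgM; first exact: cvg_cst.
    exact: dlp.
  have p0 : 0 < p by rewrite invr_gt0.
  have := dlp p p0; move/cvgrPdistC_lt => /(_ (b + 1)^-1); rewrite invr_gt0 ltr_wpDl// => /(_ isT).
  apply: filterS => n; rewrite subr0 ger0_norm ?powR_ge0// => h.
  rewrite normr_ge0/=.
  pose q := dl n `^ (- p).
  have q0 : 0 < q by rewrite powR_gt0.
  have bq : b <= q.
    have : b + 1 < q by rewrite /q powRN -[ltLHS]invrK ltf_pV2 ?posrE ?powR_gt0// invr_gt0 ltr_wpDl.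
    by lra.
  have qa : q `^ alpha = (dl n)^-1.
    by rewrite /q -powRrM mulNr /p mulVf ?gt_eqF// powR_inv1// ltW.
  apply: (le_trans (walk_sum _ (dl0 n) b0 g0 bq q0)).
  have c1 : dl n * q `^ alpha = 1 by rewrite qa mulfV// gt_eqF.
  have c2 : dl n * (2 * q) `^ alpha = 2 `^ alpha by rewrite powRM ?(ltW q0)// mulrCA c1 mulr1.
  rewrite c1 c2.
  rewrite le_eqVlt; apply/orP; left; apply/eqP.
  have -> : q ^- 2 = dl n `^ (2 * p).
    by rewrite -powR_mulrn ?(ltW q0)// /q -powRrM -powRN; congr (_ `^ _); ring.
  have -> : dl n `^ (2 * p - 1) = dl n `^ (2 * p) / dl n.
    by rewrite powRBp// powRr1// ltW.
  rewrite -(Ndl n) /K1; move: (dl n `^ (2 * p)) (expR (2 `^ alpha)) (expR 1) (dl n) (dl0 n) => y e1 e2 x x0.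
  by field; rewrite gt_eqF.
have PF : ProperFilter (E n @[n --> \oo]) by exact: fmap_proper_filter.
have := cvg_unique (@norm_hausdorff _ _) E1 E2 => /(_ PF).
move: (levy_lap b g t) (b `^ alpha * _) ((b + g) / g * _) => x y z h; lra.
Qed.

Lemma levy_lap_ge0 b g t : 0 <= levy_lap b g t.
Proof. by apply: Rintegral_ge0 => w _; exact: expR_ge0. Qed.

Let levy_integrand_le1 b g t w : 0 <= b -> 0 <= g -> 0 <= t ->
  `|expR (- (b * running_sup X t w + g * drawdown t w))| <= 1.
Proof.
move=> b0 g0 t0; rewrite ger0_norm ?expR_ge0// -expR0 ler_expR oppr_le0.
by rewrite addr_ge0// mulr_ge0 ?running_sup_ge0 ?drawdown_ge0.
Qed.

Lemma measurable_levy_integrand b g t : 0 <= t ->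
  measurable_fun [set: T] (fun w => expR (- (b * running_sup X t w + g * drawdown t w))).
Proof.
move=> t0; apply: (@measurable_lap _ _ (fun w => (running_sup X t w, drawdown t w))).
by apply/measurable_fun_pair; [exact: measurable_running_sup|exact: measurable_drawdown].
Qed.

Lemma integrable_levy_integrand b g t : 0 <= b -> 0 <= g -> 0 <= t ->
  P.-integrable [set: T] (EFin \o (fun w => expR (- (b * running_sup X t w + g * drawdown t w)))).
Proof.
move=> b0 g0 t0; apply: (@integrable_bounded _ 1); first exact: measurable_levy_integrand.
by move=> w; exact: levy_integrand_le1.
Qed.

Lemma levy_lap_le1 b g t : 0 <= b -> 0 <= g -> 0 <= t -> levy_lap b g t <= 1.
Proof.
move=> b0 g0 t0.
have -> : 1 = \int[P]_w (cst 1 w) :> R by rewrite Rintegral_cst//= probability_setT mulr1.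
apply: le_Rintegral => //; first exact: integrable_levy_integrand.
  by apply: (@integrable_bounded _ 1) => // w; rewrite normr1.
by move=> w _; apply: le_trans (ler_norm _) _; exact: levy_integrand_le1.
Qed.

Lemma measurable_levy_lap b g :
  measurable_fun [set: R] (fun s => levy_lap b g (Num.max s 0)).
Proof.
pose f (z : measurableTypeR R * T) :=
  (expR (- (b * running_sup X (Num.max z.1 0) z.2 + g * drawdown (Num.max z.1 0) z.2)))%:E.
have mf : measurable_fun [set: measurableTypeR R * T] f.
  apply/measurable_EFinP.
  have m : measurable_fun [set: measurableTypeR R * T]
      (fun z => - (b * running_sup X (Num.max z.1 0) z.2 + g * drawdown (Num.max z.1 0) z.2)).
    apply: measurableT_comp => //; apply: measurable_funD; apply: measurable_funM => //.
      exact: measurable_running_sup2.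
    exact: measurable_drawdown2.
  exact: (measurableT_comp (@measurable_expR R) m).
have f0 z : (0 <= f z)%E by rewrite lee_fin expR_ge0.
have := @measurable_fun_fubini_tonelli_F _ _ _ _ _ P f mf f0.
have mfine : measurable_fun [set: \bar R] (@fine R) by [].
by move/(measurableT_comp mfine).
Qed.

Let max0 (s : R) : 0 <= s -> Num.max s 0 = s. Proof. by move/max_idPl. Qed.

Lemma levy_lap_time q g : 0 < q -> 0 < g ->
  (\int[mu]_(t in `]0%R, +oo[) (expR (- (q * t)) * levy_lap 0 g t)%:E =
   (q `^ (alpha^-1 - 1) / (q `^ alpha^-1 + g))%:E)%E.
Proof.
move=> q0 g0.
have alpha0 : 0 < alpha by move/andP: a12 => [/(lt_trans ltr01)].
pose b := q `^ alpha^-1.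
have b0 : 0 < b by rewrite powR_gt0.
have ba : b `^ alpha = q by rewrite /b -powRrM mulVf ?gt_eqF// powRr1// ltW.
pose c := (b + g) / g.
have c0 : 0 < c by rewrite divr_gt0// addr_gt0.
pose D : set R := `]0, +oo[%classic.
have DE t : (t \in D) = (0 < t) by rewrite /D mem_setE in_itv/= andbT.
have mDD : measurable (D : set (measurableTypeR R)) by exact: measurable_itv.
pose e t := expR (- (q * t)).
pose V s := levy_lap b g (Num.max s 0); pose F s := levy_lap 0 g (Num.max s 0).
have mV : measurable_fun [set: R] V by exact: measurable_levy_lap.
have mF : measurable_fun [set: R] F by exact: measurable_levy_lap.
have me : measurable_fun [set: R] e.
  by apply: measurableT_comp => //; apply: measurableT_comp => //; exact: measurable_funM.
have VE s : 0 <= s -> V s = levy_lap b g s by move=> s0; rewrite /V max0.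
have FE s : 0 <= s -> F s = levy_lap 0 g s by move=> s0; rewrite /F max0.
have V1 s : V s <= 1 by rewrite levy_lap_le1 ?(ltW b0) ?(ltW g0)// le_max lexx orbT.
have F1 s : F s <= 1 by rewrite levy_lap_le1 ?(ltW g0)// le_max lexx orbT.
have V0 s : 0 <= V s by exact: levy_lap_ge0.
have F0 s : 0 <= F s by exact: levy_lap_ge0.
clearbody V F.
have e0 s : 0 <= e s by exact: expR_ge0.
have ie : (\int[mu]_(t in D) (e t)%:E = (q^-1)%:E)%E.
  by rewrite integral_expRM// mulr0 oppr0 expR0 mulr1.
pose h (z : R * R) := (q * e z.1 * V z.2 * \1_[set z : R * R | z.2 < z.1] z)%:E.
have mlt : measurable [set z : R * R | z.2 < z.1].
  have m : measurable_fun [set: R * R] (fun z => z.1 - z.2) by exact: measurable_funB.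
  have -> : [set z : R * R | z.2 < z.1] = (fun z => z.1 - z.2) @^-1` `]0, +oo[%classic.
    by apply/seteqP; split => z /=; rewrite in_itv/= andbT subr_gt0.
  by rewrite -[X in measurable X]setTI; apply: m => //; exact: measurable_itv.
have mh : measurable_fun [set: R * R] h.
  apply/measurable_EFinP; apply: measurable_funM; last exact: measurable_indic.
  apply: measurable_funM; last exact: measurableT_comp mV measurable_snd.
  by apply: measurable_funM => //; exact: measurableT_comp me measurable_fst.
have h0 z : (0 <= h z)%E by rewrite lee_fin !mulr_ge0// ltW.
pose I t := \int[mu]_(s in `[0, t[) levy_lap b g s.
have IE t : 0 < t -> (\int[mu]_(s in D) (V s * \1_[set z : R * R | z.2 < z.1] (t, s))%:E = (I t)%:E)%E.
  move=> t0.
  transitivity (\int[mu]_(s in `]0%R, t[) (V s)%:E)%E.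
    have -> : `]0, t[%classic = D `&` [set s | s < t].
      apply/seteqP; split => s; rewrite /D/= !in_itv/= andbT; first by case/andP.
      by move=> [-> ->].
    rewrite integral_mkcondr; apply: eq_integral => s _.
    rewrite patchE indicE /=; case: ifPn => st.
      by rewrite (_ : (t, s) \in _) ?mulr1//; move: st; rewrite !inE.
    by rewrite (_ : (t, s) \in _ = false) ?mulr0//; apply/negbTE; move: st; rewrite !notin_setE.
  rewrite integral_itv_obnd_cbnd; last by apply/measurable_EFinP; exact: measurable_funTS.
  transitivity (\int[mu]_(s in `[0%R, t[) (levy_lap b g s)%:E)%E.
    by apply: eq_integral => s; rewrite inE/= in_itv/= => /andP[s0 _]; rewrite VE.
  apply/esym/EFin_Rintegral => //.
  apply: ge0_integrable; first 2 last.
  - apply: (@le_lt_trans _ _ (\int[mu]_(s in `[0%R, t[) (cst 1%:E s))%E).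
      apply: ge0_le_integral => //.
      + by move=> s _; rewrite lee_fin levy_lap_ge0.
      + apply/measurable_EFinP; apply: eq_measurable_fun (measurable_funTS mV) => s.
        by rewrite inE/= in_itv/= => /andP[s0 _]; rewrite VE.
      + by move=> s /=; rewrite in_itv/= => /andP[s0 _]; rewrite lee_fin levy_lap_le1// ltW.
    by rewrite integral_cst//= lebesgue_measure_itv/= lte_fin t0 mul1e -EFinB ltry.
  - apply: eq_measurable_fun (measurable_funTS mV) => s.
    by rewrite inE/= in_itv/= => /andP[s0 _]; rewrite VE.
  - by move=> s _; exact: levy_lap_ge0.
have I0 t : 0 <= I t by apply: Rintegral_ge0 => s _; exact: levy_lap_ge0.
have m1 t : measurable_fun D (fun s => V s * \1_[set z : R * R | z.2 < z.1] (t, s)).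
  have -> : (fun s => V s * \1_[set z : R * R | z.2 < z.1] (t, s)) = (fun s => V s * \1_(`]-oo, t[%classic : set R) s).
    apply/funext => s; rewrite !indicE.
    have -> // : ((t, s) \in [set z : R * R | z.2 < z.1]) = (s \in (`]-oo, t[%classic : set R)).
    by apply/idP/idP; rewrite !inE/= ?in_itv/=.
  by apply: measurable_funTS; apply: measurable_funM; [exact: mV|exact: measurable_indic].
have E1 : (\int[mu]_(t in D) \int[mu]_(s in D) h (t, s) = \int[mu]_(t in D) (q * e t * I t)%:E)%E.
  apply: eq_integral => t; rewrite DE => t0.
  have qe0 : 0 <= q * e t by rewrite mulr_ge0// ltW.
  have p0 s : D s -> 0 <= V s * \1_[set z : R * R | z.2 < z.1] (t, s) by rewrite mulr_ge0.
  rewrite EFinM -(IE t t0) -(ge0_integralZl_real mu mDD (m1 t) p0 qe0).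
  by apply: eq_integral => s _; rewrite /h /= !mulrA.
have E2 : (\int[mu]_(s in D) \int[mu]_(t in D) h (t, s) = \int[mu]_(s in D) (e s * V s)%:E)%E.
  apply: eq_integral => s; rewrite DE => s0.
  transitivity (\int[mu]_(t in `]s, +oo[) (q * V s * e t)%:E)%E.
    have -> : `]s, +oo[%classic = D `&` [set t | s < t].
      apply/seteqP; split => t; rewrite /D/= !in_itv/= !andbT; last by case.
      by move=> st; split => //; exact: lt_trans s0 st.
    rewrite integral_mkcondr; apply: eq_integral => t _.
    rewrite patchE /h indicE /=; case: ifPn => st.
      by rewrite (_ : (t, s) \in _) ?mulr1 1?mulrAC//; move: st; rewrite !inE.
    by rewrite (_ : (t, s) \in _ = false) ?mulr0//; apply/negbTE; move: st; rewrite !notin_setE.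
  rewrite ge0_integralZl_real//; last 2 first.
  - exact: measurable_funTS.
  - by rewrite mulr_ge0// ltW.
  rewrite integral_expRM// -EFinM; congr EFin; rewrite /e; field; exact: lt0r_neq0.
have E12 := @tonelli_domain _ _ _ _ R mu mu D D h (measurable_itv _) (measurable_itv _) mh (fun x y _ _ => h0 (x, y)).
rewrite E1 E2 in E12.
pose LV : \bar R := (\int[mu]_(s in D) (e s * V s)%:E)%E.
pose LF : \bar R := (\int[mu]_(s in D) (e s * F s)%:E)%E.
have bound (G : R -> R) : measurable_fun [set: R] G -> (forall s, 0 <= G s) -> (forall s, 0 <= G s <= 1) ->
    (\int[mu]_(s in D) (e s * G s)%:E)%E \is a @fin_num R.
  move=> mG G0 G1; rewrite ge0_fin_numE; last by apply: integral_ge0 => s _; rewrite lee_fin mulr_ge0.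
  apply: (@le_lt_trans _ _ (\int[mu]_(t in D) (e t)%:E)%E); last by rewrite ie ltry.
  apply: ge0_le_integral => //.
  - by move=> s _; rewrite lee_fin mulr_ge0.
  - by apply/measurable_EFinP/measurable_funTS/measurable_funM.
  - by apply/measurable_EFinP/measurable_funTS.
  - by move=> s _; rewrite lee_fin ler_piMr//; have /andP[] := G1 s.
have fV : LV \is a fin_num.
  by apply: bound => // s; rewrite V0 V1.
have fF : LF \is a fin_num.
  by apply: bound => // s; rewrite F0 F1.
have mD (G : R -> R) : measurable_fun [set: R] G -> measurable_fun D (EFin \o G).
  by move=> mG; apply/measurable_EFinP; exact: measurable_funTS.
have S1 : (\int[mu]_(t in D) (e t * V t + c * e t)%:E = LV + (c * q^-1)%:E)%E.
  under eq_integral do rewrite EFinD.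
  rewrite ge0_integralD//.
  - by rewrite ge0_integralZl_real ?ie ?EFinM ?(ltW c0)//; exact: measurable_funTS.
  - by move=> t _; rewrite lee_fin mulr_ge0.
  - by apply: mD; exact: measurable_funM.
  - by move=> t _; rewrite lee_fin mulr_ge0// ltW.
  - by apply: mD; exact: measurable_funM.
have S2 : (\int[mu]_(t in D) (e t * V t + c * e t)%:E = (q^-1)%:E + LV + c%:E * LF)%E.
  transitivity (\int[mu]_(t in D) ((e t)%:E + ((q * e t * I t)%:E + (c * (e t * F t))%:E)))%E.
    apply: eq_integral => t; rewrite DE => t0.
    rewrite -!EFinD; congr EFin.
    have := levy_lap_eq (ltW b0) g0 t0.
    rewrite ba -/(I t) -/c VE ?FE ?(ltW t0)// => ->; ring.
  have mI : measurable_fun D (EFin \o (fun t => q * e t * I t)).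
    pose f z := (V z.2 * \1_[set z : R * R | z.2 < z.1] z * \1_D z.2)%:E.
    have mf : measurable_fun [set: R * R] f.
      apply/measurable_EFinP; apply: measurable_funM.
        apply: measurable_funM; last exact: measurable_indic.
        exact: measurableT_comp mV measurable_snd.
      by apply: measurableT_comp measurable_snd; exact: measurable_indic.
    have f0 z : (0 <= f z)%E by rewrite lee_fin !mulr_ge0.
    have mfine : measurable_fun [set: \bar R] (@fine R) by [].
    have mG := measurableT_comp mfine (@measurable_fun_fubini_tonelli_F _ _ _ _ _ mu f mf f0).
    apply/measurable_EFinP; apply: (eq_measurable_fun (fun t => q * e t * fine (fubini_F mu f t))).
      move=> t; rewrite DE => t0; congr (_ * _).
      rewrite -[RHS]/(fine (I t)%:E) -IE// /fubini_F; congr fine.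
      rewrite [RHS]integral_mkcond; apply: eq_integral => s _.
      by rewrite /f patchE /= [X in _ * X]indicE; case: ifPn => sD; rewrite ?mulr1 ?mulr0.
    by apply: measurable_funTS; apply: measurable_funM; [exact: measurable_funM|exact: mG].
  have p1 t : 0 <= q * e t * I t := mulr_ge0 (mulr_ge0 (ltW q0) (e0 t)) (I0 t).
  have p2 t : 0 <= c * (e t * F t) := mulr_ge0 (ltW c0) (mulr_ge0 (e0 t) (F0 t)).
  have meF : measurable_fun [set: R] (fun t => e t * F t) by exact: measurable_funM.
  have mceF : measurable_fun D (EFin \o (fun t => c * (e t * F t))).
    by apply: mD; apply: measurable_funM => //; exact: measurable_cst.
  rewrite ge0_integralD//.
  - rewrite ie ge0_integralD//.
    + rewrite E12 -/LV (ge0_integralZl_real mu mDD (measurable_funTS meF) _ (ltW c0)).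
        by rewrite -/LF addeA.
      by move=> t _; exact: mulr_ge0 (e0 t) (F0 t).
    + by move=> t _; rewrite lee_fin p1.
    + by move=> t _; rewrite lee_fin p2.
  - by move=> t _; rewrite lee_fin.
  - exact: mD.
  - by move=> t _; rewrite adde_ge0// lee_fin.
  - exact: emeasurable_funD.
have LFE : (\int[mu]_(t in `]0%R, +oo[) (e t * levy_lap 0 g t)%:E = LF)%E.
  by apply: eq_integral => t; rewrite inE/= in_itv/= andbT => t0; rewrite FE// ltW.
rewrite LFE; move: S1; rewrite S2 -(fineK fV) -(fineK fF) -EFinM -!EFinD => -[] H.
congr EFin.
have {}H : c * fine LF = c * q^-1 - q^-1 by move: H; move: (fine LV) (c * fine LF) (c / q) => x y z; lra.
have -> : fine LF = (c * q^-1 - q^-1) / c by rewrite -H mulrAC divff ?mul1r// gt_eqF.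
rewrite powRBp// powRr1 ?(ltW q0)// -/b /c; field.
by rewrite !gt_eqF// addr_gt0.
Qed.

End LevyProcess.

(** * Inversion of the Laplace transforms *)

Section GammaGrowth.
Context (R : realType).
Notation mu := (@lebesgue_measure R).
Implicit Types p q s t x y M : R.

Lemma Gamma_ge_real p s M : 0 <= p -> p <= s -> 1 <= M ->
  Gamma (p + 1) * M `^ (s - p) * expR (- M) <= Gamma (s + 1).
Proof.
move=> p0 ps M1; have M0 : 0 < M by rewrite (lt_le_trans _ M1).
have s0 := le_trans p0 ps.
have p1 : 0 < p + 1 by rewrite ltr_wpDl.
have s1 : 0 < s + 1 by rewrite ltr_wpDl.
pose c := M `^ (s - p) * expR (- M).
have c0 : 0 <= c by rewrite mulr_ge0 ?powR_ge0 ?expR_ge0.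
have ms := @measurable_gamma_integrand R (s + 1) 1 setT.
pose h x := if M < x then gamma_integrand (s + 1) 1 x else 0.
have mh : measurable_fun [set: R] h.
  by apply: measurable_fun_ifT; [exact: measurable_fun_ltr|exact: ms|exact: measurable_cst].
have h0 x : 0 <= h x by rewrite /h; case: ifP => // _; exact: gamma_integrand_ge0.
have hle x : 0 < x -> h x <= gamma_integrand (s + 1) 1 x.
  by move=> x0; rewrite /h; case: ifP => // _; exact: gamma_integrand_ge0.
have pw x : 0 < x -> c * gamma_integrand (p + 1) 1 x <= h (x + M).
  move=> x0; rewrite /h ltrDr x0 /gamma_integrand !addrK !mul1r opprD expRD.
  have xM : x <= x + M by rewrite lerDl ltW.
  have Mx : M <= x + M by rewrite lerDr ltW.
  have x0M : 0 < x + M by rewrite addr_gt0.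
  have -> : (x + M) `^ s = (x + M) `^ p * (x + M) `^ (s - p).
    by rewrite -powRDp//; congr (_ `^ _); ring.
  have h1 : x `^ p <= (x + M) `^ p.
    by apply: ge0_ler_powR; rewrite ?nnegrE ?(ltW x0) ?(ltW x0M).
  have h2 : M `^ (s - p) <= (x + M) `^ (s - p).
    by apply: ge0_ler_powR; rewrite ?nnegrE ?subr_ge0 ?(ltW M0) ?(ltW x0M).
  rewrite /c mulrACA [leRHS]mulrACA -!mulrA mulrCA.
  have e0 : 0 <= expR (- M) * expR (- x) by rewrite mulr_ge0 ?expR_ge0.
  have := ler_wpM2r e0 (ler_pM (powR_ge0 _ _) (powR_ge0 _ _) h1 h2).
  move: (x `^ p) (M `^ (s - p)) ((x + M) `^ p) ((x + M) `^ (s - p)) (expR (- M)) (expR (- x)) => A B C D E F hh.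
  have -> : A * (B * (E * F)) = A * B * (E * F) by ring.
  apply: (le_trans hh); rewrite le_eqVlt; apply/orP; left; apply/eqP; ring.
rewrite -lee_fin -[X in (_ <= X)%E]gammaE//.
apply: (@le_trans _ _ (\int[mu]_(x in `]0%R, +oo[) (c * gamma_integrand (p + 1) 1 x)%:E)%E).
  rewrite ge0_integralZl_real//.
  - by rewrite gammaE// -EFinM lee_fin [leRHS]mulrC /c mulrA.
  - exact: measurable_gamma_integrand.
  - by move=> x _; exact: gamma_integrand_ge0.
apply: (@le_trans _ _ (\int[mu]_x (h (x + M))%:E)%E).
  rewrite integral_mkcond; apply: ge0_le_integral => //.
  - move=> x _; rewrite patchE; case: ifP => // _.
    by rewrite lee_fin mulr_ge0// gamma_integrand_ge0.
  - apply: (measurable_restrictT _ _).1 => //; apply/measurable_EFinP.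
    by apply: measurable_funM => //; exact: measurable_gamma_integrand.
  - apply/measurable_EFinP; apply: measurableT_comp mh _; exact: measurable_funD.
  - move=> x _; rewrite patchE; case: ifPn => [|_]; last by rewrite lee_fin.
    by rewrite inE/= in_itv/= andbT => x0; rewrite lee_fin pw.
rewrite (@ge0_integral_shift _ M (EFin \o h)); [|exact/measurable_EFinP|by move=> x; rewrite /= lee_fin].
rewrite [leRHS]integral_mkcond; apply: ge0_le_integral => //.
- by move=> x _; rewrite /= lee_fin.
- exact/measurable_EFinP.
- apply: (measurable_restrictT _ _).1 => //; apply/measurable_EFinP.
  exact: measurable_gamma_integrand.
- move=> x _; rewrite patchE; case: ifPn => [|].
    by rewrite inE/= in_itv/= andbT => x0; rewrite /= lee_fin hle.
  rewrite notin_setE/= in_itv/= andbT => /negP; rewrite -leNgt => x0.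
  by rewrite /= lee_fin /h ltNge (le_trans x0 (ltW M0)).
Qed.

Lemma Gamma_le_expR p s : 0 <= p -> p <= s -> Gamma (p + 1) <= expR 1 * Gamma (s + 1).
Proof.
move=> p0 ps; have := Gamma_ge_real p0 ps (lexx 1); rewrite powR1 mulr1 => h.
by rewrite mulrC -ler_pdivrMr ?expR_gt0// -expRN.
Qed.

Lemma Gamma_ratio_geometric th et x : 0 <= th -> th < et -> 0 <= x ->
  exists2 C, 0 < C & forall n : nat,
    Gamma (th * n%:R + 1) * x ^+ n <= C * 2^-1 ^+ n * Gamma (et * n%:R + 1).
Proof.
move=> th0 thet x0.
pose M : R := Num.max 1 ((2 * x) `^ (et - th)^-1).
have M1 : 1 <= M by rewrite le_max lexx.
have d0 : 0 < et - th by rewrite subr_gt0.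
have xM : 2 * x <= M `^ (et - th).
  apply: (@le_trans _ _ (((2 * x) `^ (et - th)^-1) `^ (et - th))).
    by rewrite -powRrM mulVf ?gt_eqF// powRr1 ?mulr_ge0.
  have M2 : (2 * x) `^ (et - th)^-1 <= M by rewrite le_max lexx orbT.
  apply: ge0_ler_powR M2; rewrite ?nnegrE ?(ltW d0) ?powR_ge0//.
  exact: le_trans ler01 M1.
exists (expR M); first exact: expR_gt0.
move=> n.
have p0 : 0 <= th * n%:R by rewrite mulr_ge0.
have ps : th * n%:R <= et * n%:R by rewrite ler_wpM2r// ltW.
have := Gamma_ge_real p0 ps M1.
have -> : et * n%:R - th * n%:R = (et - th) * n%:R by ring.
rewrite powRrM powR_mulrn ?powR_ge0// => h.
have G0 : 0 <= Gamma (th * n%:R + 1) by apply: ltW; exact: Gamma1_gt0 p0.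
have xn : x ^+ n <= 2^-1 ^+ n * (M `^ (et - th)) ^+ n.
  rewrite -exprMn; apply: lerXn2r; rewrite ?nnegrE ?mulr_ge0 ?powR_ge0//.
  by rewrite mulrC ler_pdivlMr// mulrC.
apply: (le_trans (ler_wpM2l G0 xn)).
move: h; rewrite expRN ler_pdivrMr ?expR_gt0// => h.
have h2 : 0 <= 2^-1 ^+ n :> R by rewrite exprn_ge0.
rewrite mulrCA mulrAC [leRHS]mulrC ler_wpM2l//.
by rewrite [leRHS]mulrC.
Qed.

Lemma bin_le_exp2 m j : ('C(m, j) <= 2 ^ m)%N.
Proof.
elim: m j => [|m IH] [|j] //=; first by rewrite bin0 expn_gt0.
by rewrite binS expnS mul2n -addnn leq_add.
Qed.

Lemma Gamma_addn_le s (k n : nat) : 0 <= s -> s <= k%:R ->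
  Gamma (s + n%:R + 1) <= Gamma (s + 1) * n`!%:R * 2 ^+ (k + n).
Proof.
move=> s0 sk; have G0 : 0 < Gamma (s + 1) by exact: Gamma1_gt0.
have H : Gamma (s + n%:R + 1) * k`!%:R <= Gamma (s + 1) * (k + n)`!%:R.
  elim: n => [|n IH]; first by rewrite addr0 addn0.
  have sn0 : 0 < s + n%:R + 1 by rewrite -addrA ltr_wpDl.
  rewrite -natr1 addrA GammaS// addnS factS natrM -mulrA mulrCA.
  have h : s + n%:R + 1 <= (k + n).+1%:R by rewrite -natr1 natrD !lerD2r.
  have g0 : 0 < Gamma (s + n%:R + 1) by exact: Gamma_gt0.
  rewrite [leLHS]mulrCA [leRHS]mulrCA.
  move: (s + n%:R + 1) (Gamma (s + _ + 1)) (Gamma (s + 1)) sn0 h g0 IH => A B C sn0 h g0 IH.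
  apply: ler_pM h IH; first exact: ltW.
  by apply: mulr_ge0 => //; exact: ltW.
have k0 : 0 < k`!%:R :> R by rewrite ltr0n fact_gt0.
rewrite -(ler_pM2r k0) (le_trans H)// -!mulrA ler_pM2l//.
rewrite -natrX -!natrM ler_nat.
rewrite -(@bin_fact (k + n) n) ?leq_addl// addnK mulnCA leq_mul2l; apply/orP; right.
by rewrite leq_mul2r bin_le_exp2 orbT.
Qed.

Lemma cvg_geometric_half (C : R) : cvgn (series (fun n => C * 2^-1 ^+ n)).
Proof. by apply: is_cvg_geometric_series; rewrite ger0_norm// invf_lt1// ltr1n. Qed.

(* rG is the entire function 1/Gamma; Gamma is Euler's integral, which
   is meaningless at nonpositive arguments, hence the reflected branch. *)
Definition rG x := if 0 < x then (Gamma x)^-1 else Gamma (1 - x) * sin (pi * x) / pi.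

Lemma rG1B s : 0 < s -> rG (1 - s) = Gamma s * sin (pi * s) / pi.
Proof.
move=> s0; rewrite /rG subr_gt0; case: ifPn => s1.
  have s01 : 0 < s < 1 by rewrite s0.
  have h := Gamma_reflection s01.
  have G1 : 0 < Gamma (1 - s) by rewrite Gamma_gt0// subr_gt0.
  have sn : 0 < sin (pi * s).
    apply: sin_gt0_pi; apply/andP; split; first by rewrite mulr_gt0 ?pi_gt0.
    by rewrite gtr_pMr// pi_gt0.
  have p0 := pi_gt0 R.
  have -> : Gamma s = pi / sin (pi * s) / Gamma (1 - s) by rewrite -h mulfK// gt_eqF.
  move: (sin (pi * s)) (Gamma (1 - s)) (@pi R) sn G1 p0 => A B C A0 B0 C0.
  by field; rewrite !gt_eqF.
rewrite opprB addrCA subrr addr0; congr (_ * _ / _).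
by rewrite mulrBr mulr1 addrC sinDpi sinN opprK.
Qed.

Lemma rG_pos x : 0 < x -> rG x = (Gamma x)^-1.
Proof. by move=> x0; rewrite /rG x0. Qed.

Lemma rGS x : x * rG (x + 1) = rG x.
Proof.
have [x0|x0] := ltP 0 x.
  rewrite !rG_pos ?addr_gt0// GammaS// invfM mulrA divff ?mul1r// gt_eqF//.
have [->|xn0] := eqVneq x 0.
  by rewrite mul0r /rG ltxx mulr0 sin0 mulr0 mul0r.
have y0 : 0 < - x by rewrite oppr_gt0 lt_neqAle xn0.
have -> : x + 1 = 1 - - x by rewrite opprK addrC.
have -> : rG x = rG (1 - (- x + 1)) by congr rG; ring.
rewrite !rG1B ?addr_gt0// GammaS// mulrDr mulr1 sinDpi.
by move: (Gamma _) (sin _) => A B; rewrite !mulrA; congr (_ / _); ring.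
Qed.

Definition fpowR x t := t `^ x * rG (1 + x).

Lemma is_derive_fpowR x t : 0 < t -> is_derive t 1 (fpowR x) (fpowR (x - 1) t).
Proof.
move=> t0; have h := is_derive_powR x t0.
have -> : fpowR (x - 1) t = rG (1 + x) * (x * t `^ (x - 1)).
  rewrite /fpowR -[1 + x]addrC -mulrCA mulrA [_ * rG _]mulrC; congr (_ * _).
  by rewrite addrCA subrr addr0 rGS.
have -> : fpowR x = fun u => rG (1 + x) * u `^ x by apply/funext => u; rewrite /fpowR mulrC.
by apply: is_derive_eq.
Qed.

Lemma fpowR_fpow x t : 0 <= x -> 0 < t -> fpowR x t = fpow x t.
Proof. by move=> x0 t0; rewrite /fpowR fpowE// rG_pos 1?addrC// ltr_wpDl. Qed.

Lemma fpowR_negE s t (n : nat) : 0 < s ->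
  fpowR (- s - n%:R) t = t `^ (- s - n%:R) * ((-1) ^+ n * (Gamma (s + n%:R) * sin (pi * s) / pi)).
Proof.
move=> s0; rewrite /fpowR; congr (_ * _).
have -> : 1 + (- s - n%:R) = 1 - (s + n%:R) by ring.
rewrite rG1B ?ltr_wpDr//.
have -> : sin (pi * (s + n%:R)) = (-1) ^+ n * sin (pi * s).
  elim: n => [|n IH]; first by rewrite addr0 mul1r.
  by rewrite -natr1 addrA mulrDr mulr1 sinDpi IH exprS mulN1r mulNr.
by move: (Gamma _) (sin _) (_ ^+ n) => A B C; rewrite !mulrA; congr (_ / _); ring.
Qed.

Lemma normr_fpowR_neg_le s t (n : nat) : 0 < s -> 0 < t ->
  `|fpowR (- s - n%:R) t| <= t `^ (- s - n%:R) * Gamma (s + n%:R).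
Proof.
move=> s0 t0; rewrite fpowR_negE// normrM ger0_norm ?powR_ge0// ler_wpM2l ?powR_ge0//.
have G0 : 0 < Gamma (s + n%:R) by rewrite Gamma_gt0// ltr_wpDr.
rewrite !normrM normrX normrN1 expr1n mul1r (gtr0_norm G0) -mulrA ler_piMr ?(ltW G0)//.
have p1 : 1 <= pi :> R by rewrite (le_trans _ (pi_ge2 R))// ler1n.
have p0 := pi_gt0 R.
rewrite normfV (gtr0_norm p0) ler_pdivrMr// mul1r (le_trans _ p1)//.
by rewrite ler_norml sin_geN1 sin_le1.
Qed.

Lemma fpow_incr (r u v : R) : 0 <= r -> u <= v ->
  (v - u) * fpow r u <= fpow (r + 1) v - fpow (r + 1) u <= (v - u) * fpow r v.
Proof.
move=> r0 uv.
have r10 : 0 <= r + 1 by rewrite addr_ge0.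
have [v0|v0] := leP v 0.
  by rewrite !fpow_le0 ?(le_trans uv)// subrr !mulr0 lexx.
have [u0|u0] := leP u 0.
  rewrite !(fpow_le0 _ u0) mulr0 subr0 fpow_ge0//=.
  have -> : fpow (r + 1) v = v / (r + 1) * fpow r v.
    rewrite !fpowE// powRS// GammaS ?ltr_wpDl//.
    have G0 := Gamma1_gt0 r0; field; rewrite gt_eqF//=; lra.
  rewrite ler_wpM2r ?fpow_ge0// (le_trans (y := v))//; last by rewrite lerBrDr gerDl.
  by rewrite ler_pdivrMr ?ltr_wpDl// ler_peMr ?(ltW v0)// lerDr.
have D x : u <= x <= v -> is_derive x 1 (fpow (r + 1)) (fpow r x).
  move=> /andP[ux xv]; have x0 : 0 < x by exact: lt_le_trans u0 ux.
  have h : is_derive x 1 (fpowR (r + 1)) (fpow r x).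
    have := is_derive_fpowR (r + 1) x0.
    by rewrite addrK (fpowR_fpow r0 x0).
  apply: (@near_eq_is_derive _ _ _ (fpowR (r + 1)) (fpow (r + 1))) => //.
  by near=> z; rewrite fpowR_fpow//; near: z; exact: lt_nbhsr.
have lo := @increment_ge_derive _ (fpow (r + 1)) (fpow r) u v (fpow r u) uv D
  (fun x ux => le_fpow r0 (proj1 (andP ux))).
have D' x : u <= x <= v -> is_derive x 1 (fun x => - fpow (r + 1) x) (- fpow r x).
  by move=> ux; apply: is_deriveN; exact: D.
have hi := @increment_ge_derive _ (fun x => - fpow (r + 1) x) (fun x => - fpow r x) u v (- fpow r v) uv D' _.
rewrite mulrC lo/=.
have H : forall x, u <= x <= v -> - fpow r v <= - fpow r x.
  by move=> x /andP[_ xv]; rewrite lerN2; exact: le_fpow.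
by have := hi H; rewrite mulNr -opprD lerN2 mulrC.
Unshelve. all: by end_near. Qed.

End GammaGrowth.

Section Primitive.
Context (R : realType).
Notation mu := (@lebesgue_measure R).
Implicit Types (F f : R -> R) (a b c u v x : R).

Definition is_prim F f a b := forall u v, a <= u -> u <= v -> v <= b ->
  mu.-integrable `[u, v] (EFin \o f) /\ F v - F u = \int[mu]_(x in `[u, v]) f x.

Lemma is_primD F f G g a b : is_prim F f a b -> is_prim G g a b ->
  is_prim (fun x => F x + G x) (fun x => f x + g x) a b.
Proof.
move=> Ff Gg u v au uv vb; have [i1 e1] := Ff u v au uv vb; have [i2 e2] := Gg u v au uv vb.
have mI : measurable (`[u, v]%classic : set (measurableTypeR R)) by exact: measurable_itv.
split; first by have := integrableD mI i1 i2.
by rewrite (RintegralD mI i1 i2) -e1 -e2; ring.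
Qed.

Lemma is_primZ F f a b c : is_prim F f a b -> is_prim (fun x => c * F x) (fun x => c * f x) a b.
Proof.
move=> Ff u v au uv vb; have [i1 e1] := Ff u v au uv vb.
have mI : measurable (`[u, v]%classic : set (measurableTypeR R)) by exact: measurable_itv.
split; first by have := integrableZl mI c i1.
by rewrite (RintegralZl c mI i1) -e1 mulrBr.
Qed.

Lemma is_prim_derive F f a b :
  (forall x, a <= x <= b -> is_derive x 1 F (f x)) ->
  (forall x, a <= x <= b -> {for x, continuous f}) -> is_prim F f a b.
Proof.
move=> dF cf u v au uv vb.
have sub x : u <= x <= v -> a <= x <= b.
  by move=> /andP[ux xv]; rewrite (le_trans au ux) (le_trans xv vb).
split.
  apply: continuous_compact_integrable; first exact: segment_compact.
  apply: continuous_in_subspaceT => x; rewrite inE/= in_itv/= => h.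
  exact: cf (sub _ h).
move: uv; rewrite le_eqVlt => /predU1P[uv|uv].
  by rewrite uv subrr set_itv1 Rintegral_set1.
rewrite -[LHS]/(fine ((F v - F u)%:E)) /Rintegral; congr fine; apply/esym.
by apply: FTC2_segment => // x h; [exact: dF (sub _ h)|exact: cf (sub _ h)].
Qed.

Lemma is_prim_ge F f a b c u v : is_prim F f a b -> a <= u -> u <= v -> v <= b ->
  (forall x, u <= x <= v -> c <= f x) -> c * (v - u) <= F v - F u.
Proof.
move=> Ff au uv vb cf; have [i1 ->] := Ff u v au uv vb.
have ic : mu.-integrable `[u, v] (EFin \o cst c).
  apply: continuous_compact_integrable; first exact: segment_compact.
  by apply: continuous_in_subspaceT => x _; exact: cvg_cst.
have -> : c * (v - u) = \int[mu]_(x in `[u, v]) cst c x.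
  rewrite Rintegral_cst//= lebesgue_measure_itv/= lte_fin.
  by move: uv; rewrite le_eqVlt => /predU1P[->|->]; rewrite ?ltxx ?subrr ?mulr0.
apply: le_Rintegral => // x; rewrite inE/= in_itv/=; exact: cf.
Qed.

End Primitive.

Section ChainVanish.
Context (R : realType).
Implicit Types (t L x c : R).

(* For each n the functions g n 0, g n 1, ..., g n (m n) are successive
   antiderivatives, starting from one of dn n.  By
   iterated_antiderivative_lower_bound the decay of M n forces dl t = 0. *)
Definition chain_data (m : nat -> nat) (g : nat -> nat -> R -> R) (dn : nat -> R -> R)
    (dl : R -> R) (eps M : nat -> R) t L :=
  [/\ 0 < L,
    (forall n, is_prim (g n 0%N) (dn n) t (t + L)),
    (forall n i x, (i < m n)%N -> t <= x <= t + L -> is_derive x 1 (g n i.+1) (g n i x)),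
    (forall n x, t <= x <= t + L -> `|g n (m n) x| <= M n) &
    [/\ (forall n x, t <= x <= t + L -> `|dn n x - dl x| <= eps n),
      eps n @[n --> \oo] --> 0,
      dl x @[x --> t^'+] --> dl t &
      (forall c, 0 < c -> (c * (m n).+1%:R) ^+ (m n).+1 * M n @[n --> \oo] --> 0)]].

Lemma chain_le0 m g dn dl eps M t L : chain_data m g dn dl eps M t L -> dl t <= 0.
Proof.
move=> [L0 pr dg gM [dnl epsc dlc Mc]]; rewrite leNgt; apply/negP => dt0.
pose k := dl t / 3; have k0 : 0 < k by rewrite divr_gt0.
have dtk : dl t = 3 * k by rewrite /k; field.
have /cvgrPdist_lt/(_ _ k0) := dlc.
rewrite near_withinE => /nbhs_ballP[r /= r0 Hr].
pose L' := Num.min L (r / 2).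
have L'0 : 0 < L' by rewrite lt_min L0 divr_gt0.
have L'L : L' <= L by rewrite ge_min lexx.
have L'r : L' < r by rewrite gt_min; apply/orP; right; rewrite gtr_pMr// invf_lt1// ltr1n.
have dl2 x : t <= x <= t + L' -> 2 * k <= dl x.
  rewrite le_eqVlt => /andP[/predU1P[<- _|tx xt]]; first by rewrite dtk; lra.
  have h : `|t - x| < r by rewrite ltr0_norm ?subr_lt0//; lra.
  by have := Hr x h tx; rewrite dtk ltr_norml => /andP[? ?]; lra.
have c0 : 0 < 2 / L' by rewrite divr_gt0.
move/cvgrPdistC_lt : epsc => /(_ _ k0)[N1 _ H1].
move/cvgrPdistC_lt : (Mc _ c0) => /(_ _ k0)[N2 _ H2].
pose n := maxn N1 N2.
have := H1 n (leq_maxl _ _); have := H2 n (leq_maxr _ _); rewrite /= !subr0.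
move=> h2 h1 {H1 H2}.
pose l := L' / (m n).+1%:R.
have l0 : 0 < l by rewrite divr_gt0.
have ml : (m n).+1%:R * l = L' by rewrite mulrC divfK// gt_eqF.
have := @iterated_antiderivative_lower_bound R (m n) (g n) t l k (M n) l0 (ltW k0) _ _ _.
rewrite ml => /(_ _ _ _)/wrap[].
- move=> u v tu uv vt; apply: (is_prim_ge (pr n)) => //; first by rewrite (le_trans vt)// lerD2l.
  move=> x /andP[ux xv].
  have xL : t <= x <= t + L' by rewrite (le_trans tu ux) (le_trans xv vt).
  have xL2 : t <= x <= t + L by case/andP: xL => -> /= /le_trans; apply; rewrite lerD2l.
  have := dnl n x xL2; have := dl2 x xL; have := ler_norm (eps n).
  by rewrite ler_norml => ? ? /andP[? ?]; lra.
- move=> i im u /andP[tu ut]; apply: dg => //; rewrite tu/= (le_trans ut)// lerD2l//.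
- move=> u /andP[tu ut]; apply: gM => //; rewrite tu/= (le_trans ut)// lerD2l//.
move=> h.
have : (2 / L' * (m n).+1%:R) ^+ (m n).+1 * M n < k by apply: le_lt_trans h2; exact: ler_norm.
have -> : 2 / L' * (m n).+1%:R = 2 / l.
  by rewrite /l; field; rewrite !gt_eqF.
rewrite expr_div_n mulrAC ltr_pdivrMr ?exprn_gt0//.
by rewrite ltNge h.
Qed.

Lemma chain_vanish m g dn dl eps M t L : chain_data m g dn dl eps M t L -> dl t = 0.
Proof.
move=> H; apply/eqP; rewrite eq_le (chain_le0 H)/=.
rewrite -oppr_le0; case: H => [L0 pr dg gM [dnl epsc dlc Mc]].
apply: (@chain_le0 m (fun n i x => - g n i x) (fun n x => - dn n x) (fun x => - dl x) eps M t L).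
split => //.
- move=> n; have := is_primZ (-1) (pr n).
  by congr is_prim; apply/funext => x; rewrite mulN1r.
- by move=> n i x im xt; apply: is_deriveN; exact: dg.
- by move=> n x xt; rewrite normrN gM.
split => //.
- by move=> n x xt; rewrite -opprD normrN dnl.
- exact: cvgN.
Qed.

Lemma chain_growth (th et x C : R) (m : nat -> nat) (M : nat -> R) c :
  0 <= th -> th < et -> 0 <= x -> 0 <= C -> 0 < c ->
  (forall n, (m n)%:R <= th * n%:R + 3) ->
  (forall n, 0 <= M n <= C * (x ^+ n / Gamma (et * n%:R + 1))) ->
  (c * (m n)%:R) ^+ m n * M n @[n --> \oo] --> 0.
Proof.
move=> th0 thet x0 C0 c0 mth MC.
pose th' := (th + et) / 2.
have th1 : th < th' by rewrite /th'; lra.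
have th2 : th' < et by rewrite /th'; lra.
have th'0 : 0 <= th' by lra.
pose K : R := Num.max 1 (c * expR 1).
have K1 : 1 <= K by rewrite le_max lexx.
have Kc : c * expR 1 <= K by rewrite le_max lexx orbT.
have K0 : 0 < K by apply: lt_le_trans K1.
clearbody K th'.
have [C' C'0 HC'] := Gamma_ratio_geometric th'0 th2 (mulr_ge0 (powR_ge0 K th) x0).
pose B := C * (K `^ 3 * (expR 1 * C')).
have key : \forall n \near \oo, 0 <= (c * (m n)%:R) ^+ m n * M n <= B * 2^-1 ^+ n.
  near=> n.
  have mth' : (m n)%:R <= th' * n%:R.
    apply: le_trans (mth n) _; rewrite addrC -lerBrDr -mulrBl.
    rewrite mulrC -ler_pdivrMr ?subr_gt0//; near: n; exact: nbhs_infty_ger.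
  have /andP[M0 Mn] := MC n.
  have cm0 : 0 <= c * (m n)%:R by rewrite mulr_ge0// ltW.
  rewrite mulr_ge0 ?exprn_ge0//=.
  have G0 : 0 < Gamma (et * n%:R + 1) by apply: Gamma1_gt0; rewrite mulr_ge0//; lra.
  have m1 : (c * (m n)%:R) ^+ m n <= K `^ (m n)%:R * (m n)`!%:R.
    rewrite exprMn powR_mulrn ?(ltW K0)//.
    have h := @expR_ge_exprn R (m n)%:R (m n) (ler0n _ _).
    have f0 : 0 < (m n)`!%:R :> R by rewrite ltr0n fact_gt0.
    move: h; rewrite ler_pdivrMr// => h.
    apply: (@le_trans _ _ (c ^+ m n * (expR (m n)%:R * (m n)`!%:R))).
      by rewrite ler_wpM2l// exprn_ge0// ltW.
    rewrite mulrA ler_wpM2r ?(ltW f0)//.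
    have eE k : expR (k%:R : R) = expR 1 ^+ k by rewrite -expRM_natl mulr1.
    rewrite eE.
    by rewrite -exprMn; apply: lerXn2r => //; rewrite nnegrE ?(ltW K0)// mulr_ge0 ?expR_ge0// ltW.
  have m2 : K `^ (m n)%:R <= K `^ 3 * (K `^ th) ^+ n.
    rewrite -powR_mulrn ?powR_ge0// -powRrM -powRDp//.
    by apply: ler_powR => //; rewrite addrC; exact: mth.
  have m3 : (m n)`!%:R <= expR 1 * Gamma (th' * n%:R + 1).
    by rewrite -Gamma_nat -natr1; apply: Gamma_le_expR.
  have m4 : (c * (m n)%:R) ^+ m n <= (K `^ 3 * (K `^ th) ^+ n) * (expR 1 * Gamma (th' * n%:R + 1)).
    by apply: (le_trans m1); apply: ler_pM => //; exact: powR_ge0.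
  have m5 := ler_pM (exprn_ge0 (m n) cm0) M0 m4 Mn.
  apply: (le_trans m5).
  have h := HC' n; rewrite exprMn in h.
  rewrite -[leLHS](mulfK (lt0r_neq0 G0)) -[leRHS](mulfK (lt0r_neq0 G0)).
  apply: ler_wpM2r; first by rewrite invr_ge0 ltW.
  have D0 : 0 <= C * (K `^ 3 * expR 1) by rewrite mulr_ge0// mulr_ge0 ?powR_ge0 ?expR_ge0.
  have := ler_wpM2l D0 h.
  rewrite /B; move: (Gamma _) (Gamma _) G0 => G1 G2 G20 hh.
  apply: (le_trans (le_trans _ hh)); rewrite le_eqVlt; apply/orP; left; apply/eqP; last by ring.
  by field; rewrite gt_eqF.
apply: (@squeeze_cvgr _ _ _ _ (fun=> 0) (fun n => B * 2^-1 ^+ n)) => //.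
  exact: cvg_cst.
rewrite -[X in _ --> X](mulr0 B); apply: cvgM; first exact: cvg_cst.
by apply: cvg_expr; rewrite ger0_norm// invf_lt1// ltr1n.
Unshelve. all: by end_near. Qed.

End ChainVanish.

Section PrimitiveRegularity.
Context (R : realType).
Implicit Types (F f : R -> R) (b c x K : R).

Lemma is_prim_dist F f b c u v K l : is_prim F f b c -> b <= u -> u <= v -> v <= c ->
  (forall x, u <= x <= v -> `|f x - l| <= K) -> `|F v - F u - l * (v - u)| <= K * (v - u).
Proof.
move=> Ff bu uv vc H.
have h1 : (l - K) * (v - u) <= F v - F u.
  by apply: is_prim_ge Ff bu uv vc _ => x /H; rewrite ler_norml => /andP[? ?]; lra.
have h2 : (- (l + K)) * (v - u) <= -1 * F v - -1 * F u.
  by apply: is_prim_ge (is_primZ (-1) Ff) bu uv vc _ => x /H; rewrite ler_norml => /andP[? ?]; lra.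
rewrite ler_norml; apply/andP; split; first by move: h1; rewrite mulrBl; lra.
by move: h2; rewrite !mulN1r mulNr mulrDl; lra.
Qed.

Lemma is_prim_continuous F f b c K x : is_prim F f b c -> b < x < c ->
  (forall x, b <= x <= c -> `|f x| <= K) -> {for x, continuous F}.
Proof.
move=> Ff /andP[bx xc] fK; apply/cvgrPdist_lt => e e0.
have K0 : 0 <= K by apply: le_trans (fK x _) => //; rewrite !ltW.
have e1 : 0 < e / (K + 1) by rewrite divr_gt0// ltr_wpDl.
have lip u v : b <= u -> u <= v -> v <= c -> `|F v - F u| <= K * (v - u).
  move=> bu uv vc.
  have := @is_prim_dist F f b c u v K 0 Ff bu uv vc; rewrite mul0r subr0; apply.
  by move=> z /andP[uz zv]; rewrite subr0 fK// (le_trans bu uz) (le_trans zv vc).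
near=> s.
have bs : b <= s by apply: ltW; near: s; exact: lt_nbhsr.
have sc : s <= c by apply: ltW; near: s; exact: lt_nbhsl.
have st : `|x - s| < e / (K + 1) by near: s; apply: cvgr_dist_lt.
have h : `|F x - F s| <= K * `|x - s|.
  have [xs|sx] := leP x s.
    by rewrite distrC [`|x - s|]distrC [X in _ * X]ger0_norm ?subr_ge0// lip// ltW.
  by rewrite [X in _ * X]ger0_norm ?subr_ge0 ?(ltW sx)// lip// ltW.
apply: le_lt_trans h _; rewrite ltr_pdivlMr ?ltr_wpDl// in st.
by apply: le_lt_trans st; rewrite mulrC ler_wpM2l// lerDl.
Unshelve. all: by end_near. Qed.

Lemma is_prim_is_derive F f b c x : is_prim F f b c -> b < x < c ->
  {for x, continuous f} -> is_derive x 1 F (f x).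
Proof.
move=> Ff /andP[bx xc] cf; apply: is_derive_cvg; apply/cvgrPdistC_le => e e0.
have /cvgrPdistC_le/(_ e e0) := cf.
rewrite -[nbhs _]/(nbhs x) => /nbhs_ballP[r /= r0 Hr].
near=> h.
have h0 : h != 0 by near: h; exact: nbhs_dnbhs_neq.
have hr : `|h| < r.
  by near: h; apply: nbhs_dnbhs; apply/nbhs_ballP; exists r => // z; rewrite /ball/= sub0r normrN.
have hb : `|h| < x - b.
  near: h; apply: nbhs_dnbhs; apply/nbhs_ballP; exists (x - b); first by rewrite /= subr_gt0.
  by move=> z; rewrite /ball/= sub0r normrN.
have hc : `|h| < c - x.
  near: h; apply: nbhs_dnbhs; apply/nbhs_ballP; exists (c - x); first by rewrite /= subr_gt0.
  by move=> z; rewrite /ball/= sub0r normrN.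
have Hf z : `|z - x| < r -> `|f z - f x| <= e.
  by move=> zx; apply: Hr; rewrite /ball/= distrC.
have key : `|F (x + h) - F x - f x * h| <= e * `|h|.
  case: (boolP (0 <= h)) => [hp|]; last rewrite -ltNge => hn.
    have := @is_prim_dist F f b c x (x + h) e (f x) Ff (ltW bx).
    have -> : x + h - x = h by ring.
    rewrite (ger0_norm hp) in hr hb hc *; apply; [by rewrite lerDl|by rewrite -lerBrDl ltW|].
    move=> z /andP[z1 z2]; apply: Hf; rewrite ger0_norm ?subr_ge0//.
    by apply: le_lt_trans hr; rewrite lerBlDl.
  have := @is_prim_dist F f b c (x + h) x e (f x) Ff.
  have -> : x - (x + h) = - h by ring.
  have -> : F x - F (x + h) - f x * - h = - (F (x + h) - F x - f x * h) by ring.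
  rewrite normrN; rewrite (ltr0_norm hn) in hr hb hc *; apply.
  - by rewrite -lerBlDl -lerN2 opprB ltW.
  - by rewrite gerDl ltW.
  - exact: ltW.
  move=> z /andP[z1 z2]; apply: Hf; rewrite ler0_norm ?subr_le0//.
  by apply: le_lt_trans hr; rewrite lerN2 lerBrDl.
have -> : h^-1 * (F (x + h) - F x) - f x = h^-1 * (F (x + h) - F x - f x * h).
  by field.
by rewrite normrM normfV ler_pdivrMl ?normr_gt0// [leRHS]mulrC.
Unshelve. all: by end_near. Qed.

End PrimitiveRegularity.

Section Sandwich.
Context (R : realType).
Implicit Types (F f : R -> R) (u v x l : R).

(* Convexity of F, with subgradient f. *)
Definition sandwiched F f := forall u v, u <= v ->
  (v - u) * f u <= F v - F u <= (v - u) * f v.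

Let quotient_dist F f x h : sandwiched F f -> h != 0 ->
  `|h^-1 * (F (x + h) - F x) - f x| <= `|f (x + h) - f x|.
Proof.
move=> S h0; have [hp|hn] := ltP 0 h.
  have /andP[l1 l2] := S x (x + h) ltac:(lra).
  have E : x + h - x = h by ring.
  rewrite E in l1 l2.
  have k1 : f x <= h^-1 * (F (x + h) - F x) by rewrite mulrC ler_pdivlMr// mulrC.
  have k2 : h^-1 * (F (x + h) - F x) <= f (x + h) by rewrite mulrC ler_pdivrMr// mulrC.
  by rewrite !ger0_norm ?subr_ge0 ?lerB// (le_trans k1 k2).
have {}hn : 0 < - h by rewrite oppr_gt0 lt_neqAle h0.
have /andP[l1 l2] := S (x + h) x ltac:(lra).
have E : x - (x + h) = - h by ring.
rewrite E in l1 l2.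
have Eq : h^-1 * (F (x + h) - F x) = (- h)^-1 * (F x - F (x + h)).
  by rewrite invrN mulNr -mulrN opprB.
have k1 : f (x + h) <= h^-1 * (F (x + h) - F x).
  by rewrite Eq mulrC ler_pdivlMr// mulrC.
have k2 : h^-1 * (F (x + h) - F x) <= f x by rewrite Eq mulrC ler_pdivrMr// mulrC.
by rewrite !ler0_norm ?subr_le0// ?(le_trans k1 k2)// lerN2 lerB.
Qed.

Lemma sandwiched_derive F f x : sandwiched F f -> {for x, continuous f} ->
  is_derive x 1 F (f x).
Proof.
move=> S cf; apply: is_derive_cvg; apply/cvgrPdistC_lt => e e0.
have cf0 : f (x + h) @[h --> 0^'] --> f x.
  have c1 : x + h @[h --> 0^'] --> x.
    rewrite -[X in _ --> X]addr0; apply: cvgD; first exact: cvg_cst.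
    exact: nbhs_dnbhs.
  exact: cvg_comp c1 cf.
move/cvgrPdistC_lt : cf0 => /(_ e e0) H.
near=> h; have h0 : h != 0 by near: h; exact: nbhs_dnbhs_neq.
apply: le_lt_trans (quotient_dist x S h0) _.
by near: h.
Unshelve. all: by end_near. Qed.

Lemma sandwiched_eq F f x l : sandwiched F f -> is_derive x 1 F l -> f x = l.
Proof.
move=> S [dF eF].
have : h^-1 * (F (x + h) - F x) @[h --> 0^'] --> l.
  rewrite -eF /derive; move: dF; rewrite /derivable => /cvg_ex[l' hl'].
  have E : (fun h : R => h^-1 *: (F (h *: (1:R) + x) - F x)) = (fun h => h^-1 * (F (x + h) - F x)).
    by apply/funext => h; rewrite /GRing.scale/= mulr1 (addrC h).
  by move: hl'; rewrite E => hl'; rewrite (cvg_lim _ hl').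
move/cvgrPdist_lt => H; apply/eqP; rewrite eq_le; apply/andP; split; rewrite leNgt; apply/negP => lf.
  have e0 : 0 < f x - l by rewrite subr_gt0.
  have := H _ e0; rewrite near_withinE => /nbhs_ballP[r /= r0 Hr].
  have r2 : 0 < r / 2 by rewrite divr_gt0.
  have /Hr : ball 0 r (r / 2).
    by rewrite /ball/= sub0r normrN gtr0_norm// gtr_pMr// invf_lt1// ltr1n.
  move=> /(_ (lt0r_neq0 r2)); have /andP[l1 _] := S x (x + r / 2) ltac:(lra).
  have E : x + r / 2 - x = r / 2 by ring.
  rewrite E in l1.
  have k1 : f x <= (r / 2)^-1 * (F (x + r / 2) - F x) by rewrite mulrC ler_pdivlMr// mulrC.
  by rewrite ltr_norml => /andP[? ?]; lra.
have e0 : 0 < l - f x by rewrite subr_gt0.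
have := H _ e0; rewrite near_withinE => /nbhs_ballP[r /= r0 Hr].
have r2 : 0 < r / 2 by rewrite divr_gt0.
have rn : - (r / 2) != 0 by rewrite oppr_eq0 gt_eqF.
have /Hr : ball 0 r (- (r / 2)).
  by rewrite /ball/= sub0r opprK gtr0_norm// gtr_pMr// invf_lt1// ltr1n.
move=> /(_ rn); have /andP[_ l2] := S (x - r / 2) x ltac:(lra).
have E : x - (x - r / 2) = r / 2 by ring.
rewrite E in l2.
have Eq : (- (r / 2))^-1 * (F (x - r / 2) - F x) = (r / 2)^-1 * (F x - F (x - r / 2)).
  by rewrite invrN mulNr -mulrN opprB.
have k1 : (- (r / 2))^-1 * (F (x - r / 2) - F x) <= f x.
  by rewrite Eq ler_pdivrMl.
by rewrite ltr_norml => /andP[? ?]; lra.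
Qed.

End Sandwich.

Section PhiIncrement.
Context (R : realType) d (T : measurableType d).
Context (eta : {sigma_finite_measure set T -> \bar R}) (E : set T) (W D : T -> R).
Hypotheses (mE : measurable E).
Hypotheses (mW : measurable_fun [set: T] W) (mD : measurable_fun [set: T] D).
Hypotheses (W0 : forall x, E x -> 0 <= W x) (D0 : forall x, E x -> 0 <= D x).
Hypothesis etaWD : eta.-integrable E (EFin \o (fun x => expR (- (W x + D x)))).
Variables (r j : R).
Hypotheses (r0 : 0 <= r) (j0 : 0 <= j).

Let bounds (f0 f1 g0 g1 : T -> R) c :
  eta.-integrable E (EFin \o f0) -> eta.-integrable E (EFin \o f1) ->
  eta.-integrable E (EFin \o g0) -> eta.-integrable E (EFin \o g1) ->
  (forall x, E x -> c * g0 x <= f1 x - f0 x <= c * g1 x) ->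
  c * \int[eta]_(x in E) g0 x <= \int[eta]_(x in E) f1 x - \int[eta]_(x in E) f0 x
    <= c * \int[eta]_(x in E) g1 x.
Proof.
move=> if0 if1 ig0 ig1 H.
have i : eta.-integrable E (EFin \o (fun x => f1 x - f0 x)).
  by have := integrableB mE if1 if0.
have j0' : eta.-integrable E (EFin \o (fun x => c * g0 x)) by have := integrableZl mE c ig0.
have j1' : eta.-integrable E (EFin \o (fun x => c * g1 x)) by have := integrableZl mE c ig1.
rewrite -(RintegralB mE if1 if0) -(RintegralZl c mE ig0) -(RintegralZl c mE ig1).
by apply/andP; split; apply: le_Rintegral => // x /H /andP[].
Qed.

Let sandwichMr (c a a0 a1 a' b : R) : 0 <= b -> c * a <= a1 - a0 <= c * a' ->
  c * (a * b) <= a1 * b - a0 * b <= c * (a' * b).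
Proof.
by move=> b0 /andP[h1 h2]; rewrite -mulrBl !mulrA; apply/andP; split; apply: ler_wpM2r.
Qed.

Let sandwichMl (c a a0 a1 a' b : R) : 0 <= b -> c * a <= a1 - a0 <= c * a' ->
  c * (b * a) <= b * a1 - b * a0 <= c * (b * a').
Proof. by move=> b0 h; rewrite ![b * _]mulrC; exact: sandwichMr. Qed.

Let r10 : 0 <= r + 1. Proof. by rewrite addr_ge0. Qed.

Let j10 : 0 <= j + 1. Proof. by rewrite addr_ge0. Qed.

Lemma Phi_sandwiched1 y :
  sandwiched (fun w => Phi eta E W D (r + 1) j (w, y)) (fun w => Phi eta E W D r j (w, y)).
Proof.
move=> u v uv; apply: bounds; try exact: (integrable_Phi mE mW mD W0 D0 etaWD).
move=> x Ex; apply: sandwichMr; first exact: fpow_ge0.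
have := @fpow_incr _ r (u - W x) (v - W x) r0; rewrite lerD2r => /(_ uv).
by have -> : v - W x - (u - W x) = v - u by ring.
Qed.

Lemma Phi_sandwiched2 w :
  sandwiched (fun y => Phi eta E W D r (j + 1) (w, y)) (fun y => Phi eta E W D r j (w, y)).
Proof.
move=> u v uv; apply: bounds; try exact: (integrable_Phi mE mW mD W0 D0 etaWD).
move=> x Ex; apply: sandwichMl; first exact: fpow_ge0.
have := @fpow_incr _ j (u - D x) (v - D x) j0; rewrite lerD2r => /(_ uv).
by have -> : v - D x - (u - D x) = v - u by ring.
Qed.

End PhiIncrement.

Section LevyMean.
Context (R : realType) d (T : measurableType d) (P : probability T R).
Context (X : R -> {RV P >-> R}).
Hypothesis lX : levy_process X.
Notation mu := (@lebesgue_measure R).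
Notation W := (running_sup X).
Notation D := (drawdown X).

Definition levy_mean (phi : R * R -> R) t := \int[P]_w phi (W t w, D t w).

Variables (phi : R * R -> R) (K : R).
Hypotheses (mphi : measurable_fun [set: R * R] phi) (phi0 : forall z, 0 <= phi z).
Hypothesis phiK : forall z, 0 <= z.1 -> 0 <= z.2 -> phi z <= K.

Let cpath w : cadlag (fun s => X s w). Proof. exact: levy_cadlag. Qed.

Let max0 (s : R) : 0 <= s -> Num.max s 0 = s. Proof. by move/max_idPl. Qed.

Let measurable_phiWD t : 0 <= t -> measurable_fun [set: T] (fun w => phi (W t w, D t w)).
Proof.
move=> t0; apply: (measurableT_comp mphi); apply/measurable_fun_pair.
  exact: (measurable_running_sup lX t0).
exact: (measurable_drawdown lX t0).
Qed.

Lemma integrable_levy_mean t : 0 <= t ->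
  P.-integrable [set: T] (EFin \o (fun w => phi (W t w, D t w))).
Proof.
move=> t0; apply: measurable_bounded_integrable => //.
- by rewrite (le_lt_trans (probability_le1 _ _))// ltry.
- exact: measurable_phiWD.
exists K; split; first exact: num_real.
move=> y Ky w _ /=; rewrite ger0_norm// (le_trans _ (ltW Ky))// phiK//.
  exact: (running_sup_ge0 lX).
exact: (drawdown_ge0 lX).
Qed.

Lemma levy_mean_ge0 t : 0 <= levy_mean phi t.
Proof. by apply: Rintegral_ge0 => w _. Qed.

Lemma levy_mean_le t : 0 <= t -> levy_mean phi t <= K.
Proof.
move=> t0; have -> : K = \int[P]_w (cst K w) by rewrite Rintegral_cst//= probability_setT mulr1.
apply: le_Rintegral => //; first exact: integrable_levy_mean.
  apply: measurable_bounded_integrable => //.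
    by rewrite (le_lt_trans (probability_le1 _ _))// ltry.
  by exists `|K|; split; [exact: num_real|move=> y Ky w _ /=; exact: ltW].
move=> w _; apply: phiK; first exact: (running_sup_ge0 lX).
exact: (drawdown_ge0 lX).
Qed.

Let Z (z : measurableTypeR R * T) := (W (Num.max z.1 0) z.2, D (Num.max z.1 0) z.2).

Let measurable_Z : measurable_fun [set: measurableTypeR R * T] (phi \o Z).
Proof.
apply: (measurableT_comp mphi); apply/measurable_fun_pair.
  exact: (measurable_running_sup2 lX).
exact: (measurable_drawdown2 lX).
Qed.

Lemma measurable_levy_mean : measurable_fun [set: R] (fun s => levy_mean phi (Num.max s 0)).
Proof.
have mf : measurable_fun [set: measurableTypeR R * T] (EFin \o (phi \o Z)) by exact/measurable_EFinP.
have f0 z : (0 <= (EFin \o (phi \o Z)) z)%E by rewrite /= lee_fin; exact: phi0.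
have := @measurable_fun_fubini_tonelli_F _ _ _ _ _ P _ mf f0.
have mfine : measurable_fun [set: \bar R] (@fine R) by [].
by move/(measurableT_comp mfine).
Qed.

Lemma levy_mean_fubini (I : set (measurableTypeR R)) (u : R -> R) : measurable I ->
  (forall s, I s -> 0 <= s) -> measurable_fun [set: R] u -> (forall s, 0 <= u s) ->
  (\int[prod_measure mu P]_(z in I `*` [set: T]) (u z.1 * phi (W (Num.max z.1 0) z.2, D (Num.max z.1 0) z.2))%:E =
   \int[mu]_(s in I) (u s * levy_mean phi s)%:E)%E.
Proof.
move=> mI I0 m_u u0.
transitivity (\int[mu]_(s in I) \int[P]_w (u s * phi (W (Num.max s 0) w, D (Num.max s 0) w))%:E)%E.
  apply: (@ge0_integral_setX _ _ _ _ R mu P I setT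
    (fun z => (u z.1 * phi (W (Num.max z.1 0) z.2, D (Num.max z.1 0) z.2))%:E)) => //.
  - apply/measurable_EFinP; apply: measurable_funM => //.
    exact: measurableT_comp m_u measurable_fst.
  - by move=> s w _ _; rewrite lee_fin mulr_ge0.
apply: eq_integral => s /set_mem /I0 s0; rewrite max0//.
have i := integrable_levy_mean s0.
rewrite ge0_integralZl_real//; last exact: measurable_phiWD.
by rewrite -(EFin_Rintegral measurableT i) -EFinM.
Qed.

Lemma levy_mean_right t : continuous phi -> 0 <= t ->
  levy_mean phi s @[s --> t^'+] --> levy_mean phi t.
Proof.
move=> cphi t0; apply/cvg_at_rightP => u [ut uc].
have ut' n : t <= u n by exact: ltW.
have [||||_ h] := @cvg_Rintegral _ T R P setT measurableT (fun n w => phi (W (u n) w, D (u n) w))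
  (fun w => phi (W t w, D t w)) (cst K).
- move=> n; have u0 : 0 <= u n by exact: le_trans t0 (ut' n).
  exact: measurable_phiWD.
- move=> w _.
  have h1 : W (u n) w @[n --> \oo] --> W t w by exact: (rsup_right_cvg (cpath w) t0 ut' uc).
  have h2 : D (u n) w @[n --> \oo] --> D t w.
    by apply: cvgB => //; exact: (cadlag_right_cvg (cpath w) t0 ut' uc).
  exact: (cvg_comp _ _ (cvg_pair h1 h2) (cphi (W t w, D t w))).
- apply: measurable_bounded_integrable => //.
    by rewrite (le_lt_trans (probability_le1 _ _))// ltry.
  by exists `|K|; split; [exact: num_real|move=> y Ky w _ /=; exact: ltW].
- move=> n w _; have u0 : 0 <= u n by exact: le_trans t0 (ut' n).
  rewrite ger0_norm// phiK//; first exact: (running_sup_ge0 lX).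
  exact: (drawdown_ge0 lX).
exact: h.
Qed.

Lemma levy_mean_integrable u v : 0 <= u -> mu.-integrable `[u, v] (EFin \o levy_mean phi).
Proof.
move=> u0.
have m : measurable_fun `[u, v] (levy_mean phi).
  apply: eq_measurable_fun (measurable_funTS measurable_levy_mean) => s.
  by rewrite inE/= in_itv/= => /andP[us _]; rewrite max0// (le_trans u0).
apply: measurable_bounded_integrable => //.
  by rewrite /= lebesgue_measure_itv/=; case: ifP => _; rewrite -?EFinB ltry.
exists K; split; first exact: num_real.
move=> y Ky s; rewrite /= in_itv/= => /andP[us _].
by rewrite ger0_norm ?levy_mean_ge0// (le_trans _ (ltW Ky))// levy_mean_le// (le_trans u0).
Qed.

Lemma levy_mean_prim b :
  is_prim (fun t => \int[mu]_(s in `[0, t]) levy_mean phi s) (levy_mean phi) 0 b.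
Proof.
move=> u v u0 uv _; split; first exact: levy_mean_integrable.
rewrite Rintegral_itvB; [|exact: levy_mean_integrable|by rewrite bnd_simp|by rewrite bnd_simp].
apply: Rintegral_itv_obnd_cbnd.
apply: integrableS (levy_mean_integrable v u0) => //.
by apply: subset_itvr; rewrite bnd_simp.
Qed.

End LevyMean.

Section LaplacePowers.
Context (R : realType) d (T : measurableType d) (P : probability T R).

Lemma is_laplace_eq (phi : R * R -> R) L L' : (forall b g, 1 <= b -> 1 <= g -> L b g = L' b g) ->
  is_laplace phi L -> is_laplace phi L'.
Proof. by move=> LL [I C]; split=> // b g b1 g1; rewrite -LL//; exact: I. Qed.

Lemma is_laplace_fpow (p q : R) : 0 < p -> 0 < q ->
  is_laplace (fun z => fpow p z.1 * fpow q z.2)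
    (fun b g => b `^ (- (p + 1)) * g `^ (- (q + 1))).
Proof.
move=> p0 q0.
have i1 : P.-integrable [set: T] (EFin \o (fun w : T => expR (- (cst (0 : R) w + cst (0 : R) w)))).
  have -> : (fun w : T => expR (- (cst (0 : R) w + cst (0 : R) w))) = cst 1.
    by apply/funext => w /=; rewrite addr0 oppr0 expR0.
  apply: measurable_bounded_integrable => //.
    by rewrite (le_lt_trans (probability_le1 _ _))// ltry.
  by exists 1; split; [exact: num_real|move=> y y1 w _ /=; rewrite normr1 ltW].
have := @is_laplace_Phi R d T P setT (cst 0) (cst 0) measurableT (measurable_cst _)
  (measurable_cst _) (fun=> fun=> lexx _) (fun=> fun=> lexx _) i1 p q p0 q0.
congr is_laplace.
  apply/funext => z; rewrite /Phi/= !subr0.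
  by rewrite Rintegral_cst//= probability_setT mulr1.
apply/funext => b; apply/funext => g.
rewrite (_ : (fun x : T => _) = cst (1 : R)); last first.
  by apply/funext => x; rewrite !mulr0 addr0 oppr0 expR0.
by rewrite Rintegral_cst//= probability_setT !mulr1.
Qed.

End LaplacePowers.

Section TimeTransform.
Context (R : realType) d (T : measurableType d) (P : probability T R).
Context (X : R -> {RV P >-> R}) (alpha : R).
Hypotheses (lX : levy_process X) (a12 : 1 < alpha < 2).
Hypothesis laplaceX : forall t q : R, 0 < t -> 0 <= q ->
  'E_P[fun w => expR (- q * X t w)]%E = (expR (t * q `^ alpha))%:E.
Notation mu := (@lebesgue_measure R).
Notation a := (alpha^-1).
Notation W := (running_sup X).
Notation D := (drawdown X).

Definition time_prob : {sigma_finite_measure set (measurableTypeR R * T)%type -> \bar R} :=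
  prod_measure mu P.
Let E : set (measurableTypeR R * T)%type := `]0, +oo[%classic `*` setT.
Let W2 (z : measurableTypeR R * T) : R := z.1.
Let D2 (z : measurableTypeR R * T) : R := D (Num.max z.1 0) z.2.

Let mE : measurable E. Proof. exact: measurableX. Qed.
Let mW2 : measurable_fun [set: measurableTypeR R * T] W2. Proof. exact: measurable_fst. Qed.
Let mD2 : measurable_fun [set: measurableTypeR R * T] D2.
Proof. exact: (measurable_drawdown2 lX). Qed.
Let W20 z : E z -> 0 <= W2 z.
Proof. by move=> [/= + _]; rewrite in_itv/= andbT => /ltW. Qed.
Let D20 z : E z -> 0 <= D2 z.
Proof. by move=> _; apply: (drawdown_ge0 lX); rewrite le_max lexx orbT. Qed.

Let a0 : 0 < alpha. Proof. by move/andP: a12 => [/(lt_trans ltr01)]. Qed.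
Let av0 : 0 < a. Proof. by rewrite invr_gt0. Qed.

Let mI : measurable (`]0, +oo[%classic : set (measurableTypeR R)).
Proof. exact: measurable_itv. Qed.

Let I0 (s : R) : `]0, +oo[%classic s -> 0 <= s.
Proof. by rewrite /= in_itv/= andbT => /ltW. Qed.

Let time_integral b g : 0 < b -> 0 < g ->
  (\int[time_prob]_(z in E) (expR (- (b * W2 z + g * D2 z)))%:E =
   (b `^ (a - 1) / (b `^ a + g))%:E)%E.
Proof.
move=> b0 g0; rewrite -(levy_lap_time lX a12 laplaceX b0 g0).
have lap1 (z : R * R) : 0 <= z.1 -> 0 <= z.2 -> lap 0 g z <= 1.
  move=> z1 z2; rewrite -expR0 ler_expR oppr_le0 mul0r add0r mulr_ge0//; exact: ltW.
have lap0 (z : R * R) : 0 <= lap 0 g z by exact: expR_ge0.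
have mlap : measurable_fun [set: R * R] (lap 0 g).
    apply: measurableT_comp => //; apply: measurableT_comp => //.
    by apply: measurable_funD; exact: measurable_funM.
have mu' : measurable_fun [set: R] (fun s => expR (- (b * s))).
  by apply: measurableT_comp => //; apply: measurableT_comp => //; exact: measurable_funM.
have := levy_mean_fubini lX mlap lap0 lap1 mI I0 mu' (fun s => expR_ge0 _).
move=> <-; apply: eq_integral => z _; congr EFin.
by rewrite /lap/= mul0r add0r -expRD opprD.
Qed.

Let etaWD : time_prob.-integrable E (EFin \o (fun x => expR (- (W2 x + D2 x)))).
Proof.
apply: ge0_integrable => //.
- apply: measurable_funTS; apply: measurableT_comp => //; apply: measurableT_comp => //.
  exact: measurable_funD.
- have := time_integral ltr01 ltr01.
  rewrite (_ : (fun z => _) = fun z => (expR (- (W2 z + D2 z)))%:E); last first.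
    by apply/funext => z; rewrite !mul1r.
  by move=> ->; rewrite ltry.
Qed.

Definition psi := Phi time_prob E W2 D2.

Lemma is_laplace_psi (r j : R) : 0 < r -> 0 < j -> is_laplace (psi r j)
  (fun b g => b `^ (- (r + 1)) * g `^ (- (j + 1)) * (b `^ (a - 1) / (b `^ a + g))).
Proof.
move=> r0 j0; apply: is_laplace_eq (is_laplace_Phi mE mW2 mD2 W20 D20 etaWD r0 j0).
move=> b g b1 g1; congr (_ * _); rewrite /Rintegral time_integral//.
  exact: lt_le_trans b1.
exact: lt_le_trans g1.
Qed.

Lemma psi_step (r j t y : R) : 0 < r - a -> 0 < j -> 0 < t -> 0 < y ->
  psi r j (t, y) = fpow (r + 1 - a) t * fpow (j + 1) y - psi (r - a) (j + 1) (t, y).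
Proof.
move=> ra j0 t0 y0; have r0 : 0 < r by apply: lt_trans av0 _; rewrite -subr_gt0.
have j1 : 0 < j + 1 by rewrite addr_gt0.
have p0 : 0 < r + 1 - a by rewrite addrAC addr_gt0.
have := @is_laplace_inj _ _ _ _ _ t y
  (is_laplaceD (is_laplace_psi r0 j0) (is_laplace_psi ra j1)) (is_laplace_fpow P p0 j1).
move=> /(_ _ t0 y0) /= <-; first by rewrite addrK.
move=> b g b1 g1; have b0 : 0 < b by exact: lt_le_trans b1.
have g0 : 0 < g by exact: lt_le_trans g1.
have -> : - (j + 1 + 1) = - (j + 1) - 1 by ring.
rewrite (powRBp (- (j + 1)) 1 g0) powRr1 ?(ltW g0)//.
have -> : - (r - a + 1) = - (r + 1) + a by ring.
have -> : - (r + 1 - a + 1) = - (r + 1) + (a - 1) by ring.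
rewrite !(powRDp _ _ b0).
have B0 : 0 < b `^ a by exact: powR_gt0.
move: (b `^ a) (b `^ - _) (b `^ - _) (g `^ _) B0 => B C1 C2 G B0.
by field; rewrite !gt_eqF ?addr_gt0.
Qed.

Lemma psi_expand N (r j t y : R) : 0 < r - a * N%:R -> 0 < j -> 0 < t -> 0 < y ->
  psi r j (t, y) = \sum_(k < N) (-1) ^+ k * (fpow (r + 1 - a * k.+1%:R) t * fpow (j + k.+1%:R) y)
    + (-1) ^+ N * psi (r - a * N%:R) (j + N%:R) (t, y).
Proof.
move=> rN j0 t0 y0.
suff H (f h : R -> R -> R) : (forall r j, 0 < r - a -> 0 < j -> f r j = h r j - f (r - a) (j + 1)) ->
    0 < r - a * N%:R -> f r j = \sum_(k < N) (-1) ^+ k * h (r - a * k%:R) (j + k%:R)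
      + (-1) ^+ N * f (r - a * N%:R) (j + N%:R).
  have S r' j' (r'0 : 0 < r' - a) (j'0 : 0 < j') := psi_step r'0 j'0 t0 y0.
  refine (etrans (H (fun r j => psi r j (t, y)) (fun r j => fpow (r + 1 - a) t * fpow (j + 1) y) S rN) _).
  have e1 (k : nat) : r - a * k%:R + 1 - a = r + 1 - a * k.+1%:R by rewrite -natr1; ring.
  have e2 (k : nat) : j + k%:R + 1 = j + k.+1%:R by rewrite -addrA natr1.
  apply: (f_equal (fun x => x + _)); apply: eq_bigr => k _.
  by rewrite e1 e2.
move=> fh; elim: {rN} N => [|N IH] rN.
  by rewrite big_ord0 mulr0 subr0 addr0 add0r mul1r.
have E1 : a * N.+1%:R = a * N%:R + a by rewrite -natr1 mulrDr mulr1.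
have rN' : 0 < r - a * N%:R by apply: lt_trans rN _; rewrite E1 opprD addrA gtrBl.
rewrite (IH rN') big_ord_recr/= -addrA; congr (_ + _).
rewrite [in LHS]fh; last 2 first.
- by rewrite E1 opprD addrA in rN.
- by rewrite ltr_wpDr.
rewrite exprS mulN1r mulrBr mulNr E1 opprD addrA.
by congr (_ - _ * f _ _); rewrite -addrA natr1.
Qed.

Definition mean_pow (j y s : R) := levy_mean X (fun z => fpow j (y - z.2)) s.

Section MeanPow.
Variables (j y : R).
Hypothesis j0 : 0 <= j.

Let mphi : measurable_fun [set: R * R] (fun z : R * R => fpow j (y - z.2)).
Proof. by apply: measurable_fpow; exact: measurable_funB. Qed.
Let phi0 (z : R * R) : 0 <= fpow j (y - z.2). Proof. exact: fpow_ge0. Qed.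
Let phiK (z : R * R) : 0 <= z.1 -> 0 <= z.2 -> fpow j (y - z.2) <= fpow j y.
Proof. by move=> _ z2; apply: le_fpow => //; rewrite gerBl. Qed.

Let pow_u (r t s : R) : 0 <= r -> 0 <= fpow r (t - s). Proof. exact: fpow_ge0. Qed.
Let m_u (r t : R) : measurable_fun [set: R] (fun s => fpow r (t - s)).
Proof. by apply: measurable_fpow; exact: measurable_funB. Qed.

Lemma mean_pow_ge0 s : 0 <= mean_pow j y s.
Proof. exact: levy_mean_ge0. Qed.

Lemma mean_pow_le s : 0 <= s -> mean_pow j y s <= fpow j y.
Proof. exact: (levy_mean_le lX mphi phi0 phiK). Qed.

Lemma psiE (r t : R) : 0 <= r -> (psi r j (t, y))%:E =
  (\int[mu]_(s in `]0%R, t[) (fpow r (t - s) * mean_pow j y s)%:E)%E.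
Proof.
move=> r0.
have i := integrable_Phi mE mW2 mD2 W20 D20 etaWD r0 j0 (t, y).
rewrite /psi /Phi (EFin_Rintegral mE i).
have := levy_mean_fubini lX mphi phi0 phiK mI I0 (m_u r t) (fun s => pow_u t s r0).
move=> ->.
have -> : `]0, t[%classic = `]0, +oo[%classic `&` [set s | s < t].
  apply/seteqP; split => s; rewrite /= !in_itv/= andbT; first by case/andP.
  by move=> [-> ->].
rewrite integral_mkcondr; apply: eq_integral => s _.
rewrite patchE; case: ifPn => //; rewrite notin_setE/= => /negP; rewrite -leNgt => ts.
by rewrite fpow_le0 ?subr_le0// mul0r.
Qed.

Lemma psi_le (r t : R) : 0 <= r -> 0 < t -> psi r j (t, y) <= t * (fpow r t * fpow j y).
Proof.
move=> r0 t0; rewrite -lee_fin psiE//.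
have mIt : measurable (`]0, t[%classic : set (measurableTypeR R)) by exact: measurable_itv.
apply: (@le_trans _ _ (\int[mu]_(s in `]0%R, t[) (fpow r t * fpow j y)%:E)%E).
  apply: ge0_le_integral => //.
  - by move=> s _; rewrite lee_fin mulr_ge0 ?fpow_ge0 ?mean_pow_ge0.
  - apply/measurable_EFinP; apply: measurable_funM; first by apply: measurable_funTS; exact: m_u.
    apply: eq_measurable_fun (measurable_funTS (measurable_levy_mean lX mphi phi0)) => s.
    by rewrite inE/= in_itv/= => /andP[s0 _]; rewrite (max_idPl _)// ltW.
  - move=> s; rewrite /= in_itv/= => /andP[s0 st]; rewrite lee_fin.
    rewrite ler_pM ?fpow_ge0 ?mean_pow_ge0//.
      by apply: le_fpow => //; rewrite gerBl ltW.
    by apply: mean_pow_le; exact: ltW.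
by rewrite integral_cst//= lebesgue_measure_itv/= lte_fin t0 -EFinB subr0 -EFinM mulrC.
Qed.

Lemma psi_ge0 (r t : R) : 0 <= r -> 0 <= psi r j (t, y).
Proof. by move=> r0; apply: Phi_ge0. Qed.

Lemma psi0E (t : R) : psi 0 j (t, y) = \int[mu]_(s in `[0, t]) mean_pow j y s.
Proof.
have := psiE t (lexx 0) => /(congr1 (@fine R)) /= ->.
rewrite /Rintegral; congr fine.
transitivity (\int[mu]_(s in `]0%R, t[) (mean_pow j y s)%:E)%E.
  apply: eq_integral => s; rewrite inE/= in_itv/= => /andP[s0 st].
  by rewrite fpowE ?subr_gt0// powRr0 add0r Gamma1 divr1 mul1r.
have mm (I : set R) : (forall s, I s -> 0 <= s) -> measurable_fun I (EFin \o mean_pow j y).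
  move=> I0'; apply/measurable_EFinP.
  apply: eq_measurable_fun (measurable_funTS (measurable_levy_mean lX mphi phi0)) => s.
  by rewrite inE => /I0' s0; rewrite (max_idPl _).
rewrite integral_itv_bndo_bndc; last first.
  by apply: mm => s; rewrite /= in_itv/= => /andP[/ltW].
rewrite integral_itv_obnd_cbnd//.
by apply: mm => s; rewrite /= in_itv/= => /andP[/ltW].
Qed.

Lemma psi_prim b : is_prim (fun t => psi 0 j (t, y)) (mean_pow j y) 0 b.
Proof.
have := levy_mean_prim lX mphi phi0 phiK (b:=b).
by congr is_prim; apply/funext => t; rewrite psi0E.
Qed.

Lemma psi_sandwiched (r : R) : 0 <= r ->
  sandwiched (fun t => psi (r + 1) j (t, y)) (fun t => psi r j (t, y)).
Proof. by move=> r0; apply: (Phi_sandwiched1 mE mW2 mD2 W20 D20 etaWD). Qed.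

Lemma psi_derive (n : nat) (t : R) : 0 < t ->
  is_derive t 1 (fun t => psi n.+1%:R j (t, y)) (psi n%:R j (t, y)).
Proof.
move=> t0.
have E1 (k : nat) : k.+1%:R = k%:R + 1 :> R by rewrite natr1.
elim: n t t0 => [|n IH] t t0; rewrite E1; apply: (sandwiched_derive (psi_sandwiched _)) => //.
  apply: (@is_prim_continuous R _ (mean_pow j y) 0 (t + 1) (fpow j y)).
  - exact: psi_prim.
  - by rewrite t0/= ltrDl.
  - by move=> s /andP[s0 _]; rewrite ger0_norm ?mean_pow_ge0 ?mean_pow_le.
apply: differentiable_continuous; apply/derivable1_diffP.
by have [] := IH t t0.
Qed.

End MeanPow.
End TimeTransform.

Section StableSeries.
Context (R : realType).
Variable a : R.
Hypotheses (a2 : 2^-1 < a) (a1 : a < 1).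
Implicit Types (t y j x : R).

Let a0 : 0 < a. Proof. by apply: lt_trans a2. Qed.

Lemma is_derive_continuous (f : R -> R) x l : is_derive x 1 f l -> {for x, continuous f}.
Proof. by move=> [df _]; apply: differentiable_continuous; exact/derivable1_diffP. Qed.

Lemma is_derive_sumn (f : nat -> R -> R) (df : nat -> R) N x :
  (forall k, (k < N)%N -> is_derive x 1 (f k) (df k)) ->
  is_derive x 1 (fun z => \sum_(k < N) f k z) (\sum_(k < N) df k).
Proof.
elim: N => [|N IH] H.
  rewrite big_ord0.
  have -> : (fun z => \sum_(k < 0) f k z) = cst 0 by apply/funext => z; rewrite big_ord0.
  exact: is_derive_cst.
rewrite big_ord_recr/=.
have -> : (fun z => \sum_(k < N.+1) f k z) = (fun z => \sum_(k < N) f k z + f N z).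
  by apply/funext => z; rewrite big_ord_recr.
by apply: is_deriveD; [apply: IH => k kN; apply: H; exact: ltnW|exact: H].
Qed.

Definition tbound t0 k : R := 2 * (2 * t0 `^ (- a)) ^+ k.+1 * Gamma (a * k.+1%:R + 1).
Definition nbound t0 n : R := (2 / t0) ^+ n * n`!%:R.

Lemma tbound_ge0 t0 k : 0 <= tbound t0 k.
Proof.
rewrite /tbound mulr_ge0//; last by apply/ltW/Gamma1_gt0; rewrite mulr_ge0// ltW.
by rewrite mulr_ge0// exprn_ge0// mulr_ge0// powR_ge0.
Qed.

Lemma nbound_ge0 t0 n : 0 < t0 -> 0 <= nbound t0 n.
Proof. by move=> t00; rewrite mulr_ge0// exprn_ge0// divr_ge0// ltW. Qed.

Let Gamma_shift (k n : nat) : Gamma (a * k.+1%:R + n%:R) <=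
  2 * Gamma (a * k.+1%:R + 1) * (n`!%:R * 2 ^+ (k.+1 + n)).
Proof.
set s := a * k.+1%:R; have s0 : 0 < s by rewrite mulr_gt0.
have sa : a <= s by rewrite ler_peMr ?(ltW a0)// ler1n.
have sk : s <= k.+1%:R by rewrite ler_piMl// ltW.
have G0 := Gamma1_gt0 (ltW s0).
case: n => [|n].
  rewrite addr0 addn0 fact0 mul1r.
  have := G0; rewrite GammaS// => G1.
  have G2 : 0 < Gamma s by rewrite Gamma_gt0.
  have p2 : 1 <= 2 ^+ k.+1 :> R by rewrite exprn_ege1// ler1n.
  have s2 : 1 <= 2 * s by move: sa a2; rewrite -[2^-1]mul1r ltr_pdivrMr// mulrC; lra.
  rewrite -[leLHS]mul1r mulrA [leRHS]mulrAC ler_wpM2r ?(ltW G2)//.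
  by rewrite -[leLHS]mulr1; apply: ler_pM.
rewrite -natr1 addrA; apply: (le_trans (Gamma_addn_le n (ltW s0) sk)).
rewrite -!mulrA [leRHS]mulrCA; apply: ler_wpM2l; first exact: ltW.
rewrite mulrCA; apply: ler_pM => //.
  by rewrite ler_nat leq_fact.
apply: (@le_trans _ _ (2 ^+ (k.+1 + n.+1))); last by rewrite ler_peMl ?ler1n ?exprn_ge0.
by apply: ler_weXn2l; [rewrite ler1n|rewrite leq_add2l].
Qed.

Lemma normr_fpowR_le t0 t (k n : nat) : 0 < t0 -> t0 <= t ->
  `|fpowR (- n%:R - a * k.+1%:R) t| <= tbound t0 k * nbound t0 n.
Proof.
move=> t00 t0t; have t0' : 0 < t by exact: lt_le_trans t0t.
set s := a * k.+1%:R; have s0 : 0 < s by rewrite mulr_gt0.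
rewrite -opprD addrC opprD; apply: (le_trans (normr_fpowR_neg_le n s0 t0')).
have h1 : t `^ (- s - n%:R) <= (t0 `^ (- a)) ^+ k.+1 * t0^-1 ^+ n.
  have -> : (t0 `^ (- a)) ^+ k.+1 = t0 `^ (- s).
    by rewrite -powR_mulrn ?powR_ge0// -powRrM mulNr.
  have -> : t0^-1 ^+ n = t0 `^ (- n%:R).
    by rewrite powRN powR_mulrn ?(ltW t00)// exprVn.
  rewrite -powRDp// -opprD !powRN lef_pV2 ?posrE ?powR_gt0//.
  by apply: ge0_ler_powR; rewrite ?nnegrE ?addr_ge0 ?(ltW s0) ?(ltW t00) ?(ltW t0').
have h2 := Gamma_shift k n; rewrite -/s in h2.
have G0 : 0 <= Gamma (s + n%:R) by apply/ltW/Gamma_gt0; rewrite ltr_wpDr.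
apply: (le_trans (ler_pM (powR_ge0 _ _) G0 h1 h2)).
rewrite /tbound /nbound -/s !exprMn exprD.
move: (Gamma (s + 1)) (2 ^+ k.+1 : R) (2 ^+ n : R) ((t0 `^ (- a)) ^+ k.+1) (t0^-1 ^+ n) (n`!%:R : R) => A B C D F G.
by rewrite le_eqVlt; apply/orP; left; apply/eqP; ring.
Qed.

Lemma tbound_geometric t0 y j : 0 < t0 -> 0 < y -> -1 <= j -> exists2 C, 0 <= C &
  forall k, tbound t0 k * fpow (j + k.+1%:R) y <= C * 2^-1 ^+ k.
Proof.
move=> t00 y0 j1; have x0 : 0 <= 2 * (2 * t0 `^ (- a)) * y by rewrite !mulr_ge0// ?powR_ge0// ltW.
have [C C0 HC] := Gamma_ratio_geometric (ltW a0) a1 x0.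
exists (2 * C * expR 1 * y `^ j).
  by rewrite !mulr_ge0 ?expR_ge0 ?powR_ge0// ltW.
move=> k; have jk : 0 <= j + k.+1%:R by rewrite -natr1 addrCA addr_ge0//; lra.
rewrite fpowE// powRDp// powR_mulrn ?(ltW y0)//.
have h := HC k.+1; rewrite mul1r natr1 Gamma_nat factS natrM in h.
have G0 : 0 < Gamma (j + k.+1%:R + 1) by exact: Gamma1_gt0.
have hG : k`!%:R <= expR 1 * Gamma (j + k.+1%:R + 1).
  rewrite -Gamma_nat -natr1; apply: Gamma_le_expR; first exact: ler0n.
  have j1' : 0 <= j + 1 by rewrite -lerBlDr sub0r.
  by rewrite addrCA lerDl.
have hk : k.+1%:R <= 2 ^+ k.+1 :> R by rewrite -natrX ler_nat ltnW// ltn_expl.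
have p0 : 0 < 2 ^+ k.+1 :> R by rewrite exprn_gt0.
have h2 : 2^-1 ^+ k.+1 * k.+1%:R <= 1 :> R by rewrite exprVn mulrC ler_pdivrMr// mul1r.
have yj0 : 0 <= y `^ j by exact: powR_ge0.
rewrite mulrA ler_pdivrMr//.
apply: (@le_trans _ _ (2 * y `^ j * 2^-1 ^+ k.+1 * (Gamma (a * k.+1%:R + 1) * (2 * (2 * t0 `^ (- a)) * y) ^+ k.+1))).
  rewrite /tbound !exprMn.
  have E : 2^-1 ^+ k.+1 * 2 ^+ k.+1 = 1 :> R by rewrite exprVn mulVf// gt_eqF.
  move: (Gamma _) (2^-1 ^+ k.+1) (2 ^+ k.+1 : R) ((t0 `^ (- a)) ^+ k.+1) (y `^ j) (y ^+ k.+1) E => A V B D F G E.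
  rewrite le_eqVlt; apply/orP; left; apply/eqP.
  transitivity (2 * (B * D) * A * F * G * (V * B)); last by ring.
  by rewrite E; ring.
have q0 : 0 <= 2 * y `^ j * 2^-1 ^+ k.+1 by rewrite !mulr_ge0// exprn_ge0.
apply: (le_trans (ler_wpM2l q0 h)).
have f0 : 0 <= k`!%:R :> R by [].
have h3 : k`!%:R * (2^-1 ^+ k.+1 * k.+1%:R) <= expR 1 * Gamma (j + k.+1%:R + 1).
  by rewrite -[leRHS]mulr1; apply: ler_pM => //; rewrite mulr_ge0// exprn_ge0.
have c0 : 0 <= 2 * y `^ j * C * 2^-1 ^+ k.
  by apply: mulr_ge0; [apply: mulr_ge0; [exact: mulr_ge0|exact: ltW]|exact: exprn_ge0].
have h4 := ler_wpM2l c0 h3.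
have v1 : 2^-1 ^+ k.+1 <= 2^-1 ^+ k :> R.
  by rewrite exprS ler_piMl ?exprn_ge0// invf_le1// ler1n.
apply: (@le_trans _ _ (2 * y `^ j * C * 2^-1 ^+ k * (k`!%:R * (2^-1 ^+ k.+1 * k.+1%:R)))).
  have w0 : 0 <= 2 * y `^ j * C * (k`!%:R * (2^-1 ^+ k.+1 * k.+1%:R)).
    by apply: mulr_ge0; [apply: mulr_ge0; [exact: mulr_ge0|exact: ltW]|rewrite !mulr_ge0// exprn_ge0].
  have := ler_wpM2l w0 v1.
  move: (2^-1 ^+ k.+1) (2^-1 ^+ k) (y `^ j) (k`!%:R : R) (k.+1%:R : R) => V V' F G H hh.
  apply: (le_trans (le_trans _ hh)); rewrite le_eqVlt; apply/orP; left; apply/eqP; ring.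
apply: (le_trans h4); rewrite le_eqVlt; apply/orP; left; apply/eqP.
by move: (Gamma _) (y `^ j) (expR 1) => A F G; ring.
Qed.

Definition sterm j y x (k : nat) t : R :=
  (-1) ^+ k * (fpowR (x - a * k.+1%:R) t * fpow (j + k.+1%:R) y).

Definition Fs x j t y := limn (series (fun k => sterm j y x k t)).

Lemma is_derive_sterm j y x k t : 0 < t ->
  is_derive t 1 (sterm j y x k) (sterm j y (x - 1) k t).
Proof.
move=> t0; rewrite /sterm.
have h := is_derive_fpowR (x - a * k.+1%:R) t0.
have -> : (fun t => (-1) ^+ k * (fpowR (x - a * k.+1%:R) t * fpow (j + k.+1%:R) y)) =
    (fun t => ((-1) ^+ k * fpow (j + k.+1%:R) y) * fpowR (x - a * k.+1%:R) t).
  by apply/funext => u; rewrite [_ * fpow _ _]mulrC mulrA.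
have -> : (-1) ^+ k * (fpowR (x - 1 - a * k.+1%:R) t * fpow (j + k.+1%:R) y) =
    ((-1) ^+ k * fpow (j + k.+1%:R) y) * fpowR (x - a * k.+1%:R - 1) t.
  by rewrite [_ * fpow _ _]mulrC mulrA [x - 1 - _]addrAC.
exact: is_deriveZ.
Qed.

Lemma normr_sterm_le j y y0 t t0 (k n : nat) : -1 <= j -> 0 < t0 -> t0 <= t -> y <= y0 ->
  `|sterm j y (- n%:R) k t| <= tbound t0 k * fpow (j + k.+1%:R) y0 * nbound t0 n.
Proof.
move=> j1 t00 t0t yy0.
have jk : 0 <= j + k.+1%:R by rewrite -natr1 addrCA addr_ge0//; lra.
rewrite normrM normrX normrN1 expr1n mul1r normrM [X in _ * X]ger0_norm ?fpow_ge0//.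
rewrite [leRHS]mulrAC; apply: ler_pM; rewrite ?fpow_ge0//.
  exact: normr_fpowR_le.
exact: le_fpow.
Qed.

Lemma cvg_tbound t0 y j V : 0 < t0 -> 0 < y -> -1 <= j ->
  cvgn (series (fun k => tbound t0 k * fpow (j + k.+1%:R) y * V)).
Proof.
move=> t00 y0 j1; have [C C0 HC] := tbound_geometric t00 y0 j1.
apply: (@series_norm_le _ _ (fun k => C * `|V| * 2^-1 ^+ k)); last exact: cvg_geometric_half.
move=> k; rewrite normrM [leRHS]mulrAC ler_wpM2r//.
have jk : 0 <= j + k.+1%:R by rewrite -natr1 addrCA addr_ge0//; lra.
by rewrite ger0_norm ?HC// mulr_ge0 ?tbound_ge0 ?fpow_ge0.
Qed.

Lemma cvg_sterm j y t (n : nat) : -1 <= j -> 0 < t -> 0 < y ->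
  cvgn (series (fun k => sterm j y (- n%:R) k t)).
Proof.
move=> j1 t0 y0; apply: (series_norm_le _ (@cvg_tbound t y j (nbound t n) t0 y0 j1)) => k.
exact: normr_sterm_le.
Qed.

Lemma is_derive_Fs j y t (n : nat) : -1 <= j -> 0 < t -> 0 < y ->
  is_derive t 1 (fun t => Fs (- n%:R) j t y) (Fs (- n.+1%:R) j t y).
Proof.
move=> j1 t0 y0; have t2 : 0 < t / 2 by rewrite divr_gt0.
have H z : `|z - t| < t / 2 -> t / 2 <= z /\ 0 < z.
  by rewrite ltr_norml => /andP[h _]; split; lra.
apply: (@is_derive_series _ (sterm j y (- n%:R)) (sterm j y (- n.+1%:R)) _ _ _ t2
  (@cvg_tbound (t / 2) y j (nbound (t / 2) n.+1) t2 y0 j1)).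
- move=> k z /H[_ z0]; have -> : - n.+1%:R = - n%:R - 1 :> R by rewrite -natr1 opprD.
  exact: is_derive_sterm.
- by move=> k z /H[z0 _]; exact: normr_sterm_le.
- by move=> z /H[_ z0]; exact: cvg_sterm.
Qed.

Definition Fs_majorant j t y : R := limn (series (fun k => tbound t k * fpow (j + k.+1%:R) y)).

Lemma normr_Fs_le j y y0 t u (n : nat) : -1 <= j -> 0 < t -> t <= u -> 0 < y0 -> y <= y0 ->
  `|Fs (- n%:R) j u y| <= Fs_majorant j t y0 * nbound t n.
Proof.
move=> j1 t0 tu y00 yy0.
have c1 := @cvg_tbound t y0 j 1 t0 y00 j1.
have c2 := @cvg_tbound t y0 j (nbound t n) t0 y00 j1.
have h : `|Fs (- n%:R) j u y| <=
    limn (series (fun k => tbound t k * fpow (j + k.+1%:R) y0 * nbound t n)).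
  have := @series_tail_le _ (fun k => sterm j y (- n%:R) k u) _ 0 _ c2.
  rewrite /series/= !big_geq// !subr0; apply=> k.
  exact: (@normr_sterm_le j y y0 u t k n j1 t0 tu yy0).
apply: (le_trans h); rewrite le_eqVlt; apply/orP; left; apply/eqP.
apply/cvg_lim => //.
have -> : series (fun k => tbound t k * fpow (j + k.+1%:R) y0 * nbound t n) =
    (fun N => series (fun k => tbound t k * fpow (j + k.+1%:R) y0) N * nbound t n).
  by apply/funext => N; rewrite /series/= mulr_suml.
apply: cvgM; last exact: cvg_cst.
by have := c1; rewrite (_ : (fun k => _ * 1) = fun k => tbound t k * fpow (j + k.+1%:R) y0)//; apply/funext => k; rewrite mulr1.
Qed.

End StableSeries.

Section DrawdownMeans.
Context (R : realType) d (T : measurableType d) (P : probability T R).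
Context (X : R -> {RV P >-> R}) (alpha : R).
Hypotheses (lX : levy_process X) (a12 : 1 < alpha < 2).
Hypothesis laplaceX : forall t q : R, 0 < t -> 0 <= q ->
  'E_P[fun w => expR (- q * X t w)]%E = (expR (t * q `^ alpha))%:E.
Notation a := (alpha^-1).

Let alpha0 : 0 < alpha. Proof. by move/andP: a12 => [/(lt_trans ltr01)]. Qed.
Let a0 : 0 < a. Proof. by rewrite invr_gt0. Qed.

Lemma inv_alpha_lt1 : a < 1.
Proof. by rewrite invf_lt1//; move/andP: a12 => []. Qed.

Lemma inv_alpha_gt_half : 2^-1 < a.
Proof. by rewrite ltf_pV2 ?posrE//; move/andP: a12 => []. Qed.

Let a1 := inv_alpha_lt1.
Let a2 := inv_alpha_gt_half.

Lemma is_primS (F f : R -> R) b c b' c' : b <= b' -> c' <= c -> is_prim F f b c -> is_prim F f b' c'.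
Proof.
by move=> bb cc H u v bu uv vc; apply: H => //; [exact: le_trans bu|exact: le_trans vc cc].
Qed.

Let powsum j y N x t := \sum_(k < N) sterm a j y x k t.

Let is_derive_powsum (j y : R) N (x t : R) : 0 < t ->
  is_derive t 1 (powsum j y N x) (powsum j y N (x - 1) t).
Proof. move=> t0.
apply: (@is_derive_sumn _ (sterm a j y x) (fun k => sterm a j y (x - 1) k t) N t) => k _.
exact: is_derive_sterm. Qed.

(* m N > a N keeps the power of t in the remainder of psi_expand positive. *)
Let m N := (Num.truncn (a * N%:R)).+1.

Let g j y N i x := psi X i%:R j (x, y) + -1 * powsum j y N (i%:R + 1) x.
Let dn j y N x := mean_pow X j y x + -1 * powsum j y N 0 x.
Let dl j y x := mean_pow X j y x + -1 * Fs a 0 j x y.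

Let mean_powE_chain (j y t : R) : 0 < j -> 0 < t -> 0 < y -> exists eps M,
  chain_data m (g j y) (dn j y) (dl j y) eps M t 1.
Proof.
move=> j0 t0 y0; have j1 : -1 <= j by lra.
have t10 : 0 < t + 1 by rewrite addr_gt0.
pose Mk k := tbound a t k * fpow (j + k.+1%:R) y * nbound t 0.
have cM : cvgn (series Mk) := @cvg_tbound R a a2 a1 t y j (nbound t 0) t0 y0 j1.
pose eps N := limn (series Mk) - series Mk N.
pose K := (t + 1) * ((t + 2) * expR 1).
pose M N := K * fpow (j + N%:R) y.
exists eps, M; split; first exact: ltr01.
- move=> N; apply: is_primD.
    apply: (@is_primS _ _ 0 (t + 1)) (ltW t0) (lexx _) _.
    exact: (psi_prim lX a12 laplaceX y (ltW j0) (b:=t + 1)).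
  apply: is_primZ; apply: is_prim_derive => x /andP[tx _].
    have x0 : 0 < x by exact: lt_le_trans tx.
    have := is_derive_powsum j y N (0%:R + 1) x0.
    by have -> : 0%:R + 1 - 1 = 0 :> R by rewrite addrK.
  have x0 : 0 < x by exact: lt_le_trans tx.
  exact: is_derive_continuous (is_derive_powsum j y N 0 x0).
- move=> N i x _ /andP[tx _]; have x0 : 0 < x by exact: lt_le_trans tx.
  apply: is_deriveD; first exact: (psi_derive lX a12 laplaceX y (ltW j0)).
  have E1 : i%:R + 1 = i.+1%:R + 1 - 1 :> R by rewrite addrK natr1.
  apply: is_deriveZ; rewrite E1; exact: is_derive_powsum.
- move=> N x /andP[tx xt]; have x0 : 0 < x by exact: lt_le_trans tx.
  have aN0 : 0 <= a * N%:R by rewrite mulr_ge0// ltW.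
  have /andP[m1 m2] := truncn_itv aN0.
  have mN : 0 < (m N)%:R - a * N%:R by rewrite subr_gt0.
  have mN1 : (m N)%:R - a * N%:R <= 1 by rewrite /m -natr1 lerBlDr addrC lerD2l.
  have mk (k : nat) : (k < N)%N -> 0 < (m N)%:R + 1 - a * k.+1%:R.
    move=> kN; have : a * k.+1%:R <= a * N%:R by rewrite ler_pM2l// ler_nat.
    by move: mN; set u := _ * _; set v := _ * _; lra.
  have jN : 0 <= j + N%:R by rewrite addr_ge0// ltW.
  have -> : g j y N (m N) x = (-1) ^+ N * psi X ((m N)%:R - a * N%:R) (j + N%:R) (x, y).
    rewrite /g (psi_expand lX a12 laplaceX mN j0 x0 y0).
    have -> : powsum j y N ((m N)%:R + 1) x =
      \sum_(k < N) (-1) ^+ k * (fpow ((m N)%:R + 1 - a * k.+1%:R) x * fpow (j + k.+1%:R) y).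
      by apply: eq_bigr => k _; rewrite /sterm fpowR_fpow// ltW// mk.
    by move: (\sum_(_ < _) _) (_ * psi _ _ _ _) => A B; rewrite mulN1r addrAC subrr add0r.
  rewrite normrM normrX normrN1 expr1n mul1r ger0_norm; last exact: psi_ge0 (ltW mN).
  apply: (le_trans (psi_le lX a12 laplaceX y jN (ltW mN) x0)).
  rewrite /M mulrA; apply: ler_wpM2r; first exact: fpow_ge0.
  rewrite /K; apply: ler_pM => //; [exact: ltW|exact: fpow_ge0 (ltW mN)|].
  have x2 : x <= t + 2 by lra.
  have t20 : 0 < t + 2 by lra.
  apply: (le_trans (le_fpow (ltW mN) x2)); rewrite fpowE//.
  apply: ler_pM; rewrite ?powR_ge0 ?invr_ge0 ?(ltW (Gamma1_gt0 (ltW mN)))//.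
    rewrite -[leRHS]powRr1 ?(ltW t20)//; apply: ler_powR => //; lra.
  rewrite -[expR 1]invrK -expRN lef_pV2 ?posrE ?expR_gt0 ?(Gamma1_gt0 (ltW mN))//.
  by apply: Gamma_ge_expN1; rewrite lerDr ltW.
split.
- move=> N x /andP[tx _]; have x0 : 0 < x by exact: lt_le_trans tx.
  have -> : dn j y N x - dl j y x = Fs a 0 j x y - powsum j y N 0 x.
    by rewrite /dn /dl; move: (mean_pow _ _ _ _) (Fs _ _ _ _ _) (powsum _ _ _ _ _) => A B C; ring.
  have -> : powsum j y N 0 x = series (fun k => sterm a j y 0 k x) N by rewrite /series/= big_mkord.
  apply: (series_tail_le N _ cM) => k.
  have := @normr_sterm_le _ a a2 a1 j y y x t k 0%N j1 t0 tx (lexx _).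
  by rewrite oppr0.
- rewrite -(subrr (limn (series Mk))); apply: cvgB => //; exact: cvg_cst.
- rewrite /dl; apply: cvgD.
    apply: (levy_mean_right lX _ _ _ _ (ltW t0)); first exact: measurable_fpow (measurable_funB _ _).
    + by move=> z; apply: fpow_ge0; exact: ltW.
    + by move=> z _ z2; apply: (le_fpow (ltW j0) (_ : y - z.2 <= y)); rewrite gerBl.
    move=> z; apply: (cvg_comp (fun z : R * R => y - z.2) (fpow j)); last exact: continuous_fpow.
    by apply: cvgB; [exact: cvg_cst|exact: cvg_snd].
  apply: cvgM; first exact: cvg_cst.
  apply: cvg_at_right_filter.
  have := is_derive_Fs a2 a1 0 j1 t0 y0; rewrite oppr0.
  exact: is_derive_continuous.
- move=> c c0.
  have ey : 0 <= K * (expR 1 * y `^ j).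
    by rewrite mulr_ge0 ?mulr_ge0 ?powR_ge0 ?expR_ge0//; [exact: ltW|lra].
  apply: (@chain_growth _ a 1 y (K * (expR 1 * y `^ j)) (fun N => (m N).+1) M c (ltW a0) a1 (ltW y0) ey c0).
    move=> N; have aN0 : 0 <= a * N%:R by rewrite mulr_ge0// ltW.
    have /andP[m1 m2] := truncn_itv aN0.
    by rewrite /m -2!natr1; lra.
  move=> N; have jN : 0 <= j + N%:R by rewrite addr_ge0// ltW.
  have K0 : 0 <= K by rewrite mulr_ge0 ?mulr_ge0 ?expR_ge0//; lra.
  apply/andP; split; first by rewrite mulr_ge0 ?fpow_ge0.
  rewrite /M -mulrA; apply: ler_wpM2l => //.
  rewrite fpowE// powRDp// powR_mulrn ?(ltW y0)// mul1r.
  have G1 : Gamma (N%:R + 1) <= expR 1 * Gamma (j + N%:R + 1).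
    by apply: Gamma_le_expR => //; rewrite lerDr ltW.
  have G2 := Gamma1_gt0 jN; have G3 : 0 < Gamma (N%:R + 1 : R) by exact: Gamma1_gt0.
  have yj : 0 <= y `^ j * y ^+ N by rewrite mulr_ge0 ?powR_ge0// exprn_ge0// ltW.
  rewrite ler_pdivrMr// (_ : _ * Gamma _ = y `^ j * y ^+ N * (expR 1 * Gamma (j + N%:R + 1) / Gamma (N%:R + 1))).
    by rewrite ler_peMr// ler_pdivlMr// mul1r.
  by move: (Gamma _) (Gamma _) (expR 1) (y `^ j) (y ^+ N) => A B C D F; ring.
Qed.

Lemma mean_powE (j t y : R) : 0 < j -> 0 < t -> 0 < y -> mean_pow X j y t = Fs a 0 j t y.
Proof.
move=> j0 t0 y0; have [eps [M H]] := mean_powE_chain j0 t0 y0.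
by have := chain_vanish H; rewrite /dl mulN1r => /eqP; rewrite subr_eq0 => /eqP.
Qed.

End DrawdownMeans.

Section PowerBounds.
Context (R : realType).
Variable alpha : R.
Hypothesis a12 : 1 < alpha < 2.

Definition wpow (l : R) (n : nat) w := fpow (l + alpha * n.+1%:R) w.

Let alpha1 : 1 < alpha. Proof. by case/andP: a12. Qed.
Let alpha2 : alpha < 2. Proof. by case/andP: a12. Qed.
Let alpha0 : 0 < alpha. Proof. exact: lt_trans alpha1. Qed.

Let alpha_le n : alpha <= alpha * n.+1%:R.
Proof. by rewrite ler_peMr ?(ltW alpha0)// ler1n. Qed.

Lemma wpow_ge0 l n w : -2 <= l -> 0 < w -> 0 <= wpow l n w.
Proof.
move=> l2 w0; rewrite /wpow fpowE// divr_ge0 ?powR_ge0// ltW// Gamma_gt0//.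
by have := alpha_le n; have := alpha1; lra.
Qed.

Lemma wpow_nbound_le l t0 w1 w0 : -2 <= l <= 1 -> 0 < t0 -> 0 < w1 -> w1 <= w0 ->
  exists2 C, 0 <= C & forall n w, w1 <= w <= w0 ->
    wpow l n w * nbound t0 n.+1 <= C * 2^-1 ^+ n.
Proof.
move=> /andP[l2 l1] t00 w10 w1w0; have w00 : 0 < w0 by exact: lt_le_trans w1w0.
have x0 : 0 <= 4 * (2 / t0) * w0 `^ alpha.
  by rewrite !mulr_ge0 ?invr_ge0 ?powR_ge0// ltW.
have [C C0 HC] := Gamma_ratio_geometric ler01 alpha1 x0.
pose B := (w1 `^ l + w0 `^ l) * (16 * expR 1).
have B0 : 0 <= B by rewrite !mulr_ge0 ?addr_ge0 ?powR_ge0 ?expR_ge0.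
exists (B * C); first by rewrite mulr_ge0// ltW.
move=> n w /andP[w1w ww0]; have wp : 0 < w by exact: lt_le_trans w1w.
set s := alpha * n.+1%:R.
have as1 : alpha <= s := alpha_le n.
have s0 : 0 < s by exact: lt_le_trans as1.
have p1 : 0 < l + s + 1 by have := alpha1; lra.
have p2 : 0 < l + s + 1 + 1 by rewrite addr_gt0.
have G1 : 0 < Gamma (l + s + 1) by exact: Gamma_gt0.
have wl : w `^ l <= w1 `^ l + w0 `^ l.
  have [lp|ln] := leP 0 l.
    apply: (@le_trans _ _ (w0 `^ l)); last by rewrite lerDr powR_ge0.
    by apply: ge0_ler_powR; rewrite ?nnegrE ?(ltW wp) ?(ltW w00).
  apply: (@le_trans _ _ (w1 `^ l)); last by rewrite lerDl powR_ge0.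
  rewrite -[l]opprK !(powRN _ (- l)) lef_pV2 ?posrE ?powR_gt0//.
  by apply: ge0_ler_powR; rewrite ?nnegrE ?(ltW wp) ?(ltW w10) ?oppr_ge0 ?(ltW ln).
have ws : w `^ s <= (w0 `^ alpha) ^+ n.+1.
  rewrite -powR_mulrn ?powR_ge0// -powRrM.
  by apply: ge0_ler_powR; rewrite ?nnegrE ?(ltW wp) ?(ltW w00) ?(ltW s0).
have Ginv : (Gamma (l + s + 1))^-1 <= 16 * 4 ^+ n.+1 * expR 1 / Gamma (s + 1).
  have e1 : Gamma (l + s + 1 + 1 + 1) = (l + s + 1 + 1) * ((l + s + 1) * Gamma (l + s + 1)).
    by rewrite GammaS// GammaS.
  have h1 : Gamma (s + 1) <= expR 1 * Gamma (l + s + 1 + 1 + 1).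
    have -> : l + s + 1 + 1 + 1 = (l + 2 + s) + 1 by ring.
    apply: Gamma_le_expR; first exact: ltW.
    by rewrite lerDr -lerBlDr sub0r.
  have n2 : n.+1%:R <= 2 ^+ n.+1 :> R by rewrite -natrX ler_nat ltnW// ltn_expl.
  have n0 : 1 <= n.+1%:R :> R by rewrite ler1n.
  have s2n : s <= 2 * 2 ^+ n.+1.
    by apply: (@le_trans _ _ (2 * n.+1%:R)); [rewrite ler_wpM2r// ltW|rewrite ler_wpM2l].
  have q1 : 2 <= 2 ^+ n.+1 :> R by rewrite exprS ler_peMr// exprn_ege1// ler1n.
  have h2 : (l + s + 1 + 1) * (l + s + 1) <= 16 * 4 ^+ n.+1.
    have -> : 16 * 4 ^+ n.+1 = (4 * 2 ^+ n.+1) * (4 * 2 ^+ n.+1) :> R.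
      by rewrite mulrACA -exprMn -!natrM.
    by apply: ler_pM; rewrite ?(ltW p1) ?(ltW p2)//; move: (2 ^+ n.+1 : R) q1 s2n => Q; clear -l1; lra.
  have Gs : 0 < Gamma (s + 1) by apply: Gamma1_gt0; exact: ltW.
  rewrite ler_pdivlMr; last exact: Gs.
  rewrite mulrC ler_pdivrMr; last exact: G1.
  apply: (le_trans h1); rewrite e1 [leRHS]mulrAC mulrC !mulrA.
  apply: ler_wpM2r; first exact: expR_ge0.
  by apply: ler_wpM2r h2; exact: (ltW G1).
have h := HC n.+1; rewrite mul1r natr1 Gamma_nat -/s in h.
have Gs : 0 < Gamma (s + 1) by apply: Gamma1_gt0; exact: ltW.
rewrite /wpow -/s fpowE// powRDp// /nbound.
have m1 : w `^ l * w `^ s / Gamma (l + s + 1) <=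
    (w1 `^ l + w0 `^ l) * (w0 `^ alpha) ^+ n.+1 * (16 * 4 ^+ n.+1 * expR 1 / Gamma (s + 1)).
  apply: ler_pM Ginv; [by apply: mulr_ge0; exact: powR_ge0|by rewrite invr_ge0; exact: (ltW G1)|].
  by apply: ler_pM wl ws; exact: powR_ge0.
have nb0 : 0 <= (2 / t0) ^+ n.+1 * (n.+1)`!%:R by exact: (nbound_ge0 n.+1 t00).
apply: (le_trans (ler_wpM2r nb0 m1)).
have v1 : 2^-1 ^+ n.+1 <= 2^-1 ^+ n :> R.
  by rewrite exprS ler_piMl ?exprn_ge0// invf_le1// ler1n.
apply: (@le_trans _ _ (B * C * 2^-1 ^+ n.+1)); last first.
  by apply: ler_wpM2l v1; rewrite mulr_ge0// ltW.
have h' := ler_wpM2l B0 h.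
rewrite -[leRHS](mulfK (lt0r_neq0 Gs)).
rewrite (_ : B * C * _ * Gamma _ = B * (C * 2^-1 ^+ n.+1 * Gamma (s + 1))); last by ring.
rewrite ler_pdivlMr//; apply: (le_trans _ h').
rewrite !exprMn /B le_eqVlt; apply/orP; left; apply/eqP.
move: (Gamma _) Gs (w1 `^ l) (w0 `^ l) ((w0 `^ alpha) ^+ n.+1) (4 ^+ n.+1 : R) (2 ^+ n.+1 : R) (t0^-1 ^+ n.+1) ((n.+1)`!%:R : R) (expR 1) => G Gs' A1 A2 A3 A4 A5 A6 A7 A8.
by field; rewrite gt_eqF.
Qed.

End PowerBounds.

Section JointMeans.
Context (R : realType) d (T : measurableType d) (P : probability T R).
Context (X : R -> {RV P >-> R}) (alpha : R).
Hypotheses (lX : levy_process X) (a12 : 1 < alpha < 2).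
Hypothesis laplaceX : forall t q : R, 0 < t -> 0 <= q ->
  'E_P[fun w => expR (- q * X t w)]%E = (expR (t * q `^ alpha))%:E.
Notation mu := (@lebesgue_measure R).
Notation a := (alpha^-1).
Notation W := (running_sup X).
Notation D := (drawdown X).

Let alpha1 : 1 < alpha. Proof. by case/andP: a12. Qed.
Let alpha0 : 0 < alpha. Proof. exact: lt_trans alpha1. Qed.
Let a1 := inv_alpha_lt1 a12.
Let a2 := inv_alpha_gt_half a12.

Definition joint_mean (r : R) (z : R * R) (t : R) :=
  levy_mean X (fun z' => fpow r (z.1 - z'.1) * fpow 1 (z.2 - z'.2)) t.

Section JointMean.
Variables (r : R) (z : R * R).
Hypothesis r0 : 0 < r.

Let mphi : measurable_fun [set: R * R] (fun z' : R * R => fpow r (z.1 - z'.1) * fpow 1 (z.2 - z'.2)).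
Proof. by apply: measurable_funM; apply: measurable_fpow; exact: measurable_funB. Qed.
Let phi0 (z' : R * R) : 0 <= fpow r (z.1 - z'.1) * fpow 1 (z.2 - z'.2).
Proof. by apply: mulr_ge0; apply: fpow_ge0 => //; exact: ltW. Qed.
Let phiK (z' : R * R) : 0 <= z'.1 -> 0 <= z'.2 ->
  fpow r (z.1 - z'.1) * fpow 1 (z.2 - z'.2) <= fpow r z.1 * fpow 1 z.2.
Proof.
move=> z1 z2; apply: ler_pM; [exact: fpow_ge0 (ltW r0)|exact: fpow_ge0|..].
  by apply: (le_fpow (ltW r0)); rewrite gerBl.
by apply: (le_fpow ler01); rewrite gerBl.
Qed.
Let cphi : continuous (fun z' : R * R => fpow r (z.1 - z'.1) * fpow 1 (z.2 - z'.2)).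
Proof.
move=> z'; apply: cvgM.
  apply: (cvg_comp (fun z' : R * R => z.1 - z'.1) (fpow r)); last exact: continuous_fpow.
  by apply: cvgB; [exact: cvg_cst|exact: cvg_fst].
apply: (cvg_comp (fun z' : R * R => z.2 - z'.2) (fpow 1)); last exact: continuous_fpow.
by apply: cvgB; [exact: cvg_cst|exact: cvg_snd].
Qed.

Lemma joint_mean_ge0 t : 0 <= joint_mean r z t.
Proof. exact: levy_mean_ge0. Qed.

Lemma joint_mean_le t : 0 <= t -> joint_mean r z t <= fpow r z.1 * fpow 1 z.2.
Proof. exact: (levy_mean_le lX mphi phi0 phiK). Qed.

Lemma joint_mean_right t : 0 <= t -> joint_mean r z s @[s --> t^'+] --> joint_mean r z t.
Proof. exact: (levy_mean_right lX mphi phi0 phiK cphi). Qed.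

Lemma joint_mean_prim b :
  is_prim (fun t => \int[mu]_(s in `[0, t]) joint_mean r z s) (joint_mean r z) 0 b.
Proof. exact: (levy_mean_prim lX mphi phi0 phiK (b:=b)). Qed.

Lemma joint_mean_fubini t : 0 < t ->
  \int[time_prob P]_(x in `[0, t[%classic `*` [set: T])
    (fpow r (z.1 - W (Num.max x.1 0) x.2) * fpow 1 (z.2 - D (Num.max x.1 0) x.2)) =
  \int[mu]_(s in `[0, t]) joint_mean r z s.
Proof.
move=> t0.
have mI : measurable (`[0, t[%classic : set (measurableTypeR R)) by exact: measurable_itv.
have I0 (s : R) : `[0, t[%classic s -> 0 <= s by rewrite /= in_itv/= => /andP[].
have := levy_mean_fubini lX mphi phi0 phiK mI I0 (measurable_cst (1 : R)) (fun s => ler01).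
move=> /(congr1 (@fine R)) h.
have i := levy_mean_integrable lX mphi phi0 phiK t (lexx 0).
rewrite -Rintegral_itv_bndo_bndc; last first.
  by apply: integrableS i => //; apply: subset_itvl; rewrite bnd_simp.
rewrite /Rintegral.
transitivity (fine (\int[mu]_(s in `[0%R, t[) (cst 1 s * joint_mean r z s)%:E)); last first.
  by congr fine; apply: eq_integral => s _; rewrite mul1r.
rewrite -[RHS]h; congr fine; apply: eq_integral => s _; by rewrite mul1r.
Qed.

End JointMean.

Let is_laplace_joint r t : 0 < r -> 0 <= t -> is_laplace (fun z => joint_mean r z t)
  (fun b g => b `^ (- (r + 1)) * g `^ (- (1 + 1)) * levy_lap X b g t).
Proof.
move=> r0 t0.
apply: (@is_laplace_Phi R d T P setT (W t) (D t) measurableT) => //.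
- exact: (measurable_running_sup lX t0).
- exact: (measurable_drawdown lX t0).
- by move=> w _; exact: (running_sup_ge0 lX).
- by move=> w _; exact: (drawdown_ge0 lX).
have := integrable_levy_integrand lX ler01 ler01 t0.
by congr (_.-integrable _ _); apply/funext => w /=; rewrite !mul1r.
Qed.

Let is_laplace_mean_pow r j t : 0 < r -> 0 < j -> 0 <= t ->
  is_laplace (fun z => fpow r z.1 * mean_pow X j z.2 t)
  (fun b g => b `^ (- (r + 1)) * g `^ (- (j + 1)) * levy_lap X 0 g t).
Proof.
move=> r0 j0 t0.
have mD := measurable_drawdown lX t0.
have i1 : P.-integrable [set: T] (EFin \o (fun w : T => expR (- (cst (0 : R) w + D t w)))).
  have := integrable_levy_integrand lX (lexx 0) ler01 t0.
  by congr (_.-integrable _ _); apply/funext => w /=; rewrite mul1r mul0r.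
have := @is_laplace_Phi R d T P setT (cst 0) (D t) measurableT (measurable_cst _)
  mD (fun=> fun=> lexx _) (fun w _ => drawdown_ge0 lX w t0) i1 r j r0 j0.
congr is_laplace.
  apply/funext => z; rewrite /Phi/= /mean_pow /levy_mean.
  have i : P.-integrable [set: T] (EFin \o (fun w => fpow j (z.2 - D t w))).
    apply: (@measurable_bounded_integrable _ _ _ P) => //.
    - by rewrite (le_lt_trans (probability_le1 _ _))// ltry.
    - by apply: measurable_fpow; exact: measurable_funB.
    exists (fpow j z.2); split; first exact: num_real.
    move=> y Ky w _ /=; rewrite ger0_norm ?(fpow_ge0 _ (ltW j0))//.
    by rewrite (le_trans _ (ltW Ky))// (le_fpow (ltW j0))// gerBl (drawdown_ge0 lX).
  transitivity (fpow r z.1 * \int[P]_w fpow j (z.2 - D t w)) => //.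
  by rewrite -(RintegralZl _ measurableT i); apply: eq_Rintegral => w _; rewrite subr0.
apply/funext => b; apply/funext => g; congr (_ * _).
by apply: eq_Rintegral => w _; rewrite mulr0 mul0r.
Qed.

Let is_laplace_time r t : 0 < r -> 0 < t ->
  is_laplace (fun z => \int[mu]_(s in `[0, t]) joint_mean r z s)
  (fun b g => b `^ (- (r + 1)) * g `^ (- (1 + 1)) * \int[mu]_(s in `[0, t[) levy_lap X b g s).
Proof.
move=> r0 t0.
have mI : measurable (`[0, t[%classic : set (measurableTypeR R)) by exact: measurable_itv.
have I0 (s : R) : `[0, t[%classic s -> 0 <= s by rewrite /= in_itv/= => /andP[].
pose E : set (measurableTypeR R * T)%type := `[0, t[%classic `*` [set: T].
have mE : measurable E by exact: measurableX.
pose W' (x : measurableTypeR R * T) := W (Num.max x.1 0) x.2.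
pose D' (x : measurableTypeR R * T) := D (Num.max x.1 0) x.2.
have mW' : measurable_fun [set: measurableTypeR R * T] W' := measurable_running_sup2 lX.
have mD' : measurable_fun [set: measurableTypeR R * T] D' := measurable_drawdown2 lX.
have W0 x : E x -> 0 <= W' x.
  by move=> _; apply: (running_sup_ge0 lX); rewrite le_max lexx orbT.
have D0 x : E x -> 0 <= D' x.
  by move=> _; apply: (drawdown_ge0 lX); rewrite le_max lexx orbT.
have V b g : 1 <= b -> 1 <= g ->
    (\int[time_prob P]_(x in E) (expR (- (b * W' x + g * D' x)))%:E =
     \int[mu]_(s in `[0%R, t[) (levy_lap X b g s)%:E)%E.
  move=> b1 g1; have b0 := le_trans ler01 b1; have g0 := le_trans ler01 g1.
  have lap1 (z : R * R) : 0 <= z.1 -> 0 <= z.2 -> lap b g z <= 1.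
    by move=> z1 z2; rewrite -expR0 ler_expR oppr_le0 addr_ge0// mulr_ge0.
  have lap0 (z : R * R) : 0 <= lap b g z by exact: expR_ge0.
  have mlap : measurable_fun [set: R * R] (lap b g).
    apply: measurableT_comp => //; apply: measurableT_comp => //.
    by apply: measurable_funD; exact: measurable_funM.
  have := levy_mean_fubini lX mlap lap0 lap1 mI I0 (measurable_cst (1 : R)) (fun s => ler01).
  move=> h; transitivity (\int[mu]_(s in `[0%R, t[) (cst 1 s * levy_mean X (lap b g) s)%:E)%E.
    by rewrite -h; apply: eq_integral => x _; rewrite mul1r.
  by apply: eq_integral => s _; rewrite mul1r.
have Vfin b g : 1 <= b -> 1 <= g -> (\int[mu]_(s in `[0%R, t[) (levy_lap X b g s)%:E < +oo)%E.
  move=> b1 g1; have b0 := le_trans ler01 b1; have g0 := le_trans ler01 g1.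
  apply: (@le_lt_trans _ _ (\int[mu]_(s in `[0%R, t[) (cst 1%:E s))%E).
    apply: ge0_le_integral => //.
    + by move=> s _; rewrite lee_fin levy_lap_ge0.
    + apply/measurable_EFinP.
      apply: eq_measurable_fun (measurable_funTS (measurable_levy_lap lX b g)) => s.
      by rewrite inE/= in_itv/= => /andP[s0 _]; rewrite (max_idPl _).
    + by move=> s /=; rewrite in_itv/= => /andP[s0 _]; rewrite lee_fin (levy_lap_le1 lX).
  by rewrite integral_cst//= lebesgue_measure_itv/= lte_fin t0 mul1e -EFinB ltry.
have iE : (time_prob P).-integrable E (EFin \o (fun x => expR (- (W' x + D' x)))).
  apply: ge0_integrable => //.
  - apply: measurable_funTS; apply: measurableT_comp => //; apply: measurableT_comp => //.
    exact: measurable_funD.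
  - have := V 1 1 (lexx _) (lexx _).
    rewrite (_ : (fun z => _) = fun z => (expR (- (W' z + D' z)))%:E); last first.
      by apply/funext => z; rewrite !mul1r.
    by move=> ->; exact: Vfin.
have H := @is_laplace_Phi R _ _ (time_prob P) E W' D' mE mW' mD' W0 D0 iE r 1 r0 ltr01.
have -> : (fun z => \int[mu]_(s in `[0, t]) joint_mean r z s) = Phi (time_prob P) E W' D' r 1.
  by apply/funext => z; rewrite -(joint_mean_fubini z r0 t0).
apply: is_laplace_eq H => b g b1 g1.
by apply: (f_equal (fun x => _ * x)); rewrite /Rintegral V.
Qed.

Lemma joint_mean_step (r w y t : R) : 0 < r -> 0 < w -> 0 < y -> 0 < t ->
  joint_mean (r + alpha) (w, y) t = \int[mu]_(s in `[0, t]) joint_mean r (w, y) s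
    + fpow (r + alpha) w * mean_pow X 1 y t + -1 * (fpow (r + alpha - 1) w * fpow 2 y)
    + fpow (r + alpha - 1) w * mean_pow X 2 y t.
Proof.
move=> r0 w0 y0 t0; have t0' := ltW t0.
have ra : 0 < r + alpha by rewrite addr_gt0.
have ra1 : 0 < r + alpha - 1 by rewrite -addrA addr_gt0// subr_gt0.
have H1 := is_laplace_joint ra t0'.
have H2 := is_laplaceD (is_laplaceD (is_laplaceD (is_laplace_time r0 t0)
  (is_laplace_mean_pow ra ltr01 t0'))
  (is_laplaceZ (-1) (is_laplace_fpow P ra1 (ltr0n R 2))))
  (is_laplace_mean_pow ra1 (ltr0n R 2) t0').
refine (@is_laplace_inj R _ _ _ _ w y H1 H2 _ w0 y0) => b g b1 g1.
have b0 : 0 < b := lt_le_trans ltr01 b1.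
have g0 : 0 < g := lt_le_trans ltr01 g1.
rewrite (levy_lap_eq lX a12 laplaceX (ltW b0) g0 t0) /=.
have -> : - (2 + 1) = - (1 + 1) - 1 :> R by ring.
have -> : - (r + 1) = - (r + alpha + 1) + alpha :> R by ring.
have -> : - (r + alpha - 1 + 1) = - (r + alpha + 1) + 1 :> R by ring.
rewrite (powRBp (- (1 + 1)) 1 g0) !(powRDp _ _ b0) !powRr1 ?(ltW g0) ?(ltW b0)//.
move: (b `^ _) (b `^ alpha) (g `^ _) (Rintegral _ _ _) (levy_lap _ _ _ _) => C B G I m.
by field; rewrite gt_eqF.
Qed.

Section RecursionInTime.
Variables (w y : R).
Hypotheses (w0 : 0 < w) (y0 : 0 < y).

Let J n x := joint_mean (1 + alpha * n%:R) (w, y) x.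
Let sW n q x := wpow alpha 1 n w * Fs a (- q%:R) 1 x y + wpow alpha 0 n w * Fs a (- q%:R) 2 x y.

Let r0 n : 0 < 1 + alpha * n%:R.
Proof. by rewrite ltr_wpDr// mulr_ge0// ltW. Qed.

Let is_derive_sW n q (t : R) : 0 < t -> is_derive t 1 (sW n q) (sW n q.+1 t).
Proof.
move=> t0; apply: is_deriveD; apply: is_deriveZ.
  by apply: (is_derive_Fs a2 a1) => //; rewrite (le_trans _ ler01)// lerN10.
by apply: (is_derive_Fs a2 a1) => //; rewrite (le_trans (lerN10 R)).
Qed.

Let K n x := \int[mu]_(s in `[0, x]) J n s.

Let J_step n (t : R) : 0 < t ->
  J n.+1 t = K n t + sW n 0%N t + - (wpow alpha 0 n w * fpow 2 y).
Proof.
move=> t0; rewrite /J /K /sW /wpow.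
have -> : 1 + alpha * n.+1%:R = 1 + alpha * n%:R + alpha.
  by rewrite -natr1 mulrDr mulr1 addrA.
have -> : 0 + alpha * n.+1%:R = 1 + alpha * n%:R + alpha - 1.
  by rewrite -natr1; ring.
rewrite (joint_mean_step (r0 n) w0 y0 t0).
rewrite (mean_powE lX a12 laplaceX ltr01 t0 y0) (mean_powE lX a12 laplaceX (ltr0n R 2) t0 y0).
rewrite mulr0n oppr0.
move: (Rintegral _ _ _) (fpow _ _) (fpow _ _) (fpow _ _) (Fs _ _ _ _ _) (Fs _ _ _ _ _) => A1 A2 A3 A4 A5 A6.
by ring.
Qed.

Let K_prim n b : is_prim (K n) (J n) 0 b.
Proof. exact: joint_mean_prim. Qed.

Let J_bound n (x : R) : 0 <= x -> `|J n x| <= fpow (1 + alpha * n%:R) w * fpow 1 y.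
Proof.
by move=> x0; rewrite ger0_norm ?joint_mean_le ?joint_mean_ge0.
Qed.

Let J_cont n (t : R) : 0 < t -> {for t, continuous (J n.+1)}.
Proof.
move=> t0.
have cK : {for t, continuous (K n)}.
  have tb : 0 < t < t + 1 by rewrite t0 ltrDl ltr01.
  refine (@is_prim_continuous R (K n) (J n) 0 (t + 1) (fpow (1 + alpha * n%:R) w * fpow 1 y) t (@K_prim n (t + 1)) tb _).
  by move=> x /andP[x0 _]; exact: J_bound.
have cS := is_derive_continuous (is_derive_sW n 0 t0).
have cc : K n x + sW n 0%N x + - (wpow alpha 0 n w * fpow 2 y) @[x --> t] --> J n.+1 t.
  rewrite (J_step n t0); apply: cvgD; last exact: cvg_cst.
  by apply: cvgD; [exact: cK|exact: cS].
apply: cvg_trans cc; apply: near_eq_cvg.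
by near=> x; rewrite J_step//; near: x; exact: lt_nbhsr.
Unshelve. all: by end_near. Qed.

Let J_derive n (t : R) : 0 < t -> is_derive t 1 (J n.+2) (J n.+1 t + sW n.+1 1%N t).
Proof.
move=> t0.
have dK : is_derive t 1 (K n.+1) (J n.+1 t).
  have tb : 0 < t < t + 1 by rewrite t0 ltrDl ltr01.
  exact: (@is_prim_is_derive R (K n.+1) (J n.+1) 0 (t + 1) t (@K_prim n.+1 (t + 1)) tb (@J_cont n t t0)).
have dS := is_deriveD (is_deriveD dK (is_derive_sW n.+1 0 t0))
  (is_derive_cst (- (wpow alpha 0 n.+1 w * fpow 2 y)) t 1).
rewrite addr0 in dS.
apply: near_eq_is_derive dS.
by near=> x; rewrite J_step//; near: x; exact: lt_nbhsr.
Unshelve. all: by end_near. Qed.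

Let Fs_bound (j t x : R) n : -1 <= j -> 0 < t -> t <= x ->
  `|Fs a (- n%:R) j x y| <= Fs_majorant a j t y * nbound t n.
Proof. by move=> j1 t0 tx; apply: (normr_Fs_le a2 a1). Qed.

Let sW_bound (t : R) : 0 < t -> exists2 C : R, 0 <= C & forall q (x : R), t <= x -> `|sW q q.+1 x| <= C * 2^-1 ^+ q.
Proof.
move=> t0.
have [|C1 C10 H1] := @wpow_nbound_le R alpha a12 1 t w w _ t0 w0 (lexx _).
  by rewrite lexx andbT (le_trans _ ler01)// oppr_le0.
have [|C2 C20 H2] := @wpow_nbound_le R alpha a12 0 t w w _ t0 w0 (lexx _).
  by rewrite ler01 andbT oppr_le0.
pose S j := Fs_majorant a j t y.
have j11 : -1 <= 1 :> R by rewrite (le_trans (lerN10 R)).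
have j12 : -1 <= 2 :> R by rewrite (le_trans (lerN10 R)).
exists (C1 * `|S 1| + C2 * `|S 2|); first by rewrite addr_ge0// mulr_ge0.
move=> q x tx; rewrite mulrDl (le_trans (ler_normD _ _))// lerD//.
  have p0 : 0 <= wpow alpha 1 q w by apply: wpow_ge0 => //; rewrite (le_trans _ ler01)// oppr_le0.
  rewrite normrM (ger0_norm p0).
  have h := ler_wpM2l p0 (Fs_bound q.+1 j11 t0 tx).
  apply: (le_trans h).
  have h' : S 1 * nbound t q.+1 <= `|S 1| * nbound t q.+1.
    by apply: ler_wpM2r (ler_norm _); exact: nbound_ge0.
  apply: (le_trans (ler_wpM2l p0 h')); rewrite mulrCA [leRHS]mulrAC mulrC.
  by apply: ler_wpM2r => //; apply: H1; rewrite lexx.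
have p0 : 0 <= wpow alpha 0 q w by apply: wpow_ge0 => //; rewrite oppr_le0.
rewrite normrM (ger0_norm p0).
have h := ler_wpM2l p0 (Fs_bound q.+1 j12 t0 tx).
apply: (le_trans h).
have h' : S 2 * nbound t q.+1 <= `|S 2| * nbound t q.+1.
  by apply: ler_wpM2r (ler_norm _); exact: nbound_ge0.
apply: (le_trans (ler_wpM2l p0 h')); rewrite mulrCA [leRHS]mulrAC mulrC.
by apply: ler_wpM2r => //; apply: H2; rewrite lexx.
Qed.

Let g n i x := J i.+1 x + \sum_(q < n - i) sW (i.+1 + q) q.+1 x.
Let dn n x := J 0 x + \sum_(q < n.+1) sW q q.+1 x.
Let dl x := J 0 x + limn (series (fun q => sW q q.+1 x)).

Let joint_chain (t : R) : 0 < t -> exists eps M, chain_data id g dn dl eps M t 1.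
Proof.
move=> t0; have [C C0 HC] := sW_bound t0.
have cM := @cvg_geometric_half R C.
pose eps N := limn (series (fun q => C * 2^-1 ^+ q)) - series (fun q => C * 2^-1 ^+ q) N.+1.
pose M n := fpow (1 + alpha * n.+1%:R) w * fpow 1 y.
have dsum N (m : nat -> nat) (q0 : nat -> nat) (x : R) : 0 < x ->
    is_derive x 1 (fun z => \sum_(q < N) sW (m q) (q0 q) z) (\sum_(q < N) sW (m q) (q0 q).+1 x).
  move=> x0; apply: (@is_derive_sumn _ (fun q => sW (m q) (q0 q)) (fun q => sW (m q) (q0 q).+1 x) N x) => q _.
  exact: is_derive_sW.
exists eps, M; split; first exact: ltr01.
- move=> n.
  pose G x := K 0 x + (sW 0 0 x + \sum_(q < n) sW q.+1 q.+1 x - wpow alpha 0 0 w * fpow 2 y).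
  pose f x := J 0 x + (sW 0 1 x + \sum_(q < n) sW q.+1 q.+2 x).
  have dS (x : R) : 0 < x -> is_derive x 1 (fun x => sW 0 0 x + \sum_(q < n) sW q.+1 q.+1 x - wpow alpha 0 0 w * fpow 2 y)
      (sW 0 1 x + \sum_(q < n) sW q.+1 q.+2 x).
    move=> x0; have h := is_deriveB (is_deriveD (is_derive_sW 0 0 x0) (dsum n S S x x0))
      (is_derive_cst (wpow alpha 0 0 w * fpow 2 y) x 1).
    by rewrite subr0 in h.
  have cS (x : R) : 0 < x -> {for x, continuous (fun x => sW 0 1 x + \sum_(q < n) sW q.+1 q.+2 x)}.
    move=> x0.
    exact: is_derive_continuous (is_deriveD (is_derive_sW 0 1 x0) (dsum n S (S \o S) x x0)).
  have GP : is_prim G f t (t + 1).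
    apply: is_primD.
      exact: (@is_primS _ _ _ 0 (t + 1) _ _ (ltW t0) (lexx _) (@K_prim 0%N (t + 1))).
    apply: is_prim_derive => x /andP[tx _]; [apply: dS|apply: cS]; exact: lt_le_trans tx.
  have fE : f = dn n.
    apply/funext => x; rewrite /f /dn big_ord_recl/=; congr (_ + (_ + _)).
  rewrite -fE => u v tu uv vt; have [i1 e1] := GP u v tu uv vt; split=> //.
  have GE (x : R) : t <= x -> g n 0 x = G x.
    move=> tx; have x0 : 0 < x by exact: lt_le_trans tx.
    rewrite /g /G subn0 (J_step 0 x0).
    have -> : \sum_(q < n) sW (1 + q) q.+1 x = \sum_(q < n) sW q.+1 q.+1 x by [].
    by move: (\sum_(_ < _) _) (K _ _) (sW _ _ _) (_ * _) => A1 A2 A3 A4; ring.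
  by rewrite (GE v (le_trans tu uv)) (GE u tu).
- move=> n i x im /andP[tx _]; have x0 : 0 < x by exact: lt_le_trans tx.
  have h := is_deriveD (J_derive i x0) (dsum (n - i.+1)%N (addn i.+2) S x x0).
  have -> : g n i x = J i.+1 x + sW i.+1 1 x + \sum_(q < n - i.+1) sW (i.+2 + q) q.+2 x.
    rewrite /g -(subnSK im) big_ord_recl/= addn0 addrA.
    apply: (f_equal (fun z => J i.+1 x + sW i.+1 1 x + z)).
    by apply: eq_bigr => q _; rewrite /bump leq0n add1n addnS addSn.
  exact: h.
- move=> n x /andP[tx _]; rewrite /g subnn big_ord0 addr0; apply: J_bound.
  by rewrite ltW// (lt_le_trans t0).
split.
- move=> n x /andP[tx _]; rewrite /dn /dl opprD addrACA subrr add0r distrC.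
  have -> : \sum_(q < n.+1) sW q q.+1 x = series (fun q => sW q q.+1 x) n.+1 by rewrite /series/= big_mkord.
  by apply: (series_tail_le n.+1 _ cM) => q; exact: HC.
- rewrite -(subrr (limn (series (fun q => C * 2^-1 ^+ q)))); apply: cvgB; first exact: cvg_cst.
  by have := cM; rewrite -(cvg_shiftS (series _)).
- rewrite /dl; apply: cvgD; first by apply: joint_mean_right => //; exact: ltW.
  apply: (@tannery _ _ _ _ (fun q x => sW q q.+1 x) (fun q => sW q q.+1 t) _ cM).
    by near=> x => q; apply: HC; apply: ltW; near: x; exact: nbhs_right_gt.
  move=> q; apply: cvg_at_right_filter; exact: is_derive_continuous (is_derive_sW q q.+1 t0).
move=> c c0.
pose C' := expR 1 * w `^ (1 + alpha) * fpow 1 y.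
have C'0 : 0 <= C' by apply: mulr_ge0; [apply: mulr_ge0; [exact: expR_ge0|exact: powR_ge0]|exact: fpow_ge0].
have x0 : 0 <= w `^ alpha by exact: powR_ge0.
apply: (@chain_growth _ 1 alpha (w `^ alpha) C' S M c ler01 alpha1 x0 C'0 c0).
  by move=> n; rewrite mul1r -natr1 lerD2l ler1n.
move=> n; have p0 : 0 < 1 + alpha * n.+1%:R by exact: r0.
apply/andP; split; first by rewrite mulr_ge0 ?fpow_ge0// ltW.
rewrite /M /C' [leRHS]mulrAC; apply: ler_wpM2r; first exact: fpow_ge0.
rewrite fpowE; last exact: w0.
have E1 : 1 + alpha * n.+1%:R = (1 + alpha) + alpha * n%:R by rewrite -natr1; ring.
have -> : w `^ (1 + alpha * n.+1%:R) = w `^ (1 + alpha) * (w `^ alpha) ^+ n.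
  by rewrite E1 powRDp// -powR_mulrn// -powRrM.
have p1 : 0 <= alpha * n%:R by rewrite mulr_ge0// ltW.
have G1 := Gamma1_gt0 (ltW p0); have G2 := Gamma1_gt0 p1.
have h : Gamma (alpha * n%:R + 1) <= expR 1 * Gamma (1 + alpha * n.+1%:R + 1).
  by apply: Gamma_le_expR => //; rewrite E1 lerDr addr_ge0// ltW.
rewrite ler_pdivrMr; last exact: G1.
move: (Gamma _) (Gamma _) G1 G2 h => B A B0 A0 h.
have E2 : expR 1 * w `^ (1 + alpha) * ((w `^ alpha) ^+ n / B) * A =
  w `^ (1 + alpha) * (w `^ alpha) ^+ n * (expR 1 * A / B) by ring.
rewrite E2; apply: ler_peMr; first by apply: mulr_ge0; [exact: powR_ge0|exact: exprn_ge0].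
by rewrite ler_pdivlMr// mul1r.
Unshelve. all: by end_near. Qed.

Lemma joint_meanE (t : R) : 0 < t -> joint_mean 1 (w, y) t =
  - limn (series (fun n => wpow alpha 1 n w * Fs a (- n.+1%:R) 1 t y
                         + wpow alpha 0 n w * Fs a (- n.+1%:R) 2 t y)).
Proof.
move=> t0; have [eps [M H]] := joint_chain t0; have /eqP := chain_vanish H.
by rewrite /dl addr_eq0 /J mulr0 addr0 => /eqP.
Qed.

End RecursionInTime.
End JointMeans.

(** * The double series and the joint density *)

Section FpowCalculus.
Context (R : realType).
Implicit Types r u : R.

Lemma fpow_continuous_at r u : 0 < r \/ 0 < u -> {for u, continuous (fpow r)}.
Proof.
move=> [r0|u0]; first exact: continuous_fpow.
have h : u' `^ r / Gamma (r + 1) @[u' --> u] --> fpow r u.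
  by rewrite fpowE//; apply: cvgM; [exact: continuous_powR|exact: cvg_cst].
apply: cvg_trans h; apply: near_eq_cvg.
by near=> v; rewrite fpowE//; near: v; exact: lt_nbhsr.
Unshelve. all: by end_near. Qed.

Lemma is_derive_fpow r u : 0 < r -> 0 < u -> is_derive u 1 (fpow r) (fpow (r - 1) u).
Proof.
move=> r0 u0.
have h : is_derive u 1 (fun v => (Gamma (r + 1))^-1 * v `^ r) (fpow (r - 1) u).
  have -> : fpow (r - 1) u = (Gamma (r + 1))^-1 * (r * u `^ (r - 1)).
    rewrite fpowE// subrK GammaS//; have G0 := Gamma_gt0 r0.
    by move: (Gamma r) (u `^ _) G0 => G B G0; field; rewrite !gt_eqF.
  by apply: is_deriveZ; exact: is_derive_powR.
apply: near_eq_is_derive h.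
by near=> v; rewrite fpowE 1?mulrC//; near: v; exact: lt_nbhsr.
Unshelve. all: by end_near. Qed.

End FpowCalculus.

Section DoubleSeries.
Context (R : realType).
Variables (alpha t : R).
Hypotheses (a12 : 1 < alpha < 2) (t0 : 0 < t).
Implicit Types l i w y : R.
Notation a := (alpha^-1).

Let alpha1 : 1 < alpha. Proof. by case/andP: a12. Qed.
Let alpha0 : 0 < alpha. Proof. exact: lt_trans alpha1. Qed.
Let a1 := inv_alpha_lt1 a12.
Let a2 := inv_alpha_gt_half a12.

Definition Fy i (n : nat) y : R := - Fs a (- n.+1%:R) i t y.

Let ik_ge0 i (k : nat) : -1 <= i -> 0 <= i + k.+1%:R.
Proof. by move=> i1; rewrite -natr1 addrCA addr_ge0//; lra. Qed.

Let ik_gt0 i (k : nat) : 0 <= i -> 0 < i + k.+1%:R.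
Proof. by move=> i1; rewrite ltr_wpDl. Qed.

Lemma Fy_le0 i n y : y <= 0 -> Fy i n y = 0.
Proof.
move=> y0; apply/eqP; rewrite oppr_eq0; apply/eqP; rewrite /Fs.
have -> : series (fun k => sterm a i y (- n.+1%:R) k t) = fun=> 0.
  apply/funext => N; rewrite /series/=; apply: big1 => k _.
  by rewrite /sterm fpow_le0 ?mulr0.
exact: lim_cst.
Qed.

Lemma normr_Fy_le i n y y0 : -1 <= i -> 0 < y0 -> y <= y0 ->
  `|Fy i n y| <= Fs_majorant a i t y0 * nbound t n.+1.
Proof. by move=> i1 y00 yy0; rewrite normrN; apply: (normr_Fs_le a2 a1). Qed.

Lemma Fy_continuous i n y : -1 <= i -> 0 <= i \/ 0 < y -> {for y, continuous (Fy i n)}.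
Proof.
move=> i1 iy.
have y0 : 0 < `|y| + 1 by rewrite ltr_wpDl.
apply: cvgN.
apply: (@tannery _ _ (nbhs y) _ (fun k y' => sterm a i y' (- n.+1%:R) k t)
  (fun k => sterm a i y (- n.+1%:R) k t) _ (@cvg_tbound R a a2 a1 t (`|y| + 1) i (nbound t n.+1) t0 y0 i1)).
  near=> y' => k; apply: (normr_sterm_le a2 a1) => //.
  apply: ltW; near: y'; apply: lt_nbhsl.
  by rewrite (le_lt_trans (ler_norm y))// ltrDl.
move=> k; apply: cvgM; first exact: cvg_cst.
apply: cvgM; first exact: cvg_cst.
apply: fpow_continuous_at; case: iy => [i0|]; [left; exact: ik_gt0|by right].
Unshelve. all: by end_near. Qed.

Lemma is_derive_Fy i n y : 0 <= i -> 0 < y -> is_derive y 1 (Fy i n) (Fy (i - 1) n y).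
Proof.
move=> i0 y0; apply: is_deriveN.
have i1 : -1 <= i - 1 by lra.
have i1' : -1 <= i by lra.
have y2 : 0 < y + y by rewrite addr_gt0.
have H z : `|z - y| < y -> 0 < z /\ z <= y + y.
  by rewrite ltr_norml => /andP[h1 h2]; split; lra.
apply: (@is_derive_series _ (fun k z => sterm a i z (- n.+1%:R) k t)
  (fun k z => sterm a (i - 1) z (- n.+1%:R) k t) _ _ _ y0
  (@cvg_tbound R a a2 a1 t (y + y) (i - 1) (nbound t n.+1) t0 y2 i1)).
- move=> k z /H[z0 _]; apply: is_deriveZ; apply: is_deriveZ.
  have -> : i - 1 + k.+1%:R = i + k.+1%:R - 1 by rewrite addrAC.
  exact: is_derive_fpow (ik_gt0 k i0) z0.
- by move=> k z /H[z0 zy]; apply: (normr_sterm_le a2 a1).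
- by move=> z /H[z0 zy]; exact: (cvg_sterm a2 a1).
Qed.

Let wexp_gt0 l (n : nat) : -1 <= l -> 0 < l + alpha * n.+1%:R.
Proof.
move=> l1; have : alpha <= alpha * n.+1%:R by rewrite ler_peMr ?(ltW alpha0)// ler1n.
by have := alpha1; lra.
Qed.

Lemma wpow_continuous l n w : -1 <= l \/ 0 < w -> {for w, continuous (wpow alpha l n)}.
Proof.
move=> lw; apply: fpow_continuous_at; case: lw => [l1|]; [left; exact: wexp_gt0|by right].
Qed.

Lemma is_derive_wpow l n w : -1 <= l -> 0 < w ->
  is_derive w 1 (wpow alpha l n) (wpow alpha (l - 1) n w).
Proof.
move=> l1 w0; rewrite /wpow.
have -> : l - 1 + alpha * n.+1%:R = l + alpha * n.+1%:R - 1 by rewrite addrAC.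
exact: is_derive_fpow (wexp_gt0 n l1) w0.
Qed.

Lemma wpow_near_le l w : -2 <= l <= 1 -> -1 <= l \/ 0 < w -> exists2 C : R, 0 <= C &
  \forall w' \near w, forall n, `|wpow alpha l n w'| * nbound t n.+1 <= C * 2^-1 ^+ n.
Proof.
move=> l21; have /andP[l2 _] := l21; have nb n : 0 <= nbound t n by exact: nbound_ge0.
move=> [l1|w0].
  have w1 : 0 < `|w| + 1 by rewrite ltr_wpDl.
  have [C C0 H] := wpow_nbound_le a12 l21 t0 w1 (lexx _).
  exists C => //; near=> w' => n.
  have ww : w' <= `|w| + 1.
    apply: ltW; near: w'; apply: lt_nbhsl.
    by rewrite (le_lt_trans (ler_norm w))// ltrDl.
  have e0 := ltW (wexp_gt0 n l1).
  apply: le_trans (H n (`|w| + 1) _); last by rewrite lexx.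
  by rewrite ger0_norm ?fpow_ge0// ler_wpM2r// le_fpow.
have w2 : 0 < w / 2 by rewrite divr_gt0.
have [|C C0 H] := wpow_nbound_le a12 l21 t0 w2 (_ : w / 2 <= w + w).
  by lra.
exists C => //; near=> w' => n.
have w'1 : w / 2 <= w' by apply: ltW; near: w'; apply: lt_nbhsr; lra.
have w'2 : w' <= w + w by apply: ltW; near: w'; apply: lt_nbhsl; lra.
rewrite ger0_norm; first by apply: H; rewrite w'1.
by apply: (wpow_ge0 a12) => //; exact: lt_le_trans w'1.
Unshelve. all: by end_near. Qed.

Definition Q l i w y := limn (series (fun n => wpow alpha l n w * Fy i n y)).

Lemma Q_le0 l i w y : w <= 0 \/ y <= 0 -> Q l i w y = 0.
Proof.
move=> wy; rewrite /Q.
have -> : series (fun n => wpow alpha l n w * Fy i n y) = fun=> 0; last exact: lim_cst.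
apply/funext => N; rewrite /series/=; apply: big1 => k _.
by case: wy => [w0|y0]; [rewrite /wpow fpow_le0 ?mul0r|rewrite Fy_le0 ?mulr0].
Qed.

(* At these (l, i, w, y) all the powers of w and y in the series are continuous
   near the point: an exponent may be nonpositive only away from its zero. *)
Definition adm l i w y := [/\ -2 <= l <= 1, -1 <= i, -1 <= l \/ 0 < w & 0 <= i \/ 0 < y].

Lemma Q_near_le l i w y : adm l i w y -> exists2 C : R, 0 <= C &
  (\forall w' \near w, forall y' n, y' <= `|y| + 1 ->
    `|wpow alpha l n w' * Fy i n y'| <= C * 2^-1 ^+ n).
Proof.
move=> [l21 i1 lw iy]; have [C C0 H] := wpow_near_le l21 lw.
have y0 : 0 < `|y| + 1 by rewrite ltr_wpDl.
pose S := Fs_majorant a i t (`|y| + 1).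
exists (C * `|S|); first exact: mulr_ge0.
apply: filterS H => w' H y' n yy; rewrite normrM.
apply: (@le_trans _ _ (`|wpow alpha l n w'| * (`|S| * nbound t n.+1))).
  apply: ler_wpM2l => //; apply: (le_trans (normr_Fy_le n i1 y0 yy)).
  by apply: ler_wpM2r (ler_norm _); exact: nbound_ge0.
rewrite mulrCA [leRHS]mulrAC [leRHS]mulrC; apply: ler_wpM2l => //; exact: H.
Qed.

Lemma Q_is_cvg l i w y : adm l i w y -> cvgn (series (fun n => wpow alpha l n w * Fy i n y)).
Proof.
move=> H; have [C C0 /nbhs_singleton h] := Q_near_le H.
apply: (series_norm_le _ (@cvg_geometric_half R C)) => n.
by apply: h; rewrite (le_trans (ler_norm _))// lerDl.
Qed.

Lemma Q_cvg (T : topologicalType) (F : set_system T) (FF : ProperFilter F) (u v : T -> R) l i w y :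
  adm l i w y -> u x @[x --> F] --> w -> v x @[x --> F] --> y ->
  Q l i (u x) (v x) @[x --> F] --> Q l i w y.
Proof.
move=> H uw vy; have [C C0 h] := Q_near_le H; case: H => [l21 i1 lw iy].
have hx : \forall x \near F, forall y' n, y' <= `|y| + 1 ->
    `|wpow alpha l n (u x) * Fy i n y'| <= C * 2^-1 ^+ n := uw _ h.
apply: (@tannery _ _ F _ (fun n x => wpow alpha l n (u x) * Fy i n (v x)) _ _ (@cvg_geometric_half R C)).
  near=> x => n.
  have h2 : forall y' n, y' <= `|y| + 1 -> `|wpow alpha l n (u x) * Fy i n y'| <= C * 2^-1 ^+ n.
    by near: x.
  apply: h2; apply: ltW; near: x; apply: (cvgr_lt _ vy).
  by rewrite (le_lt_trans (ler_norm y))// ltrDl.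
move=> n; apply: cvgM.
  by apply: (cvg_comp _ _ uw); exact: wpow_continuous.
by apply: (cvg_comp _ _ vy); exact: Fy_continuous.
Unshelve. all: by end_near. Qed.

Let leibniz (A B C D e : R) : A * B + e * (C * D) = C *: (D * e : R) + B *: (A : R).
Proof. by rewrite /GRing.scale/=; ring. Qed.

Lemma is_derive_Q1 l i w (dl e : R) : 0 <= dl -> -1 <= l <= 1 -> 0 <= i -> 0 < w -> 0 < dl * w + e ->
  is_derive w 1 (fun s => Q l i s (dl * s + e))
    (Q (l - 1) i w (dl * w + e) + dl * Q l (i - 1) w (dl * w + e)).
Proof.
move=> dl0 /andP[l1 l2] i0 w0 y0; set y := dl * w + e.
have A1 : adm l i w y by split => //; [lra|lra|left|left].
have A2 : adm (l - 1) i w y by split => //; [lra|lra|right|left].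
have A3 : adm l (i - 1) w y by split => //; [lra|lra|left|right].
have [C1 C10 h1] := Q_near_le A2; have [C2 C20 h2] := Q_near_le A3.
have cv : (fun s => dl * s + e) s @[s --> w] --> y.
  by apply: cvgD; [apply: cvgM; [exact: cvg_cst|exact: cvg_id]|exact: cvg_cst].
have n1 : \forall s \near w, 0 < s by exact: lt_nbhsr.
have n2 : \forall s \near w, 0 < dl * s + e by exact: (cvgr_gt _ cv).
have n3 : \forall s \near w, dl * s + e <= `|y| + 1.
  by apply: (cvgr_le _ cv); rewrite (le_lt_trans (ler_norm y))// ltrDl.
have FI P1 P2 := @filterI _ _ (nbhs_filter w) P1 P2.
have := FI _ _ h1 (FI _ _ h2 (FI _ _ n1 (FI _ _ n2 n3))).
move=> /nbhs_ballP[r /= r0 Hr].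
have {}Hr z : `|z - w| < r -> _ := fun h => Hr z (eq_ind _ is_true h _ (congr1 (fun x => x < r) (distrC z w))).
pose df n s := wpow alpha (l - 1) n s * Fy i n (dl * s + e)
  + dl * (wpow alpha l n s * Fy (i - 1) n (dl * s + e)).
have c1 := Q_is_cvg A2; have c2 := Q_is_cvg A3.
have -> : Q (l - 1) i w y + dl * Q l (i - 1) w y = limn (series (df ^~ w)).
  apply/esym/cvg_lim => //.
  have -> : series (df ^~ w) = (fun N => series (fun n => wpow alpha (l - 1) n w * Fy i n y) N
      + dl * series (fun n => wpow alpha l n w * Fy (i - 1) n y) N).
    by apply/funext => N; rewrite /series/= mulr_sumr -big_split.
  apply: cvgD; first exact: c1.
  by apply: cvgM; [exact: cvg_cst|exact: c2].
apply: (@is_derive_series _ (fun n s => wpow alpha l n s * Fy i n (dl * s + e)) df _ w r r0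
  (@cvg_geometric_half R (C1 + dl * C2))).
- move=> n z /Hr[_ [_ [z0 [y'0 _]]]].
  have d1 := is_derive_wpow n l1 z0.
  have dv : is_derive z 1 (fun s => dl * s + e) dl.
    have h : is_derive z 1 (fun s : R => dl * s + e) (dl * 1 + 0).
      by apply: is_deriveD; apply: is_deriveZ.
    by rewrite mulr1 addr0 in h.
  have d2 := @is_derive1_comp _ (Fy i n) (fun s => dl * s + e) z (Fy (i - 1) n (dl * z + e)) dl (is_derive_Fy n i0 y'0) dv.
  have dm := is_deriveM d1 d2.
  have -> : df n z = wpow alpha l n z *: (Fy (i - 1) n (dl * z + e) * dl)
      + (Fy i n \o (fun s => dl * s + e)) z *: wpow alpha (l - 1) n z.
    exact: leibniz.
  exact: dm.
- move=> n z /Hr[b1 [b2 [z0 [y'0 y'1]]]].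
  rewrite /df mulrDl (le_trans (ler_normD _ _))// lerD//; first exact: b1.
  by rewrite normrM (ger0_norm dl0) -mulrA; apply: ler_wpM2l => //; exact: b2.
- move=> z /Hr[_ [_ [z0 [y'0 _]]]]; apply: Q_is_cvg.
  by split => //; [lra|lra|left|left].
Qed.

Lemma is_derive_Q2 l i w y : -2 <= l <= 1 -> 0 <= i -> 0 < w -> 0 < y ->
  is_derive y 1 (Q l i w) (Q l (i - 1) w y).
Proof.
move=> l21 i0 w0 y0.
have A3 : adm l (i - 1) w y by split => //; [lra|right|right].
have [C2 C20 /nbhs_singleton h2] := Q_near_le A3.
have n1 : \forall s \near y, 0 < s by exact: lt_nbhsr.
have n3 : \forall s \near y, s <= `|y| + 1.
  near=> s; apply: ltW; near: s; apply: lt_nbhsl.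
  by rewrite (le_lt_trans (ler_norm y))// ltrDl.
have := @filterI _ _ (nbhs_filter y) _ _ n1 n3.
move=> /nbhs_ballP[r /= r0 Hr].
have {}Hr z : `|z - y| < r -> 0 < z /\ z <= `|y| + 1.
  by rewrite distrC => h; exact: Hr.
apply: (@is_derive_series _ (fun n s => wpow alpha l n w * Fy i n s)
  (fun n s => wpow alpha l n w * Fy (i - 1) n s) _ y r r0 (@cvg_geometric_half R C2)).
- by move=> n z /Hr[z0 _]; apply: is_deriveZ; exact: is_derive_Fy.
- by move=> n z /Hr[z0 z1]; exact: h2.
- move=> z /Hr[z0 _]; apply: Q_is_cvg.
  by split => //; [lra|right|left].
Unshelve. all: by end_near. Qed.

End DoubleSeries.

Section Rays.
Context (R : realType).
Notation RR := (measurableTypeR R * measurableTypeR R)%type.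

Lemma eq_measure_rays (m1 m2 : {measure set (measurableTypeR R) -> \bar R}) :
  (m1 [set: R] < +oo)%E -> (forall x : R, m1 `]-oo, x[%classic = m2 `]-oo, x[%classic) ->
  forall A, measurable A -> m1 A = m2 A.
Proof.
move=> m1oo m12 A mA.
pose G : set (set (measurableTypeR R)) := @RGenInftyO.G R.
pose g (n : nat) : set (measurableTypeR R) := `]-oo, n%:R[%classic.
have mG : @measurable _ (measurableTypeR R) = <<s G >> := RGenInftyO.measurableE R.
have GI : setI_closed G.
  move=> _ _ [x ->] [y ->]; exists (Num.min x y).
  apply/seteqP; split => z /=; rewrite !in_itv/= lt_min; first by move=> [-> ->].
  by move=> /andP.
have Gg n : G (g n) by exists n%:R.
have gT : \bigcup_n g n = setT.
  apply/seteqP; split => // x _; exists (Num.bound `|x|) => //.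
  by rewrite /g /= in_itv/=; apply: (le_lt_trans (ler_norm _)); exact: archi_boundP.
have G12 B : G B -> m1 B = m2 B by move=> [x ->].
have g1 n : (m1 (g n) < +oo)%E.
  apply: le_lt_trans m1oo; apply: le_measure; rewrite ?inE//.
  exact: measurable_itv.
exact: (measure_unique G g mG GI Gg gT m1 m2 G12 g1 A mA).
Qed.

Lemma eq_measure_rays2 (m1 m2 : {measure set RR -> \bar R}) :
  (m1 [set: RR] < +oo)%E ->
  (forall x y : R, m1 (`]-oo, x[%classic `*` `]-oo, y[%classic) =
                   m2 (`]-oo, x[%classic `*` `]-oo, y[%classic)) ->
  forall C, measurable C -> m1 C = m2 C.
Proof.
move=> m1oo H; apply: eq_measure_setX => // A B mA mB.
have mray (y : R) : measurable (`]-oo, y[%classic : set (measurableTypeR R)) by exact: measurable_itv.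
have fin (m : {measure set RR -> \bar R}) (D : set RR) : measurable D ->
    (m [set: RR] < +oo)%E -> (m D < +oo)%E.
  by move=> mD; apply: le_lt_trans; apply: le_measure; rewrite ?inE.
have step1 (y : R) : m1 (A `*` `]-oo, y[%classic) = m2 (A `*` `]-oo, y[%classic).
  have mD : measurable ([set: measurableTypeR R] `*` (`]-oo, y[%classic : set (measurableTypeR R))).
    exact: measurableX.
  have [m1' E1] := pushforward_measure (mrestr m1 mD) (@measurable_fst _ _ (measurableTypeR R) (measurableTypeR R)).
  have [m2' E2] := pushforward_measure (mrestr m2 mD) (@measurable_fst _ _ (measurableTypeR R) (measurableTypeR R)).
  have X (C : set (measurableTypeR R)) : fst @^-1` C `&` ([set: measurableTypeR R] `*` (`]-oo, y[%classic : set (measurableTypeR R))) =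
      C `*` `]-oo, y[%classic.
    by apply/seteqP; split => z /= => [[? []]|[]].
  have Y1 C : m1' C = m1 (C `*` `]-oo, y[%classic) by rewrite E1 /mrestr/=; congr (m1 _); exact: X.
  have Y2 C : m2' C = m2 (C `*` `]-oo, y[%classic) by rewrite E2 /mrestr/=; congr (m2 _); exact: X.
  rewrite -Y1 -Y2; apply: eq_measure_rays => //.
    by rewrite Y1; apply: fin => //; exact: measurableX.
  by move=> x; rewrite Y1 Y2; exact: H.
have mD : measurable ((A : set (measurableTypeR R)) `*` [set: measurableTypeR R]) by exact: measurableX.
have [m1' E1] := pushforward_measure (mrestr m1 mD) (@measurable_snd _ _ (measurableTypeR R) (measurableTypeR R)).
have [m2' E2] := pushforward_measure (mrestr m2 mD) (@measurable_snd _ _ (measurableTypeR R) (measurableTypeR R)).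
have X (C : set (measurableTypeR R)) : snd @^-1` C `&` ((A : set (measurableTypeR R)) `*` [set: measurableTypeR R]) =
    A `*` C.
  by apply/seteqP; split => z /= => [[? []]|[]].
have Y1 C : m1' C = m1 (A `*` C) by rewrite E1 /mrestr/=; congr (m1 _); exact: X.
have Y2 C : m2' C = m2 (A `*` C) by rewrite E2 /mrestr/=; congr (m2 _); exact: X.
rewrite -Y1 -Y2; apply: eq_measure_rays => //.
  by rewrite Y1; apply: fin => //; exact: measurableX.
by move=> y; rewrite Y1 Y2; exact: step1.
Qed.

End Rays.

Section Density.
Context d (T : measurableType d) (R : realType) (m : {measure set T -> \bar R}) (f : T -> R).
Hypotheses (mf : measurable_fun [set: T] f) (f0 : forall x, 0 <= f x).

Lemma density_measure : exists m' : {measure set T -> \bar R},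
  forall A, m' A = (\int[m]_(x in A) (f x)%:E)%E.
Proof.
pose F (A : set T) := (\int[m]_(x in A) (f x)%:E)%E.
have F0 : F set0 = 0%E by rewrite /F integral_set0.
have Fge0 A : (0 <= F A)%E by apply: integral_ge0 => x _; rewrite lee_fin.
have Fs : semi_sigma_additive F.
  move=> A mA tA mUA; rewrite /F ge0_integral_bigcup//.
  - by apply: is_cvg_ereal_nneg_natsum_cond => n _ _; exact: Fge0.
  - by apply/measurable_EFinP; exact: measurable_funTS.
  - by move=> x _; rewrite lee_fin.
pose m' : {measure set T -> \bar R} := HB.pack F (isMeasure.Build _ _ _ F F0 Fge0 Fs).
by exists m'.
Qed.

End Density.

Section RealSeries.
Context (R : realType).

Lemma nondecreasing_derive_ge0 (f : R -> R) (x l b c : R) : b < x < c ->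
  (forall u v, b < u -> u <= v -> v < c -> f u <= f v) -> is_derive x 1 f l -> 0 <= l.
Proof.
move=> /andP[bx xc] nd [df ef].
have : h^-1 * (f (x + h) - f x) @[h --> 0^'] --> l.
  rewrite -ef /derive; move: df; rewrite /derivable => /cvg_ex[l' hl'].
  have E : (fun h : R => h^-1 *: (f (h *: (1:R) + x) - f x)) = (fun h => h^-1 * (f (x + h) - f x)).
    by apply/funext => h; rewrite /GRing.scale/= mulr1 (addrC h).
  by move: hl'; rewrite E => hl'; rewrite (cvg_lim _ hl').
move/cvgrPdist_lt => H; rewrite leNgt; apply/negP => l0.
have e0 : 0 < - l by rewrite oppr_gt0.
have := H _ e0; rewrite near_withinE => /nbhs_ballP[r /= r0 Hr].
pose h := Num.min (r / 2) ((c - x) / 2).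
have h0 : 0 < h by rewrite lt_min !divr_gt0// subr_gt0.
have hr : h < r by rewrite gt_min; apply/orP; left; rewrite gtr_pMr// invf_lt1// ltr1n.
have hc : h < c - x.
  by rewrite gt_min; apply/orP; right; rewrite gtr_pMr ?subr_gt0// invf_lt1// ltr1n.
have /Hr : ball 0 r h by rewrite /ball/= sub0r normrN gtr0_norm.
move=> /(_ (lt0r_neq0 h0)).
have q0 : 0 <= h^-1 * (f (x + h) - f x).
  rewrite mulr_ge0 ?invr_ge0 ?(ltW h0)// subr_ge0; apply: nd => //; first by rewrite lerDl ltW.
  by rewrite -ltrBrDl.
by rewrite ltr_norml opprK => /andP[? _]; lra.
Qed.

Lemma double_sum_swap (x : nat -> nat -> R) (U V : R^nat) :
  (forall k, 0 <= U k) -> (forall n, 0 <= V n) ->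
  (forall n k, `|x n k| <= U k * V n) -> cvgn (series U) -> cvgn (series V) ->
  (forall k, cvgn (series (x ^~ k))) /\
  series (fun k => limn (series (x ^~ k))) N @[N --> \oo] --> limn (series (fun n => limn (series (x n)))).
Proof.
move=> U0 V0 xUV cU cV.
have cUV c : cvgn (series (fun n => c * V n)).
  have -> : series (fun n => c * V n) = (fun N => c * series V N).
    by apply/funext => N; rewrite /series/= mulr_sumr.
  by apply: is_cvgM => //; exact: is_cvg_cst.
have cVU c : cvgn (series (fun k => U k * c)).
  have -> : series (fun k => U k * c) = (fun N => series U N * c).
    by apply/funext => N; rewrite /series/= mulr_suml.
  by apply: is_cvgM => //; exact: is_cvg_cst.
have ck k : cvgn (series (x ^~ k)) by apply: (series_norm_le _ (cUV (U k))) => n; exact: xUV.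
have cn n : cvgn (series (x n)) by apply: (series_norm_le _ (cVU (V n))) => k; exact: xUV.
split => //.
have E N : series (fun k => limn (series (x ^~ k))) N = limn (series (fun n => series (x n) N)) /\
    cvgn (series (fun n => series (x n) N)).
  elim: N => [|N [IH1 IH2]].
    have -> : (fun n => series (x n) 0) = fun=> 0.
      by apply/funext => n; rewrite /series/= big_geq.
    have -> : series (fun=> 0 : R) = fun=> 0.
      by apply/funext => n; rewrite /series/= big1.
    have -> : limn (fun=> 0 : R) = 0 by exact: lim_cst.
    by rewrite /series/= big_geq//; split => //; exact: cvg_cst.
  have e : series (fun n => series (x n) N.+1) =
      (fun M => series (fun n => series (x n) N) M + series (x ^~ N) M).
    apply/funext => M; rewrite /series/= -big_split/=.
    by apply: eq_bigr => n _; rewrite big_nat_recr.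
  have sS (s : R^nat) : series s N.+1 = series s N + s N by rewrite /series/= big_nat_recr.
  rewrite sS IH1 e; split; last exact: is_cvgD.
  by rewrite limD.
have -> : (fun N => series (fun k => limn (series (x ^~ k))) N) =
    (fun N => limn (series (fun n => series (x n) N))) by apply/funext => N; case: (E N).
apply: (@tannery _ nat \oo _ (fun n N => series (x n) N) _ _ (cUV (limn (series U)))); last exact: cn.
apply: nearW => N n.
apply: (@le_trans _ _ (series U N * V n)).
  rewrite /series/= mulr_suml (le_trans (ler_norm_sum _ _ _))//.
  by apply: ler_sum => k _; exact: xUV.
apply: ler_wpM2r => //.
by apply: nondecreasing_cvgn_le => //; exact: nondecreasing_series.
Qed.

End RealSeries.

Section QMeasurable.
Context (R : realType).
Variables (alpha t : R).
Hypotheses (a12 : 1 < alpha < 2) (t0 : 0 < t).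

Let a1 := inv_alpha_lt1 a12.
Let a2 := inv_alpha_gt_half a12.

Lemma is_derive_Qw (l i w y : R) : -1 <= l <= 1 -> 0 <= i -> 0 < w -> 0 < y ->
  is_derive w 1 (fun s => Q alpha t l i s y) (Q alpha t (l - 1) i w y).
Proof.
move=> l1 i0 w0 y0.
have E (s : R) : 0 * s + y = y by rewrite mul0r add0r.
have EQ : (fun s => Q alpha t l i s (0 * s + y)) = (fun s => Q alpha t l i s y).
  by apply/funext => s; exact: (f_equal (Q alpha t l i s) (E s)).
have EV : Q alpha t (l - 1) i w (0 * w + y) + 0 * Q alpha t l (i - 1) w (0 * w + y) =
    Q alpha t (l - 1) i w y.
  rewrite [X in _ + X]mul0r addr0; exact: (f_equal (Q alpha t (l - 1) i w) (E w)).
have y1 : 0 < 0 * w + y by rewrite E.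
have h := is_derive_eq (@is_derive_Q1 R alpha t a12 t0 l i w 0 y (lexx _) l1 i0 w0 y1) EV.
exact: (eq_ind _ (fun F : R -> R => is_derive w 1 F (Q alpha t (l - 1) i w y)) h _ EQ).
Qed.

Lemma Q_continuous_w (l i w y : R) : adm l i w y -> {for w, continuous (fun s => Q alpha t l i s y)}.
Proof.
move=> A; apply: (@Q_cvg R alpha t a12 t0 R (nbhs w) _ id (fun=> y) l i w y A); first exact: cvg_id.
exact: cvg_cst.
Qed.

Lemma Q_continuous_y (l i w y : R) : adm l i w y -> {for y, continuous (Q alpha t l i w)}.
Proof.
move=> A; apply: (@Q_cvg R alpha t a12 t0 R (nbhs y) _ (fun=> w) id l i w y A); last exact: cvg_id.
exact: cvg_cst.
Qed.

Lemma measurable_Fy i n : -1 <= i -> measurable_fun [set: R] (Fy alpha t i n).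
Proof.
move=> i1; apply: measurableT_comp => //.
apply: (@measurable_fun_cvg _ _ _ _ (fun N y => series (fun k => sterm alpha^-1 i y (- n.+1%:R) k t) N)).
  move=> N; rewrite /series/=; apply: measurable_sum => k.
  by apply: measurable_funM => //; apply: measurable_funM => //; exact: measurable_fpow.
move=> y _; have [y0|y0] := ltP 0 y; first by have := @cvg_sterm R _ a2 a1 i y t n.+1 i1 t0 y0.
have E0 : series (fun k => sterm alpha^-1 i y (- n.+1%:R) k t) = fun=> 0.
  apply/funext => N; rewrite /series/=; apply: big1 => k _.
  by rewrite /sterm fpow_le0 ?mulr0.
have E1 : Fs alpha^-1 (- n.+1%:R) i t y = 0 by rewrite /Fs E0; exact: lim_cst.
by rewrite E1 E0; exact: cvg_cst.
Qed.

Lemma measurable_Q l i : -2 <= l <= 1 -> -1 <= i ->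
  measurable_fun [set: R * R] (fun z => Q alpha t l i z.1 z.2).
Proof.
move=> l1 i1.
apply: (@measurable_fun_cvg _ _ _ _ (fun N (z : R * R) => series (fun n => wpow alpha l n z.1 * Fy alpha t i n z.2) N)).
  move=> N; rewrite /series/=; apply: measurable_sum => n.
  apply: measurable_funM; first exact: measurable_fpow measurable_fst.
  by apply: (measurableT_comp (measurable_Fy n i1)); exact: measurable_snd.
move=> z _; case: (boolP ((0 < z.1) && (0 < z.2))) => [/andP[w0 y0]|].
  by apply: (Q_is_cvg a12 t0); split => //; right.
rewrite negb_and -!leNgt => /orP wy.
rewrite Q_le0//.
have -> : (fun N => series (fun n => wpow alpha l n z.1 * Fy alpha t i n z.2) N) = fun=> 0.
  apply/funext => N; rewrite /series/=; apply: big1 => k _.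
  by case: wy => [w0|y0]; [rewrite /wpow fpow_le0 ?mul0r|rewrite Fy_le0 ?mulr0].
exact: cvg_cst.
Qed.

End QMeasurable.

Section Law.
Context (R : realType) d (T : measurableType d) (P : probability T R).
Context (X : R -> {RV P >-> R}) (alpha t : R).
Hypotheses (lX : levy_process X) (a12 : 1 < alpha < 2).
Hypothesis laplaceX : forall t q : R, 0 < t -> 0 <= q ->
  'E_P[fun w => expR (- q * X t w)]%E = (expR (t * q `^ alpha))%:E.
Hypothesis t0 : 0 < t.
Notation mu := (@lebesgue_measure R).
Notation W := (running_sup X t).
Notation D := (drawdown X t).
Notation Qt := (Q alpha t).

Let mW : measurable_fun [set: T] W. Proof. exact: (measurable_running_sup lX (ltW t0)). Qed.
Let mD : measurable_fun [set: T] D. Proof. exact: (measurable_drawdown lX (ltW t0)). Qed.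
Let W0 x : [set: T] x -> 0 <= W x. Proof. by move=> _; exact: (running_sup_ge0 lX _ (ltW t0)). Qed.
Let D0 x : [set: T] x -> 0 <= D x. Proof. by move=> _; exact: (drawdown_ge0 lX _ (ltW t0)). Qed.
Let iWD : P.-integrable [set: T] (EFin \o (fun x => expR (- (W x + D x)))).
Proof.
have := integrable_levy_integrand lX ler01 ler01 (ltW t0).
by congr (_.-integrable _ _); apply/funext => w /=; rewrite !mul1r.
Qed.

Definition cdfWD (w y : R) := Phi P setT W D 0 0 (w, y).

Let negD (A B C E : R) : A * B + C * E = - (A * - B + C * - E).
Proof. by ring. Qed.

Let Phi11 (w y : R) : 0 < w -> 0 < y -> Phi P setT W D 1 1 (w, y) = Qt 1 1 w y + Qt 0 2 w y.
Proof.
move=> w0 y0; have -> : Phi P setT W D 1 1 (w, y) = joint_mean X 1 (w, y) t by [].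
rewrite (joint_meanE lX a12 laplaceX w0 y0 t0).
have A1 : adm 1 1 w y by split; [lra|lra|right|right].
have A2 : adm 0 2 w y by split; [lra|lra|right|right].
have c1 := Q_is_cvg a12 t0 A1; have c2 := Q_is_cvg a12 t0 A2.
rewrite -[RHS]opprK; congr (- _); apply/cvg_lim => //.
have -> : series (fun n => wpow alpha 1 n w * Fs alpha^-1 (- n.+1%:R) 1 t y
                         + wpow alpha 0 n w * Fs alpha^-1 (- n.+1%:R) 2 t y) =
  (fun N => - (series (fun n => wpow alpha 1 n w * Fy alpha t 1 n y) N +
               series (fun n => wpow alpha 0 n w * Fy alpha t 2 n y) N)).
  apply/funext => N; rewrite /series/= -big_split -sumrN/=; apply: eq_bigr => n _.
  exact: negD.
by apply: cvgN; apply: cvgD; [exact: c1|exact: c2].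
Qed.

Let Phi01 (w y : R) : 0 < w -> 0 < y -> Phi P setT W D 0 1 (w, y) = Qt 0 1 w y + Qt (-1) 2 w y.
Proof.
move=> w0 y0.
have S := Phi_sandwiched1 measurableT mW mD W0 D0 iWD (lexx 0) ler01 y.
apply: (sandwiched_eq S).
have h : is_derive w 1 (fun s => Qt 1 1 s y + Qt 0 2 s y) (Qt 0 1 w y + Qt (-1) 2 w y).
  apply: is_deriveD.
    have := @is_derive_Qw R alpha t a12 t0 1 1 w y _ _ w0 y0; rewrite subrr; apply; lra.
  have := @is_derive_Qw R alpha t a12 t0 0 2 w y _ _ w0 y0; rewrite sub0r; apply; lra.
apply: near_eq_is_derive h.
near=> s; rewrite add0r Phi11//; near: s; exact: lt_nbhsr.
Unshelve. all: by end_near. Qed.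

Lemma cdfWDE (w y : R) : 0 < w -> 0 < y -> cdfWD w y = Qt 0 0 w y + Qt (-1) 1 w y.
Proof.
move=> w0 y0.
have S := Phi_sandwiched2 measurableT mW mD W0 D0 iWD (lexx 0) (lexx 0) w.
apply: (sandwiched_eq S).
have h : is_derive y 1 (fun s => Qt 0 1 w s + Qt (-1) 2 w s) (Qt 0 0 w y + Qt (-1) 1 w y).
  apply: is_deriveD.
    have := @is_derive_Q2 R alpha t a12 t0 0 1 w y _ _ w0 y0; rewrite subrr; apply; lra.
  have := @is_derive_Q2 R alpha t a12 t0 (-1) 2 w y _ _ w0 y0.
  have -> : 2 - 1 = 1 :> R by lra.
  by apply; lra.
apply: near_eq_is_derive h.
near=> s; rewrite add0r Phi01//; near: s; exact: lt_nbhsr.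
Unshelve. all: by end_near. Qed.

Let ind0 (u : R) : fpow 0 u = (nat_of_bool (0 < u))%:R.
Proof.
have [u0|u0] := ltP 0 u; last by rewrite fpow_le0.
by rewrite fpowE// powRr0 add0r Gamma1 divr1.
Qed.

Lemma prob_cdfWD (w y : R) : P [set x | W x < w /\ D x < y] = (cdfWD w y)%:E.
Proof.
rewrite /cdfWD /Phi (EFin_Rintegral measurableT (integrable_Phi measurableT mW mD W0 D0 iWD (lexx 0) (lexx 0) (w, y))).
pose A := [set x | W x < w /\ D x < y].
have mA : measurable A.
  have -> : A = (W @^-1` `]-oo, w[%classic) `&` (D @^-1` `]-oo, y[%classic).
    by apply/seteqP; split => x /=; rewrite !in_itv.
  apply: measurableI; rewrite -[X in measurable X]setTI; [apply: mW|apply: mD] => //; exact: measurable_itv.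
rewrite -/A -[X in P X]setIT -integral_indic//; apply: eq_integral => x _.
congr EFin; rewrite indicE !ind0 !subr_gt0 -natrM mulnb; congr (nat_of_bool _)%:R.
by apply/idP/idP; rewrite inE /A /=; [move=> [-> ->]|move/andP].
Qed.

Let Kt (w y : R) := Qt (-1) 0 w y + Qt (-2) 1 w y.
Definition densWD (z : R * R) := Qt (-1) (-1) z.1 z.2 + Qt (-2) 0 z.1 z.2.

Let is_derive_Kt (w y : R) : 0 < w -> 0 < y -> is_derive y 1 (Kt w) (densWD (w, y)).
Proof.
move=> w0 y0; apply: is_deriveD.
  have := @is_derive_Q2 R alpha t a12 t0 (-1) 0 w y _ _ w0 y0; rewrite sub0r; apply; lra.
have := @is_derive_Q2 R alpha t a12 t0 (-2) 1 w y _ _ w0 y0; rewrite subrr; apply; lra.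
Qed.

Let is_derive_cdf (w y : R) : 0 < w -> 0 < y -> is_derive w 1 (fun s => cdfWD s y) (Kt w y).
Proof.
move=> w0 y0.
have h : is_derive w 1 (fun s => Qt 0 0 s y + Qt (-1) 1 s y) (Kt w y).
  apply: is_deriveD.
    have := @is_derive_Qw R alpha t a12 t0 0 0 w y _ _ w0 y0; rewrite sub0r; apply; lra.
  have := @is_derive_Qw R alpha t a12 t0 (-1) 1 w y _ _ w0 y0.
  have -> : -1 - 1 = -2 :> R by lra.
  by apply; lra.
apply: near_eq_is_derive h.
near=> s; rewrite cdfWDE//; near: s; exact: lt_nbhsr.
Unshelve. all: by end_near. Qed.

Let cdf_increment w1 w2 u v : w1 <= w2 -> u <= v ->
  cdfWD w1 v - cdfWD w1 u <= cdfWD w2 v - cdfWD w2 u.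
Proof.
move=> w12 uv.
have i w y := integrable_Phi measurableT mW mD W0 D0 iWD (lexx 0) (lexx 0) (w, y).
pose F w x := fpow 0 ((w, v).1 - W x) * fpow 0 ((w, v).2 - D x)
  - fpow 0 ((w, u).1 - W x) * fpow 0 ((w, u).2 - D x).
have e w : cdfWD w v - cdfWD w u = \int[P]_x F w x := esym (RintegralB measurableT (i w v) (i w u)).
suff h : \int[P]_x F w1 x <= \int[P]_x F w2 x.
  have L (p q p' q' : R) : p = p' -> q = q' -> p' <= q' -> p <= q by move=> -> ->.
  exact: L (e w1) (e w2) h.
apply: le_Rintegral; first exact: measurableT.
- by have := integrableB measurableT (i w1 v) (i w1 u).
- by have := integrableB measurableT (i w2 v) (i w2 u).
move=> x _; rewrite /F /= -!mulrBr; apply: ler_wpM2r.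
  by rewrite subr_ge0 le_fpow// lerD2r.
by rewrite le_fpow// lerD2r.
Qed.

Let Kt_nondecreasing (w u v : R) : 0 < w -> 0 < u -> u <= v -> Kt w u <= Kt w v.
Proof.
move=> w0 u0 uv; have v0 : 0 < v by exact: lt_le_trans uv.
rewrite -subr_ge0.
have dd := is_deriveB (is_derive_cdf w0 v0) (is_derive_cdf w0 u0).
have ww : 0 < w < w + 1 by rewrite w0 ltrDl ltr01.
by apply: (nondecreasing_derive_ge0 ww _ dd) => w1 w2 _ w12 _; exact: cdf_increment.
Qed.

Lemma densWD_ge0 z : 0 <= densWD z.
Proof.
case: z => w y; case: (boolP ((0 < w) && (0 < y))) => [/andP[w0 y0]|].
  have yy : 0 < y < y + 1 by rewrite y0 ltrDl ltr01.
  apply: (nondecreasing_derive_ge0 yy _ (is_derive_Kt w0 y0)) => u v u0 uv _.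
  exact: Kt_nondecreasing.
by rewrite negb_and -!leNgt => /orP wy; rewrite /densWD !Q_le0// addr0.
Qed.

Lemma densWD_eq0 (w y : R) : w <= 0 \/ y <= 0 -> densWD (w, y) = 0.
Proof. by move=> wy; rewrite /densWD !Q_le0// addr0. Qed.

Lemma measurable_densWD : measurable_fun [set: R * R] densWD.
Proof. by apply: measurable_funD; apply: (measurable_Q a12 t0); lra. Qed.

Let adm_pos (l i w y : R) : -2 <= l <= 1 -> -1 <= i -> 0 < w -> 0 < y -> adm l i w y.
Proof. by move=> *; split => //; right. Qed.

Let Kt_eq0 w : Kt w 0 = 0.
Proof. by rewrite /Kt !Q_le0 ?addr0//; right. Qed.

Let Kt_continuous_y (w y : R) : 0 < w -> {for y, continuous (Kt w)}.
Proof.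
move=> w0; apply: cvgD; apply: (Q_continuous_y a12 t0).
  by split; [lra|lra|right|left].
by split; [lra|lra|right|left].
Qed.

Let integral_dens_y (w y : R) : 0 < w -> 0 < y ->
  (\int[mu]_(s in `]0%R, y[) (densWD (w, s))%:E = (Kt w y)%:E)%E.
Proof.
move=> w0 y0.
have := @ge0_FTC_oo R (fun s => densWD (w, s)) (Kt w) 0 y (Kt w 0) (Kt w y) y0.
rewrite Kt_eq0 subr0; apply.
- by move=> s _; exact: densWD_ge0.
- by move=> s /andP[s0 _]; exact: is_derive_Kt.
- move=> s /andP[s0 _]; apply: cvgD.
    by apply: (Q_continuous_y a12 t0); apply: adm_pos => //; lra.
  by apply: (Q_continuous_y a12 t0); apply: adm_pos => //; lra.
- have h : Kt w x @[x --> 0^'+] --> Kt w 0.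
    by apply: cvg_at_right_filter; exact: Kt_continuous_y.
  by rewrite Kt_eq0 in h.
- by apply: cvg_at_left_filter; exact: Kt_continuous_y.
Qed.

Let Kt_ge0 (w y : R) : 0 < w -> 0 < y -> 0 <= Kt w y.
Proof.
move=> w0 y0; rewrite -lee_fin -integral_dens_y//; apply: integral_ge0 => s _.
by rewrite lee_fin densWD_ge0.
Qed.

Let integral_Kt (w y : R) : 0 < w -> 0 < y ->
  (\int[mu]_(s in `]0%R, w[) (Kt s y)%:E = (cdfWD w y)%:E)%E.
Proof.
move=> w0 y0; pose H s := Qt 0 0 s y + Qt (-1) 1 s y.
have Hc v : {for v, continuous H}.
  apply: cvgD; apply: (Q_continuous_w a12 t0).
    by split; [lra|lra|left; lra|right].
  by split; [lra|lra|left; lra|right].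
have H0 : H 0 = 0 by rewrite /H !Q_le0 ?addr0//; left.
have := @ge0_FTC_oo R (fun s => Kt s y) H 0 w (H 0) (H w) w0.
rewrite H0 subr0 (cdfWDE w0 y0); apply.
- by move=> s /andP[s0 _]; exact: Kt_ge0.
- move=> s /andP[s0 _]; have := is_derive_cdf s0 y0.
  apply: near_eq_is_derive.
  near=> v; rewrite /H -cdfWDE//; near: v; exact: lt_nbhsr.
- move=> s /andP[s0 _]; apply: cvgD.
    by apply: (Q_continuous_w a12 t0); apply: adm_pos => //; lra.
  by apply: (Q_continuous_w a12 t0); apply: adm_pos => //; lra.
- have h : H x @[x --> 0^'+] --> H 0 by apply: cvg_at_right_filter; exact: Hc.
  by rewrite H0 in h.
- by apply: cvg_at_left_filter; exact: Hc.
Unshelve. all: by end_near. Qed.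

Let integral_ray (f : R -> \bar R) (x : R) : (forall s, s <= 0 -> f s = 0%E) ->
  (\int[mu]_(s in `]-oo, x[) f s = \int[mu]_(s in `]0%R, x[) f s)%E.
Proof.
move=> f0; rewrite integral_mkcond [RHS]integral_mkcond; apply: eq_integral => s _.
rewrite !patchE !mem_setE !in_itv/=; have [s0|s0] := ltP 0 s => //=.
by rewrite f0//; case: ifP.
Qed.

Lemma law_WD (B : set (R * R)) : measurable B ->
  P [set x | B (W x, D x)] = (\int[mu \x mu]_(z in B) (densWD z)%:E)%E.
Proof.
move=> mB.
have mWD : measurable_fun [set: T] (fun x => (W x, D x) : measurableTypeR R * measurableTypeR R).
  exact/measurable_fun_pair.
have [m1 E1] := pushforward_measure P mWD.
have [m2 E2] := @density_measure _ _ R (mu \x mu)%E densWD measurable_densWD densWD_ge0.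
have -> : P [set x | B (W x, D x)] = m1 B by rewrite E1.
rewrite -E2; apply: eq_measure_rays2 => //.
  have -> : m1 setT = P setT by rewrite E1 preimage_setT.
  by rewrite probability_setT ltry.
move=> w y.
transitivity (P [set x | W x < w /\ D x < y]).
  by rewrite E1; congr (P _); apply/seteqP; split => x /=; rewrite !in_itv.
rewrite E2 (@ge0_integral_setX _ _ _ _ R mu mu `]-oo, w[%classic `]-oo, y[%classic (fun z => (densWD z)%:E)); last 4 first.
- exact: measurable_itv.
- exact: measurable_itv.
- by apply/measurable_EFinP; exact: measurable_densWD.
- by move=> *; rewrite lee_fin densWD_ge0.
rewrite integral_ray; last first.
  by move=> s s0; apply: integral0_eq => v _; rewrite densWD_eq0//; left.
have [w0|w0] := leP w 0.
  rewrite set_itv_ge ?bnd_simp -?leNgt// integral_set0.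
  rewrite [X in P X](_ : _ = set0) ?measure0//; apply/seteqP; split => // x /= [Ww _].
  by have := W0 (I : [set: T] x); rewrite leNgt (lt_le_trans Ww).
have [y0|y0] := leP y 0.
  rewrite integral0_eq; last first.
    move=> s _; apply: integral0_eq => v; rewrite /= in_itv/= => vy.
    by rewrite densWD_eq0//; right; apply: ltW; exact: lt_le_trans y0.
  rewrite [X in P X](_ : _ = set0) ?measure0//; apply/seteqP; split => // x /= [_ Dy].
  by have := D0 (I : [set: T] x); rewrite leNgt (lt_le_trans Dy).
rewrite prob_cdfWD -integral_Kt//; apply: eq_integral => s; rewrite inE/= in_itv/= => /andP[s0 _].
rewrite integral_ray; first by rewrite integral_dens_y.
by move=> v v0; rewrite densWD_eq0//; right.
Qed.

End Law.

Section KilledKernel.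
Context (R : realType).
Variable alpha : R.
Hypothesis a12 : 1 < alpha < 2.

Definition killed_kernel (c x t : R) := Q alpha t (-1) 0 c (c - x).

Let alpha1 : 1 < alpha. Proof. by case/andP: a12. Qed.
Let alpha0 : 0 < alpha. Proof. exact: lt_trans alpha1. Qed.
Let a1 := inv_alpha_lt1 a12.
Let a2 := inv_alpha_gt_half a12.

Lemma is_derive_killed_kernel (c x t : R) : 0 < t -> Num.max x 0 < c ->
  is_derive c 1 (fun c' => killed_kernel c' x t) (densWD alpha t (c, c - x)).
Proof.
rewrite gt_max => t0 /andP[xc c0].
have E (s : R) : 1 * s + - x = s - x by rewrite mul1r.
have y1 : 0 < 1 * c + - x by rewrite E subr_gt0.
have l1 : -1 <= (-1 : R) <= 1 by lra.
have h := @is_derive_Q1 R alpha t a12 t0 (-1) 0 c 1 (- x) ler01 l1 (lexx _) c0 y1.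
have EQ : (fun s => Q alpha t (-1) 0 s (1 * s + - x)) = (fun s => killed_kernel s x t).
  by apply/funext => s; exact: (f_equal (Q alpha t (-1) 0 s) (E s)).
have EV : Q alpha t (-1 - 1) 0 c (1 * c + - x) + 1 * Q alpha t (-1) (0 - 1) c (1 * c + - x) =
    densWD alpha t (c, c - x).
  have -> : -1 - 1 = -2 :> R by lra.
  by rewrite E sub0r mul1r addrC.
exact: (eq_ind _ (fun F : R -> R => is_derive c 1 F _) (is_derive_eq h EV) _ EQ).
Qed.

Lemma killed_kernel_cvg (T : topologicalType) (F : set_system T) (FF : ProperFilter F)
    (u v : T -> R) (c x t : R) : 0 < t ->
  u s @[s --> F] --> c -> v s @[s --> F] --> x ->
  killed_kernel (u s) (v s) t @[s --> F] --> killed_kernel c x t.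
Proof.
move=> t0 uc vx; apply: (@Q_cvg R alpha t a12 t0 T F FF u (fun s => u s - v s)) => //.
  by split; [lra|lra|left|left].
exact: cvgB.
Qed.

Section KernelAsIntegral.
Variable t : R.
Hypothesis t0 : 0 < t.
Hypothesis dens_ge0 : forall z, 0 <= densWD alpha t z.

Lemma integral_densWD_diag (c x : R) : 0 < c -> x < c ->
  (\int[@lebesgue_measure R]_(w in `](Num.max x 0)%R, c[) (densWD alpha t (w, w - x))%:E =
   (killed_kernel c x t)%:E)%E.
Proof.
move=> c0 xc; pose m := Num.max x 0.
have mc : m < c by rewrite gt_max xc.
have Fm : killed_kernel m x t = 0.
  rewrite /killed_kernel Q_le0//; case: (leP x 0) => x0; [left|right].
    by rewrite /m (max_idPr x0).
  by rewrite /m (max_idPl (ltW x0)) subrr.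
have := @ge0_FTC_oo R (fun w => densWD alpha t (w, w - x)) (fun w => killed_kernel w x t) m c
  0 (killed_kernel c x t) mc.
rewrite subr0; apply.
- by move=> w _; exact: dens_ge0.
- by move=> w /andP[mw _]; exact: is_derive_killed_kernel.
- move=> w /andP[]; rewrite gt_max => /andP[xw w0] _.
  have cv : v - x @[v --> w] --> w - x by apply: cvgB; [exact: cvg_id|exact: cvg_cst].
  have y0 : 0 < w - x by rewrite subr_gt0.
  apply: cvgD; apply: (@Q_cvg R alpha t a12 t0 R (nbhs w) _ id (fun v => v - x)); try exact: cvg_id; try exact: cv.
    by split; [lra|lra|right|right].
  by split; [lra|lra|right|right].
- have h : killed_kernel w x t @[w --> m^'+] --> killed_kernel m x t.
    apply: cvg_at_right_filter.
    by apply: (@killed_kernel_cvg R (nbhs m) _ id (fun=> x)) => //; exact: cvg_cst.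
  by rewrite Fm in h.
- apply: cvg_at_left_filter.
  by apply: (@killed_kernel_cvg R (nbhs c) _ id (fun=> x)) => //; exact: cvg_cst.
Qed.

End KernelAsIntegral.

Lemma double_series_densWD (x c : R) : Num.max x 0 < c ->
  double_series_sum (fun k n : nat =>
    Gamma (k%:R / alpha + n%:R) / (Gamma (alpha * n%:R) * k`!%:R) *
    (-1) ^+ (k + n) * sin (pi * k%:R / alpha) *
    (k%:R * c + (alpha * n%:R - 1) * (c - x)) *
    (c - x) ^+ (k - 1) * c `^ (alpha * n%:R - 2)) (pi * densWD alpha 1 (c, c - x)).
Proof.
rewrite gt_max => /andP[xc c0]; set y := c - x; have y0 : 0 < y by rewrite subr_gt0.
set term := fun k n : nat => _.
pose s1 (n k : nat) := sterm alpha^-1 (-1) y (- n.+1%:R) k 1.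
pose s2 (n k : nat) := sterm alpha^-1 0 y (- n.+1%:R) k 1.
pose z (n k : nat) := - (wpow alpha (-1) n c * s1 n k + wpow alpha (-2) n c * s2 n k).
have E n k : term k.+1 n.+1 = pi * z n k.
  have s0 : 0 < alpha^-1 * k.+1%:R by rewrite mulr_gt0// invr_gt0.
  rewrite /term /z /s1 /s2 /sterm /wpow.
  have -> : - n.+1%:R - alpha^-1 * k.+1%:R = - (alpha^-1 * k.+1%:R) - n.+1%:R by rewrite addrC.
  rewrite fpowR_negE// powR1 mul1r.
  have an : 1 < alpha * n.+1%:R.
    by rewrite (lt_le_trans alpha1)// ler_peMr ?(ltW alpha0)// ler1n.
  rewrite !(fpowE _ c0).
  have -> : -1 + alpha * n.+1%:R + 1 = alpha * n.+1%:R by ring.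
  have -> : -2 + alpha * n.+1%:R + 1 = alpha * n.+1%:R - 1 by ring.
  have -> : -2 + alpha * n.+1%:R = alpha * n.+1%:R - 2 by ring.
  have -> : -1 + alpha * n.+1%:R = alpha * n.+1%:R - 2 + 1 by ring.
  rewrite (powRS _ c0).
  have G0 : 0 < Gamma (alpha * n.+1%:R - 1) by rewrite Gamma_gt0// subr_gt0.
  have GE : Gamma (alpha * n.+1%:R) = (alpha * n.+1%:R - 1) * Gamma (alpha * n.+1%:R - 1).
    by rewrite -GammaS ?subrK// subr_gt0.
  have -> : -1 + k.+1%:R = k%:R :> R by rewrite -natr1; ring.
  have -> : 0 + k.+1%:R = k.+1%:R :> R by rewrite add0r.
  rewrite !fpow_nat// GE factS natrM subn1/=.
  have -> : pi * k.+1%:R / alpha = pi * (alpha^-1 * k.+1%:R) by rewrite -mulrA [_ / alpha]mulrC.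
  have -> : k.+1%:R / alpha = alpha^-1 * k.+1%:R by rewrite mulrC.
  have -> : (-1) ^+ (k.+1 + n.+1) = (-1) ^+ k * (-1) ^+ n :> R.
    by rewrite addSn addnS !exprS !mulN1r opprK exprD.
  rewrite [(-1) ^+ n.+1]exprS [y ^+ k.+1]exprS.
  have f0 : k`!%:R != 0 :> R by rewrite pnatr_eq0 -lt0n fact_gt0.
  have k0 : k.+1%:R != 0 :> R by rewrite pnatr_eq0.
  have p0 : pi != 0 :> R by rewrite gt_eqF// pi_gt0.
  have b0 : alpha * n.+1%:R - 1 != 0 by rewrite gt_eqF// subr_gt0.
  have g0 : Gamma (alpha * n.+1%:R - 1) != 0 by rewrite gt_eqF.
  move: (Gamma (alpha^-1 * _ + _)) (sin _) (c `^ _) (y ^+ k) ((-1) ^+ k) ((-1) ^+ n).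
  move: (Gamma _) g0 => A1 A10.
  move: (alpha * n.+1%:R) b0 => A2 A20.
  move: (k.+1%:R) k0 (k`!%:R) f0 => A3 A30 A4 A40.
  move: (@pi R) p0 => A5 A50 B1 B2 B3 B4 B5 B6.
  by field; rewrite A10 A20 A30 A40 A50.
have j1 : -1 <= (-1 : R) by [].
have j2 : -1 <= (0 : R) by rewrite lerN10.
have [B1 B10 HB1] := @tbound_geometric R _ a2 a1 1 y (-1) ltr01 y0 j1.
have [B2 B20 HB2] := @tbound_geometric R _ a2 a1 1 y 0 ltr01 y0 j2.
have l1 : -2 <= (-1 : R) <= 1 by lra.
have l2 : -2 <= (-2 : R) <= 1 by lra.
have [C1 C10 HC1] := wpow_nbound_le a12 l1 ltr01 c0 (lexx c).
have [C2 C20 HC2] := wpow_nbound_le a12 l2 ltr01 c0 (lexx c).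
have cc : c <= c <= c by rewrite lexx.
have part (l j B C : R) n k : -2 <= l -> -1 <= j -> 0 <= B -> 0 <= C ->
    (forall k, tbound alpha^-1 1 k * fpow (j + k.+1%:R) y <= B * 2^-1 ^+ k) ->
    (forall n w, c <= w <= c -> wpow alpha l n w * nbound 1 n.+1 <= C * 2^-1 ^+ n) ->
    `|wpow alpha l n c * sterm alpha^-1 j y (- n.+1%:R) k 1| <= (B * C) * 2^-1 ^+ k * 2^-1 ^+ n.
  move=> l2' j1' B0 C0 HB HC.
  have w0 := wpow_ge0 a12 n l2' c0.
  rewrite normrM (ger0_norm w0).
  have h1 := @normr_sterm_le R _ a2 a1 j y y 1 1 k n.+1 j1' ltr01 (lexx _) (lexx _).
  apply: (le_trans (ler_wpM2l w0 h1)).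
  have jk : 0 <= j + k.+1%:R by rewrite -natr1 addrCA addr_ge0//; lra.
  have t1 : 0 <= tbound alpha^-1 1 k * fpow (j + k.+1%:R) y.
    by apply: mulr_ge0; [exact: tbound_ge0|exact: fpow_ge0].
  have t2 : 0 <= wpow alpha l n c * nbound 1 n.+1 by rewrite mulr_ge0// nbound_ge0.
  rewrite mulrCA; apply: (le_trans (ler_pM t1 t2 (HB k) (HC n c cc))).
  by rewrite le_eqVlt; apply/orP; left; apply/eqP; ring.
pose U k := (B1 * C1 + B2 * C2) * 2^-1 ^+ k.
pose V n := 1 * 2^-1 ^+ n : R.
have BC0 : 0 <= B1 * C1 + B2 * C2 by rewrite addr_ge0// mulr_ge0.
have U0 k : 0 <= U k by rewrite mulr_ge0// exprn_ge0.
have V0 n : 0 <= V n by rewrite mulr_ge0// exprn_ge0.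
have zUV n k : `|z n k| <= U k * V n.
  rewrite normrN (le_trans (ler_normD _ _))// /U /V mul1r !mulrDl lerD//.
    by apply: part => //; lra.
  by apply: part => //; lra.
have [ck cz] := double_sum_swap U0 V0 zUV (@cvg_geometric_half R _) (@cvg_geometric_half R _).
have cs1 n := @cvg_sterm R _ a2 a1 (-1) y 1 n.+1 j1 ltr01 y0.
have cs2 n := @cvg_sterm R _ a2 a1 0 y 1 n.+1 j2 ltr01 y0.
have lin (p q : R) (f g : nat -> R) N :
    series (fun k => - (p * f k + q * g k)) N = p * - series f N + q * - series g N.
  rewrite /series/= -!sumrN !mulr_sumr -big_split/=.
  by apply: eq_bigr => k _; rewrite opprD !mulrN.
have Ez n : limn (series (z n)) =
    wpow alpha (-1) n c * Fy alpha 1 (-1) n y + wpow alpha (-2) n c * Fy alpha 1 0 n y.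
  apply/cvg_lim => //.
  have -> : series (z n) = (fun N => wpow alpha (-1) n c * - series (s1 n) N
      + wpow alpha (-2) n c * - series (s2 n) N).
    by apply/funext => N; exact: lin.
  apply: cvgD; apply: cvgM; try exact: cvg_cst; apply: cvgN.
    exact: cs1.
  exact: cs2.
have A1 : adm (-1) (-1) c y by split => //; right.
have A2 : adm (-2) 0 c y by split => //; [right|left].
have c1 := Q_is_cvg a12 ltr01 A1; have c2 := Q_is_cvg a12 ltr01 A2.
have EQ : limn (series (fun n => limn (series (z n)))) = densWD alpha 1 (c, y).
  apply/cvg_lim => //.
  have -> : series (fun n => limn (series (z n))) =
      (fun N => series (fun n => wpow alpha (-1) n c * Fy alpha 1 (-1) n y) N
        + series (fun n => wpow alpha (-2) n c * Fy alpha 1 0 n y) N).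
    by apply/funext => N; rewrite /series/= -big_split/=; apply: eq_bigr => n _; rewrite Ez.
  by apply: cvgD; [exact: c1|exact: c2].
have shift (u : nat -> R) l : series (fun n => u n.+1) N @[N --> \oo] --> l ->
    (\sum_(1 <= n < N) u n) @[N --> \oo] --> l.
  move=> h; rewrite -(cvg_shiftS (fun N => \sum_(1 <= n < N) u n)).
  have -> // : (fun N => \sum_(1 <= n < N.+1) u n) = series (fun n => u n.+1).
  by apply/funext => N; rewrite big_add1.
exists (fun k => pi * limn (series (z ^~ k.-1))); split.
  case=> // k _; apply: shift.
  have -> : series (fun n => term k.+1 n.+1) = (fun N => pi * series (z ^~ k) N).
    by apply/funext => N; rewrite /series/= mulr_sumr; apply: eq_bigr => n _; exact: E.
  by apply: cvgM; [exact: cvg_cst|exact: ck].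
apply: shift.
have -> : series (fun k => pi * limn (series (z ^~ k.+1.-1))) =
    (fun N => pi * series (fun k => limn (series (z ^~ k))) N).
  by apply/funext => N; rewrite /series/= mulr_sumr.
by apply: cvgM; [exact: cvg_cst|rewrite -EQ; exact: cz].
Qed.

End KilledKernel.

Section Shear.
Context (R : realType).
Notation mu := (@lebesgue_measure R).

Lemma ge0_integral_shear (F : R * R -> \bar R) : measurable_fun [set: R * R] F ->
  (forall z, (0 <= F z)%E) ->
  (\int[mu \x mu]_z F z = \int[mu]_x \int[mu]_w F (w, w - x)%R)%E.
Proof.
move=> mF F0.
have mG : measurable_fun [set: measurableTypeR R * measurableTypeR R] (fun z : R * R => F (z.1, z.1 - z.2)).
  apply: (measurableT_comp mF); apply/measurable_fun_pair; first exact: measurable_fst.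
  exact: measurable_funB.
rewrite -setXTT (@ge0_integral_setX _ _ _ _ R mu mu setT setT F); first last.
- by move=> x y _ _; exact: F0.
- exact: mF.
- exact: measurableT.
- exact: measurableT.
transitivity (\int[mu]_w \int[mu]_x F (w, w - x)%R)%E.
  apply: eq_integral => w _.
  have mFw : measurable_fun [set: R] (fun y => F (w, y)).
    by apply: (measurableT_comp mF); exact/measurable_fun_pair.
  by rewrite -(ge0_integral_reflect w mFw (fun y => F0 (w, y))).
by rewrite (@tonelli_domain _ _ _ _ R mu mu setT setT (fun z => F (z.1, z.1 - z.2)%R)).
Qed.

End Shear.

Section JointLaw.
Context (R : realType) d (T : measurableType d) (P : probability T R).
Context (X : R -> {RV P >-> R}) (alpha t : R).
Hypotheses (lX : levy_process X) (a12 : 1 < alpha < 2).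
Hypothesis laplaceX : forall t q : R, 0 < t -> 0 <= q ->
  'E_P[fun w => expR (- q * X t w)]%E = (expR (t * q `^ alpha))%:E.
Hypothesis t0 : 0 < t.
Notation mu := (@lebesgue_measure R).
Notation dens := (densWD alpha t).

Let dens_ge0 z : 0 <= dens z. Proof. exact: (densWD_ge0 lX a12 laplaceX t0). Qed.
Let mdens : measurable_fun [set: R * R] dens. Proof. exact: (measurable_densWD a12 t0). Qed.

Lemma prob_XW (B : set (R * R)) : measurable B ->
  P [set w | B (X t w, running_sup X t w)] =
  (\int[mu]_x \int[mu]_c (dens (c, c - x) * \1_B (x, c))%:E)%E.
Proof.
move=> mB.
pose B' : set (R * R) := [set z | B (z.1 - z.2, z.1)].
have mphi : measurable_fun [set: R * R] (fun z : R * R => (z.1 - z.2, z.1) : R * R).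
  by apply/measurable_fun_pair; [exact: measurable_funB|exact: measurable_fst].
have mB' : measurable B' by rewrite -[B']setTI; exact: mphi.
transitivity (P [set w | B' (running_sup X t w, drawdown X t w)]).
  by congr (P _); apply/seteqP; split => w; rewrite /B'/= /drawdown subKr.
rewrite (law_WD lX a12 laplaceX t0 mB').
rewrite integral_mkcond.
transitivity (\int[mu \x mu]_z (dens z * \1_B' z)%:E)%E.
  apply: eq_integral => z _; rewrite patchE indicE; case: ifP => _; by rewrite ?mulr1 ?mulr0.
rewrite ge0_integral_shear.
- apply: eq_integral => x _; apply: eq_integral => c _; congr (_ * _)%:E.
  rewrite !indicE; congr (nat_of_bool _)%:R.
  by apply/idP/idP; rewrite !inE /B'/= subKr.
- by apply/measurable_EFinP; apply: measurable_funM => //; exact: measurable_indic.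
- by move=> z; rewrite lee_fin mulr_ge0.
Qed.

Lemma killed_density (c : R) : 0 < c ->
  is_killed_density X c t (fun x => killed_kernel alpha c x t).
Proof.
move=> c0; split.
- move=> x; rewrite in_itv/= => xc.
  rewrite -lee_fin -(integral_densWD_diag a12 t0 dens_ge0 c0 xc).
  by apply: integral_ge0 => w _; rewrite lee_fin.
- move=> x _.
  by apply: (@killed_kernel_cvg R alpha a12 R (nbhs x) _ (fun=> c) id) => //; exact: cvg_cst.
move=> A mA Ac.
pose B : set (R * R) := A `*` `]-oo, c]%classic.
have mB : measurable B by apply: measurableX => //; exact: measurable_itv.
transitivity (P [set w | B (X t w, running_sup X t w)]).
  by congr (P _); apply/seteqP; split => w; rewrite /B/= in_itv.
rewrite prob_XW// [RHS]integral_mkcond; apply: eq_integral => x _.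
rewrite patchE; case: ifPn => [|xA]; last first.
  apply: integral0_eq => w _; rewrite indicE.
  have -> : ((x, w) \in B) = false.
    by apply/negbTE; apply: contra xA; rewrite !inE => -[].
  by rewrite mulr0.
rewrite inE => xA; have xc : x < c by have := Ac x xA; rewrite /= in_itv.
rewrite -(integral_densWD_diag a12 t0 dens_ge0 c0 xc).
have mf : measurable_fun [set: R] (fun w => dens (w, w - x)).
  apply: (measurableT_comp mdens); apply/measurable_fun_pair => //; exact: measurable_funB.
rewrite integral_itv_bndo_bndc; last by apply/measurable_EFinP; exact: measurable_funTS.
rewrite [RHS]integral_mkcond; apply: eq_integral => w _.
rewrite patchE indicE mem_setE in_itv/= gt_max.
have -> : ((x, w) \in B) = (w <= c).
  by apply/idP/idP; rewrite inE /B/= in_itv/=; [case|move=> ?; split].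
case: (leP w c) => wc; rewrite ?andbF ?mulr0 ?mulr1 ?andbT//.
case: ifPn => //; rewrite negb_and -!leNgt => /orP[wx|w0]; rewrite (densWD_eq0 _ _)//.
  by right; rewrite subr_le0.
by left.
Qed.

Lemma joint_density : is_joint_density P (X t) (running_sup X t)
  (fun z => dens (z.2, z.2 - z.1)).
Proof.
have mf : measurable_fun [set: R * R] (fun z : R * R => dens (z.2, z.2 - z.1)).
  apply: (measurableT_comp mdens); apply/measurable_fun_pair; first exact: measurable_snd.
  exact: measurable_funB.
split.
- exact: measurable_funPT.
- exact: (measurable_running_sup lX (ltW t0)).
- exact: mf.
- by move=> z; exact: dens_ge0.
move=> B mB; rewrite prob_XW// [RHS]integral_mkcond -setXTT.
transitivity (\int[mu \x mu]_(z in [set: R] `*` [set: R]) (dens (z.2, z.2 - z.1) * \1_B z)%:E)%E; last first.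
  apply: eq_integral => z _; rewrite patchE indicE; case: ifP => _; by rewrite ?mulr1 ?mulr0.
rewrite (@ge0_integral_setX _ _ _ _ R mu mu setT setT (fun z => (dens (z.2, z.2 - z.1) * \1_B z)%:E))//.
- by apply/measurable_EFinP; apply: measurable_funM => //; exact: measurable_indic.
- by move=> *; rewrite lee_fin mulr_ge0.
Qed.

End JointLaw.

Theorem corollary4 (R : realType) (d : measure_display) (T : measurableType d)
    (P : probability T R) (alpha : R) (X : R -> {RV P >-> R}) :
  1 < alpha < 2 ->
  stable_process alpha X ->
  (forall t q : R, 0 < t -> 0 <= q ->
     'E_P[fun w => expR (- q * X t w)]%E = (expR (t * q `^ alpha))%:E) ->
  exists h : R -> R -> R -> R,
    [/\ (forall c t : R, 0 < c -> 0 < t ->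
           is_killed_density X c t (fun x => h c x t)),
        (forall x c : R, Num.max x 0 < c ->
           exists2 S : R,
             double_series_sum (fun k n : nat =>
               Gamma (k%:R / alpha + n%:R) / (Gamma (alpha * n%:R) * k`!%:R) *
               (-1) ^+ (k + n) * sin (pi * k%:R / alpha) *
               (k%:R * c + (alpha * n%:R - 1) * (c - x)) *
               (c - x) ^+ (k - 1) * c `^ (alpha * n%:R - 2)) S &
             is_derive c 1 (fun c' => h c' x 1) (pi^-1 * S)) &
        is_joint_density P (X 1) (running_sup X 1)
          (fun z : R * R => let: (x, c) := z in
             if Num.max x 0 < c then derive1 (fun c' => h c' x 1) c else 0)].
Proof.
move=> a12 [lX _] laplaceX.
exists (killed_kernel alpha); split.
- by move=> c t c0 t0; exact: killed_density.
- move=> x c xc; exists (pi * densWD alpha 1 (c, c - x)).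
    exact: double_series_densWD.
  rewrite mulKf ?gt_eqF ?pi_gt0//.
  exact: is_derive_killed_kernel.
have -> : (fun z : R * R => let: (x, c) := z in
    if Num.max x 0 < c then derive1 (fun c' => killed_kernel alpha c' x 1) c else 0) =
    (fun z => densWD alpha 1 (z.2, z.2 - z.1)).
  apply/funext => -[x c] /=; case: ifPn => [xc|].
    rewrite derive1E; have := is_derive_killed_kernel a12 ltr01 xc.
    by move=> h; exact: derive_val.
  rewrite -leNgt le_max => /orP[cx|c0]; rewrite densWD_eq0//.
    by right; rewrite subr_le0.
  by left.
exact: joint_density.
Qed.
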